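(* Let $d\in\{1,2\}$. Let $\sigma:\mathbb{R}\to\mathbb{R}$ be Lipschitz continuous with Lipschitz constant $L\in(0,\infty)$ and $\sigma(1)\neq 0$. Let $\gamma:\mathbb{R}^d\to[0,\infty]$ be a tempered nonnegative and nonnegative definite function whose spectral measure $\mu$ satisfies $\int_{\mathbb{R}^d}\frac{\mu(dz)}{1+|z|^2}<\infty$. Suppose that $\gamma\in L^1(\mathbb{R})$ if $d=1$, and that $\gamma\in L^1(\mathbb{R}^2)\cap L^{\ell}(\mathbb{R}^2)$ for some $\ell>1$ if $d=2$. Let $u$ be the random field solution of the stochastic wave equation $\partial_t^2u=\Delta u+\sigma(u)\dot W$ on $\mathbb{R}_+\times\mathbb{R}^d$ with $u(0,x)=1$, $\partial_tu(0,x)=0$, driven by the centered Gaussian noise $\dot W$ that is white in time with spatial covariance $\gamma$. Fix $t>0$. Then the random field $\{u(t,x):x\in\mathbb{R}^d\}$ has the following properties: (i) it is strictly stationary, i.e. the finite-dimensional distributions of $\{u(t,x+y):x\in\mathbb{R}^d\}$ do not depend on $y\in\mathbb{R}^d$; (ii) it is ergodic (with respect to spatial shifts).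
   Context: Noise. $\gamma$ is the Fourier transform of a tempered nonnegative measure $\mu$ (the spectral measure), normalized so that $\int_{\mathbb{R}^{2d}}f(y)g(z)\gamma(y-z)\,dy\,dz=\int_{\mathbb{R}^d}\hat f(\xi)\hat g(-\xi)\,\mu(d\xi)$ with $\hat f(\xi)=\int e^{-ix\cdot\xi}f(x)\,dx$. $\mathfrak{H}$ is the completion of $C_c(\mathbb{R}_+\times\mathbb{R}^d)$ under $\langle f,g\rangle_{\mathfrak{H}}=\int_{\mathbb{R}_+}\int_{\mathbb{R}^{2d}}f(s,y)g(s,z)\gamma(y-z)\,dy\,dz\,ds$, and $W=\{W(\phi):\phi\in\mathfrak{H}\}$ is a centered Gaussian family with $\mathbb{E}[W(\phi)W(\psi)]=\langle\phi,\psi\rangle_{\mathfrak{H}}$; formally $\mathbb{E}[\dot W(t,x)\dot W(s,y)]=\delta_0(t-s)\gamma(x-y)$. The filtration $\{\mathcal{F}_t\}$ is generated by the null sets and the $W(\phi)$ with $\phi$ continuous and compactly supported in $[0,t]\times\mathbb{R}^d$. Solution. The fundamental solution of the wave equation is $G_t(x)=\frac12\mathbf{1}_{\{|x|<t\}}$ if $d=1$ and $G_t(x)=\frac{1}{2\pi\sqrt{t^2-|x|^2}}\mathbf{1}_{\{|x|<t\}}$ if $d=2$. The random field solution is the unique $\{\mathcal{F}_t\}$-adapted random field $u$ with $\sup_{(t,x)\in[0,T]\times\mathbb{R}^d}\mathbb{E}[|u(t,x)|^k]<\infty$ for all $T<\infty$, $k\ge2$, satisfying $$u(t,x)=1+\int_0^t\int_{\mathbb{R}^d}G_{t-s}(x-y)\,\sigma(u(s,y))\,W(ds,dy),$$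 with the stochastic integral in the Dalang–Walsh sense (existence and uniqueness are known under the stated conditions on $\sigma$ and $\gamma$). Ergodicity: a strictly stationary random field on $\mathbb{R}^d$ is ergodic if every event in the $\sigma$-field it generates that is invariant under all spatial shifts has probability $0$ or $1$. *)

(* Defs.v *)
From HB Require Import structures.
From mathcomp Require Import all_boot all_order all_algebra.
From mathcomp Require Import complex.
From mathcomp Require Import all_classical all_reals all_analysis.

Set Implicit Arguments.
Unset Strict Implicit.
Unset Printing Implicit Defensive.
Import Order.TTheory GRing.Theory Num.Theory.
Import numFieldNormedType.Exports.
Local Open Scope classical_set_scope.
Local Open Scope ring_scope.

(* 'rV[R]_n carries the sigma-algebra generated by the coordinates, which is its
   Borel sigma-algebra (this is the convention of the library for n.-tuple T). *)
Definition rV_display : measure_display. Proof. exact: default_measure_display. Qed.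

Section measurable_rV.
Context {R : realType} {n : nat}.

Definition rV_coord (i : 'I_n) (x : 'rV[R]_n) : R := x ord0 i.

Let rV_set0 : g_sigma_preimage rV_coord set0.
Proof. exact: sigma_algebra0. Qed.

Let rV_setC A : g_sigma_preimage rV_coord A -> g_sigma_preimage rV_coord (~` A).
Proof. exact: sigma_algebraC. Qed.

Let rV_bigcup (F : (set 'rV[R]_n)^nat) :
  (forall i, g_sigma_preimage rV_coord (F i)) ->
  g_sigma_preimage rV_coord (\bigcup_i F i).
Proof. exact: sigma_algebra_bigcup. Qed.

HB.instance Definition _ := @isMeasurable.Build rV_display 'rV[R]_n
  (g_sigma_preimage rV_coord) rV_set0 rV_setC rV_bigcup.

Lemma measurable_rV_coord i : measurable_fun [set: 'rV[R]_n] (rV_coord i).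
Proof.
move=> _ Y mY; rewrite setTI; apply: sub_sigma_algebra => /=.
rewrite -bigcup_seq/=; exists i => /=; first by rewrite mem_index_enum.
by exists Y => //; rewrite setTI.
Qed.

Lemma measurable_fun_rV d (T : measurableType d) (f : T -> 'rV[R]_n) :
  (forall i, measurable_fun setT (rV_coord i \o f)) -> measurable_fun setT f.
Proof.
move=> mf _ Y mY; rewrite setTI; move: Y mY.
suff: (measurable : set (set 'rV[R]_n)) `<=` [set Y | measurable (f @^-1` Y)] by [].
apply: smallest_sub.
  split=> /= [|A mA|F mF].
  - by rewrite preimage_set0.
  - by rewrite setTD preimage_setC; exact: measurableC.
  - by rewrite preimage_bigcup; exact: bigcupT_measurable.
rewrite -bigcup_seq; apply: bigcup_sub => i _ _ [B mB <-] /=.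
by rewrite setTI -comp_preimage -[X in measurable X]setTI; exact: mf.
Qed.

End measurable_rV.

Section lebesgue_rV.
Context {R : realType}.

Definition rV_cons n (p : R * 'rV[R]_n) : 'rV[R]_n.+1 :=
  row_mx (const_mx p.1 : 'rV_1) p.2.
Definition rV_uncons n (x : 'rV[R]_n.+1) : R * 'rV[R]_n :=
  (x ord0 ord0, rsubmx (x : 'rV_(1 + n))).

Lemma rV_consK n : cancel (@rV_cons n) (@rV_uncons n).
Proof.
case=> a x; rewrite /rV_uncons /rV_cons /= row_mxKr; congr pair.
transitivity (row_mx (const_mx a : 'rV_1) x ord0 (lshift n ord0)).
  by congr (fun_of_matrix _ _ _); exact: val_inj.
by have := @row_mxEl R 1 1 n (const_mx a) x ord0 ord0; rewrite [RHS]mxE.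
Qed.

Lemma measurable_rV_cons n : measurable_fun setT (@rV_cons n).
Proof.
apply: measurable_fun_rV => i.
have [j ->|j ->] := @split_ordP 1 n i.
  rewrite (_ : _ \o _ = fst) //; apply/funext => p.
  by have := @row_mxEl R 1 1 n (const_mx p.1) p.2 ord0 j; rewrite [RHS]mxE.
rewrite (_ : _ \o _ = rV_coord j \o snd).
  by apply: measurableT_comp => //; exact: measurable_rV_coord.
by apply/funext => p; exact: (@row_mxEr _ 1 1 n).
Qed.

Lemma measurable_rV_uncons n : measurable_fun setT (@rV_uncons n).
Proof.
apply: measurable_fun_pair; first exact: measurable_rV_coord.
apply: measurable_fun_rV => i.
rewrite (_ : _ \o _ = rV_coord (rshift 1 i)); first exact: measurable_rV_coord.
by apply/funext => x; rewrite /rV_coord /= mxE.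
Qed.

Section step.
Context {n : nat}.
Variable m : {sigma_finite_measure set 'rV[R]_n -> \bar R}.

Definition rV_prod_measure : set 'rV[R]_n.+1 -> \bar R :=
  pushforward (lebesgue_measure \x m)%E (@rV_cons n).

Let rV_prod0 : rV_prod_measure set0 = 0%E.
Proof. by rewrite /rV_prod_measure /pushforward preimage_set0 measure0. Qed.

Let rV_prod_ge0 A : (0 <= rV_prod_measure A)%E.
Proof. exact: (measure_ge0 (lebesgue_measure \x m)%E). Qed.

Let rV_prod_sigma_additive : semi_sigma_additive rV_prod_measure.
Proof.
move=> F mF tF mUF; rewrite /rV_prod_measure /pushforward preimage_bigcup.
apply: measure_semi_sigma_additive.
- by move=> k; rewrite -[X in measurable X]setTI; exact: measurable_rV_cons.
- apply/trivIsetP => /= i j _ _ ij; rewrite -preimage_setI.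
  by move/trivIsetP : tF => /(_ _ _ _ _ ij) ->//; rewrite preimage_set0.
- by rewrite -preimage_bigcup -[X in measurable X]setTI;
    exact: measurable_rV_cons.
Qed.

HB.instance Definition _ := isMeasure.Build _ _ _ rV_prod_measure
  rV_prod0 rV_prod_ge0 rV_prod_sigma_additive.

Let rV_prod_sigma_finite : sigma_finite setT rV_prod_measure.
Proof.
have /sigma_finiteP[F [FT ndF Foo]] := sigma_finiteT (@lebesgue_measure R).
have /sigma_finiteP[G [GT ndG Goo]] := sigma_finiteT m.
exists (fun k => @rV_uncons n @^-1` (F k `*` G k)).
  rewrite -preimage_bigcup; apply/esym; rewrite -subTset => x _ /=.
  have [i _ Fi] : (\bigcup_i F i) (rV_uncons x).1 by rewrite -FT.
  have [j _ Gj] : (\bigcup_i G i) (rV_uncons x).2 by rewrite -GT.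
  exists (maxn i j) => //; split.
  - by move: Fi; exact/subsetPset/ndF/leq_maxl.
  - by move: Gj; exact/subsetPset/ndG/leq_maxr.
move=> k; have [mF Fk] := Foo k; have [mG Gk] := Goo k; split.
  rewrite -[X in measurable X]setTI; apply: measurable_rV_uncons => //.
  exact: measurableX.
rewrite /rV_prod_measure /pushforward -comp_preimage.
rewrite (_ : _ \o _ = id); last by apply/funext => x /=; rewrite rV_consK.
rewrite preimage_id.
by rewrite product_measure1E// lte_mul_pinfty// ge0_fin_numE.
Qed.

HB.instance Definition _ :=
  @Measure_isSigmaFinite.Build _ _ _ rV_prod_measure rV_prod_sigma_finite.

End step.

Fixpoint lebesgue_rV (n : nat) : {sigma_finite_measure set 'rV[R]_n -> \bar R} :=
  match n with
  | 0 => \d_(0 : 'rV[R]_0)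
  | n'.+1 => rV_prod_measure (lebesgue_rV n')
  end.

End lebesgue_rV.

Section space.
Context {R : realType} {d : nat}.
Local Notation E := 'rV[R]_d.
Local Notation lam := (@lebesgue_rV R d).
Implicit Types (gam : E -> \bar R) (f g : E -> R) (x y xi : E).

Definition dotv x y : R := \sum_i x ord0 i * y ord0 i.
(* The norm `|x| of the library on 'rV[R]_d is the sup norm. *)
Definition enorm x : R := Num.sqrt (dotv x x).

Definition Cc_space f : Prop :=
  continuous f /\ exists K : set E, compact K /\ forall x, ~ K x -> f x = 0.

Definition tempered_measure (mu : {measure set E -> \bar R}) : Prop :=
  exists k : nat, (\int[mu]_x ((1 + enorm x ^+ 2) ^- k)%:E < +oo)%E.

Definition tempered_fun gam : Prop :=
  exists k : nat, (\int[lam]_x (((1 + enorm x ^+ 2) ^- k)%:E * gam x) < +oo)%E.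

(* \int\int f(y) g(z) gam(y - z) dy dz *)
Definition energy gam f g : \bar R :=
  (\int[lam \x lam]_p ((f p.1 * g p.2)%:E * gam (p.1 - p.2)%R))%E.

(* Since gam may take the value +oo, nonnegative definiteness is understood in
   the sense of distributions. *)
Definition nonneg_definite gam : Prop :=
  forall f, Cc_space f -> (0 <= energy gam f f)%E.

Definition fourier f xi : R[i] :=
  Complex (\int[lam]_x (f x * cos (dotv x xi)))%R
          (- \int[lam]_x (f x * sin (dotv x xi)))%R.

(* The second equation says that the imaginary part of
   \int fourier f xi * fourier g (- xi) mu(d xi) vanishes. *)
Definition spectral_measure gam (mu : {measure set E -> \bar R}) : Prop :=
  tempered_measure mu /\
  forall f g, Cc_space f -> Cc_space g ->
    energy gam f g =
      (\int[mu]_xi (complex.Re (fourier f xi * fourier g (- xi)))%:E)%E /\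
    (\int[mu]_xi (complex.Im (fourier f xi * fourier g (- xi)))%:E = 0)%E.

(* Fundamental solution of the wave equation; only d = 1, 2 are meaningful.
   It vanishes for t <= 0. *)
Definition wave_kernel (t : R) x : R :=
  if enorm x < t then
    if d == 1%N then 2^-1
    else (2 * pi * Num.sqrt (t ^+ 2 - enorm x ^+ 2))^-1
  else 0.

(* The functions of C_c(R_+ x R^d), extended by 0 to negative times. *)
Definition Cc_spacetime (phi : R * E -> R) : Prop :=
  {within [set p | 0 <= p.1], continuous phi} /\
  exists K : set (R * E), [/\ compact K, K `<=` [set p | 0 <= p.1]
    & forall p, ~ K p -> phi p = 0].

Definition noise_form gam (phi psi : R * E -> R) : \bar R :=
  (\int[lebesgue_measure]_(s in `[0%R, +oo[)
     energy gam (fun y => phi (s, y)) (fun z => psi (s, z)))%E.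

Definition noise_norm2 gam (phi : R * E -> R) : \bar R := noise_form gam phi phi.

(* The Hilbert space H, i.e., the completion of C_c(R_+ x R^d): its elements are
   represented by Cauchy sequences, without passing to the quotient. *)
Record hilbert gam := Hilbert {
  hseq :> nat -> R * E -> R ;
  hseq_Cc : forall n, Cc_spacetime (hseq n) ;
  hseq_cauchy : forall e : R, 0 < e -> exists N, forall m n,
    (N <= m)%N -> (N <= n)%N ->
    (noise_norm2 gam (hseq m \- hseq n)%R < e%:E)%E }.

Definition hdot gam (phi psi : hilbert gam) : \bar R :=
  limn (fun n => noise_form gam (phi n) (psi n)).

Lemma noise_norm20 gam : noise_norm2 gam (cst 0) = 0%E.
Proof.
apply: integral0_eq => s _; apply: integral0_eq => p _ /=.
by rewrite mul0r mul0e.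
Qed.

Lemma Cc_cauchy gam (phi : R * E -> R) (e : R) : 0 < e ->
  exists N : nat, forall m n, (N <= m)%N -> (N <= n)%N ->
    (noise_norm2 gam (phi \- phi)%R < e%:E)%E.
Proof.
move=> e0; exists 0%N => _ _ _ _.
rewrite (_ : phi \- phi = cst 0) ?noise_norm20 ?lte_fin//.
by apply/funext => p /=; rewrite subrr.
Qed.

Definition hilbert_of gam (phi : R * E -> R) (Cphi : Cc_spacetime phi) :
    hilbert gam :=
  @Hilbert gam (fun=> phi) (fun=> Cphi) (@Cc_cauchy gam phi).

(* The measurable function phi : R_+ x R^d -> R, which need not be continuous,
   is an element of H, namely h. *)
Definition represents gam (h : hilbert gam) (phi : R * E -> R) : Prop :=
  (fun n => noise_norm2 gam (h n \- phi)) @ \oo --> 0%E.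

End space.

Section noise.
Context {R : realType} {d : nat} {disp : measure_display}
  {T : measurableType disp}.
Variable P : probability T R.
Local Notation E := 'rV[R]_d.
Local Notation lam := (@lebesgue_rV R d).

(* N(0, s^2); the case s = 0 is separate because normal_prob 0 0 is not the
   Dirac mass at 0 in the library. *)
Definition centered_gaussian (X : T -> R) : Prop :=
  exists s : R, forall B : set R, measurable B ->
    P (X @^-1` B) = if s == 0 then \d_(0 : R) B else normal_prob 0 s B.

Definition isonormal (gam : E -> \bar R) (W : hilbert gam -> T -> R) : Prop :=
  [/\ forall phi, measurable_fun setT (W phi),
      forall n (c : 'I_n -> R) (phi : 'I_n -> hilbert gam),
        centered_gaussian (fun w => \sum_i c i * W (phi i) w)
    & forall phi psi, ('E_P[W phi \* W psi] = hdot phi psi)%E].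

Section integral.
Variables (gam : E -> \bar R) (W : hilbert gam -> T -> R).

Definition filtration (t : R) : set (set T) :=
  <<s [set A | measurable A /\ P A = 0%E] `|`
      [set A | exists (phi : R * E -> R) (Cphi : Cc_spacetime phi) (B : set R),
         [/\ forall p, closure [set q | phi q != 0] p -> p.1 <= t,
             measurable B & A = W (hilbert_of gam Cphi) @^-1` B] ] >>.

(* The process X(w) 1_{]a, b]}(s) 1_A(y), whose stochastic integral is
   X (M_b(A) - M_a(A)) = X W(1_{]a, b]} 1_A), where M_t(A) = W(1_{[0, t]} 1_A). *)
Record elementary := Elementary {
  el_coef : T -> R ;
  el_start : R ;
  el_end : R ;
  el_set : set E ;
  el_vec : hilbert gam ;
  el_time : 0 <= el_start < el_end ;
  el_bounded : exists M, forall w, `|el_coef w| <= M ;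
  el_past : forall B : set R, measurable B ->
    filtration el_start (el_coef @^-1` B) ;
  el_setP : measurable el_set /\ bounded_set el_set ;
  el_vecP : represents el_vec
    (fun p => \1_(`]el_start, el_end] `*` el_set) p) }.

Definition simple_process (S : seq elementary) (s : R) (y : E) (w : T) : R :=
  \sum_(e <- S) el_coef e w * \1_(`]el_start e, el_end e] `*` el_set e) (s, y).

Definition simple_integral (S : seq elementary) (w : T) : R :=
  \sum_(e <- S) el_coef e w * W (el_vec e) w.

Definition predictable_sets : set (set (R * E * T)) :=
  <<s [set D | exists (a b : R) (A : set E) (F : set T),
         [/\ 0 <= a < b, measurable A, filtration a F
           & D = (`]a, b] `*` A) `*` F] ] >>.

(* Only positive times are relevant for the stochastic integral. *)
Definition predictable (Phi : R -> E -> T -> R) : Prop :=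
  forall B : set R, measurable B ->
    predictable_sets [set z | 0 < z.1.1 /\ B (Phi z.1.1 z.1.2 z.2)].

(* The square of Walsh's norm ||Phi||_+ *)
Definition walsh_norm2 (Phi : R -> E -> T -> R) : \bar R :=
  (\int[P]_w \int[lebesgue_measure]_(s in `[0%R, +oo[)
     energy gam (fun y => `|Phi s y w|%R) (fun z => `|Phi s z w|%R))%E.

(* I = \int_{R_+} \int_{R^d} Phi(s, y) W(ds, dy), which is defined up to a null
   set: the extension to the predictable processes Phi with ||Phi||_+ < oo of
   the integral of simple processes, by density and L^2-continuity. *)
Definition walsh_integral (Phi : R -> E -> T -> R) (I : T -> R) : Prop :=
  [/\ predictable Phi, (walsh_norm2 Phi < +oo)%E, measurable_fun setT I
    & exists S : nat -> seq elementary,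
        (fun n => walsh_norm2
           (fun s y w => simple_process (S n) s y w - Phi s y w)) @ \oo --> 0%E /\
        (fun n => \int[P]_w ((simple_integral (S n) w - I w) ^+ 2)%:E)%E
           @ \oo --> 0%E].

Definition adapted (u : R -> E -> T -> R) : Prop :=
  forall t x (B : set R), 0 <= t -> measurable B ->
    filtration t (u t x @^-1` B).

(* wave_kernel (t - s) vanishes for s >= t, so that the stochastic integral over
   R_+ x R^d is the one over [0, t] x R^d. *)
Definition wave_solution (sigma : R -> R) (u : R -> E -> T -> R) : Prop :=
  [/\ adapted u,
      forall t1 k : R, 0 <= t1 -> 2 <= k ->
        (ereal_sup [set \int[P]_w (`|u p.1 p.2 w| `^ k)%:E
                     | p in (`[0%R, t1] `*` [set: E])%classic] < +oo)%E
    & forall t x, 0 <= t -> exists I : T -> R,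
        walsh_integral
          (fun s y w => wave_kernel (t - s) (x - y) * sigma (u s y w)) I /\
        {ae P, forall w, u t x w = 1 + I w}].

End integral.

Definition strictly_stationary (v : E -> T -> R) : Prop :=
  forall (y : E) n (x : 'I_n -> E) (B : set (n.-tuple R)), measurable B ->
    P [set w | B [tuple v (x i + y) w | i < n]] =
    P [set w | B [tuple v (x i) w | i < n]].

Definition cylinder_sets : set (set (E -> R)) :=
  <<s [set A | exists (x : E) (B : set R),
         measurable B /\ A = [set f | B (f x)] ] >>.

(* Invariance of the event {v \in A} is understood modulo P: no subset of E -> R
   in the product sigma-algebra is exactly invariant, except set0 and setT. *)
Definition ergodic (v : E -> T -> R) : Prop :=
  forall A, cylinder_sets A ->
    (forall y, P ([set w | A (v ^~ w)] `+`
                  [set w | A (fun x => v (x + y) w)]) = 0%E) ->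
    P [set w | A (v ^~ w)] = 0%E \/ P [set w | A (v ^~ w)] = 1%E.

End noise.

(* Main.v *)
Require Import Defs.
From HB Require Import structures.
From mathcomp Require Import all_boot all_order all_algebra.
From mathcomp Require Import all_classical all_reals all_analysis.
From mathcomp Require Import measurable_realfun ring lra.
Import Order.TTheory GRing.Theory Num.Theory.
Import numFieldNormedType.Exports.
Local Open Scope classical_set_scope.
Local Open Scope ring_scope.
Set Implicit Arguments.
Unset Strict Implicit.
Unset Printing Implicit Defensive.

(** Translating the noise by y acts on the trigonometric polynomials of the noise, here called
    codes, and preserves their means because the covariance is translation invariant. Consider the
    smallest q such that every pair (u(t,x), u(t,x+y)) is within q in L2 of a pair (code, translated
    code). Predictable integrands are L2 limits of sums of products of a code of the past with a
    deterministic function, the integrals of such sums are limits of codes, and translation commutes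
    with this. Hence the Walsh isometry yields the same Gronwall estimate for q as for the difference
    of two solutions, and q = 0. Stationarity follows. Since gamma is integrable, a code decorrelates
    from its translates at infinity, so the spatial shifts are mixing, which gives ergodicity.

    The Gronwall estimate needs a bound of the energy of the wave kernel G_r which is uniform in
    r <= T. It comes from a trilinear Young inequality with G_r in L^p, p = 2l/(2l-1) < 2, and gamma
    in L^l. *)

(** No transformation of the probability space implements the translations, and random variables are
    not given as functionals of the noise. The translate of a variable is therefore never defined:
    [near X Y 0] only says that [Y] behaves as the translate of [X], and everything is transferred
    through codes. Cosines of linear forms suit this purpose: they are bounded, their products are
    again sums of cosines, and their means are explicit functions of the covariances, so that
    Gaussian laws on the line suffice. Events are reached through one general fact: the sets whose
    indicators are L2 limits of an algebra of bounded functions form a sigma-algebra. It is applied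
    to codes, to pairs, to test functions and to predictable processes. A difficulty is that Walsh's
    norm does not control the L2 norm of processes. The stochastic integral is a limit along simple
    processes converging in Walsh's norm only, whereas the Gronwall estimate compares second moments
    point by point in space-time. Hence two approximations of the same integrand, compared by two
    different bounds of the isometry, [isum_le_wen] and [isum_le_stdev]. *)

Lemma cvge0_le {R : realType} (u : nat -> \bar R) : u @ \oo --> 0%E ->
  forall e : R, 0 < e -> exists N, forall n, (N <= n)%N -> (u n <= e%:E)%E.
Proof.
move=> /fine_cvgP[[N1 _ ufin] /cvgrPdist_le u0] e /u0[N2 _ ue].
exists (maxn N1 N2) => n; rewrite geq_max => /andP[/ufin/= ufn /ue/=].
rewrite sub0r normrN -(fineK ufn) lee_fin; apply: le_trans; exact: ler_norm.
Qed.

Lemma le0_cvge {R : realType} (u : nat -> \bar R) : (forall n, 0 <= u n)%E ->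
  (forall e : R, 0 < e -> exists N, forall n, (N <= n)%N -> (u n <= e%:E)%E) ->
  u @ \oo --> 0%E.
Proof.
move=> u0 ue; have fin n e : (u n <= e%:E)%E -> u n \is a fin_num.
  by move=> une; rewrite ge0_fin_numE// (le_lt_trans une) ?ltry.
apply/fine_cvgP; split.
  have [N Nu] := ue 1 ltr01; exists N => // n /= /Nu; exact: fin.
apply/cvgrPdist_le => e e0; have [N Nu] := ue e e0; exists N => // n /= /Nu une.
rewrite sub0r normrN ger0_norm ?fine_ge0// -lee_fin fineK//; exact: fin une.
Qed.

(** * Squared L2 norms *)

Section sqn.
Context {d : measure_display} {X : measurableType d} {R : realType}.
Variable m : {measure set X -> \bar R}.
Implicit Types f g h : X -> R.

(** Kept in [\bar R], so that estimates can be chained before integrability is known. *)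
Definition sqn f : \bar R := (\int[m]_x (f x ^+ 2)%:E)%E.

Lemma sqn_ge0 f : (0 <= sqn f)%E.
Proof. by apply: integral_ge0 => x _; rewrite lee_fin sqr_ge0. Qed.

Lemma measurable_sq f : measurable_fun setT f ->
  measurable_fun setT (fun x => (f x ^+ 2)%:E).
Proof. by move=> mf; apply/measurable_EFinP; exact: measurable_funX. Qed.

Lemma le_sqn f g : measurable_fun setT f -> measurable_fun setT g ->
  (forall x, `|f x| <= `|g x|) -> (sqn f <= sqn g)%E.
Proof.
move=> mf mg fg; apply: ge0_le_integral => //.
- by move=> x _; rewrite lee_fin sqr_ge0.
- exact: measurable_sq.
- exact: measurable_sq.
- by move=> x _; rewrite lee_fin -[leLHS]real_normK ?num_real// -[leRHS]real_normK ?num_real// lerXn2r ?nnegrE.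
Qed.

Lemma sqnZ (k : R) f : measurable_fun setT f ->
  sqn (fun x => k * f x)%R = ((k ^+ 2)%:E * sqn f)%E.
Proof.
move=> mf; rewrite /sqn -ge0_integralZl_EFin//.
- by apply: eq_integral => x _; rewrite exprMn EFinM.
- by move=> x _; rewrite lee_fin sqr_ge0.
- exact: measurable_sq.
- exact: sqr_ge0.
Qed.

Lemma sqnN f : sqn (fun x => - f x)%R = sqn f.
Proof. by apply: eq_integral => x _; rewrite sqrrN. Qed.

Lemma sqnBC f g : sqn (fun x => f x - g x)%R = sqn (fun x => g x - f x)%R.
Proof. by apply: eq_integral => x _; rewrite -sqrrN opprB. Qed.

Lemma sqn_le_mix f g h (a b : R) : 0 <= a -> 0 <= b ->
  measurable_fun setT f -> measurable_fun setT g -> measurable_fun setT h ->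
  (forall x, h x ^+ 2 <= a * f x ^+ 2 + b * g x ^+ 2) ->
  (sqn h <= a%:E * sqn f + b%:E * sqn g)%E.
Proof.
move=> a0 b0 mf mg mh hfg; rewrite /sqn -!ge0_integralZl_EFin//; first last.
- exact: measurable_sq.
- by move=> x _; rewrite lee_fin sqr_ge0.
- exact: measurable_sq.
- by move=> x _; rewrite lee_fin sqr_ge0.
rewrite -ge0_integralD//; first last.
- by apply: measurable_funeM; exact: measurable_sq.
- by move=> x _; rewrite -EFinM lee_fin mulr_ge0 ?sqr_ge0.
- by apply: measurable_funeM; exact: measurable_sq.
- by move=> x _; rewrite -EFinM lee_fin mulr_ge0 ?sqr_ge0.
apply: ge0_le_integral => //.
- by move=> x _; rewrite lee_fin sqr_ge0.
- exact: measurable_sq.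
- by apply: emeasurable_funD; apply: measurable_funeM; exact: measurable_sq.
- by move=> x _; rewrite -!EFinM -EFinD lee_fin.
Qed.

Lemma sqnD f g : measurable_fun setT f -> measurable_fun setT g ->
  (sqn (fun x => f x + g x)%R <= 2%:E * sqn f + 2%:E * sqn g)%E.
Proof.
move=> mf mg; apply: sqn_le_mix => //; first exact: measurable_funD.
by move=> x; have := sqr_ge0 (f x - g x); nra.
Qed.

Lemma sqnB f g h : measurable_fun setT f -> measurable_fun setT g ->
  measurable_fun setT h ->
  (sqn (fun x => f x - h x)%R <=
   2%:E * sqn (fun x => f x - g x)%R + 2%:E * sqn (fun x => g x - h x)%R)%E.
Proof.
move=> mf mg mh; apply: le_trans (sqnD _ _); [|exact: measurable_funB..].
by rewrite le_eqVlt; apply/orP; left; apply/eqP/eq_integral => x _; congr (_%:E); ring.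
Qed.

Lemma sqnMl f g (M : R) : measurable_fun setT f -> measurable_fun setT g ->
  (forall x, `|f x| <= M) ->
  (sqn (fun x => f x * g x)%R <= (M ^+ 2)%:E * sqn g)%E.
Proof.
move=> mf mg fM; rewrite -sqnZ//; apply: le_sqn.
- exact: measurable_funM.
- exact: measurable_funM.
by move=> x; rewrite !normrM ler_wpM2r//; exact: le_trans (fM x) (ler_norm _).
Qed.

Lemma sqn_cvg0 (h : nat -> X -> R) g :
  (forall n, measurable_fun setT (h n)) -> measurable_fun setT g ->
  (sqn g < +oo)%E -> (forall n x, `|h n x| <= `|g x|) ->
  (forall x, h n x @[n --> \oo] --> 0) ->
  forall e, 0 < e -> exists N, forall n, (N <= n)%N -> (sqn (h n) <= e%:E)%E.
Proof.
move=> mh mg goo hg h0 e e0.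
have : (fun n => sqn (h n)) @ \oo --> 0%E.
  rewrite -(_ : \int[m]_x (cst 0%E) x = 0)%E; last exact: integral0.
  apply: (@dominated_cvg _ _ _ m _ _ _ _ (fun x => (g x ^+ 2)%:E)) => //.
  - by move=> n; exact: measurable_sq.
  - move=> x _; apply: cvg_EFin; first exact: nearW.
    rewrite (_ : _ \o _ = (fun n => h n x * h n x)).
      by rewrite -(mulr0 (0 : R)); exact: cvgM.
    by apply/funext => n /=; rewrite expr2.
  - apply/integrableP; split; first exact: measurable_sq.
    by under eq_integral do rewrite gee0_abs ?lee_fin ?sqr_ge0//.
  - move=> n x _; rewrite gee0_abs ?lee_fin ?sqr_ge0//.
    by rewrite -[leLHS]real_normK ?num_real// -[leRHS]real_normK ?num_real// lerXn2r ?nnegrE.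
by move/cvge0_le; exact.
Qed.

End sqn.

(** * The closure in L2 of an algebra of bounded functions *)

Section iter_sign.
Context {R : realFieldType}.
Implicit Types x : R.

(* Its iterates converge pointwise on [-1, 1] to the sign, so the sign is a
   pointwise bounded limit of polynomials. *)
Definition sign_step x : R := x * (3 - x ^+ 2) / 2.

Lemma sign_stepN x : sign_step (- x) = - sign_step x.
Proof. by rewrite /sign_step; field. Qed.

Lemma sign_step_itv x : 0 < x <= 1 -> x <= sign_step x <= 1.
Proof.
move=> /andP[x0 x1]; apply/andP; split; rewrite -subr_ge0.
  rewrite [leRHS](_ : _ = x * ((1 - x) * (1 + x)) / 2); last by rewrite /sign_step; field.
  by rewrite !divr_ge0 ?mulr_ge0//; lra.
rewrite [leRHS](_ : _ = (1 - x) ^+ 2 * (2 + x) / 2); last by rewrite /sign_step; field.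
by rewrite !divr_ge0 ?mulr_ge0 ?sqr_ge0//; lra.
Qed.

Lemma iter_sign_step_itv n x : 0 < x <= 1 -> x <= iter n sign_step x <= 1.
Proof.
move=> xP; elim: n => [|n /andP[IH1 IH2]]; first by rewrite lexx; case/andP: xP.
have /sign_step_itv/andP[h1 h2] : 0 < iter n sign_step x <= 1.
  by case/andP: xP => x0 _; rewrite IH2 (lt_le_trans x0).
by rewrite iterS h2 (le_trans IH1).
Qed.

(** [1 - sign_step y = (1 - y) (1 - (y + y^2) / 2)], and the iterates stay above [x]: each step
    contracts the distance to 1 by the factor [1 - x / 2] at least. *)
Lemma iter_sign_step_rate n x : 0 < x <= 1 ->
  1 - iter n sign_step x <= (1 - x / 2) ^+ n.
Proof.
move=> xP; elim: n => [|n IH]; first by rewrite /= expr0; case/andP: xP; lra.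
rewrite iterS exprSr; have /andP[h1 h2] := iter_sign_step_itv n xP.
case/andP: xP => x0 x1; set y := iter n sign_step x in IH h1 h2 *.
apply: (@le_trans _ _ ((1 - y) * (1 - x / 2))).
  rewrite [leLHS](_ : _ = (1 - y) * (1 - (y + y ^+ 2) / 2)); last by rewrite /sign_step; field.
  by rewrite ler_wpM2l//; [lra|have := sqr_ge0 y; lra].
by rewrite ler_wpM2r//; lra.
Qed.

Lemma iter_sign_stepN n x : iter n sign_step (- x) = - iter n sign_step x.
Proof. by elim: n => //= n ->; rewrite sign_stepN. Qed.

Lemma iter_sign_step0 n : iter n sign_step 0 = 0.
Proof. by elim: n => //= n ->; rewrite /sign_step !mul0r. Qed.

Lemma iter_sign_step_le1 n x : `|x| <= 1 -> `|iter n sign_step x| <= 1.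
Proof.
rewrite ler_norml => /andP[x1 x2].
have [x0|x0|->] := ltgtP x 0; last by rewrite iter_sign_step0 normr0.
- have /(iter_sign_step_itv n)/andP[h1 h2] : 0 < - x <= 1 by lra.
  by rewrite -normrN -iter_sign_stepN ger0_norm//; lra.
- have /(iter_sign_step_itv n)/andP[h1 h2] : 0 < x <= 1 by lra.
  by rewrite ger0_norm//; lra.
Qed.

End iter_sign.

Lemma cvg_iter_sign_step {R : realType} (x : R) : `|x| <= 1 ->
  iter n sign_step x @[n --> \oo] --> Num.sg x.
Proof.
have pos (y : R) : 0 < y <= 1 -> iter n sign_step y @[n --> \oo] --> (1 : R).
  move=> yP; apply: (@squeeze_cvgr _ \oo _ _ (fun n => 1 - (1 - y / 2) ^+ n) (cst 1)).
  - apply: nearW => n /=; have := iter_sign_step_rate n yP.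
    by have /andP[_ ? ?] := iter_sign_step_itv n yP; apply/andP; split; lra.
  - rewrite -[X in _ --> X]subr0; apply: cvgB; first exact: cvg_cst.
    by apply: cvg_expr; case/andP: yP => y0 y1; rewrite ger0_norm; first lra; lra.
  - exact: cvg_cst.
rewrite ler_norml => /andP[x1 x2].
have [x0|x0|->] := ltgtP x 0.
- rewrite ltr0_sg//; have /pos h : 0 < - x <= 1 by lra.
  rewrite (_ : (fun n => _) = fun n => - iter n sign_step (- x)); first exact: cvgN.
  by apply/funext => n; rewrite iter_sign_stepN opprK.
- by rewrite gtr0_sg//; apply: pos; lra.
- by rewrite sgr0; under eq_fun do rewrite iter_sign_step0; exact: cvg_cst.
Qed.

Section L2cl.
Context {d : measure_display} {X : measurableType d} {R : realType}.
Variable m : {finite_measure set X -> \bar R}.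
Implicit Types (f g h : X -> R) (A : set (X -> R)) (S : set X).

Definition bdd (Y : Type) (f : Y -> R) := exists M, forall x, `|f x| <= M.

(** Constants enter through the closure only ([A1] below), because test functions of bounded support
    approximate them on a bounded set without containing them. *)
Record is_alg A := IsAlg {
  alg_meas : forall f, A f -> measurable_fun setT f;
  alg_bdd : forall f, A f -> bdd f;
  algD : forall f g, A f -> A g -> A (fun x => f x + g x);
  algZ : forall (k : R) f, A f -> A (fun x => k * f x);
  algM : forall f g, A f -> A g -> A (fun x => f x * g x) }.

Definition L2cl A f := measurable_fun setT f /\
  forall e : R, 0 < e -> exists2 g, A g & (sqn m (fun x => f x - g x)%R <= e%:E)%E.

(** These sets play the role of the completed sigma-algebra generated by [A], without any
    measurability with respect to a second sigma-algebra. *)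
Definition Sig A S := measurable S /\ L2cl A \1_S.

Lemma bddP (Y : Type) (f : Y -> R) : bdd f -> exists2 M, 0 < M & forall x, `|f x| <= M.
Proof.
case=> M fM; exists (`|M| + 1) => [|x]; first by rewrite ltr_wpDl.
by apply: le_trans (fM x) _; apply: le_trans (ler_norm _) _; rewrite lerDl.
Qed.

Variable A : set (X -> R).
Hypothesis Aalg : is_alg A.

Lemma sub_L2cl f : A f -> L2cl A f.
Proof.
move=> Af; split=> [|e e0]; first exact: alg_meas Af.
exists f => //; rewrite /sqn; under eq_integral do rewrite subrr expr0n/=.
by rewrite integral0 lee_fin ltW.
Qed.

Lemma L2cl_lim f : measurable_fun setT f ->
  (forall e : R, 0 < e -> exists2 g, L2cl A g & (sqn m (fun x => f x - g x)%R <= e%:E)%E) ->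
  L2cl A f.
Proof.
move=> mf H; split=> // e e0; have e4 : 0 < e / 4 by lra.
have [g [mg Hg] fg] := H _ e4; have [h Ah gh] := Hg _ e4.
exists h => //; apply: le_trans (sqnB _ mf mg _) _; first exact: alg_meas Ah.
apply: le_trans (leeD (lee_wpmul2l _ fg) (lee_wpmul2l _ gh)) _ => //.
by rewrite -!EFinM -EFinD lee_fin; lra.
Qed.

Lemma L2clD f g : L2cl A f -> L2cl A g -> L2cl A (fun x => f x + g x).
Proof.
move=> [mf Hf] [mg Hg]; split=> [|e e0]; first exact: measurable_funD.
have e4 : 0 < e / 4 by lra.
have [f' Af ff] := Hf _ e4; have [g' Ag gg] := Hg _ e4.
exists (fun x => f' x + g' x); first exact: algD.
have mf' := alg_meas Aalg Af; have mg' := alg_meas Aalg Ag.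
rewrite (_ : (fun x => _) = (fun x => (f x - f' x) + (g x - g' x))); last first.
  by apply/funext => x; ring.
apply: le_trans (sqnD _ _ _) _; [exact: measurable_funB..|].
apply: le_trans (leeD (lee_wpmul2l _ ff) (lee_wpmul2l _ gg)) _ => //.
by rewrite -!EFinM -EFinD lee_fin; lra.
Qed.

Lemma L2clZ k f : L2cl A f -> L2cl A (fun x => k * f x).
Proof.
move=> [mf Hf]; split=> [|e e0]; first exact: measurable_funM.
have k0 : 0 < k ^+ 2 + 1 by rewrite ltr_wpDl// sqr_ge0.
have [f' Af ff] := Hf _ (divr_gt0 e0 k0).
exists (fun x => k * f' x); first exact: algZ.
have mf' := alg_meas Aalg Af.
rewrite (_ : (fun x => _) = (fun x => k * (f x - f' x))); last first.
  by apply/funext => x; ring.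
rewrite sqnZ; last exact: measurable_funB.
apply: le_trans (lee_wpmul2l _ ff) _; first by rewrite lee_fin sqr_ge0.
by rewrite -EFinM lee_fin mulrA ler_pdivrMr// mulrC ler_pM2l//; lra.
Qed.

Lemma L2clB f g : L2cl A f -> L2cl A g -> L2cl A (fun x => f x - g x).
Proof.
move=> hf /(L2clZ (-1)) hg; rewrite (_ : (fun x => _) = fun x => f x + -1 * g x).
  exact: L2clD.
by apply/funext => x; ring.
Qed.

(** [f g - f' g' = g (f - f') + f' (g - g')]. The bound of [f'] is needed to choose the precision of
    [g'], so [f'] is fixed before [g']. *)
Lemma L2clM f g : L2cl A f -> L2cl A g -> bdd g -> L2cl A (fun x => f x * g x).
Proof.
move=> [mf Hf] [mg Hg] /bddP[M M0 gM]; split=> [|e e0]; first exact: measurable_funM.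
have M20 : 0 < M ^+ 2 by rewrite exprn_gt0.
have [f' Af ff] := Hf _ (divr_gt0 e0 (mulr_gt0 (ltr0n _ 4) M20)).
have [M' M'0 fM] := bddP (alg_bdd Aalg Af).
have M'20 : 0 < M' ^+ 2 by rewrite exprn_gt0.
have [g' Ag gg] := Hg _ (divr_gt0 e0 (mulr_gt0 (ltr0n _ 4) M'20)).
exists (fun x => f' x * g' x); first exact: algM.
have mf' := alg_meas Aalg Af; have mg' := alg_meas Aalg Ag.
rewrite (_ : (fun x => _) = (fun x => g x * (f x - f' x) + f' x * (g x - g' x))); last first.
  by apply/funext => x; ring.
apply: le_trans (sqnD _ _ _) _.
- by apply: measurable_funM => //; exact: measurable_funB.
- by apply: measurable_funM => //; exact: measurable_funB.
apply: (@le_trans _ _ (2%:E * (e / 4)%:E + 2%:E * (e / 4)%:E)%E); last first.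
  by rewrite -!EFinM -EFinD lee_fin; lra.
apply: leeD; apply: lee_wpmul2l => //.
- apply: le_trans (sqnMl _ mg _ gM) _; first exact: measurable_funB.
  apply: le_trans (lee_wpmul2l _ ff) _; first by rewrite lee_fin ltW.
  by rewrite -EFinM lee_fin le_eqVlt; apply/orP; left; apply/eqP; field; rewrite lt0r_neq0.
- apply: le_trans (sqnMl _ mf' _ fM) _; first exact: measurable_funB.
  apply: le_trans (lee_wpmul2l _ gg) _; first by rewrite lee_fin ltW.
  by rewrite -EFinM lee_fin le_eqVlt; apply/orP; left; apply/eqP; field; rewrite lt0r_neq0.
Qed.

Lemma sqn_cst (k : R) : (sqn m (cst k) = (k ^+ 2)%:E * m setT)%E.
Proof. by rewrite /sqn; under eq_integral do rewrite /=; rewrite integral_cst. Qed.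

Lemma sqn_bdd_lty f : measurable_fun setT f -> bdd f -> (sqn m f < +oo)%E.
Proof.
move=> mf [M fM]; apply: (@le_lt_trans _ _ (sqn m (cst M))).
  by apply: le_sqn => // x /=; exact: le_trans (fM x) (ler_norm _).
by rewrite sqn_cst lte_mul_pinfty ?lee_fin ?sqr_ge0// fin_num_fun_lty.
Qed.

Lemma L2cl_dct (h : nat -> X -> R) f M : (forall n, L2cl A (h n)) ->
  (forall n x, `|h n x| <= M) -> (forall x, h n x @[n --> \oo] --> f x) ->
  L2cl A f.
Proof.
move=> hA hM hf.
have mf : measurable_fun setT f.
  by apply: (measurable_fun_cvg (h := h)) => [n|x _]; [case: (hA n)|exact: hf].
have fM x : `|f x| <= M.
  by apply: (cvgr_to_le (cvg_norm (hf x))); apply: nearW.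
apply: L2cl_lim => // e e0.
have [|||||N HN] := @sqn_cvg0 _ _ _ m (fun n x => f x - h n x) (cst (M + M)) _ _ _ _ _ e e0.
- by move=> n; apply: measurable_funB => //; case: (hA n).
- exact: measurable_cst.
- by apply: sqn_bdd_lty => //; exists `|M + M| => x.
- move=> n x /=; apply: le_trans (ler_normB _ _) _; apply: le_trans _ (ler_norm _).
  exact: lerD.
- move=> x; rewrite -(subrr (f x)); apply: cvgB => //; exact: cvg_cst.
by exists (h N) => //; exact: HN.
Qed.

End L2cl.

Lemma cvg_eventually {R : realType} (u : nat -> R) l N :
  (forall n, (N <= n)%N -> u n = l) -> u @ \oo --> l.
Proof. by move=> h; apply: cvg_near_cst; exists N. Qed.

(** * The sets and the functions determined by an algebra *)

Section Sig.
Context {d : measure_display} {X : measurableType d} {R : realType}.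
Variable m : {finite_measure set X -> \bar R}.
Variable A : set (X -> R).
Hypothesis Aalg : is_alg A.
Hypothesis A1 : L2cl m A (cst 1).
Implicit Types (f g h : X -> R) (S : set X).

Lemma indic_bdd S : bdd (\1_S : X -> R).
Proof. by exists 1 => x; rewrite indicE; case: (_ \in _); rewrite ?normr1 ?normr0. Qed.

Lemma SigT : Sig m A setT.
Proof. by split=> //; rewrite indicT. Qed.

Lemma SigC S : Sig m A S -> Sig m A (~` S).
Proof.
move=> [mS hS]; split; first exact: measurableC.
rewrite (_ : \1_(~` S) = fun x => cst 1 x - \1_S x :> R); first exact: (L2clB Aalg).
by apply/funext => x; rewrite !indicE in_setC; case: (x \in S); rewrite /= ?subrr ?subr0.
Qed.

Lemma SigI S S' : Sig m A S -> Sig m A S' -> Sig m A (S `&` S').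
Proof.
move=> [mS hS] [mS' hS']; split; first exact: measurableI.
by rewrite indicI; apply: (L2clM Aalg) => //; exact: indic_bdd.
Qed.

Lemma SigU S S' : Sig m A S -> Sig m A S' -> Sig m A (S `|` S').
Proof. by move=> /SigC hS /SigC hS'; rewrite -[_ `|` _]setCK setCU; apply/SigC/SigI. Qed.

Lemma Sig0 : Sig m A set0.
Proof. by rewrite -setCT; apply/SigC/SigT. Qed.

Lemma Sig_bigcup (F : nat -> set X) : (forall n, Sig m A (F n)) -> Sig m A (\bigcup_n F n).
Proof.
move=> FS; split; first by apply: bigcupT_measurable => n; case: (FS n).
have FnS n : Sig m A (\big[setU/set0]_(i < n) F i).
  by elim/big_ind : _ => //; [exact: Sig0|exact: SigU].
apply: (@L2cl_dct _ _ _ m A Aalg (fun n => \1_(\big[setU/set0]_(i < n) F i)) _ 1).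
- by move=> n; case: (FnS n).
- by move=> n x; rewrite indicE; case: (_ \in _); rewrite ?normr1 ?normr0.
move=> x; have [[k _ Fkx]|nx] := pselect ((\bigcup_n F n) x).
- rewrite indicE mem_set; last by exists k.
  apply: (@cvg_eventually _ _ _ k.+1) => n kn.
  by rewrite indicE mem_set// -bigcup_mkord; exists k.
- rewrite indicE memNset//.
  apply: (@cvg_eventually _ _ _ 0) => n _ /=.
  by rewrite indicE memNset// -bigcup_mkord => -[k _ ?]; apply: nx; exists k.
Qed.

Lemma Sig_sub_sigma (G : set (set X)) : G `<=` Sig m A -> <<s G>> `<=` Sig m A.
Proof.
move=> GS; apply: smallest_sub => //; split; first exact: Sig0.
- by move=> S /SigC; rewrite setTD.
- exact: Sig_bigcup.
Qed.

Lemma L2cl_sg f : L2cl m A f -> (forall x, `|f x| <= 1) -> L2cl m A (fun x => Num.sg (f x)).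
Proof.
move=> hf f1; apply: (@L2cl_dct _ _ _ m A Aalg (fun n x => iter n (@sign_step R) (f x)) _ 1).
- elim=> [//|n IH]; rewrite (_ : (fun x => _) =
    fun x => (3 / 2) * iter n (@sign_step R) (f x) +
      (- 2^-1) * (iter n (@sign_step R) (f x) * iter n (@sign_step R) (f x) * iter n (@sign_step R) (f x))).
    have b : bdd (fun x => iter n (@sign_step R) (f x)).
      by exists 1 => x; exact: iter_sign_step_le1.
    apply: (L2clD Aalg); apply: (L2clZ Aalg) => //.
    by do 2 apply: (L2clM Aalg) => //.
  by apply/funext => x; rewrite iterS /sign_step; field.
- by move=> n x; exact: iter_sign_step_le1.
- by move=> x; exact: cvg_iter_sign_step.
Qed.

(** The indicator of []0, +oo[] is [(s + s^2) / 2] with [s] the sign; it is applied to [f - a],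
    rescaled into [[-1, 1]] where the iterates of [sign_step] converge. *)
Lemma Sig_gt f (a : R) : L2cl m A f -> bdd f -> Sig m A [set x | a < f x].
Proof.
move=> hf /bddP[M M0 fM]; have mf := hf.1.
have c0 : 0 < M + `|a| by rewrite ltr_pwDl.
have hg : L2cl m A (fun x => Num.sg ((M + `|a|)^-1 * (f x - a))).
  apply: L2cl_sg => [|x].
    apply: (L2clZ Aalg); rewrite (_ : (fun x => _) = fun x => f x - a * cst 1 x).
      by apply: (L2clB Aalg) => //; exact: (L2clZ Aalg).
    by apply/funext => x; rewrite mulr1.
  rewrite normrM gtr0_norm ?invr_gt0// mulrC ler_pdivrMr// mul1r.
  by apply: le_trans (ler_normB _ _) _; rewrite lerD2r.
have gb : bdd (fun x => Num.sg ((M + `|a|)^-1 * (f x - a))).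
  by exists 1 => x; rewrite normr_sg; case: (_ == 0).
split.
  rewrite -[X in measurable X]setTI; rewrite (_ : [set x | _] = f @^-1` `]a, +oo[); first exact: mf.
  by apply/seteqP; split => x /=; rewrite in_itv/= andbT.
rewrite (_ : \1_[set x | _] = fun x => 2^-1 * (Num.sg ((M + `|a|)^-1 * (f x - a)) +
   Num.sg ((M + `|a|)^-1 * (f x - a)) * Num.sg ((M + `|a|)^-1 * (f x - a)))).
  by apply: (L2clZ Aalg); apply: (L2clD Aalg) => //; exact: (L2clM Aalg).
apply/funext => x; rewrite sgrM gtr0_sg ?invr_gt0// mul1r indicE.
have [ax|xa|->] := ltgtP a (f x).
- by rewrite gtr0_sg ?subr_gt0// mem_set//=; field.
- by rewrite ltr0_sg ?subr_lt0// memNset//=; [field|apply/negP; rewrite -leNgt ltW].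
- by rewrite subrr sgr0 memNset/= ?ltxx//; field.
Qed.

Lemma Sig_preimage f : (forall a, Sig m A [set x | a < f x]) ->
  forall B, measurable B -> Sig m A (f @^-1` B).
Proof.
move=> H B mB.
have : (@RGenOInfty.G R).-sigma.-measurable B by rewrite -RGenOInfty.measurableE.
move: B {mB}; apply: (@smallest_sub _ _ _ [set B | Sig m A (f @^-1` B)]).
  split=> /= [|S hS|F hF].
  - by rewrite preimage_set0; exact: Sig0.
  - by rewrite setTD preimage_setC; exact: SigC.
  - by rewrite preimage_bigcup; exact: Sig_bigcup.
move=> _ [a ->] /=; rewrite (_ : _ @^-1` _ = [set x | a < f x])//.
by apply/seteqP; split => x /=; rewrite in_itv/= andbT.
Qed.

Lemma Sig_meas f : (forall B, measurable B -> Sig m A (f @^-1` B)) -> measurable_fun setT f.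
Proof. by move=> H _ B mB; rewrite setTI; case: (H B mB). Qed.

(* Binary digits: if the half-line indicator is in the closure, halving reduces
   an error of [1/2^n] to [1/2^(n+1)]. *)
Lemma L2cl_approx01 f (psi : R -> R) n : (forall B, measurable B -> Sig m A (f @^-1` B)) ->
  measurable_fun setT psi -> (forall r, 0 <= psi r <= 1) ->
  exists2 g, L2cl m A g & forall x, `|psi (f x) - g x| <= 2^-1 ^+ n.
Proof.
move=> H; elim: n psi => [|n IH] psi mpsi psi01.
  exists (fun x => 0 * cst 1 x) => [|x]; first exact: (L2clZ Aalg).
  by rewrite mul0r subr0 expr0; have /andP[h1 h2] := psi01 (f x); rewrite ger0_norm.
pose B := psi @^-1` `]2^-1, +oo[.
have mB : measurable B by rewrite -[X in measurable X]setTI; exact: mpsi.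
have mp : measurable_fun setT (fun r => 2 * psi r - \1_B r : R).
  by apply: measurable_funB; [exact: measurable_funM|exact: measurable_indic].
have [r|g hg gP] := IH (fun r => 2 * psi r - \1_B r) mp.
  have /andP[h1 h2] := psi01 r; rewrite indicE.
  have [rB|rB] := boolP (r \in B).
  - move: rB; rewrite inE /B/= in_itv/= andbT => rB.
    by apply/andP; split=> /=; lra.
  - move: rB; rewrite notin_setE /B/= in_itv/= andbT => /negP; rewrite -leNgt => rB.
    by apply/andP; split=> /=; lra.
exists (fun x => 2^-1 * (g x + \1_(f @^-1` B) x)).
  by apply: (L2clZ Aalg); apply: (L2clD Aalg) => //; case: (H _ mB).
move=> x; rewrite (_ : _ - _ = 2^-1 * (2 * psi (f x) - \1_B (f x) - g x)); last first.
  by rewrite (_ : \1_(f @^-1` B) x = \1_B (f x)) ?indicE//; field.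
by rewrite normrM ger0_norm// exprS ler_wpM2l.
Qed.

Lemma L2cl_unif f : measurable_fun setT f ->
  (forall e : R, 0 < e -> exists2 g, L2cl m A g & forall x, `|f x - g x| <= e) -> L2cl m A f.
Proof.
move=> mf H; apply: (L2cl_lim Aalg) => // e e0.
have mT : m setT \is a fin_num by rewrite ge0_fin_numE// fin_num_fun_lty.
have M0 : 0 < fine (m setT) + 1 by rewrite ltr_wpDl// fine_ge0.
pose e1 := Num.sqrt (e / (fine (m setT) + 1)).
have e10 : 0 < e1 by rewrite sqrtr_gt0 divr_gt0.
have [g hg fg] := H _ e10; exists g => //.
apply: (@le_trans _ _ (sqn m (cst e1))).
  apply: le_sqn => //; first by apply: measurable_funB => //; case: hg.
  by move=> x; rewrite (le_trans (fg x))// ger0_norm// ltW.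
rewrite sqn_cst -(fineK mT) -EFinM lee_fin sqr_sqrtr; last by rewrite divr_ge0// ltW.
by rewrite mulrAC ler_pdivrMr// ler_pM2l//; lra.
Qed.

Lemma L2cl_comp_bdd f (psi : R -> R) M : (forall B, measurable B -> Sig m A (f @^-1` B)) ->
  measurable_fun setT psi -> (forall r, `|psi r| <= M) -> L2cl m A (psi \o f).
Proof.
move=> H mpsi psiM; have mf := Sig_meas H.
have M0 : 0 <= M := le_trans (normr_ge0 _) (psiM 0).
have [M0'|M0'] := eqVneq M 0.
  rewrite (_ : psi \o f = fun x => 0 * cst 1 x); first exact: (L2clZ Aalg).
  apply/funext => x; rewrite mul0r /=; apply/eqP; rewrite -normr_le0.
  by rewrite -M0'; exact: psiM.
have {}M0 : 0 < M by rewrite lt_neqAle eq_sym M0'.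
have h01 : L2cl m A (fun x => (2 * M)^-1 * (psi (f x) + M)).
  apply: L2cl_unif => [|e e0].
    apply: measurable_funM => //; apply: measurable_funD => //.
    exact: (measurableT_comp mpsi mf).
  have [k hk] : exists k, (2^-1 : R) ^+ k <= e.
    have : (GRing.exp (2^-1 : R)) @ \oo --> 0 by apply: cvg_expr; rewrite ger0_norm//; lra.
    move/cvgrPdist_le => /(_ _ e0)[k _ /(_ k (leqnn k))]; rewrite sub0r normrN => h.
    by exists k; apply: le_trans h; exact: ler_norm.
  have [||g hg gP] := @L2cl_approx01 f (fun r => (2 * M)^-1 * (psi r + M)) k H.
  - by apply: measurable_funM => //; exact: measurable_funD.
  - move=> r; have := psiM r; rewrite ler_norml => /andP[h1 h2].
    rewrite mulrC divr_ge0 ?ler_pdivrMr ?mul1r ?mulr_gt0//=; lra.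
  by exists g => // x; exact: le_trans (gP x) hk.
rewrite (_ : psi \o f = fun x => (2 * M) * ((2 * M)^-1 * (psi (f x) + M)) - M * cst 1 x).
  by apply: (L2clB Aalg); exact: (L2clZ Aalg).
by apply/funext => x; rewrite /= mulr1 mulrA divff ?mul1r ?addrK// mulf_neq0// lt0r_neq0.
Qed.

Definition clip (k r : R) := Num.max (- k) (Num.min r k).

Lemma measurable_clip k : measurable_fun setT (clip k).
Proof. by apply: measurable_maxr => //; exact: measurable_minr. Qed.

Lemma clip_le k r : 0 <= k -> `|clip k r| <= k.
Proof.
move=> k0; rewrite ler_norml /clip le_max lexx/= ge_max; apply/andP; split; first by lra.
by rewrite ge_min lexx orbT.
Qed.

Lemma clip_id k r : `|r| <= k -> clip k r = r.
Proof. by rewrite ler_norml /clip => /andP[h1 h2]; rewrite min_l// max_r. Qed.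

Lemma clip_sat k r : 0 <= k -> k <= r -> clip k r = k.
Proof. by move=> k0 kr; rewrite /clip min_r// max_r//; lra. Qed.

Lemma clip_le_id k r : 0 <= k -> `|clip k r| <= `|r|.
Proof.
move=> k0; have [rk|kr] := leP `|r| k; first by rewrite clip_id.
exact: le_trans (clip_le _ k0) (ltW kr).
Qed.

Lemma clip_lip k r r' : `|clip k r - clip k r'| <= `|r - r'|.
Proof.
wlog h : r r' / r <= r'.
  by move=> H; case/orP: (le_total r r') => /H //; rewrite distrC [X in _ <= X]distrC.
have h2 : clip k r <= clip k r'.
  by rewrite /clip le_max2 ?le_min2.
rewrite distrC [X in _ <= X]distrC !ger0_norm ?subr_ge0// /clip /Num.max /Num.min.
by move: h h2; rewrite /clip /Num.max /Num.min; do ![case: ifP] => *; lra.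
Qed.

Lemma cvg_clip (r : R) : clip n%:R r @[n --> \oo] --> r.
Proof.
apply: (@cvg_eventually _ _ _ (Num.bound `|r|)) => n hn.
rewrite clip_id//; apply: le_trans (ltW (archi_boundP (normr_ge0 r))) _.
by rewrite ler_nat.
Qed.

(** A converse of [Sig_L2cl]: the truncations of [f] are bounded, hence in the closure, and they
    converge to [f] by domination. *)
Lemma L2cl_of_Sig f : (forall B, measurable B -> Sig m A (f @^-1` B)) ->
  (sqn m f < +oo)%E -> L2cl m A f.
Proof.
move=> H foo; have mf := Sig_meas H; apply: (L2cl_lim Aalg) => // e e0.
have mc n : measurable_fun setT (fun x => clip n%:R (f x)).
  by apply: (measurableT_comp (measurable_clip _)).
have [|||||N HN] := @sqn_cvg0 _ _ _ m (fun n x => f x - clip n%:R (f x)) (fun x => 2 * f x) _ _ _ _ _ e e0.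
- by move=> n; exact: measurable_funB.
- exact: measurable_funM.
- by rewrite sqnZ// lte_mul_pinfty ?lee_fin.
- move=> n x; rewrite normrM ger0_norm//; apply: le_trans (ler_normB _ _) _.
  by rewrite mulr_natl mulr2n lerD2l clip_le_id.
- by move=> x; rewrite -(subrr (f x)); apply: cvgB; [exact: cvg_cst|exact: cvg_clip].
exists (clip N%:R \o f); last exact: HN.
by apply: (@L2cl_comp_bdd _ _ N%:R) => // [|r]; [exact: measurable_clip|exact: clip_le].
Qed.

Lemma Sig_alg f : A f -> forall B, measurable B -> Sig m A (f @^-1` B).
Proof.
move=> Af; apply: Sig_preimage => a; apply: Sig_gt; first exact: sub_L2cl.
exact: alg_bdd Af.
Qed.

(* Indicators of half-lines are limits of Lipschitz functions, which preserve L2 limits. *)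
Lemma Sig_L2cl f : L2cl m A f -> forall B, measurable B -> Sig m A (f @^-1` B).
Proof.
move=> hf; have mf := hf.1; apply: Sig_preimage => a.
(* This is [min (1, n (r - a)^+)]: it is [n]-Lipschitz and increases to the indicator of []a,
   +oo[]. *)
pose ramp n r : R := clip 1 (clip n%:R (n%:R * Num.max (r - a) 0)).
have mramp n : measurable_fun setT (ramp n).
  apply: measurableT_comp; first exact: measurable_clip.
  apply: measurableT_comp; first exact: measurable_clip.
  apply: measurable_funM => //; apply: measurable_maxr => //.
  exact: measurable_funB.
have hr n : L2cl m A (ramp n \o f).
  apply: (L2cl_lim Aalg); first exact: measurableT_comp.
  move=> e e0; have n0 : (0 : R) < n%:R ^+ 2 + 1 by rewrite ltr_wpDl ?sqr_ge0.
  have [g Ag fg] := hf.2 _ (divr_gt0 e0 n0).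
  have mg := alg_meas Aalg Ag; exists (ramp n \o g).
    apply: (@L2cl_comp_bdd _ _ 1) => // [|r]; first exact: Sig_alg.
    exact: clip_le.
  apply: (@le_trans _ _ (sqn m (fun x => n%:R * (f x - g x))%R)).
    apply: le_sqn.
    - by apply: measurable_funB; exact: measurableT_comp.
    - by apply: measurable_funM => //; exact: measurable_funB.
    move=> x; rewrite /ramp /=; apply: le_trans (clip_lip _ _ _) _.
    apply: le_trans (clip_lip _ _ _) _; rewrite -mulrBr !normrM ler_wpM2l//.
    have h1 := ler_norm (f x - g x); have := ler_norm (g x - f x).
    rewrite distrC ler_norml /Num.max => h2.
    by case: ifP; case: ifP => ? ?; apply/andP; split; lra.
  rewrite sqnZ; last exact: measurable_funB.
  apply: le_trans (lee_wpmul2l _ fg) _; first by rewrite lee_fin sqr_ge0.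
  by rewrite -EFinM lee_fin mulrA ler_pdivrMr// mulrC ler_pM2l//; lra.
split.
  rewrite -[X in measurable X]setTI; rewrite (_ : [set x | _] = f @^-1` `]a, +oo[); first exact: mf.
  by apply/seteqP; split => x /=; rewrite in_itv/= andbT.
apply: (@L2cl_dct _ _ _ m A Aalg (fun n => ramp n \o f) _ 1) => //.
  by move=> n x; exact: clip_le.
move=> x; rewrite indicE; have [ax|xa] := ltP a (f x).
- rewrite mem_set//=; have fa0 : 0 < f x - a by rewrite subr_gt0.
  apply: (@cvg_eventually _ _ _ (Num.bound (f x - a)^-1).+1) => n hn.
  have n1 : 1 <= n%:R :> R by rewrite ler1n; exact: leq_trans hn.
  have h : 1 <= n%:R * (f x - a).
    rewrite -ler_pdivrMr// mul1r; apply/ltW; apply: lt_le_trans (_ : (Num.bound (f x - a)^-1)%:R <= _).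
      by apply: archi_boundP; rewrite invr_ge0 ltW.
    by rewrite ler_nat; exact: ltnW.
  rewrite /ramp /= (max_l (ltW fa0)) clip_sat//.
  by rewrite /clip le_max le_min h n1 orbT.
- rewrite memNset/=; last by apply/negP; rewrite -leNgt.
  apply: (@cvg_eventually _ _ _ 0) => n _.
  rewrite /ramp /= max_r ?subr_le0// mulr0 (@clip_id n%:R) ?normr0//.
  by rewrite clip_id ?normr0.
Qed.

End Sig.

(** * Gaussian characteristic functions *)

Section gauss_fourier.
Context {R : realType}.
Local Notation leb := (@lebesgue_measure R).

Definition gaussq (a z : R) : R := expR (- (a * z ^+ 2)).

Lemma gaussq_ge0 a z : 0 <= gaussq a z. Proof. exact: expR_ge0. Qed.

Lemma continuous_gaussq a : continuous (gaussq a).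
Proof.
move=> z; apply: (@continuous_comp R R R (fun z => - (a * z ^+ 2)) expR z); last exact: continuous_expR.
by apply: cvgN; apply: cvgM; [exact: cvg_cst|exact: exprn_continuous].
Qed.

Lemma measurable_gaussq a : measurable_fun setT (gaussq a).
Proof. by apply: continuous_measurable_fun; exact: continuous_gaussq. Qed.

Lemma integrable_gaussq a : 0 < a -> leb.-integrable setT (EFin \o gaussq a).
Proof.
move=> a0; pose s := Num.sqrt (2 * a)^-1.
have a20 : 0 < (2 * a)^-1 by rewrite invr_gt0 mulr_gt0.
have s0 : s != 0 by rewrite lt0r_neq0// sqrtr_gt0.
have -> : EFin \o gaussq a = (fun z => (normal_peak s)^-1%:E * (normal_pdf 0 s z)%:E)%E.
  apply/funext => z; rewrite /= normal_pdfE// -EFinM mulrA mulVf ?mul1r; last first.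
    by rewrite lt0r_neq0// normal_peak_gt0.
  congr (expR _)%:E; rewrite subr0 mulNr; congr (- _); rewrite sqr_sqrtr ?ltW//.
  by rewrite mulrC; congr (_ * _); field; rewrite lt0r_neq0.
by apply: integrableZl => //; exact: integrable_normal_pdf.
Qed.

(** Half of the exponent absorbs the factor [|z|]. The resulting integrable bound dominates the
    derivative of the Fourier integrand uniformly in the frequency. *)
Lemma le_gaussq a z : 0 < a ->
  `|z| * gaussq a z <= (1 + 2 / a) * gaussq (a / 2) z.
Proof.
move=> a0.
have -> : gaussq a z = gaussq (a / 2) z * gaussq (a / 2) z.
  by rewrite /gaussq -expRD; congr expR; field.
rewrite mulrA ler_wpM2r ?gaussq_ge0//.
have h : gaussq (a / 2) z * (1 + a / 2 * z ^+ 2) <= 1.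
  rewrite /gaussq [leRHS](_ : 1 = expR (- (a / 2 * z ^+ 2)) * expR (a / 2 * z ^+ 2)); last first.
    by rewrite -expRD addNr expR0.
  by rewrite ler_wpM2l ?expR_ge0// expR_ge1Dx.
have h2 : `|z| <= (1 + 2 / a) * (1 + a / 2 * z ^+ 2).
  have -> : z ^+ 2 = `|z| ^+ 2 by rewrite real_normK ?num_real.
  have -> : (1 + 2 / a) * (1 + a / 2 * `|z| ^+ 2) = 1 + 2 / a + a / 2 * `|z| ^+ 2 + `|z| ^+ 2.
    by field; rewrite lt0r_neq0.
  have p1 : 0 <= 2 / a by rewrite divr_ge0// ltW.
  have p2 : 0 <= a / 2 * `|z| ^+ 2 by rewrite mulr_ge0 ?sqr_ge0// divr_ge0// ltW.
  by have := sqr_ge0 (`|z| - 1); nra.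
apply: le_trans (ler_wpM2r (gaussq_ge0 _ _) h2) _.
have p : 0 <= 1 + 2 / a by rewrite addr_ge0// divr_ge0// ltW.
by move: h; rewrite mulrC -(mulrA (1 + 2 / a)) => /(ler_wpM2l p); rewrite mulr1.
Qed.

Lemma integrable_le (f g : R -> R) : measurable_fun setT f ->
  leb.-integrable setT (EFin \o g) -> (forall z, `|f z| <= g z) ->
  leb.-integrable setT (EFin \o f).
Proof.
move=> mf ig fg; apply: (le_integrable _ _ _ ig) => //; first exact/measurable_EFinP.
by move=> z _ /=; rewrite lee_fin (le_trans (fg z))// ler_norm.
Qed.

Variable a : R.
Hypothesis a0 : 0 < a.
Local Notation q := (gaussq a).

(** By symmetry of the Gaussian this is its whole Fourier transform, which keeps the argument real;
    [gauss_sin] is minus its derivative. *)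
Definition gauss_cos (x : R) : R := \int[leb]_z (cos (x * z) * q z).
Definition gauss_sin (x : R) : R := \int[leb]_z (z * sin (x * z) * q z).

Let mcos (x : R) : measurable_fun setT (fun z : R => cos (x * z) * q z).
Proof.
apply: measurable_funM; last exact: measurable_gaussq.
apply: measurableT_comp; last exact: measurable_funM.
by apply: continuous_measurable_fun; exact: continuous_cos.
Qed.

Let msin (x : R) : measurable_fun setT (fun z : R => sin (x * z)).
Proof.
apply: measurableT_comp; last exact: measurable_funM.
by apply: continuous_measurable_fun; exact: continuous_sin.
Qed.

Let icos (x : R) : leb.-integrable setT (EFin \o (fun z : R => cos (x * z) * q z)).
Proof.
apply: (integrable_le (mcos x) (integrable_gaussq a0)) => z.
by rewrite normrM [X in _ * X]ger0_norm ?gaussq_ge0// ler_piMl ?gaussq_ge0// cos_max.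
Qed.

Let iabs : leb.-integrable setT (EFin \o (fun z : R => `|z| * q z)).
Proof.
have a20 : 0 < a / 2 by rewrite divr_gt0.
apply: (@integrable_le _ (fun z : R => (1 + 2 / a) * gaussq (a / 2) z)).
- apply: measurable_funM; last exact: measurable_gaussq.
  by apply: continuous_measurable_fun; exact: norm_continuous.
- rewrite (_ : EFin \o _ = fun z : R => (1 + 2 / a)%:E * (gaussq (a / 2) z)%:E)%E//.
  by apply: integrableZl => //; exact: integrable_gaussq.
- by move=> z; rewrite ger0_norm ?mulr_ge0 ?gaussq_ge0//; exact: le_gaussq.
Qed.

Let isin (x : R) : leb.-integrable setT (EFin \o (fun z : R => z * sin (x * z) * q z)).
Proof.
apply: (integrable_le _ iabs).
  by apply: measurable_funM; [exact: measurable_funM|exact: measurable_gaussq].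
move=> z; rewrite !normrM [X in _ * X]ger0_norm ?gaussq_ge0//.
by rewrite ler_wpM2r ?gaussq_ge0// ler_piMr// sin_max.
Qed.

Lemma is_derive_gauss_cos (x : R) : is_derive x (1 : R) gauss_cos (- gauss_sin x).
Proof.
have der (y z : R) : is_derive y (1 : R) (fun y : R => cos (y * z) * q z) (- (z * sin (y * z) * q z)).
  apply: is_derive_eq; rewrite /GRing.scale/=; ring.
have dE y z : partial1of2 (fun y z : R => cos (y * z) * q z) y z = - (z * sin (y * z) * q z).
  by rewrite partial1of2E; apply: derive_val.
have Ix : `]x - 1, x + 1[%classic x by rewrite /= in_itv/= ltrBlDr ltrDl ltr01 /=.
have H1 y (_ : `]x - 1, x + 1[%classic y) := icos y.
have H2 (y z : R) : `]x - 1, x + 1[%classic y -> [set: R] z -> derivable ((fun y z : R => cos (y * z) * q z) ^~ z) y 1.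
  by move=> _ _; have [] := der y z.
have H3 (y z : R) : `]x - 1, x + 1[%classic y -> [set: R] z ->
    `|partial1of2 (fun y z : R => cos (y * z) * q z) y z| <= `|z| * q z.
  move=> _ _; rewrite dE normrN !normrM [X in _ * X]ger0_norm ?gaussq_ge0//.
  by rewrite ler_wpM2r ?gaussq_ge0// ler_piMr// sin_max.
have H0 (z : R) : 0 <= `|z| * q z by rewrite mulr_ge0 ?gaussq_ge0.
apply: DeriveDef.
  exact: (derivable_under_integral measurableT Ix H1 H2 H0 iabs H3).
rewrite -derive1E; have := differentiation_under_integral measurableT Ix H1 H2 H0 iabs H3.
rewrite -/gauss_cos => ->.
rewrite /gauss_sin -mulN1r -RintegralZl//.
by apply: eq_Rintegral => z _; rewrite dE mulN1r.
Qed.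

Lemma cvg_integral_sym (f : R -> R) : leb.-integrable setT (EFin \o f) ->
  (\int[leb]_(z in `[(- n.+1%:R)%R, n.+1%:R%R]) (f z)%:E)%E @[n --> \oo] -->
  (\int[leb]_z (f z)%:E)%E.
Proof.
move=> fi; have mf := measurable_int _ fi.
under eq_fun do rewrite integral_mkcond.
apply: (@dominated_cvg _ _ _ leb _ _ _ _ (fun z : R => `|f z|%:E)) => //.
- by move=> n; apply/measurable_restrict => //; exact: measurable_funS mf.
- move=> z _; apply: cvg_near_cst; exists (Num.bound `|z|) => // n /= hn.
  rewrite patchE mem_set//= in_itv/= -ler_norml.
  apply: le_trans (ltW (archi_boundP (normr_ge0 z))) _.
  by rewrite ler_nat ltnW.
- exact: (integrable_abse fi).
- move=> n z _; rewrite patchE; case: ifP => _ //=; rewrite ?normr0 lee_fin//.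
Qed.

(* Integration by parts turns [gauss_cos' = - gauss_sin] into a linear differential equation. *)
Lemma gauss_ibp (x : R) : x * gauss_cos x = 2 * a * gauss_sin x.
Proof.
pose h (z : R) : R := sin (x * z) * q z.
pose h' (z : R) := x * (cos (x * z) * q z) - 2 * a * (z * sin (x * z) * q z).
have dh z : is_derive z (1 : R) h (h' z).
  by rewrite /h /h' /gaussq; apply: is_derive_eq; rewrite /GRing.scale/= ?expr1; ring.
have ch' : continuous h'.
  move=> z; have cx : {for z, continuous (fun z : R => x * z)}.
    by apply: cvgM; [exact: cvg_cst|exact: cvg_id].
  apply: cvgB; apply: cvgM; try exact: cvg_cst.
  - apply: cvgM; last exact: continuous_gaussq.
    by apply: (@continuous_comp R R R (fun z : R => x * z) cos z) => //; exact: continuous_cos.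
  - apply: cvgM; last exact: continuous_gaussq.
    apply: cvgM; first exact: cvg_id.
    by apply: (@continuous_comp R R R (fun z : R => x * z) sin z) => //; exact: continuous_sin.
have ih' : leb.-integrable setT (EFin \o h').
  rewrite (_ : EFin \o h' = (fun z : R => x%:E * (cos (x * z) * q z)%:E - (2 * a)%:E * (z * sin (x * z) * q z)%:E)%E)//.
  by apply: integrableB => //; apply: integrableZl => //; [exact: icos|exact: isin].
have FTC n : (\int[leb]_(z in `[(- n.+1%:R)%R, n.+1%:R%R]) (h' z)%:E = (h n.+1%:R - h (- n.+1%:R))%:E)%E.
  rewrite (@continuous_FTC2 _ h' h) ?EFinB//.
  - by rewrite gtrN ?ltr0n.
  - exact: continuous_subspaceT.
  - have ch : continuous h by move=> z; apply: differentiable_continuous; apply/derivable1_diffP; have [] := dh z.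
    split; first by move=> z _; have [] := dh z.
    + exact/cvg_at_right_filter/ch.
    + exact/cvg_at_left_filter/ch.
  - by move=> z _; rewrite derive1E; have [_ ->] := dh z.
(* The boundary terms are dominated by a geometric sequence, as [n <= (n+1)^2] in the exponent. *)
have c0 : (h n.+1%:R - h (- n.+1%:R)) @[n --> \oo] --> 0.
  have e1 : `|expR (- a)| < 1 by rewrite ger0_norm ?expR_ge0// expR_lt1 oppr_lt0.
  have q1 (y : R) n : `|y| = n.+1%:R -> `|h y| <= expR (- a) ^+ n.
    move=> yn; rewrite normrM [X in _ * X]ger0_norm ?gaussq_ge0//.
    apply: le_trans (ler_piMl (gaussq_ge0 _ _) (sin_max _)) _.
    rewrite /gaussq -expRM_natl ler_expR mulrN lerN2 mulrC ler_wpM2l//; first exact: ltW.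
    rewrite -[y ^+ 2]real_normK ?num_real// yn -natrX ler_nat.
    by rewrite (leq_trans (leqnSn n))// leq_pmulr.
  have e2 : (2 * expR (- a) ^+ n) @[n --> \oo] --> (0 : R).
    by rewrite -[X in _ --> X](mulr0 2); apply: cvgM; [exact: cvg_cst|exact: cvg_expr].
  apply/cvgrPdist_le => e e0; move/cvgrPdist_le : e2 => /(_ _ e0)[N _ HN]; exists N => // n /HN /=.
  rewrite !sub0r !normrN => hn; apply: le_trans hn; apply: le_trans (ler_normB _ _) _.
  have y1 : `|n.+1%:R : R| = n.+1%:R by rewrite ger0_norm.
  have y2 : `|- n.+1%:R : R| = n.+1%:R by rewrite normrN.
  apply: le_trans (lerD (q1 _ n y1) (q1 _ n y2)) _; apply: le_trans (ler_norm _).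
  by rewrite -mulr2n mulr_natl.
have : (\int[leb]_z (h' z)%:E = 0)%E.
  have := cvg_integral_sym ih'; under eq_fun do rewrite FTC.
  move/cvg_lim => <- //; apply/cvg_lim => //.
  by apply: cvg_EFin; first exact: nearW.
move=> h0; have : \int[leb]_z h' z = 0 by rewrite /Rintegral h0.
rewrite /h' RintegralB//; first last.
- rewrite (_ : EFin \o _ = fun z : R => (2 * a)%:E * (z * sin (x * z) * q z)%:E)%E//.
  by apply: integrableZl => //; exact: isin.
- rewrite (_ : EFin \o _ = fun z : R => x%:E * (cos (x * z) * q z)%:E)%E//.
  by apply: integrableZl => //; exact: icos.
rewrite !RintegralZl//.
by move/eqP; rewrite subr_eq0 => /eqP.
Qed.

(** The equation [F' x = - x F x / (2 a)] makes [F x * expR (x^2 / (4 a))] constant. *)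
Lemma gauss_cosE (x : R) : gauss_cos x = gauss_cos 0 * expR (- (x ^+ 2 / (4 * a))).
Proof.
pose k (x : R) : R := gauss_cos x * expR (x ^+ 2 / (4 * a)).
have dk y : is_derive y (1 : R) k 0.
  have dc := is_derive_gauss_cos y.
  rewrite /k; apply: is_derive_eq; rewrite /GRing.scale/= ?expr1.
  have hG : gauss_sin y = y * gauss_cos y / (2 * a).
    by rewrite gauss_ibp; field; rewrite lt0r_neq0.
  by rewrite hG; field; rewrite lt0r_neq0.
have := is_derive_0_is_cst x 0 dk; rewrite /k expr0n/= mul0r expR0 mulr1 => <-.
by rewrite -mulrA -expRD subrr expR0 mulr1.
Qed.

End gauss_fourier.

(** The common source of the Cauchy-Schwarz inequalities of [ip] and of the covariance form. *)
Lemma discriminant_le0 {R : realType} (a b c : R) : 0 <= a -> 0 <= c ->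
  (forall k, 0 <= a + 2 * k * b + k ^+ 2 * c) -> b ^+ 2 <= a * c.
Proof.
move=> a0 c0 H; have [c00|cN0] := eqVneq c 0.
  rewrite c00 mulr0; have [->|bN0] := eqVneq b 0; first by rewrite expr0n.
  (* For [c = 0] the expression is affine in [k], and this [k] gives it the value [-1]. *)
  have := H (- (a + 1) / 2 / b); rewrite c00 mulr0 addr0.
  have -> : a + 2 * (- (a + 1) / 2 / b) * b = -1 by field.
  by rewrite oppr_ge0 ler10.
have cp : 0 < c by rewrite lt_neqAle eq_sym cN0.
have := H (- b / c); have -> : a + 2 * (- b / c) * b + (- b / c) ^+ 2 * c = a - b ^+ 2 / c by field.
by rewrite subr_ge0 ler_pdivrMr.
Qed.

(** * The inner product of L2 *)

Section L2.
Context {d : measure_display} {X : measurableType d} {R : realType}.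
Variable m : {measure set X -> \bar R}.
Implicit Types f g h : X -> R.

Definition L2 f := measurable_fun setT f /\ (sqn m f < +oo)%E.
Definition ip f g : R := \int[m]_x (f x * g x).

Lemma L2_int f g : L2 f -> L2 g -> m.-integrable setT (EFin \o (fun x => f x * g x)).
Proof.
move=> [mf foo] [mg goo]; apply/integrableP; split.
  by apply/measurable_EFinP; exact: measurable_funM.
apply: (@le_lt_trans _ _ (sqn m f + sqn m g)%E); last exact: lte_add_pinfty.
rewrite -ge0_integralD//; first last.
- exact: measurable_sq.
- by move=> x _; rewrite lee_fin sqr_ge0.
- exact: measurable_sq.
- by move=> x _; rewrite lee_fin sqr_ge0.
apply: ge0_le_integral => //.
- apply: measurableT_comp => //; apply/measurable_EFinP; exact: measurable_funM.
- by apply: emeasurable_funD; exact: measurable_sq.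
move=> x _; rewrite /= -EFinD lee_fin ler_norml.
by have := sqr_ge0 (f x - g x); have := sqr_ge0 (f x + g x); nra.
Qed.

Lemma sqn_ip f : L2 f -> sqn m f = (ip f f)%:E.
Proof.
move=> Lf; rewrite /ip /Rintegral fineK; last exact: (integrable_fin_num measurableT (L2_int Lf Lf)).
by apply: eq_integral => x _; rewrite expr2.
Qed.

Lemma ipC f g : ip f g = ip g f.
Proof. by apply: eq_Rintegral => x _; rewrite mulrC. Qed.

Lemma ip_ge0 f : 0 <= ip f f.
Proof. by apply: Rintegral_ge0 => // x _; rewrite -expr2 sqr_ge0. Qed.

Lemma L2D f g : L2 f -> L2 g -> L2 (fun x => f x + g x).
Proof.
move=> [mf foo] [mg goo]; split; first exact: measurable_funD.
apply: le_lt_trans (sqnD _ mf mg) _.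
by apply: lte_add_pinfty; apply: lte_mul_pinfty.
Qed.

Lemma L2Z k f : L2 f -> L2 (fun x => k * f x).
Proof.
move=> [mf foo]; split; first exact: measurable_funM.
by rewrite sqnZ//; apply: lte_mul_pinfty => //; rewrite lee_fin sqr_ge0.
Qed.

Lemma L2N f : L2 f -> L2 (fun x => - f x).
Proof. by move=> [mf foo]; split; [exact: measurableT_comp|rewrite sqnN]. Qed.

Lemma L2B f g : L2 f -> L2 g -> L2 (fun x => f x - g x).
Proof. by move=> Lf Lg; apply: L2D => //; exact: L2N. Qed.

Lemma L2_0 : L2 (cst 0).
Proof.
by split=> //; rewrite /sqn; under eq_integral do rewrite /= expr0n/=; rewrite integral0 ltry.
Qed.

Lemma L2_sum (I : Type) (s : seq I) (F : I -> X -> R) : (forall i, L2 (F i)) ->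
  L2 (fun x => \sum_(i <- s) F i x).
Proof.
move=> H; elim: s => [|i s IH].
  by rewrite (_ : (fun _ => _) = cst 0); [exact: L2_0|apply/funext => x; rewrite big_nil].
rewrite (_ : (fun _ => _) = fun x => F i x + \sum_(i <- s) F i x); first exact: L2D.
by apply/funext => x; rewrite big_cons.
Qed.

Lemma L2_le f g : measurable_fun setT f -> L2 g -> (forall x, `|f x| <= `|g x|) -> L2 f.
Proof. by move=> mf [mg goo] fg; split=> //; apply: le_lt_trans goo; exact: le_sqn. Qed.

Lemma L2Ml f g : measurable_fun setT f -> bdd f -> L2 g -> L2 (fun x => f x * g x).
Proof.
move=> mf [M fM] [mg goo]; split; first exact: measurable_funM.
apply: le_lt_trans (sqnMl _ mf mg fM) _.
by apply: lte_mul_pinfty => //; rewrite lee_fin sqr_ge0.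
Qed.

Lemma ipDl f g h : L2 f -> L2 g -> L2 h -> ip (fun x => f x + g x) h = ip f h + ip g h.
Proof.
move=> Lf Lg Lh; rewrite /ip -RintegralD//; [|exact: L2_int..].
by apply: eq_Rintegral => x _; rewrite mulrDl.
Qed.

Lemma ipZl k f g : L2 f -> L2 g -> ip (fun x => k * f x) g = k * ip f g.
Proof.
move=> Lf Lg; rewrite /ip -RintegralZl//; last exact: L2_int.
by apply: eq_Rintegral => x _; rewrite mulrA.
Qed.

Lemma ipDr f g h : L2 f -> L2 g -> L2 h -> ip h (fun x => f x + g x) = ip h f + ip h g.
Proof. by move=> *; rewrite ipC ipDl// !(ipC h). Qed.

Lemma ipZr k f g : L2 f -> L2 g -> ip g (fun x => k * f x) = k * ip g f.
Proof. by move=> *; rewrite ipC ipZl// !(ipC g). Qed.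

Lemma ipBl f g h : L2 f -> L2 g -> L2 h -> ip (fun x => f x - g x) h = ip f h - ip g h.
Proof.
move=> Lf Lg Lh; rewrite (_ : (fun x => _) = fun x => f x + -1 * g x); last first.
  by apply/funext => x; rewrite mulN1r.
by rewrite ipDl ?ipZl ?mulN1r//; exact: L2Z.
Qed.

Lemma ipBr f g h : L2 f -> L2 g -> L2 h -> ip h (fun x => f x - g x) = ip h f - ip h g.
Proof. by move=> *; rewrite ipC ipBl// !(ipC h). Qed.

Lemma ip0l g : ip (cst 0) g = 0.
Proof.
by rewrite /ip /Rintegral; under eq_integral do rewrite mul0r; rewrite integral0.
Qed.

Lemma ip_suml (I : Type) (s : seq I) (F : I -> X -> R) g : (forall i, L2 (F i)) -> L2 g ->
  ip (fun x => \sum_(i <- s) F i x) g = \sum_(i <- s) ip (F i) g.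
Proof.
move=> HF Lg; elim: s => [|i s IH].
  rewrite big_nil (_ : (fun _ => _) = cst 0) ?ip0l//.
  by apply/funext => x; rewrite big_nil.
rewrite (_ : (fun _ => _) = fun x => F i x + \sum_(i <- s) F i x); last first.
  by apply/funext => x; rewrite big_cons.
by rewrite ipDl ?IH ?big_cons//; exact: L2_sum.
Qed.

Lemma ip_sumr (I : Type) (s : seq I) (F : I -> X -> R) g : (forall i, L2 (F i)) -> L2 g ->
  ip g (fun x => \sum_(i <- s) F i x) = \sum_(i <- s) ip g (F i).
Proof.
by move=> HF Lg; rewrite ipC ip_suml//; apply: eq_bigr => i _; rewrite ipC.
Qed.

Lemma ip_CS f g : L2 f -> L2 g -> ip f g ^+ 2 <= ip f f * ip g g.
Proof.
move=> Lf Lg; apply: discriminant_le0; [exact: ip_ge0..|] => k.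
have Lk := L2Z k Lg; have Lfg := L2D Lf Lk.
have -> : ip f f + 2 * k * ip f g + k ^+ 2 * ip g g = ip (fun x => f x + k * g x) (fun x => f x + k * g x).
  by rewrite ipDl// !ipDr// !ipZl// !ipZr// (ipC g f); ring.
exact: ip_ge0.
Qed.

Lemma ip_norm_le f g : L2 f -> L2 g -> `|ip f g| <= Num.sqrt (ip f f) * Num.sqrt (ip g g).
Proof.
move=> Lf Lg; rewrite -sqrtrM ?ip_ge0// -sqrtr_sqr ler_wsqrtr//; exact: ip_CS.
Qed.

Definition l2cvg (f_ : nat -> X -> R) f :=
  forall e : R, 0 < e -> exists N, forall n, (N <= n)%N ->
    (sqn m (fun x => f_ n x - f x)%R <= e%:E)%E.

Lemma l2cvg_cst f : l2cvg (fun=> f) f.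
Proof.
move=> e e0; exists 0%N => n _; rewrite /sqn.
by under eq_integral do rewrite subrr expr0n/=; rewrite integral0 lee_fin ltW.
Qed.

Lemma l2cvg_ip0 (f_ : nat -> X -> R) f : (forall n, L2 (f_ n)) -> L2 f -> l2cvg f_ f ->
  Num.sqrt (ip (fun x => f_ n x - f x) (fun x => f_ n x - f x)) @[n --> \oo] --> 0.
Proof.
move=> Lf_ Lf H; rewrite -(sqrtr0 R); apply: continuous_cvg; first exact: sqrt_continuous.
apply/cvgrPdist_le => e e0; have [N HN] := H _ e0; exists N => // n /= /HN.
have Ln := L2B (Lf_ n) Lf.
by rewrite sqn_ip// lee_fin sub0r normrN ger0_norm ?ip_ge0.
Qed.

Lemma l2cvg_ip (f_ g_ : nat -> X -> R) f g : (forall n, L2 (f_ n)) -> (forall n, L2 (g_ n)) ->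
  L2 f -> L2 g -> l2cvg f_ f -> l2cvg g_ g -> ip (f_ n) (g_ n) @[n --> \oo] --> ip f g.
Proof.
move=> Lf_ Lg_ Lf Lg /(l2cvg_ip0 Lf_ Lf) cf /(l2cvg_ip0 Lg_ Lg) cg.
apply/subr_cvg0; apply: norm_cvg0.
pose a n := Num.sqrt (ip (fun x => f_ n x - f x) (fun x => f_ n x - f x)).
pose b n := Num.sqrt (ip (fun x => g_ n x - g x) (fun x => g_ n x - g x)).
apply: (@squeeze_cvgr _ \oo _ _ (cst 0) (fun n => a n * b n + a n * Num.sqrt (ip g g) + Num.sqrt (ip f f) * b n)).
- apply: nearW => n; rewrite normr_ge0/=.
  have LfB := L2B (Lf_ n) Lf; have LgB := L2B (Lg_ n) Lg.
  have -> : ip (f_ n) (g_ n) - ip f g = ip (fun x => f_ n x - f x) (fun x => g_ n x - g x)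
      + ip (fun x => f_ n x - f x) g + ip f (fun x => g_ n x - g x).
    by rewrite !ipBl// ?ipBr//; ring.
  apply: le_trans (ler_normD _ _) _; apply: lerD; last exact: ip_norm_le.
  by apply: le_trans (ler_normD _ _) _; apply: lerD; exact: ip_norm_le.
- exact: cvg_cst.
- rewrite [X in _ --> X](_ : 0 = 0 * 0 + 0 * Num.sqrt (ip g g) + Num.sqrt (ip f f) * 0); last by ring.
  apply: cvgD; [apply: cvgD|]; apply: cvgM => //; exact: cvg_cst.
Qed.

End L2.

(** * The functions [(n+1) sin (x / (n+1))] *)

Section sine_ratio.
Context {R : realType}.
Implicit Types x y : R.

Lemma norm_sin_le y : `|sin y| <= `|y|.
Proof.
wlog y0 : y / 0 <= y.
  move=> H; case/orP: (le_total 0 y) => [/H//|y0].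
  by rewrite -normrN -sinN -[leRHS]normrN H// oppr_ge0.
move: y0; rewrite le_eqVlt => /orP[/eqP <-|y0]; first by rewrite sin0.
have h1 (x : R) : x \in `]0, y[ -> is_derive x (1 : R) (@sin R) (cos x).
  by move=> _; exact: is_derive_sin.
have h2 : {within `[0, y], continuous (@sin R)}.
  exact/continuous_subspaceT/continuous_sin.
have [c _] := MVT y0 h1 h2.
by rewrite sin0 !subr0 => ->; rewrite normrM ler_piMl// cos_max.
Qed.

(* Bounded trigonometric substitutes for the identity. *)
Definition sinr (n : nat) x : R := n.+1%:R * sin (n.+1%:R^-1 * x).

Lemma sinr_le n x : `|sinr n x| <= `|x|.
Proof.
rewrite normrM ger0_norm//; apply: le_trans (ler_wpM2l _ (norm_sin_le _)) _ => //.
by rewrite normrM gtr0_norm ?invr_gt0// mulrA divff ?mul1r.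
Qed.

Lemma sinr_bdd n x : `|sinr n x| <= n.+1%:R.
Proof. by rewrite normrM ger0_norm// ler_piMr// sin_max. Qed.

Lemma measurable_sinr n : measurable_fun setT (sinr n).
Proof.
apply: measurable_funM => //; apply: measurableT_comp; last exact: measurable_funM.
by apply: continuous_measurable_fun; exact: continuous_sin.
Qed.

Lemma cvg_sinr x : sinr n x @[n --> \oo] --> x.
Proof.
have [->|x0] := eqVneq x 0.
  by apply: (@cvg_eventually _ _ _ 0) => n _; rewrite /sinr mulr0 sin0 mulr0.
have [dsin dsinE] := @is_derive_sin R 0.
have : h^-1 * sin h @[h --> 0^'] --> (1 : R).
  move: dsin => /cvg_ex[l]; move: dsinE; rewrite /derive cos0 => E H.
  move: (H); rewrite (cvg_lim _ H) in E => //; rewrite E.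
  apply: cvg_trans; apply: near_eq_cvg; near=> h.
  by rewrite /= add0r sin0 subr0 [h%:A]mulr1 addr0 || rewrite /= addr0 sin0 subr0 /GRing.scale/= mulr1.
move/cvgr_dnbhsP => /(_ (fun n => n.+1%:R^-1 * x)) H.
have {}H : (n.+1%:R^-1 * x)^-1 * sin (n.+1%:R^-1 * x) @[n --> \oo] --> (1 : R).
  apply: H; split; first by move=> n; rewrite mulf_neq0 ?invr_eq0 ?pnatr_eq0.
  by rewrite -[X in _ --> X](mul0r x); apply: cvgM; [exact: cvg_harmonic|exact: cvg_cst].
rewrite -[X in _ --> X]mul1r.
rewrite (_ : (fun n => _) = fun n => (n.+1%:R^-1 * x)^-1 * sin (n.+1%:R^-1 * x) * x).
  by apply: cvgM => //; exact: cvg_cst.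
apply/funext => n; have : n.+1%:R != 0 :> R by rewrite pnatr_eq0.
by rewrite /sinr; move: (n.+1%:R : R) => c c0; field; rewrite x0 c0.
Unshelve. all: by end_near. Qed.

End sine_ratio.

(** * Expectations under a Gaussian law *)

Section expectation_of_law.
Context {dT : measure_display} {T : measurableType dT} {R : realType}.
Variable P : probability T R.
Implicit Types (X f : T -> R) (g : R -> R).

Definition Ex f : R := \int[P]_w f w.

Lemma bdd_L2 f : measurable_fun setT f -> bdd f -> L2 P f.
Proof. by move=> mf bf; split=> //; exact: sqn_bdd_lty. Qed.

Lemma bdd_int f : measurable_fun setT f -> bdd f -> P.-integrable setT (EFin \o f).
Proof.
move=> mf bf; have L1 : L2 P (cst (1 : R)) by apply: bdd_L2 => //; exists 1 => w; rewrite normr1.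
have := L2_int L1 (bdd_L2 mf bf).
by rewrite (_ : EFin \o _ = EFin \o f)//; apply/funext => w /=; rewrite mul1r.
Qed.

Lemma integral_law X (mX : measurable_fun setT X) (nu : {measure set (measurableTypeR R) -> \bar R}) g :
  (forall B, measurable B -> P (X @^-1` B) = nu B) ->
  measurable_fun setT g -> bdd g ->
  Ex (g \o X) = \int[nu]_r g r.
Proof.
move=> law mg bg; pose mixX := isMeasurableFun.Build _ _ T (measurableTypeR R) X mX.
pose X' : {mfun T >-> measurableTypeR R} := HB.pack (X : T -> measurableTypeR R) mixX.
rewrite /Ex /Rintegral; congr fine.
transitivity (\int[distribution P X']_r (g r)%:E)%E.
  rewrite integral_distribution//; first exact/measurable_EFinP.
  apply: bdd_int; first exact: measurableT_comp.
  by case: bg => M gM; exists M => w; exact: gM.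
by apply: eq_measure_integral => B mB _; exact: law.
Qed.

(** The density is identified almost everywhere with the Radon-Nikodym derivative, since both have
    the same integrals over measurable sets. *)
Lemma integral_normal (s : R) g : s != 0 -> measurable_fun setT g -> bdd g ->
  \int[normal_prob 0 s]_r g r = \int[lebesgue_measure]_r (g r * normal_pdf 0 s r).
Proof.
move=> s0 mg [M gM]; rewrite /Rintegral; congr fine.
have ig : (normal_prob 0 s).-integrable setT (EFin \o g).
  apply: measurable_bounded_integrable => //; first exact: fin_num_fun_lty.
  exists M; split; [exact: num_real|move=> x Mx r _ /=; exact: le_trans (gM r) (ltW Mx)].
rewrite -(Radon_Nikodym_change_of_variables (normal_prob_dominates 0 s))//=.
apply: ae_eq_integral => //.
- apply: emeasurable_funM; first exact/measurable_EFinP.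
  apply: (measurable_int lebesgue_measure).
  by apply: Radon_Nikodym_integrable; exact: normal_prob_dominates.
- by apply/measurable_EFinP; apply: measurable_funM => //; exact: measurable_normal_pdf.
under [X in ae_eq _ _ _ X]eq_fun do rewrite EFinM.
apply: ae_eqe_mul2l => /=.
rewrite Radon_NikodymE//=; first exact: normal_prob_dominates.
move=> abmu; case: cid => /= h [h1 h2 h3].
apply: integral_ae_eq => //=.
- by apply/measurable_EFinP; exact: measurable_normal_pdf.
- by move=> E E01 mE; rewrite -h3.
Qed.

Lemma Rintegral_odd g : measurable_fun setT g ->
  lebesgue_measure.-integrable setT (EFin \o g) ->
  (forall r, g (- r) = - g r) -> \int[lebesgue_measure]_r g r = 0.
Proof.
move=> mg ig odd; have h : \int[lebesgue_measure]_r g r = \int[lebesgue_measure]_r g (- r).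
  rewrite /Rintegral; congr fine.
  have mN : measurable_fun setT (-%R : measurableTypeR R -> measurableTypeR R).
    by apply: continuous_measurable_fun; exact: opp_continuous.
  have mgE : measurable_fun setT (fun r : measurableTypeR R => (g r)%:E) by exact/measurable_EFinP.
  have ig' : lebesgue_measure.-integrable ((-%R : measurableTypeR R -> measurableTypeR R) @^-1` setT)
      ((fun r : measurableTypeR R => (g r)%:E) \o (-%R : measurableTypeR R -> measurableTypeR R)).
    rewrite preimage_setT (_ : _ \o _ = fun r => - (g r)%:E)%E; first exact: integrableN.
    by apply/funext => r /=; rewrite odd EFinN.
  have := integral_pushforward mN mgE ig' measurableT.
  rewrite preimage_setT => <-.
  by apply: eq_measure_integral => B mB _; rewrite -[LHS]lebesgue_measureN.
have : \int[lebesgue_measure]_r g (- r) = - \int[lebesgue_measure]_r g r.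
  rewrite -mulN1r -RintegralZl//; apply: eq_Rintegral => r _; rewrite odd mulN1r//.
by rewrite -h => /eqP; rewrite -subr_eq0 opprK -mulr2n mulrn_eq0 => /eqP.
Qed.

Lemma measurable_cos_lin (x b : R) : measurable_fun setT (fun r : R => cos (x * r + b)).
Proof.
apply: measurableT_comp.
  by apply: continuous_measurable_fun; exact: continuous_cos.
by apply: measurable_funD => //; exact: measurable_funM.
Qed.

(** The phase [b] is carried along because codes contain one; in the expansion of [cos (x X + b)]
    the sine part vanishes by oddness. Here [v] is just a parameter of the law; [gaussian_L2]
    identifies it with the second moment. *)
Lemma gaussian_cos X : measurable_fun setT X -> centered_gaussian P X ->
  exists2 v, 0 <= v & forall x b, Ex (fun w => cos (x * X w + b)) = cos b * expR (- (x ^+ 2 * v / 2)).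
Proof.
move=> mX [s law]; exists (s ^+ 2); first exact: sqr_ge0.
move=> x b; have bc : bdd (fun r : R => cos (x * r + b)) by exists 1 => r; exact: cos_max.
have mc := measurable_cos_lin x b.
have [s0|s0] := eqVneq s 0.
  rewrite -[LHS]/(Ex ((fun r : R => cos (x * r + b)) \o X)).
  rewrite (integral_law mX (nu := \d_(0 : measurableTypeR R)) _ mc bc); last by move=> B /law; rewrite s0 eqxx.
  rewrite /Rintegral integral_dirac//; last exact/measurable_EFinP.
  by rewrite diracT mul1e/= mulr0 add0r s0 expr0n/= mulr0 mul0r oppr0 expR0 mulr1.
rewrite -[LHS]/(Ex ((fun r : R => cos (x * r + b)) \o X)).
rewrite (integral_law mX (nu := normal_prob 0 s) _ mc bc); last by move=> B /law; rewrite (negbTE s0).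
rewrite (integral_normal s0 mc bc).
have s20 : 0 < s ^+ 2 by rewrite exprn_even_gt0.
pose a := (2 * s ^+ 2)^-1; have a0 : 0 < a by rewrite invr_gt0 mulr_gt0.
have pdfE r : normal_pdf 0 s r = normal_peak s * gaussq a r.
  rewrite normal_pdfE//; congr (_ * expR _).
  by rewrite subr0 mulNr; congr (- _); rewrite mulrC /a mulr_natl.
have icos (y : R) : lebesgue_measure.-integrable setT (EFin \o (fun r : R => cos (y * r) * normal_pdf 0 s r)).
  apply: (integrable_le _ (integrable_normal_pdf 0 s)).
    apply: measurable_funM; last exact: measurable_normal_pdf.
    by have := measurable_cos_lin y 0; under eq_fun do rewrite addr0.
  by move=> r; rewrite normrM [X in _ * X]ger0_norm ?normal_pdf_ge0// ler_piMl ?normal_pdf_ge0// cos_max.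
have isin : lebesgue_measure.-integrable setT (EFin \o (fun r : R => sin (x * r) * normal_pdf 0 s r)).
  apply: (integrable_le _ (integrable_normal_pdf 0 s)).
    apply: measurable_funM; last exact: measurable_normal_pdf.
    apply: measurableT_comp; last exact: measurable_funM.
    by apply: continuous_measurable_fun; exact: continuous_sin.
  by move=> r; rewrite normrM [X in _ * X]ger0_norm ?normal_pdf_ge0// ler_piMl ?normal_pdf_ge0// sin_max.
have gc y : \int[lebesgue_measure]_r (cos (y * r) * normal_pdf 0 s r) = normal_peak s * gauss_cos a y.
  rewrite /gauss_cos -RintegralZl//.
    by apply: eq_Rintegral => r _; rewrite pdfE; ring.
  have := @integrableZl _ _ _ lebesgue_measure setT measurableT (normal_peak s)^-1 _ (icos y).
  congr (_.-integrable _ _); apply/funext => r /=; rewrite -EFinM pdfE; congr EFin.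
  by field; rewrite lt0r_neq0// normal_peak_gt0.
have g0 : normal_peak s * gauss_cos a 0 = 1.
  rewrite -gc; have := integral_normal_pdf (0 : R) s; rewrite /Rintegral => h.
  by under eq_integral do rewrite mul0r cos0 mul1r; rewrite h.
transitivity (\int[lebesgue_measure]_r (cos b * (cos (x * r) * normal_pdf 0 s r) -
    sin b * (sin (x * r) * normal_pdf 0 s r))).
  by apply: eq_Rintegral => r _; rewrite cosD; ring.
rewrite RintegralB//; first last.
- rewrite (_ : EFin \o _ = fun r : R => (sin b)%:E * (sin (x * r) * normal_pdf 0 s r)%:E)%E//.
  exact: integrableZl.
- rewrite (_ : EFin \o _ = fun r : R => (cos b)%:E * (cos (x * r) * normal_pdf 0 s r)%:E)%E//.
  by apply: integrableZl => //; exact: icos.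
rewrite !RintegralZl// (@Rintegral_odd (fun r => sin (x * r) * normal_pdf 0 s r))//; first last.
- by move=> r; rewrite !pdfE /gaussq sqrrN mulrN sinN mulNr.
- by have /measurable_int/measurable_EFinP := isin.
rewrite mulr0 subr0 gc (gauss_cosE a0) (mulrA (normal_peak s)) g0 mul1r; congr (_ * expR (- _)).
by rewrite /a; field; rewrite s0.
Qed.

Lemma Ex_lin2 f (g : T -> R) (a b : R) : P.-integrable setT (EFin \o f) -> P.-integrable setT (EFin \o g) ->
  Ex (fun w => a * f w + b * g w) = a * Ex f + b * Ex g.
Proof.
move=> fi gi; rewrite /Ex RintegralD// ?RintegralZl//.
- by rewrite (_ : EFin \o _ = fun w => a%:E * (f w)%:E)%E//; exact: integrableZl.
- by rewrite (_ : EFin \o _ = fun w => b%:E * (g w)%:E)%E//; exact: integrableZl.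
Qed.

Lemma Ex_cst (k : R) : Ex (cst k) = k.
Proof. by rewrite /Ex Rintegral_cst// [X in fine X]probability_setT mulr1. Qed.

End expectation_of_law.

(** * Trigonometric polynomials of a Gaussian family *)

Lemma sqn_fatou {d : measure_display} {X : measurableType d} {R : realType}
  (m : {measure set X -> \bar R}) (h_ : nat -> X -> R) (h : X -> R) (C : \bar R) :
  (forall n, measurable_fun setT (h_ n)) -> (forall x, h_ n x @[n --> \oo] --> h x) ->
  (forall n, (sqn m (h_ n) <= C)%E) -> (sqn m h <= C)%E.
Proof.
move=> mh hh hC; apply: le_trans (_ : limn_einf (fun n => sqn m (h_ n)) <= C)%E.
  rewrite [leLHS](_ : _ = \int[m]_x limn_einf (fun n => (h_ n x ^+ 2)%:E))%E.
    by apply: fatou => // [n|n x _]; [exact: measurable_sq|rewrite lee_fin sqr_ge0].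
  apply: eq_integral => x _; apply/esym.
  suff /cvg_limn_einf_sup[] : (h_ n x ^+ 2)%:E @[n --> \oo] --> (h x ^+ 2)%:E by [].
  apply: cvg_EFin; first exact: nearW.
  rewrite (expr2 (h x)) (_ : _ \o _ = fun n => h_ n x * h_ n x); first by apply: cvgM; exact: hh.
  by apply/funext => n /=; rewrite expr2.
rewrite limn_einf_lim; apply: lime_le; first exact: is_cvg_einfs.
apply: nearW => n; apply: le_trans (hC n); apply: ereal_inf_lbound.
by exists n => /=.
Qed.

Section sinr_L2.
Context {d : measure_display} {X : measurableType d} {R : realType}.
Variable m : {measure set X -> \bar R}.

Lemma L2_sinr n f : L2 m f -> L2 m (fun x => sinr n (f x) : R).
Proof.
move=> Lf; apply: (L2_le _ Lf); last by move=> x; exact: sinr_le.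
by apply: (measurableT_comp (measurable_sinr n)); case: Lf.
Qed.

Lemma l2cvg_sinr f : L2 m f -> l2cvg m (fun n x => sinr n (f x) : R) f.
Proof.
move=> Lf; have [mf foo] := Lf; apply: (sqn_cvg0 (g := fun x => 2 * f x)).
- by move=> n; case: (L2B (L2_sinr n Lf) Lf).
- exact: measurable_funM.
- by case: (L2Z 2 Lf).
- move=> n x; apply: le_trans (ler_normB _ _) _.
  apply: le_trans (lerD (sinr_le _ _) (lexx _)) _.
  by rewrite normrM ger0_norm// mulr_natl mulr2n.
- by move=> x; rewrite -(subrr (f x)); apply: cvgB; [exact: cvg_sinr|exact: cvg_cst].
Qed.

Lemma l2cvgMl (c : X -> R) f_ f : measurable_fun setT c -> bdd c ->
  (forall n, L2 m (f_ n)) -> L2 m f -> l2cvg m f_ f ->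
  l2cvg m (fun n x => c x * f_ n x) (fun x => c x * f x).
Proof.
move=> mc /bddP[M M0 cM] Lf_ Lf H e e0.
have M20 : 0 < M ^+ 2 by rewrite exprn_gt0.
have [N HN] := H _ (divr_gt0 e0 M20); exists N => n /HN Hn.
have LB := L2B (Lf_ n) Lf.
rewrite (_ : (fun x => _) = fun x => c x * (f_ n x - f x)); last by apply/funext => x; ring.
apply: le_trans (sqnMl m mc LB.1 cM) _.
apply: le_trans (lee_wpmul2l _ Hn) _; first by rewrite lee_fin ltW.
by rewrite -EFinM lee_fin mulrCA divff ?mulr1// lt0r_neq0.
Qed.

End sinr_L2.

Section gaussian_moment.
Context {dT : measure_display} {T : measurableType dT} {R : realType}.
Variable P : probability T R.

Lemma sin_cos_pihalf (x : R) : cos (x + - (pi / 2)) = sin x.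
Proof. by rewrite cosB cos_pihalf sin_pihalf mulr0 add0r mulr1. Qed.

(** The second moment is recovered from the characteristic function. By [sin^2 = (1 - cos 2) / 2],
    the bounded variable [sinr n X] has second moment [c n], which is at most [v] and tends to [v].
    Fatou's lemma puts [X] in L2; then [sinr n X] converges to [X] in L2 and the second moment of
    [X] is [v]. *)
Lemma gaussian_L2 X : measurable_fun setT X -> centered_gaussian P X ->
  L2 P X /\ forall b, Ex P (fun w => cos (X w + b)) = cos b * expR (- (ip P X X / 2)).
Proof.
move=> mX gX; have [v v0 Hv] := gaussian_cos mX gX.
have ms n : measurable_fun setT (fun w => sinr n (X w)) := measurableT_comp (measurable_sinr n) mX.
have Ls n : L2 P (fun w => sinr n (X w)).
  by apply: bdd_L2 => //; exists n.+1%:R => w; exact: sinr_bdd.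
pose c n : R := n.+1%:R ^+ 2 * (1 - expR (- ((n.+1%:R^-1 * 2) ^+ 2 * v / 2))) / 2.
have sc n : sqn P (fun w => sinr n (X w)) = (c n)%:E.
  rewrite sqn_ip//; congr (_%:E).
  transitivity (Ex P (fun w => n.+1%:R ^+ 2 / 2 * cst 1 w + (- (n.+1%:R ^+ 2 / 2)) * cos (n.+1%:R^-1 * 2 * X w + 0))).
    apply: eq_Rintegral => w _; rewrite /sinr addr0 /=.
    have -> : n.+1%:R^-1 * 2 * X w = (n.+1%:R^-1 * X w) *+ 2 by rewrite mulrAC mulr_natr.
    rewrite cos_mulr2n mulrACA -[X in _ * X]expr2 sin2cos2; move: (cos _) => s.
    by field.
  rewrite Ex_lin2; first last.
  - apply: bdd_int; last by exists 1 => w; exact: cos_max.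
    exact: (measurableT_comp (measurable_cos_lin _ _) mX).
  - by apply: bdd_int => //; exists 1 => w; rewrite normr1.
  by rewrite Ex_cst Hv cos0 mul1r /c; field.
have N0 n : (n.+1%:R : R) != 0 by rewrite pnatr_eq0.
have c_le n : c n <= v.
  rewrite /c; set u := (_ ^+ 2 * v / 2); have h := expR_ge1Dx (- u).
  have uE : v = n.+1%:R ^+ 2 * u / 2 by rewrite /u; field; rewrite addrC natr1 N0.
  by rewrite [leRHS]uE ler_pM2r ?invr_gt0// ler_pM2l ?exprn_gt0//; lra.
have c_ge n : v - 2 * v ^+ 2 * n.+1%:R^-1 <= c n.
  rewrite /c; set u := (_ ^+ 2 * v / 2).
  have u0 : 0 <= u by rewrite divr_ge0// mulr_ge0// sqr_ge0.
  (* It follows from [expR (- u) * (1 + u) <= 1] and [(1 - u + u^2) (1 + u) = 1 + u^3]. *)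
  have eu : expR (- u) <= 1 - u + u ^+ 2.
    have h := expR_ge1Dx u; have h1 : expR (- u) * (1 + u) <= 1.
      by rewrite -[leRHS](expR0 R) -(addNr u) expRD ler_wpM2l// expR_ge0.
    have h0 := expR_ge0 (- u).
    have h2 : 0 <= u ^+ 3 by rewrite exprn_ge0.
    have h3 : (1 - u + u ^+ 2) * (1 + u) = 1 + u ^+ 3 by ring.
    by rewrite -(ler_pM2r (_ : 0 < 1 + u)) ?h3; lra.
  have uE : v = n.+1%:R ^+ 2 * u / 2 by rewrite /u; field; rewrite addrC natr1 N0.
  have nn : n.+1%:R^-1 ^+ 2 <= n.+1%:R^-1 :> R.
    by rewrite expr2 ler_piMl ?invr_ge0// invf_le1 ?ler1n.
  have : n.+1%:R ^+ 2 * (u - u ^+ 2) / 2 <= n.+1%:R ^+ 2 * (1 - expR (- u)) / 2.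
    by rewrite ler_pM2r ?invr_gt0// ler_pM2l ?exprn_gt0//; lra.
  apply: le_trans.
  have -> : n.+1%:R ^+ 2 * (u - u ^+ 2) / 2 = v - 2 * v ^+ 2 * n.+1%:R^-1 ^+ 2.
    by rewrite /u; field; rewrite addrC natr1 N0.
  by rewrite lerB// ler_wpM2l// mulr_ge0// sqr_ge0.
have cv : c n @[n --> \oo] --> v.
  apply: (@squeeze_cvgr _ \oo _ _ (fun n => v - 2 * v ^+ 2 * n.+1%:R^-1) (cst v)).
  - by apply: nearW => n /=; rewrite c_ge c_le.
  - rewrite -[X in _ --> X]subr0; apply: cvgB; first exact: cvg_cst.
    by rewrite -[X in _ --> X](mulr0 (2 * v ^+ 2)); apply: cvgM; [exact: cvg_cst|exact: cvg_harmonic].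
  - exact: cvg_cst.
have LX : L2 P X.
  split=> //; apply: (@le_lt_trans _ _ v%:E); last exact: ltry.
  apply: (sqn_fatou ms) => [w|n]; first exact: cvg_sinr.
  by rewrite sc lee_fin.
split=> // b; have -> : ip P X X = v.
  have h := l2cvg_ip Ls Ls LX LX (l2cvg_sinr LX) (l2cvg_sinr LX).
  have hc : (fun n => ip P (fun w => sinr n (X w)) (fun w => sinr n (X w))) = c.
    by apply/funext => n; apply/EFin_inj; rewrite -sqn_ip.
  by rewrite hc in h; apply: (cvg_unique _ h cv).
by have := Hv 1 b; rewrite expr1n mul1r => <-; apply: eq_Rintegral => w _; rewrite mul1r.
Qed.

End gaussian_moment.

Section code.
Context {R : realType}.

(** Linear forms and codes are syntax: translating them is a [map], so nothing has to be checked
    about different codes that define the same random variable. *)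
Definition linform (H : Type) := seq (R * H).
Definition lscale H (k : R) (l : linform H) : linform H := [seq (k * p.1, p.2) | p <- l].
Definition lmap H H' (f : H -> H') (l : linform H) : linform H' := [seq (p.1, f p.2) | p <- l].

(* [(a, l, b)] stands for the function [a * cos (l + b)]. *)
Definition code (H : Type) := seq (R * linform H * R).
Definition cmap H H' (f : H -> H') (c : code H) : code H' :=
  [seq (p.1.1, lmap f p.1.2, p.2) | p <- c].
Definition cscale H (k : R) (c : code H) : code H := [seq (k * p.1.1, p.1.2, p.2) | p <- c].
(** [cos a cos b = (cos (a + b) + cos (a - b)) / 2]. *)
Definition cmul H (c c' : code H) : code H :=
  [seq (p.1.1 * p'.1.1 / 2, p.1.2 ++ p'.1.2, p.2 + p'.2) | p <- c, p' <- c'] ++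
  [seq (p.1.1 * p'.1.1 / 2, p.1.2 ++ lscale (-1) p'.1.2, p.2 - p'.2) | p <- c, p' <- c'].
Definition ccst H (k : R) : code H := [:: (k, [::], 0)].
(** The code of [sinr n] of a linear form, through [sin x = cos (x - pi / 2)]. *)
Definition csin H n (l : linform H) : code H :=
  [:: (n.+1%:R, lscale n.+1%:R^-1 l, - (pi / 2))].

(** Defined by recursion, since membership in a list would require decidable equality on [H]. *)
Fixpoint terms H (Q : linform H -> Prop) (c : code H) : Prop :=
  if c is p :: c' then Q p.1.2 /\ terms Q c' else True.

Lemma terms_cat H (Q : linform H -> Prop) c c' : terms Q c -> terms Q c' -> terms Q (c ++ c').
Proof. by elim: c => //= p c IH [Qp Qc] Qc'; split=> //; exact: IH. Qed.

Lemma terms_scale H (Q : linform H -> Prop) k c : terms Q c -> terms Q (cscale k c).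
Proof. by elim: c => //= p c IH [Qp Qc]; split=> //; exact: IH. Qed.

Definition linform_closed H (Q : linform H -> Prop) :=
  (forall l l', Q l -> Q l' -> Q (l ++ l')) /\ (forall k l, Q l -> Q (lscale k l)).

Lemma terms_mul H (Q : linform H -> Prop) c c' : linform_closed Q ->
  terms Q c -> terms Q c' -> terms Q (cmul c c').
Proof.
move=> [Qcat Qscale] Hc Hc'; rewrite /cmul; apply: terms_cat.
- elim: c Hc => //= p c IH [Qp Qc]; apply: terms_cat; last exact: IH.
  by elim: c' Hc' {IH} => //= p' c' IH' [Qp' Qc']; split; [exact: Qcat|exact: IH'].
- elim: c Hc => //= p c IH [Qp Qc]; apply: terms_cat; last exact: IH.
  by elim: c' Hc' {IH} => //= p' c' IH' [Qp' Qc']; split; [apply: Qcat => //; exact: Qscale|exact: IH'].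
Qed.

Lemma cmap_cat H H' (f : H -> H') c c' : cmap f (c ++ c') = cmap f c ++ cmap f c'.
Proof. exact: map_cat. Qed.

Lemma lmap_cat H H' (f : H -> H') l l' : lmap f (l ++ l') = lmap f l ++ lmap f l'.
Proof. exact: map_cat. Qed.

Lemma lmap_scale H H' (f : H -> H') k l : lmap f (lscale k l) = lscale k (lmap f l).
Proof. by rewrite /lmap /lscale -!map_comp. Qed.

Lemma cmap_scale H H' (f : H -> H') k c : cmap f (cscale k c) = cscale k (cmap f c).
Proof. by rewrite /cmap /cscale -!map_comp. Qed.

Lemma cmap_mul H H' (f : H -> H') c c' : cmap f (cmul c c') = cmul (cmap f c) (cmap f c').
Proof.
rewrite /cmul cmap_cat; congr cat; elim: c => //= p c IH; rewrite cmap_cat IH; congr cat.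
- by rewrite /cmap -!map_comp; apply: eq_map => p' /=; rewrite lmap_cat.
- by rewrite /cmap -!map_comp; apply: eq_map => p' /=; rewrite lmap_cat lmap_scale.
Qed.

End code.

Section gaussian_family.
Context {dT : measure_display} {T : measurableType dT} {R : realType}.
Variables (P : probability T R) (H : Type) (W : H -> T -> R).

Definition gaussian_family :=
  (forall h, measurable_fun setT (W h)) /\
  (forall n (c : 'I_n -> R) (h : 'I_n -> H),
     centered_gaussian P (fun w => \sum_i c i * W (h i) w)).

Hypothesis gW : gaussian_family.

Definition lin (l : linform H) (w : T) : R := \sum_(p <- l) p.1 * W p.2 w.
Definition qcov h h' : R := ip P (W h) (W h').
Definition cov (l l' : linform H) : R :=
  \sum_(p <- l) \sum_(p' <- l') p.1 * p'.1 * qcov p.2 p'.2.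
Definition ev (c : code H) (w : T) : R :=
  \sum_(p <- c) p.1.1 * cos (lin p.1.2 w + p.2).
(** The expectation of [ev c] (see [Ex_ev]), written in terms of covariances alone; this is what
    makes it invariant under translations. *)
Definition mean (c : code H) : R :=
  \sum_(p <- c) p.1.1 * (cos p.2 * expR (- (cov p.1.2 p.1.2 / 2))).

Lemma lin_cat l l' w : lin (l ++ l') w = lin l w + lin l' w.
Proof. exact: big_cat. Qed.

Lemma lin_scale k l w : lin (lscale k l) w = k * lin l w.
Proof. by rewrite /lin /lscale big_map mulr_sumr; apply: eq_bigr => p _; rewrite mulrA. Qed.

Lemma measurable_lin l : measurable_fun setT (lin l).
Proof.
rewrite (_ : lin l = fun w => \sum_(p <- l) (fun p w => p.1 * W p.2 w) p w)//.
apply: measurable_sum => p; apply: measurable_funM => //; exact: gW.1.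
Qed.

Lemma lin_gaussian l : centered_gaussian P (lin l).
Proof.
have := gW.2 (size l) (fun i => (tnth (in_tuple l) i).1) (fun i => (tnth (in_tuple l) i).2).
congr (centered_gaussian P _); apply/funext => w; rewrite /lin.
by rewrite [RHS]big_tnth.
Qed.

Lemma L2_W h : L2 P (W h).
Proof.
have := (gaussian_L2 (measurable_lin [:: (1, h)]) (lin_gaussian [:: (1, h)])).1.
congr (L2 P _); apply/funext => w; rewrite /lin big_seq1 mul1r//.
Qed.

Lemma L2_lin l : L2 P (lin l).
Proof. exact: (gaussian_L2 (measurable_lin l) (lin_gaussian l)).1. Qed.

Lemma ip_lin l l' : ip P (lin l) (lin l') = cov l l'.
Proof.
have LZ p : L2 P (fun w => p.1 * W p.2 w) by apply: L2Z; exact: L2_W.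
rewrite /lin (ip_suml _ LZ); last exact: L2_lin.
apply: eq_bigr => p _; rewrite (ip_sumr _ LZ)//.
apply: eq_bigr => p' _; rewrite ipZl ?ipZr ?mulrA//; exact: L2_W.
Qed.

Lemma covC l l' : cov l l' = cov l' l. Proof. by rewrite -!ip_lin ipC. Qed.

Lemma cov_catl l1 l2 l : cov (l1 ++ l2) l = cov l1 l + cov l2 l.
Proof. exact: big_cat. Qed.

Lemma cov_scalel k l l' : cov (lscale k l) l' = k * cov l l'.
Proof.
rewrite /cov big_map mulr_sumr; apply: eq_bigr => p _.
by rewrite mulr_sumr; apply: eq_bigr => p' _ /=; rewrite !mulrA.
Qed.

Lemma Ex_cos_lin l b : Ex P (fun w => cos (lin l w + b)) = cos b * expR (- (cov l l / 2)).
Proof. by rewrite (gaussian_L2 (measurable_lin l) (lin_gaussian l)).2 ip_lin. Qed.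

Lemma measurable_cos_linform l b : measurable_fun setT (fun w => cos (lin l w + b)).
Proof.
have := measurableT_comp (measurable_cos_lin 1 b) (measurable_lin l).
by apply: eq_measurable_fun => w _ /=; rewrite mul1r.
Qed.

Lemma measurable_ev c : measurable_fun setT (ev c).
Proof.
rewrite (_ : ev c = fun w => \sum_(p <- c) (fun p w => p.1.1 * cos (lin p.1.2 w + p.2)) p w)//.
by apply: measurable_sum => p; apply: measurable_funM => //; exact: measurable_cos_linform.
Qed.

Lemma ev_bdd c : bdd (ev c).
Proof.
exists (\sum_(p <- c) `|p.1.1|) => w; apply: le_trans (ler_norm_sum _ _ _) _.
by apply: ler_sum => p _; rewrite normrM ler_piMr// cos_max.
Qed.

Lemma L2_ev c : L2 P (ev c).
Proof. by apply: bdd_L2; [exact: measurable_ev|exact: ev_bdd]. Qed.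

Lemma Ex_ev c : Ex P (ev c) = mean c.
Proof.
elim: c => [|p c IH].
  rewrite /mean big_nil (_ : ev [::] = cst 0) ?Ex_cst//.
  by apply/funext => w; rewrite /ev big_nil.
transitivity (Ex P (fun w => p.1.1 * cos (lin p.1.2 w + p.2) + 1 * ev c w)).
  by apply: eq_Rintegral => w _; rewrite /ev big_cons mul1r.
rewrite Ex_lin2; first last.
- by apply: bdd_int; [exact: measurable_ev|exact: ev_bdd].
- by apply: bdd_int; [exact: measurable_cos_linform|exists 1 => w; exact: cos_max].
by rewrite mul1r IH Ex_cos_lin /mean big_cons.
Qed.

Lemma ev_cat c c' w : ev (c ++ c') w = ev c w + ev c' w.
Proof. exact: big_cat. Qed.

Lemma ev_scale k c w : ev (cscale k c) w = k * ev c w.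
Proof. by rewrite /ev big_map mulr_sumr; apply: eq_bigr => p _ /=; rewrite mulrA. Qed.

Lemma ev_cst k w : ev (ccst H k) w = k.
Proof. by rewrite /ev /ccst big_seq1 /= /lin big_nil addr0 cos0 mulr1. Qed.

Lemma ev_mul c c' w : ev (cmul c c') w = ev c w * ev c' w.
Proof.
rewrite /cmul ev_cat /ev !big_allpairs_dep/= -big_split/= mulr_suml.
apply: eq_bigr => p _; rewrite -big_split/= mulr_sumr; apply: eq_bigr => p' _.
rewrite /= !lin_cat lin_scale mulN1r.
have -> : lin p.1.2 w + lin p'.1.2 w + (p.2 + p'.2) = (lin p.1.2 w + p.2) + (lin p'.1.2 w + p'.2) by ring.
have -> : lin p.1.2 w - lin p'.1.2 w + (p.2 - p'.2) = (lin p.1.2 w + p.2) - (lin p'.1.2 w + p'.2) by ring.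
by rewrite cosD cosB; field.
Qed.

Lemma ev_sin n l w : ev (csin n l) w = sinr n (lin l w).
Proof. by rewrite /ev /csin big_seq1 /= lin_scale sin_cos_pihalf. Qed.

Lemma ip_ev c c' : ip P (ev c) (ev c') = mean (cmul c c').
Proof. by rewrite -Ex_ev; apply: eq_Rintegral => w _; rewrite ev_mul. Qed.

Lemma mean_sin n l : mean (csin n l) = 0.
Proof. by rewrite /mean /csin big_seq1 /= cosN cos_pihalf mul0r mulr0. Qed.

Lemma mean_cat c c' : mean (c ++ c') = mean c + mean c'.
Proof. exact: big_cat. Qed.

Definition orth (l l' : linform H) := cov l l' = 0.

Lemma orth_closed l' : linform_closed (fun l => orth l l').
Proof.
split=> [l1 l2|k l]; rewrite /orth; first by rewrite cov_catl => -> ->; rewrite addr0.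
by rewrite cov_scalel => ->; rewrite mulr0.
Qed.

(** Uncorrelated jointly Gaussian forms are independent: the variances of [l + l'] and [l - l'] are
    both the sum of the two variances, so the exponential factors out and the two cosines of phases
    recombine into a product. *)
Lemma mean_mul1 p p' : orth p.1.2 p'.1.2 ->
  mean (cmul [:: p] [:: p']) = mean [:: p] * mean [:: p'].
Proof.
move=> o; have o' : cov p'.1.2 p.1.2 = 0 by rewrite covC.
rewrite /mean !big_cons !big_nil !addr0 /=.
have h k : cov (p.1.2 ++ lscale k p'.1.2) (p.1.2 ++ lscale k p'.1.2) =
   cov p.1.2 p.1.2 + k ^+ 2 * cov p'.1.2 p'.1.2.
  rewrite cov_catl cov_scalel (covC p.1.2) (covC p'.1.2 (_ ++ _)) !cov_catl !cov_scalel o o'.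
  ring.
have l1 : p.1.2 ++ p'.1.2 = p.1.2 ++ lscale 1 p'.1.2.
  by rewrite /lscale; congr cat; rewrite -[LHS]map_id; apply: eq_map => -[a b]; rewrite mul1r.
rewrite l1 !h expr1n sqrrN expr1n mul1r mulrDl opprD expRD cosD cosB.
by field.
Qed.

Lemma mean_mul c c' :
  terms (fun l' => terms (fun l => orth l l') c) c' ->
  mean (cmul c c') = mean c * mean c'.
Proof.
move=> h; rewrite -ip_ev.
have LC p : L2 P (ev [:: p]) := L2_ev _.
have E c1 : ev c1 = fun w => \sum_(p <- c1) ev [:: p] w.
  by apply/funext => w; apply: eq_bigr => p _; rewrite /ev big_seq1.
have M c1 : mean c1 = \sum_(p <- c1) mean [:: p].
  by apply: eq_bigr => p _; rewrite /mean big_seq1.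
rewrite (E c) (ip_suml _ LC); last exact: L2_ev.
rewrite (M c) (M c') mulr_suml.
have {}h : terms (fun l => terms (fun l' => orth l l') c') c.
  elim: c' h => [|p' c' IH] /=; first by move=> _; elim: c.
  move=> [h1 /IH h2] {IH}; elim: c h1 h2 => //= p c IH [? ?] [? ?]; split=> //; exact: IH.
elim: c h => [|p c IH] /= h; first by rewrite !big_nil.
rewrite !big_cons IH; last by case: h.
congr (_ + _); rewrite (E c') (ip_sumr _ LC)// mulr_sumr; case: h => + _.
elim: c' {IH} => [|p' c' IH] /= h; first by rewrite !big_nil.
rewrite !big_cons IH; last by case: h.
by congr (_ + _); rewrite ip_ev mean_mul1//; case: h.
Qed.

End gaussian_family.

(** * Independence of the past and of a later increment *)

Section past_future.
Context {dT : measure_display} {T : measurableType dT} {R : realType}.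
Variables (P : probability T R) (H : Type) (W : H -> T -> R).
Hypothesis gW : gaussian_family P W.
Local Notation ev := (ev W).
Local Notation lin := (lin W).
Local Notation mean := (mean P W).
Local Notation cov := (cov P W).
Local Notation qcov := (qcov P W).
Local Notation orth := (orth P W).

Definition uncorrelated (v : H) : linform H -> Prop := fun l => orth l [:: (1, v)].

Lemma lin1 v : lin [:: (1, v)] = W v.
Proof. by apply/funext => w; rewrite /lin big_seq1 mul1r. Qed.

Lemma uncorrelated_all v l l' : uncorrelated v l ->
  foldr (fun p A => p.2 = v /\ A) True l' -> orth l l'.
Proof.
move=> Ql; rewrite /orth (covC gW); elim: l' => [|[k h] l' IH] /=; first by rewrite /cov big_nil.
move=> [-> /IH h']; rewrite -cat1s cov_catl h' addr0.
have -> : [:: (k, v)] = lscale k [:: (1, v)] by rewrite /lscale /= mulr1.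
by rewrite cov_scalel (covC gW) Ql mulr0.
Qed.

Lemma mean_mul_sin c n v k : terms (uncorrelated v) c ->
  mean (cmul c (csin n (lscale k [:: (1, v)]))) = 0.
Proof.
move=> Qc; rewrite (mean_mul gW) ?mean_sin ?mulr0//=; split=> //.
by elim: c Qc => //= p c IH [Qp Qc]; split; [exact: (uncorrelated_all Qp)|exact: IH].
Qed.

Lemma mean_mul_sin2 c n v : terms (uncorrelated v) c ->
  mean (cmul c (cmul (csin n [:: (1, v)]) (csin n [:: (1, v)]))) =
  mean c * mean (cmul (csin n [:: (1, v)]) (csin n [:: (1, v)])).
Proof.
move=> Qc; rewrite (mean_mul gW)//=; split; last split => //.
- by elim: c Qc => //= p c IH [Qp Qc]; split; [exact: (uncorrelated_all Qp)|exact: IH].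
- by elim: c Qc => //= p c IH [Qp Qc]; split; [exact: (uncorrelated_all Qp)|exact: IH].
Qed.

(** The computation behind Walsh's isometry. Only [v'] is uncorrelated with [c], while [v] may be
    correlated with both, so [v] is regressed on [v']: the residual [l] is uncorrelated with [v'],
    which is then independent of [c] and [l] jointly. The residual contributes 0, and [c] factors
    out of the remaining square. Independence is known for codes, hence the bounded [sinr n] in
    place of the linear forms and a passage to the limit. *)
Lemma ip_past c v v' : terms (uncorrelated v') c ->
  ip P (fun w => ev c w * W v w) (W v') = mean c * qcov v v'.
Proof.
move=> Qc; have Lv := L2_W gW v; have Lv' := L2_W gW v'.
have mc := measurable_ev gW c; have bc := ev_bdd W c.
have Lcv u := L2Ml mc bc (L2_W gW u).
have [q0|qN0] := eqVneq (qcov v' v') 0.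
  have z X : L2 P X -> ip P X (W v') = 0.
    move=> LX; have := ip_CS LX Lv'; rewrite -/(qcov v' v') q0 mulr0 => h.
    by apply/eqP; rewrite -sqrf_eq0 eq_le h sqr_ge0.
  by rewrite z// -[qcov v v']/(ip P (W v) (W v')) z ?mulr0.
pose a := qcov v v' / qcov v' v'.
pose l : linform H := [:: (1, v); (- a, v')].
have linE w : lin l w = W v w - a * W v' w.
  by rewrite /lin /l !big_cons big_nil /= mul1r addr0 mulNr.
have Ll := L2_lin gW l.
have lo : uncorrelated v' l.
  rewrite /uncorrelated /orth -(ip_lin gW) lin1.
  rewrite (_ : lin l = fun w => W v w - a * W v' w); last exact/funext.
  rewrite ipBl ?ipZl//; last exact: L2Z.
  by rewrite /a -/(qcov v v') -/(qcov v' v') divfK ?subrr.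
have e1 : ip P (fun w => ev c w * lin l w) (W v') = 0.
  have := l2cvg_ip (fun n => L2Ml mc bc (L2_sinr n Ll)) (fun n => L2_sinr n Lv')
    (L2Ml mc bc Ll) Lv' (l2cvgMl mc bc (fun n => L2_sinr n Ll) Ll (l2cvg_sinr Ll)) (l2cvg_sinr Lv').
  move/cvg_lim => <- //; apply/cvg_lim => //; apply: (@cvg_eventually _ _ _ 0) => n _.
  transitivity (ip P (ev (cmul c (csin n l))) (ev (csin n [:: (1, v')]))).
    by apply: eq_Rintegral => w _; rewrite ev_mul !ev_sin lin1.
  rewrite (ip_ev gW); have := @mean_mul_sin (cmul c (csin n l)) n v' 1.
  rewrite {1}/lscale /= mulr1; apply; apply: terms_mul => //; first exact: orth_closed.
  by split=> //; exact: ((orth_closed P W [:: (1, v')]).2 n.+1%:R^-1 l lo).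
have e2 : ip P (fun w => ev c w * W v' w) (W v') = mean c * qcov v' v'.
  have Ls n := L2_sinr n Lv'.
  have h1 := l2cvg_ip (fun n => L2Ml mc bc (Ls n)) Ls
    (L2Ml mc bc Lv') Lv' (l2cvgMl mc bc Ls Lv' (l2cvg_sinr Lv')) (l2cvg_sinr Lv').
  have h2 : mean c * ip P (fun w => sinr n (W v' w)) (fun w => sinr n (W v' w)) @[n --> \oo]
      --> mean c * qcov v' v'.
    by apply: cvgM; [exact: cvg_cst|exact: (l2cvg_ip Ls Ls Lv' Lv' (l2cvg_sinr Lv') (l2cvg_sinr Lv'))].
  move: h2; rewrite (_ : (fun n => _) = fun n =>
      ip P (fun w => ev c w * sinr n (W v' w)) (fun w => sinr n (W v' w))) => [h2|].
    exact: (cvg_unique _ h1 h2).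
  apply/funext => n.
  transitivity (ip P (ev c) (ev (cmul (csin n [:: (1, v')]) (csin n [:: (1, v')])))).
    rewrite (ip_ev gW) (mean_mul_sin2 _ Qc) -(ip_ev gW); congr (_ * _).
    by apply: eq_Rintegral => w _; rewrite !ev_sin lin1.
  by apply: eq_Rintegral => w _; rewrite ev_mul !ev_sin lin1 mulrA.
have -> : ip P (fun w => ev c w * W v w) (W v') =
   ip P (fun w => ev c w * lin l w + a * (ev c w * W v' w)) (W v').
  by apply: eq_Rintegral => w _; rewrite linE; ring.
have Lcl := L2Ml mc bc Ll; have Lcv' := Lcv v'.
rewrite ipDl ?ipZl ?e1 ?e2//; last exact: L2Z.
by rewrite /a; field.
Qed.

Definition past_codes (Q : linform H -> Prop) : set (T -> R) :=
  [set f | exists2 c, terms Q c & f = ev c].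

Lemma past_codes_alg Q : linform_closed Q -> is_alg (past_codes Q).
Proof.
move=> Qcl; split.
- by move=> _ [c _ ->]; exact: (measurable_ev gW).
- by move=> _ [c _ ->]; exact: ev_bdd.
- move=> _ _ [c Qc ->] [c' Qc' ->]; exists (c ++ c'); first exact: terms_cat.
  by apply/funext => w; rewrite ev_cat.
- move=> k _ [c Qc ->]; exists (cscale k c); first exact: terms_scale.
  by apply/funext => w; rewrite ev_scale.
- move=> _ _ [c Qc ->] [c' Qc' ->]; exists (cmul c c'); first exact: terms_mul.
  by apply/funext => w; rewrite ev_mul.
Qed.

Lemma past_codes1 Q : linform_closed Q -> Q [::] -> L2cl P (past_codes Q) (cst 1).
Proof.
move=> Qcl Q0; apply: (sub_L2cl _ (past_codes_alg Qcl)).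
by exists (ccst H 1) => //; apply/funext => w; rewrite ev_cst.
Qed.

Lemma sqn_past_sinr c n v : terms (uncorrelated v) c ->
  (sqn P (fun w => ev c w * sinr n (W v w))%R <= (qcov v v)%:E * sqn P (ev c))%E.
Proof.
move=> Qc; have Lv := L2_W gW v; have Ls := L2_sinr n Lv.
have Lc := L2_ev gW c; have := L2Ml (measurable_ev gW c) (ev_bdd W c) Ls => Lcs.
have cl := orth_closed P W [:: (1, v)].
rewrite (sqn_ip Lcs) (sqn_ip Lc) -EFinM lee_fin.
have -> : ip P (fun w => ev c w * sinr n (W v w)) (fun w => ev c w * sinr n (W v w)) =
    ip P (ev (cmul c c)) (ev (cmul (csin n [:: (1, v)]) (csin n [:: (1, v)]))).
  by apply: eq_Rintegral => w _; rewrite !ev_mul !ev_sin lin1; ring.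
rewrite (ip_ev gW) mean_mul_sin2; last exact: terms_mul.
rewrite -!(ip_ev gW) mulrC ler_wpM2r ?ip_ge0// -lee_fin -!sqn_ip//; last exact: (L2_ev gW).
rewrite (_ : ev (csin _ _) = fun w => sinr n (W v w)); last by apply/funext => w; rewrite ev_sin lin1.
by apply: le_sqn => [||w]; [case: Ls|case: Lv|exact: sinr_le].
Qed.

(** [X] is only an L2 limit of codes and [W v] is unbounded, so the product cannot be approximated
    at once. With [sinr n (W v)] in place of [W v], the variable [X] can be replaced by a code at a
    cost tending to 0, and independence gives a bound that does not depend on [n]; Fatou's lemma
    then removes [n]. The factor 4 comes from two uses of [(a + b)^2 <= 2 a^2 + 2 b^2]. *)
Lemma sqn_past (X : T -> R) c v : L2cl P (past_codes (uncorrelated v)) X ->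
  terms (uncorrelated v) c ->
  (sqn P (fun w => (X w - ev c w) * W v w)%R <= (4 * qcov v v)%:E * sqn P (fun w => X w - ev c w)%R)%E.
Proof.
move=> [mX hX] Qc; have mc := measurable_ev gW c; have mXc := measurable_funB mX mc.
have [mv _] := L2_W gW v.
have q0 : 0 <= qcov v v by exact: ip_ge0.
apply: (@sqn_fatou _ _ _ _ (fun n w => (X w - ev c w) * sinr n (W v w))) => [n|w|n].
- by apply: measurable_funM => //; exact: (measurableT_comp (measurable_sinr n)).
- by apply: cvgM; [exact: cvg_cst|exact: cvg_sinr].
have ms : measurable_fun setT (fun w => sinr n (W v w)) by exact: (measurableT_comp (measurable_sinr n)).
apply/lee_addgt0Pr => e e0.
(* The error [e / K] enters with the factors [2 (n+1)^2] and [4 qcov v v]; [K] exceeds their sum. *)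
pose K := 2 * n.+1%:R ^+ 2 + 4 * qcov v v + 1.
have n20 : 0 <= n.+1%:R ^+ 2 :> R by rewrite sqr_ge0.
have K0 : 0 < K by rewrite /K; lra.
have [_ [c' Qc' ->] Hc'] := hX _ (divr_gt0 e0 K0).
have mc' := measurable_ev gW c'.
pose c1 := c' ++ cscale (-1) c.
have c1E w : ev c1 w = ev c' w - ev c w by rewrite ev_cat ev_scale mulN1r.
have Qc1 : terms (uncorrelated v) c1 by apply: terms_cat => //; exact: terms_scale.
have m1 := measurable_ev gW c1.
have mXc' := measurable_funB mX mc'.
rewrite (_ : (fun w => _) = fun w => (X w - ev c' w) * sinr n (W v w) + ev c1 w * sinr n (W v w)); last first.
  by apply/funext => w; rewrite c1E; ring.
apply: le_trans (sqnD _ _ _) _; [exact: measurable_funM..|].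
have h1 : (sqn P (fun w => (X w - ev c' w) * sinr n (W v w))%R <= (n.+1%:R ^+ 2 * (e / K))%:E)%E.
  rewrite (_ : (fun w => _) = fun w => sinr n (W v w) * (X w - ev c' w)); last by apply/funext => w; rewrite mulrC.
  apply: le_trans (sqnMl _ ms mXc' (fun w => sinr_bdd n _)) _.
  by rewrite (EFinM (n.+1%:R ^+ 2)); apply: lee_wpmul2l => //; rewrite lee_fin.
have h2 : (sqn P (fun w => ev c1 w * sinr n (W v w))%R <= (qcov v v)%:E * (2%:E * (e / K)%:E + 2%:E * sqn P (fun w => X w - ev c w)%R))%E.
  apply: le_trans (sqn_past_sinr n Qc1) _; apply: lee_wpmul2l; first by rewrite lee_fin.
  rewrite (_ : ev c1 = fun w => ev c' w - ev c w); last exact/funext.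
  apply: le_trans (sqnB _ mc' mX mc) _; apply: leeD => //.
  by apply: lee_wpmul2l => //; rewrite sqnBC.
apply: le_trans (leeD (lee_wpmul2l _ h1) (lee_wpmul2l _ h2)) _ => //.
rewrite muleDr ?ge0_adde_def ?inE ?mule_ge0 ?sqn_ge0 ?lee_fin ?divr_ge0 ?(ltW e0) ?(ltW K0)//.
rewrite muleDr ?ge0_adde_def ?inE ?mule_ge0 ?sqn_ge0 ?lee_fin ?divr_ge0 ?(ltW e0) ?(ltW K0)//.
rewrite addeA addeC; apply: leeD.
  by rewrite !muleA -!EFinM lee_wpmul2r ?sqn_ge0// lee_fin; lra.
rewrite -!EFinM -EFinD lee_fin (_ : _ + _ = (2 * n.+1%:R ^+ 2 + 4 * qcov v v) * (e / K)); last by ring.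
rewrite mulrA ler_pdivrMr// mulrC ler_pM2l// /K; lra.
Qed.

End past_future.

(** * Pairs of random variables *)

Section pair_measure.
Context {dT : measure_display} {T : measurableType dT} {R : realType}.
Variable P : probability T R.

(* A pair of random variables is a function on [T * bool]. *)
Definition glue (f g : T -> R) (p : T * bool) : R := if p.2 then f p.1 else g p.1.

(** The squared distance of two pairs becomes a single [sqn], so the closure theory of algebras
    applies to pairs as it stands. *)
Definition pair_measure (A : set (T * bool)) : \bar R :=
  (P [set w | A (w, true)] + P [set w | A (w, false)])%E.

Lemma measurable_slice (A : set (T * bool)) b : measurable A -> measurable [set w | A (w, b)].
Proof.
move=> mA; have m : measurable_fun setT (fun w : T => (w, b)) by exact: measurable_fun_pair.
by rewrite -[X in measurable X]setTI; exact: m.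
Qed.

Let pm0 : pair_measure set0 = 0%E.
Proof. by rewrite /pair_measure !measure0 adde0. Qed.

Let pm_ge0 A : (0 <= pair_measure A)%E.
Proof. by rewrite adde_ge0. Qed.

Let pm_sigma : semi_sigma_additive pair_measure.
Proof.
move=> F mF tF mUF; rewrite /pair_measure.
have h b : (fun n => \sum_(0 <= i < n) P [set w | F i (w, b)])%E @ \oo --> P [set w | (\bigcup_n F n) (w, b)].
  rewrite (_ : [set w | _] = \bigcup_n [set w | F n (w, b)])//.
  apply: measure_semi_sigma_additive => [n||].
  - exact: measurable_slice.
  - apply/trivIsetP => /= i j _ _ ij; apply/seteqP; split => w //= [Fi Fj].
    have : (F i `&` F j) (w, b) by [].
    by move/trivIsetP : tF => /(_ i j Logic.I Logic.I ij) ->.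
  - exact: measurable_slice mUF.
rewrite [X in X @ _ --> _](_ : _ = fun n => \sum_(0 <= i < n) P [set w | F i (w, true)] +
   \sum_(0 <= i < n) P [set w | F i (w, false)])%E; last by apply/funext => n; rewrite big_split.
apply: cvgeD (h true) (h false).
by rewrite ge0_adde_def// inE.
Qed.

HB.instance Definition _ := isMeasure.Build _ _ _ pair_measure pm0 pm_ge0 pm_sigma.

Let pm_fin : fin_num_fun pair_measure.
Proof. by move=> A mA; rewrite fin_numD !fin_num_measure//; exact: measurable_slice. Qed.

HB.instance Definition _ := Measure_isFinite.Build _ _ _ pair_measure pm_fin.

Lemma measurable_glue f g : measurable_fun setT f -> measurable_fun setT g ->
  measurable_fun setT (glue f g).
Proof.
move=> mf mg _ B mB; rewrite setTI.
rewrite (_ : _ @^-1` _ = (f @^-1` B `*` [set true]) `|` (g @^-1` B `*` [set false])).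
  apply: measurableU; apply: measurableX => //; rewrite -[X in measurable X]setTI; [exact: mf|exact: mg].
by apply/seteqP; split => -[w []] //=; [left|right|case=> -[]|case=> -[]].
Qed.

Lemma sqn_pair (h : T * bool -> R) : measurable_fun setT h ->
  sqn pair_measure h = (sqn P (fun w => h (w, true)) + sqn P (fun w => h (w, false)))%E.
Proof.
move=> mh; have m (b : bool) : measurable_fun setT (fun w : T => (w, b)) by exact: measurable_fun_pair.
have mh2 := measurable_sq mh.
have pos : {in setT, forall p, (0 <= (h p ^+ 2)%:E)%E} by move=> p _; rewrite lee_fin sqr_ge0.
have h1 := ge0_integral_pushforward (m true) P measurableT mh2 pos.
have h2 := ge0_integral_pushforward (m false) P measurableT mh2 pos.
rewrite !preimage_setT in h1 h2.
rewrite /sqn -[X in _ = (X + _)%E]h1 -[X in _ = (_ + X)%E]h2.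
rewrite -ge0_integral_measure_add//; last by move=> p _; rewrite lee_fin sqr_ge0.
by apply: eq_measure_integral => A mA _; apply/esym; exact: measure_addE.
Qed.

End pair_measure.

(** * Random variables close to a code and to its translate *)

Section near.
Context {dT : measure_display} {T : measurableType dT} {R : realType}.
Variables (P : probability T R) (H : Type) (W : H -> T -> R).
Hypothesis gW : gaussian_family P W.
Variable sh : H -> H.
Hypothesis qsh : forall h h', qcov P W (sh h) (sh h') = qcov P W h h'.
Local Notation ev := (ev W).
Local Notation mean := (mean P W).
Local Notation cov := (cov P W).
Local Notation tau := (cmap sh).
Implicit Types (X Y f : T -> R) (c : @code R H).

Lemma cov_lmap l l' : cov (lmap sh l) (lmap sh l') = cov l l'.
Proof.
rewrite /cov big_map; apply: eq_bigr => p _; rewrite big_map; apply: eq_bigr => p' _ /=.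
by rewrite qsh.
Qed.

Lemma mean_tau c : mean (tau c) = mean c.
Proof. by rewrite /mean big_map; apply: eq_bigr => p _ /=; rewrite cov_lmap. Qed.

Lemma ip_tau c c' : ip P (ev (tau c)) (ev (tau c')) = ip P (ev c) (ev c').
Proof. by rewrite !(ip_ev gW) -cmap_mul mean_tau. Qed.

Lemma evB c c' w : ev (c ++ cscale (-1) c') w = ev c w - ev c' w.
Proof. by rewrite ev_cat ev_scale mulN1r. Qed.

Lemma sqn_tauB c c' : sqn P (fun w => ev (tau c) w - ev (tau c') w)%R =
  sqn P (fun w => ev c w - ev c' w)%R.
Proof.
have E c1 c2 : (fun w => ev c1 w - ev c2 w) = ev (c1 ++ cscale (-1) c2).
  by apply/funext => w; rewrite evB.
rewrite !E -cmap_scale -cmap_cat !sqn_ip; first by rewrite ip_tau.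
- exact: (L2_ev gW).
- exact: (L2_ev gW).
Qed.

(* [X] and [Y] are within squared distance [q] of a code and of its translate, for the same
   code; for [q = 0] this says that [Y] is the translate of [X]. *)
Definition near X Y (q : R) :=
  [/\ measurable_fun setT X, measurable_fun setT Y &
  forall e : R, 0 < e -> exists c, (sqn P (fun w => X w - ev c w)%R <= (q + e)%:E)%E /\
    (sqn P (fun w => Y w - ev (tau c) w)%R <= (q + e)%:E)%E].

Definition pair_alg : set (T * bool -> R) := [set f | exists c, f = glue (ev c) (ev (tau c))].

Lemma pair_alg_alg : is_alg pair_alg.
Proof.
split.
- by move=> _ [c ->]; apply: measurable_glue; exact: (measurable_ev gW).
- move=> _ [c ->]; have [M M0 cM] := bddP (ev_bdd W c); have [N N0 cN] := bddP (ev_bdd W (tau c)).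
  exists (M + N) => -[w []]; rewrite /glue/=.
  + by apply: le_trans (cM w) _; rewrite lerDl ltW.
  + by apply: le_trans (cN w) _; rewrite lerDr ltW.
- move=> _ _ [c ->] [c' ->]; exists (c ++ c').
  by apply/funext => -[w []]; rewrite /glue/= ?cmap_cat ev_cat.
- move=> k _ [c ->]; exists (cscale k c).
  by apply/funext => -[w []]; rewrite /glue/= ?cmap_scale ev_scale.
- move=> _ _ [c ->] [c' ->]; exists (cmul c c').
  by apply/funext => -[w []]; rewrite /glue/= ?cmap_mul ev_mul.
Qed.

Lemma pair_alg1 : L2cl (pair_measure P) pair_alg (cst 1).
Proof.
apply: (sub_L2cl _ pair_alg_alg); exists (ccst H 1).
by apply/funext => -[w []]; rewrite /glue/= ev_cst.
Qed.

Lemma near_le X Y q q' : q <= q' -> near X Y q -> near X Y q'.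
Proof.
move=> qq [mX mY h]; split=> // e /h[c [h1 h2]]; exists c; split.
- by apply: le_trans h1 _; rewrite lee_fin lerD2r.
- by apply: le_trans h2 _; rewrite lee_fin lerD2r.
Qed.

Lemma near_inf X Y q (r : R) : 0 < r -> (forall n, near X Y (q + r * 2^-1 ^+ n)) -> near X Y q.
Proof.
move=> r0 h; have [mX mY _] := h 0%N; split=> // e e0.
have : (fun n => r * 2^-1 ^+ n) @ \oo --> 0.
  by rewrite -(mulr0 r); apply: cvgM; [exact: cvg_cst|apply: cvg_expr; rewrite ger0_norm//; lra].
have e2 : 0 < e / 2 by rewrite divr_gt0.
move/cvgrPdist_le => /(_ _ e2)[N _ /(_ N (leqnn N))]; rewrite /= sub0r normrN ger0_norm; last first.
  by rewrite mulr_ge0 ?exprn_ge0// ltW.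
move=> hN; have [_ _ /(_ _ e2)[c [h1 h2]]] := h N; exists c; split.
- by apply: le_trans h1 _; rewrite lee_fin; lra.
- by apply: le_trans h2 _; rewrite lee_fin; lra.
Qed.

Lemma L2cl_near X Y : L2cl (pair_measure P) pair_alg (glue X Y) ->
  measurable_fun setT X -> measurable_fun setT Y -> near X Y 0.
Proof.
move=> [mXY h] mX mY; split=> // e e0; have [_ [c ->] hc] := h e e0; exists c.
have mc := measurable_ev gW c; have mtc := measurable_ev gW (tau c).
rewrite add0r; move: hc; rewrite sqn_pair; last first.
  by apply: measurable_funB => //; exact: measurable_glue.
rewrite /glue/= => hc; split; apply: le_trans hc.
- by rewrite leeDl// sqn_ge0.
- by rewrite leeDr// sqn_ge0.
Qed.

Lemma near_L2cl X Y : near X Y 0 -> L2cl (pair_measure P) pair_alg (glue X Y).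
Proof.
move=> [mX mY h]; split=> [|e e0]; first exact: measurable_glue.
have [|c [h1 h2]] := h (e / 2); first by rewrite divr_gt0.
have mc := measurable_ev gW c; have mtc := measurable_ev gW (tau c).
exists (glue (ev c) (ev (tau c))); first by exists c.
rewrite sqn_pair; last by apply: measurable_funB => //; exact: measurable_glue.
apply: le_trans (leeD h1 h2) _; rewrite -EFinD lee_fin; lra.
Qed.

Lemma near_ev c : near (ev c) (ev (tau c)) 0.
Proof.
apply: L2cl_near; [|exact: (measurable_ev gW)..].
by apply: (sub_L2cl _ pair_alg_alg); exists c.
Qed.

(** [f] of a code is no longer a code. But [f] of the glued pair of a code and its translate is a
    bounded function measurable for the sets of the pair algebra, so a single code approximates both
    components. The factor 2 is the cost of the triangle inequality for squares. *)
Lemma near_lip X Y q (k : R) (f : R -> R) : 0 <= k -> measurable_fun setT f ->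
  (forall r r', `|f r - f r'| <= k * `|r - r'|) -> near X Y q ->
  near (f \o X) (f \o Y) (2 * k ^+ 2 * q).
Proof.
move=> k0 mf lip [mX mY h]; split; [exact: measurableT_comp..|] => e e0.
have K0 : 0 < 4 * (k ^+ 2 + 1) by rewrite mulr_gt0// ltr_wpDl ?sqr_ge0.
have [c [h1 h2]] := h _ (divr_gt0 e0 K0).
have mc := measurable_ev gW c; have mtc := measurable_ev gW (tau c).
have mg : measurable_fun setT (f \o glue (ev c) (ev (tau c))).
  by apply: measurableT_comp => //; exact: measurable_glue.
have : L2cl (pair_measure P) pair_alg (f \o glue (ev c) (ev (tau c))).
  apply: (L2cl_of_Sig pair_alg_alg pair_alg1) => [B mB|].
    rewrite comp_preimage; apply: (Sig_alg pair_alg_alg pair_alg1); first by exists c.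
    by rewrite -[X in measurable X]setTI; exact: mf.
  apply: sqn_bdd_lty => //; have [M M0 cM] := bddP (alg_bdd pair_alg_alg (ex_intro _ c erefl)).
  exists (`|f 0| + k * M) => p /=; rewrite -[X in `|X|](subrK (f 0)) addrC.
  apply: le_trans (ler_normD _ _) _; rewrite lerD2l.
  by apply: le_trans (lip _ _) _; rewrite subr0 ler_wpM2l.
rewrite (_ : f \o _ = glue (f \o ev c) (f \o ev (tau c))); last by apply/funext => -[w []].
move/L2cl_near => []; [exact: measurableT_comp..|] => _ _ H1.
have e4 : 0 < e / 4 by rewrite divr_gt0.
have [c' [h3 h4]] := H1 _ e4; exists c'.
have mc' := measurable_ev gW c'; have mtc' := measurable_ev gW (tau c').
have key (X1 C C' : T -> R) : measurable_fun setT X1 -> measurable_fun setT C -> measurable_fun setT C' ->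
   (sqn P (fun w => X1 w - C w)%R <= (q + e / (4 * (k ^+ 2 + 1)))%:E)%E ->
   (sqn P (fun w => (f \o C) w - C' w)%R <= (0 + e / 4)%:E)%E ->
   (sqn P (fun w => (f \o X1) w - C' w)%R <= (2 * k ^+ 2 * q + e)%:E)%E.
  move=> mX1 mC mC' g1 g2.
  have mfX : measurable_fun setT (f \o X1) by exact: measurableT_comp.
  have mfC : measurable_fun setT (f \o C) by exact: measurableT_comp.
  apply: le_trans (sqnB _ mfX mfC mC') _.
  have g3 : (sqn P (fun w => (f \o X1) w - (f \o C) w)%R <= (k ^+ 2 * (q + e / (4 * (k ^+ 2 + 1))))%:E)%E.
    apply: (@le_trans _ _ (sqn P (fun w => k * (X1 w - C w))%R)).
      apply: le_sqn => [||w]; [exact: measurable_funB|by apply: measurable_funM => //; exact: measurable_funB|].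
      by rewrite normrM (ger0_norm k0); exact: lip.
    rewrite sqnZ; last exact: measurable_funB.
    by rewrite (EFinM (k ^+ 2)); apply: lee_wpmul2l => //; rewrite lee_fin sqr_ge0.
  apply: le_trans (leeD (lee_wpmul2l _ g3) (lee_wpmul2l _ g2)) _ => //.
  rewrite -!EFinM -EFinD lee_fin.
  have : k ^+ 2 * (e / (4 * (k ^+ 2 + 1))) <= e / 4.
    rewrite mulrA ler_pdivrMr// (_ : e / 4 * _ = (k ^+ 2 + 1) * e); last by field.
    by rewrite ler_wpM2r ?ltW//; lra.
  lra.
by split; [exact: key h1 h3|exact: key h2 h4].
Qed.

(** Let [d] be a code realizing [near X Y q]. Translation preserves the distance of [c] and [d],
    which passes through [X], whence [2 (2 |c - X|^2 + 2 q) + 2 q]. *)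
Lemma near_dist X Y q c : 0 <= q -> near X Y q ->
  (sqn P (fun w => ev (tau c) w - Y w)%R <= 4%:E * sqn P (fun w => ev c w - X w)%R + (6 * q)%:E)%E.
Proof.
move=> q0 [mX mY h]; apply/lee_addgt0Pr => e e0.
have e6 : 0 < e / 6 by rewrite divr_gt0.
have [d [h1 h2]] := h _ e6.
have mc := measurable_ev gW c; have mtc := measurable_ev gW (tau c).
have md := measurable_ev gW d; have mtd := measurable_ev gW (tau d).
apply: le_trans (sqnB _ mtc mtd mY) _; rewrite sqn_tauB.
rewrite sqnBC in h2.
apply: le_trans (leeD (lee_wpmul2l _ (sqnB _ mc mX md)) (lee_wpmul2l _ h2)) _ => //.
rewrite muleDr ?ge0_adde_def ?inE ?mule_ge0 ?sqn_ge0//.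
have -> : (2%:E * (2%:E * sqn P (fun w => ev c w - X w)%R) = 4%:E * sqn P (fun w => ev c w - X w)%R)%E.
  by rewrite muleA -EFinM; congr (_%:E * _)%E; ring.
rewrite -!addeA; apply: leeD => //.
apply: le_trans (leeD (lee_wpmul2l _ (lee_wpmul2l _ h1)) (lexx _)) _ => //.
by rewrite -!EFinM -!EFinD lee_fin; lra.
Qed.

Lemma Sig_pair S : Sig (pair_measure P) pair_alg S ->
  near \1_[set w | S (w, true)] \1_[set w | S (w, false)] 0.
Proof.
move=> [mS hS]; apply: L2cl_near.
- rewrite (_ : glue _ _ = \1_S)//.
  by apply/funext => -[w []]; rewrite /glue/= !indicE; congr (_%:R); apply/idP/idP; rewrite !inE.
- by apply: measurable_indic; exact: measurable_slice.
- by apply: measurable_indic; exact: measurable_slice.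
Qed.

Lemma near_Ex X Y : L2 P X -> L2 P Y -> near X Y 0 -> Ex P X = Ex P Y.
Proof.
move=> LX LY [_ _ h]; have L1 : L2 P (cst (1 : R)) by apply: bdd_L2 => //; exists 1 => w; rewrite normr1.
have E f : Ex P f = ip P f (cst 1) by apply: eq_Rintegral => w _; rewrite mulr1.
have H0 n : 0 < n.+1%:R^-1 :> R by rewrite invr_gt0.
have hh n : exists c, (sqn P (fun w => X w - ev c w)%R <= (n.+1%:R^-1)%:E)%E /\
    (sqn P (fun w => Y w - ev (tau c) w)%R <= (n.+1%:R^-1)%:E)%E.
  by have [c] := h _ (H0 n); rewrite add0r; exists c.
have [c hc] := choice hh.
have cv (Z : T -> R) (c' : nat -> @code R H) : (forall n, (sqn P (fun w => Z w - ev (c' n) w)%R <= (n.+1%:R^-1)%:E)%E) ->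
    l2cvg P (fun n => ev (c' n)) Z.
  move=> hZ e e0; have : (n.+1%:R^-1 : R) @[n --> \oo] --> 0 by exact: cvg_harmonic.
  move/cvgrPdist_le => /(_ _ e0)[N _ HN]; exists N => n /HN /=.
  rewrite sub0r normrN ger0_norm ?invr_ge0// => hn; rewrite sqnBC.
  by apply: le_trans (hZ n) _; rewrite lee_fin.
have hX := cv X c (fun n => (hc n).1); have hY := cv Y (fun n => tau (c n)) (fun n => (hc n).2).
have cX := l2cvg_ip (fun n => L2_ev gW (c n)) (fun n => L1) LX L1 hX (l2cvg_cst P _).
have cY := l2cvg_ip (fun n => L2_ev gW (tau (c n))) (fun n => L1) LY L1 hY (l2cvg_cst P _).
rewrite !E; apply: cvg_unique cX _ => //; move: cY.
by under eq_fun do rewrite -E (Ex_ev gW) mean_tau -(Ex_ev gW) E.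
Qed.

Lemma Ex_indic S : measurable S -> (Ex P \1_S)%:E = P S.
Proof.
move=> mS; rewrite /Ex /Rintegral fineK integral_indic ?setIT//; exact: fin_num_measure.
Qed.

Lemma L2_indic S : measurable S -> L2 P (\1_S : T -> R).
Proof. by move=> mS; apply: bdd_L2; [exact: measurable_indic|exact: indic_bdd]. Qed.

Lemma Sig_pair_eq S : Sig (pair_measure P) pair_alg S ->
  P [set w | S (w, true)] = P [set w | S (w, false)].
Proof.
move=> hS; have mS := hS.1.
rewrite -!Ex_indic; [|exact: measurable_slice..]; congr (_%:E).
by apply: near_Ex (Sig_pair hS); apply: L2_indic; exact: measurable_slice.
Qed.

End near.

(** * Stationarity and ergodicity of a field of translates *)

Section stationary_ergodic.
Context {dT : measure_display} {T : measurableType dT} {R : realType} {d : nat}.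
Local Notation E := 'rV[R]_d.
Variables (P : probability T R) (H : Type) (W : H -> T -> R).
Hypothesis gW : gaussian_family P W.
Variable sh : E -> H -> H.
Hypothesis qsh : forall y h h', qcov P W (sh y h) (sh y h') = qcov P W h h'.
Variable v : E -> T -> R.
Hypothesis near_v : forall x y, near P W (sh y) (v x) (v (x + y)) 0.
Variable y_ : nat -> E.
Hypothesis mixing : forall h h', qcov P W h (sh (y_ n) h') @[n --> \oo] --> 0.
Local Notation ev := (ev W).
Local Notation mean := (mean P W).
Local Notation cov := (cov P W).
Local Notation tau y := (cmap (sh y)).
Local Notation SigP y := (Sig (pair_measure P) (pair_alg W (sh y))).
Local Notation gl x y := (glue (v x) (v (x + y))).

Lemma Sig_glue x y B : measurable B -> SigP y (gl x y @^-1` B).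
Proof.
apply: Sig_L2cl; [exact: (pair_alg_alg gW)|exact: (pair_alg1 gW)|].
exact: (near_L2cl gW (near_v x y)).
Qed.

(** The two events are the two slices of one set in the space of pairs. This set is determined by
    the pair algebra, and the slices of such sets have equal probability because translation
    preserves the means of codes. *)
Lemma near_stationary : strictly_stationary P v.
Proof.
move=> y n x B mB; apply/esym.
apply: (@Sig_pair_eq _ _ _ P _ W gW _ (qsh y) [set p | B [tuple gl (x i) y p | i < n]]).
have pa := pair_alg_alg gW (sh y); have p1 := pair_alg1 gW (sh y).
suff : (measurable : set (set (n.-tuple R))) `<=`
    [set B | SigP y [set p | B [tuple gl (x i) y p | i < n]]] by apply.
apply: smallest_sub.
  split=> [|S hS|F hF].
  - exact: (Sig0 pa p1).
  - by rewrite setTD; exact: (SigC pa p1 hS).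
  - exact: (Sig_bigcup pa p1 hF).
rewrite -bigcup_seq; apply: bigcup_sub => i _ _ [C mC <-] /=.
rewrite (_ : [set p | _] = gl (x i) y @^-1` C); first exact: Sig_glue.
by apply/seteqP; split => p; rewrite /= tnth_mktuple => //; case.
Qed.

Lemma cov_mixing l l' : cov l (lmap (sh (y_ n)) l') @[n --> \oo] --> 0.
Proof.
elim: l => [|p l IH].
  by apply: (@cvg_eventually _ _ _ 0) => n _; exact: big_nil.
rewrite (_ : (fun n => _) = fun n => (\sum_(p' <- l') p.1 * p'.1 * qcov P W p.2 (sh (y_ n) p'.2)) +
    cov l (lmap (sh (y_ n)) l')); last first.
  by apply/funext => n; rewrite /cov big_cons; congr (_ + _); rewrite big_map.
rewrite [X in _ --> X](_ : 0 = 0 + 0); last by rewrite addr0.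
apply: cvgD => //; elim: l' {IH} => [|p' l' IH].
  by apply: (@cvg_eventually _ _ _ 0) => n _; rewrite big_nil.
rewrite (_ : (fun n => _) = fun n => p.1 * p'.1 * qcov P W p.2 (sh (y_ n) p'.2) +
    \sum_(p' <- l') p.1 * p'.1 * qcov P W p.2 (sh (y_ n) p'.2)); last first.
  by apply/funext => n; rewrite big_cons.
rewrite [X in _ --> X](_ : 0 = p.1 * p'.1 * 0 + 0); last by rewrite mulr0 addr0.
apply: cvgD => //.
by apply: cvgM; [exact: cvg_cst|exact: mixing].
Qed.

(** For two single cosines the mean is an explicit continuous function of the cross covariance
    [k n], whose value at 0 is the product of the means; bilinearity does the rest. *)
Lemma mean_mixing c c' : mean (cmul c (tau (y_ n) c')) @[n --> \oo] --> mean c * mean c'.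
Proof.
have LC p : L2 P (ev [:: p]) := L2_ev gW _.
have Eev c1 : ev c1 = fun w => \sum_(p <- c1) ev [:: p] w.
  by apply/funext => w; apply: eq_bigr => p _; rewrite /ev big_seq1.
have M c1 : mean c1 = \sum_(p <- c1) mean [:: p].
  by apply: eq_bigr => p _; rewrite /mean big_seq1.
have one p p' : mean (cmul [:: p] (tau (y_ n) [:: p'])) @[n --> \oo] --> mean [:: p] * mean [:: p'].
  pose k n := cov p.1.2 (lmap (sh (y_ n)) p'.1.2).
  pose A := p.1.1 * p'.1.1 / 2.
  pose V := cov p.1.2 p.1.2 + cov p'.1.2 p'.1.2.
  have h n (s : R) : cov (p.1.2 ++ lscale s (lmap (sh (y_ n)) p'.1.2)) (p.1.2 ++ lscale s (lmap (sh (y_ n)) p'.1.2)) =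
      cov p.1.2 p.1.2 + s ^+ 2 * cov p'.1.2 p'.1.2 + 2 * s * k n.
    rewrite cov_catl cov_scalel (covC gW p.1.2) (covC gW (lmap _ _) (_ ++ _)) !cov_catl !cov_scalel.
    by rewrite (covC gW (lmap _ _) p.1.2) (cov_lmap (qsh _)) /k; ring.
  have l1 n : p.1.2 ++ lmap (sh (y_ n)) p'.1.2 = p.1.2 ++ lscale 1 (lmap (sh (y_ n)) p'.1.2).
    by rewrite /lscale; congr cat; rewrite -[LHS]map_id; apply: eq_map => -[a b]; rewrite mul1r.
  have -> : (fun n => mean (cmul [:: p] (tau (y_ n) [:: p']))) = fun n =>
      A * (cos (p.2 + p'.2) * expR (- ((V + 2 * k n) / 2))) + A * (cos (p.2 - p'.2) * expR (- ((V - 2 * k n) / 2))).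
    apply/funext => n; rewrite /mean !big_cons !big_nil !addr0 /= l1 !h.
    rewrite expr1n sqrrN expr1n !mul1r mulr1 mulrN1 mulNr.
    by congr (_ * (_ * expR (- (_ / 2))) + _ * (_ * expR (- (_ / 2)))); rewrite /V; ring.
  have -> : mean [:: p] * mean [:: p'] = A * (cos (p.2 + p'.2) * expR (- ((V + 2 * 0) / 2))) +
      A * (cos (p.2 - p'.2) * expR (- ((V - 2 * 0) / 2))).
    rewrite /mean !big_seq1 cosD cosB /A mulr0 subr0 addr0.
    have -> : - (V / 2) = - (cov p.1.2 p.1.2 / 2) + - (cov p'.1.2 p'.1.2 / 2) by rewrite /V; field.
    by rewrite expRD; field.
  have ck : k n @[n --> \oo] --> 0 by exact: cov_mixing.
  have ce (s : R) : expR (- ((V + s * k n) / 2)) @[n --> \oo] --> expR (- ((V + s * 0) / 2)).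
    apply: continuous_cvg; first exact: continuous_expR.
    apply: cvgN; apply: cvgM; last exact: cvg_cst.
    by apply: cvgD; [exact: cvg_cst|apply: cvgM => //; exact: cvg_cst].
  have ce' : expR (- ((V - 2 * k n) / 2)) @[n --> \oo] --> expR (- ((V - 2 * 0) / 2)).
    apply: continuous_cvg; first exact: continuous_expR.
    apply: cvgN; apply: cvgM; last exact: cvg_cst.
    by apply: cvgB; [exact: cvg_cst|apply: cvgM => //; exact: cvg_cst].
  apply: cvgD; apply: cvgM; try exact: cvg_cst; apply: cvgM; try exact: cvg_cst; first exact: ce.
  exact: ce'.
rewrite (_ : (fun n => _) = fun n => \sum_(p <- c) ip P (ev [:: p]) (ev (tau (y_ n) c'))); last first.
  by apply/funext => n; rewrite -(ip_ev gW) [X in ip _ X _](Eev c) (ip_suml _ LC)//; exact: (L2_ev gW).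
rewrite (M c) mulr_suml; elim: c => [|p c IH].
  by apply: (@cvg_eventually _ _ _ 0) => n _; rewrite !big_nil.
rewrite (_ : (fun n => _) = fun n => ip P (ev [:: p]) (ev (tau (y_ n) c')) +
   \sum_(p <- c) ip P (ev [:: p]) (ev (tau (y_ n) c'))); last by apply/funext => n; rewrite big_cons.
rewrite big_cons; apply: cvgD => // {IH}.
elim: c' => [|p' c' IH].
  apply: (@cvg_eventually _ _ _ 0) => n _; rewrite /mean big_nil mulr0 ipC.
  by rewrite (_ : ev [::] = cst 0) ?ip0l//; apply/funext => w; rewrite /ev big_nil.
have -> : mean [:: p] * mean (p' :: c') = mean [:: p] * mean [:: p'] + mean [:: p] * mean c'.
  by rewrite -mulrDr; congr (_ * _); rewrite -cat1s mean_cat.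
rewrite (_ : (fun n => _) = fun n => mean (cmul [:: p] (tau (y_ n) [:: p'])) + ip P (ev [:: p]) (ev (tau (y_ n) c'))).
  exact: cvgD.
apply/funext => n; rewrite -(ip_ev gW) -ipDr; [|exact: LC|exact: (L2_ev gW)|exact: LC].
congr (ip _ _ _); apply/funext => w; rewrite -ev_cat -cmap_cat//.
Qed.

(* An invariant event is close to a code and, with the same precision, to all its translates;
   these decorrelate from the code at infinity, so the event is independent of itself. *)
Lemma near_ergodic : ergodic P v.
Proof.
move=> A cA invA; pose F := [set w | A (v ^~ w)]; pose Fy y := [set w | A (fun x => v (x + y) w)].
have SF y : SigP y [set p | A (fun x => gl x y p)].
  have pa := pair_alg_alg gW (sh y); have p1 := pair_alg1 gW (sh y).
  suff : cylinder_sets `<=` [set A | SigP y [set p | A (fun x => gl x y p)]] by apply.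
  apply: smallest_sub.
    split=> [|S hS|G hG].
    - exact: (Sig0 pa p1).
    - by rewrite setTD; exact: (SigC pa p1 hS).
    - exact: (Sig_bigcup pa p1 hG).
  by move=> _ [x [B [mB ->]]]; exact: (Sig_glue x y mB).
have nF y : near P W (sh y) \1_F \1_(Fy y) 0 by exact: (Sig_pair gW (SF y)).
have mF : measurable F by exact: (measurable_slice true (SF 0).1).
have mFy y : measurable (Fy y) by exact: (measurable_slice false (SF y).1).
have LF := L2_indic P mF.
(* Invariance modulo [P] makes the two indicators equal almost surely. *)
have symF y (g : T -> R) : L2 P g -> sqn P (fun w => \1_(Fy y) w - g w)%R = sqn P (fun w => \1_F w - g w)%R.
  move=> Lg; apply: ge0_ae_eq_integral => //.
  - by apply: measurable_sq; apply: measurable_funB => //; case: Lg.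
  - by apply: measurable_sq; apply: measurable_funB => //; case: Lg.
  - by move=> w _; rewrite lee_fin sqr_ge0.
  - by move=> w _; rewrite lee_fin sqr_ge0.
  have m1 : measurable (F `+` Fy y) by apply: measurableU; exact: measurableD.
  exists (F `+` Fy y); split => //; first exact: invA.
  move=> w /= hw; apply: contrapT => nw; apply: hw => _; rewrite !indicE.
  have -> // : (w \in Fy y) = (w \in F).
  apply/idP/idP; rewrite !inE => h; apply: contrapT => h'; apply: nw; [right|left] => //.
pose a := Ex P \1_F.
have E1 (f : T -> R) : Ex P f = ip P f (cst 1) by apply: eq_Rintegral => w _; rewrite mulr1.
have L1 : L2 P (cst (1 : R)) by apply: bdd_L2 => //; exists 1 => w; rewrite normr1.
have H0 n : 0 < n.+1%:R^-1 :> R by rewrite invr_gt0.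
(* The code is chosen before the translation that decorrelates it from itself. The constant 10 is
   [2 + 2 * 4]: the distance to the translated code passes through another code [c'], adapted to
   that translation. *)
have hh (n : nat) : exists p : @code R H * E,
   [/\ (sqn P (fun w => \1_F w - ev p.1 w)%R <= (n.+1%:R^-1)%:E)%E,
       (sqn P (fun w => \1_F w - ev (tau p.2 p.1) w)%R <= (10 * n.+1%:R^-1)%:E)%E &
       `|ip P (ev p.1) (ev (tau p.2 p.1)) - mean p.1 * mean p.1| <= n.+1%:R^-1].
  have [_ _ /(_ _ (H0 n))[c [h1 _]]] := nF 0.
  have /cvgrPdist_le/(_ _ (H0 n))[N _ /(_ N (leqnn N))/= hN] := @mean_mixing c c.
  exists (c, y_ N); split => /=; first by rewrite add0r in h1.
  - have [_ mf /(_ _ (H0 n))[c' [h2 h3]]] := nF (y_ N).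
    rewrite !add0r in h1 h2 h3.
    have mc := measurable_ev gW c; have mc' := measurable_ev gW c'.
    have mtc := measurable_ev gW (tau (y_ N) c); have mtc' := measurable_ev gW (tau (y_ N) c').
    rewrite -(symF (y_ N)); last exact: (L2_ev gW).
    apply: le_trans (sqnB _ mf mtc' mtc) _; rewrite (sqn_tauB gW (qsh _)).
    rewrite sqnBC in h2.
    have h4 : (sqn P (fun w => ev c' w - ev c w)%R <= (4 * n.+1%:R^-1)%:E)%E.
      apply: le_trans (sqnB _ mc' LF.1 mc) _.
      apply: le_trans (leeD (lee_wpmul2l _ h2) (lee_wpmul2l _ h1)) _ => //.
      by rewrite -!EFinM -EFinD lee_fin; move: (n.+1%:R^-1 : R) => i; lra.
    apply: le_trans (leeD (lee_wpmul2l _ h3) (lee_wpmul2l _ h4)) _ => //.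
    by rewrite -!EFinM -EFinD lee_fin; move: (n.+1%:R^-1 : R) => i; lra.
  - by rewrite (ip_ev gW) distrC.
have [p hp] := choice hh.
have cv (k : R) (c' : nat -> @code R H) : 0 < k ->
    (forall n, (sqn P (fun w => \1_F w - ev (c' n) w)%R <= (k * n.+1%:R^-1)%:E)%E) ->
    l2cvg P (fun n => ev (c' n)) \1_F.
  move=> k0 hZ e e0; have : (k * n.+1%:R^-1 : R) @[n --> \oo] --> 0.
    by rewrite -(mulr0 k); apply: cvgM; [exact: cvg_cst|exact: cvg_harmonic].
  move/cvgrPdist_le => /(_ _ e0)[N _ HN]; exists N => n /HN /=.
  rewrite sub0r normrN ger0_norm ?mulr_ge0 ?invr_ge0 ?(ltW k0)// => hn; rewrite sqnBC.
  by apply: le_trans (hZ n) _; rewrite lee_fin.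
have c1 : l2cvg P (fun n => ev (p n).1) \1_F.
  by apply: (cv 1) => // n; rewrite mul1r; case: (hp n).
have c2 : l2cvg P (fun n => ev (tau (p n).2 (p n).1)) \1_F.
  by apply: (cv 10) => // n; case: (hp n).
have Lev n := L2_ev gW (p n).1; have Lev2 n := L2_ev gW (tau (p n).2 (p n).1).
have i1 := l2cvg_ip Lev Lev2 LF LF c1 c2.
have i2 := l2cvg_ip Lev (fun=> L1) LF L1 c1 (l2cvg_cst P _).
have m1 : mean (p n).1 @[n --> \oo] --> a.
  rewrite /a E1; move: i2; apply: cvg_trans; apply: near_eq_cvg; apply: nearW => n.
  by rewrite -E1 (Ex_ev gW).
have i3 : ip P (ev (p n).1) (ev (tau (p n).2 (p n).1)) @[n --> \oo] --> a * a.
  have m2 : mean (p n).1 * mean (p n).1 @[n --> \oo] --> a * a by exact: cvgM.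
  apply/subr_cvg0.
  rewrite (_ : (fun n => _) = fun n => (ip P (ev (p n).1) (ev (tau (p n).2 (p n).1)) - mean (p n).1 * mean (p n).1) +
     (mean (p n).1 * mean (p n).1 - a * a)); last by apply/funext => n; ring.
  rewrite [X in _ --> X](_ : 0 = 0 + 0); last by rewrite addr0.
  apply: cvgD; last by apply/subr_cvg0.
  apply: norm_cvg0; apply: (@squeeze_cvgr _ \oo _ _ (cst 0) (fun n => n.+1%:R^-1)).
  - by apply: nearW => n; rewrite normr_ge0/=; case: (hp n).
  - exact: cvg_cst.
  - exact: cvg_harmonic.
have aa : a = a * a.
  rewrite -(cvg_unique _ i1 i3)// /a /Ex; apply: eq_Rintegral => w _.
  by rewrite indicE; case: (w \in F); rewrite ?mulr1 ?mulr0.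
have : a * (a - 1) = 0 by rewrite mulrBr mulr1 -aa subrr.
move/eqP; rewrite mulf_eq0 subr_eq0 -/F => /orP[/eqP a0|/eqP a1]; [left|right];
  by rewrite -(Ex_indic P mF) -/a ?a0 ?a1.
Qed.

End stationary_ergodic.

(** * Translations and products of Lebesgue measures *)

Section lebesgue_translation.
Context {R : realType}.
Local Notation leb := (@lebesgue_measure R).

Lemma ge0_integral_leb_affine (phi : R -> R) (f : R -> \bar R) :
  measurable_fun setT (phi : measurableTypeR R -> measurableTypeR R) ->
  (forall A : set (measurableTypeR R), measurable A -> pushforward leb (phi : _ -> measurableTypeR R) A = leb A) ->
  measurable_fun setT f -> (forall r, 0 <= f r)%E ->
  (\int[leb]_r f (phi r) = \int[leb]_r f r)%E.
Proof.
move=> mphi H mf f0.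
have pos : {in setT, forall r : measurableTypeR R, (0 <= f r)%E} by move=> r _.
have := ge0_integral_pushforward mphi leb measurableT mf pos.
rewrite preimage_setT => <-.
by apply: eq_measure_integral => A mA _; exact: H.
Qed.

Lemma ge0_integral_lebN (f : R -> \bar R) : measurable_fun setT f -> (forall r, 0 <= f r)%E ->
  (\int[leb]_r f (- r)%R = \int[leb]_r f r)%E.
Proof.
apply: (@ge0_integral_leb_affine -%R); last exact: lebesgue_measureN.
by apply: continuous_measurable_fun; exact: opp_continuous.
Qed.

Lemma ge0_integral_leb_shift (a : R) (f : R -> \bar R) : measurable_fun setT f -> (forall r, 0 <= f r)%E ->
  (\int[leb]_r f (r + a)%R = \int[leb]_r f r)%E.
Proof.
have ms : measurable_fun setT (fun r : measurableTypeR R => r + a : measurableTypeR R).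
  by apply: measurable_funD.
apply: (@ge0_integral_leb_affine (fun r => r + a)) => // A mA.
pose mu := measure_function_pushforward__canonical__measure_function_Measure leb ms.
apply/esym; apply: (lebesgue_measure_unique (mu := mu)) => // _ [[b c]] _ <-.
rewrite /mu /= /pushforward /=.
rewrite (_ : _ @^-1` _ = `]b - a, c - a]%classic); last first.
  by apply/seteqP; split => r /=; rewrite !in_itv/= ltrBlDr lerBrDr.
rewrite !lebesgue_measure_itv/= !lte_fin ltrD2r.
by case: ifP => // _; rewrite -!EFinB; congr (_%:E); ring.
Qed.

End lebesgue_translation.

Section lebesgue_rV_translation.
Context {R : realType}.
Local Notation leb := (@lebesgue_measure R).
Local Notation lam n := (@lebesgue_rV R n).

Lemma measurable_funD_rV {n} d (X : measurableType d) (f g : X -> 'rV[R]_n) :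
  measurable_fun setT f -> measurable_fun setT g -> measurable_fun setT (fun x => f x + g x).
Proof.
move=> mf mg; apply: measurable_fun_rV => i.
rewrite (_ : _ \o _ = fun x => rV_coord i (f x) + rV_coord i (g x)); last first.
  by apply/funext => x; rewrite /rV_coord /= mxE.
by apply: measurable_funD; apply: measurableT_comp => //; exact: measurable_rV_coord.
Qed.

Lemma measurable_funN_rV {n} d (X : measurableType d) (f : X -> 'rV[R]_n) :
  measurable_fun setT f -> measurable_fun setT (fun x => - f x).
Proof.
move=> mf; apply: measurable_fun_rV => i.
rewrite (_ : _ \o _ = fun x => - rV_coord i (f x)); last first.
  by apply/funext => x; rewrite /rV_coord /= mxE.
by apply: measurableT_comp => //; apply: measurableT_comp => //; exact: measurable_rV_coord.
Qed.

Lemma measurable_funB_rV {n} d (X : measurableType d) (f g : X -> 'rV[R]_n) :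
  measurable_fun setT f -> measurable_fun setT g -> measurable_fun setT (fun x => f x - g x).
Proof. by move=> mf mg; apply: measurable_funD_rV => //; exact: measurable_funN_rV. Qed.

Lemma rV_unconsK n : cancel (@rV_uncons R n) (@rV_cons R n).
Proof.
move=> x; have e : row_mx (lsubmx (x : 'M[R]_(1, 1 + n))) (rsubmx (x : 'M[R]_(1, 1 + n))) = x.
  exact: hsubmxK.
apply: etrans e; have -> // : lsubmx (x : 'M[R]_(1, 1 + n)) = const_mx (x ord0 ord0).
by apply/matrixP => i j; rewrite !mxE !ord1; congr (x _ _); exact: val_inj.
Qed.

Lemma rV_consD n (p q : R * 'rV[R]_n) : rV_cons (p.1 + q.1, p.2 + q.2) = rV_cons p + rV_cons q.
Proof.
apply: (can_inj (@rV_unconsK n)); rewrite rV_consK.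
have [p1 p2] := (congr1 fst (rV_consK p), congr1 snd (rV_consK p)).
have [q1 q2] := (congr1 fst (rV_consK q), congr1 snd (rV_consK q)).
rewrite -p1 -p2 -q1 -q2 /rV_uncons; congr pair; first by rewrite /= [RHS]mxE.
by apply/matrixP => i j; rewrite !mxE.
Qed.

Lemma rV_consN n (p : R * 'rV[R]_n) : rV_cons (- p.1, - p.2) = - rV_cons p.
Proof.
apply: (can_inj (@rV_unconsK n)); rewrite rV_consK.
have [p1 p2] := (congr1 fst (rV_consK p), congr1 snd (rV_consK p)).
rewrite -p1 -p2 /rV_uncons; congr pair; first by rewrite /= [RHS]mxE.
by apply/matrixP => i j; rewrite !mxE.
Qed.

Lemma ge0_integral_rVS n (f : 'rV[R]_n.+1 -> \bar R) : measurable_fun setT f -> (forall x, 0 <= f x)%E ->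
  (\int[lam n.+1]_x f x = \int[leb]_a \int[lam n]_x f (rV_cons (a, x)))%E.
Proof.
move=> mf f0; have pos : {in setT, forall x, (0 <= f x)%E} by move=> x _.
have mc : measurable_fun [set: measurableTypeR R * 'rV[R]_n] (@rV_cons R n : measurableTypeR R * 'rV[R]_n -> _).
  by move=> mT Y mY; exact: (@measurable_rV_cons R n mT Y mY).
have := ge0_integral_pushforward mc [the {measure set (measurableTypeR R * 'rV[R]_n) -> \bar R} of (leb \x lam n)%E] measurableT mf pos.
have := @fubini_tonelli1 _ _ _ _ _ leb (lam n) (f \o @rV_cons R n) (measurableT_comp mf mc) (fun=> f0 _).
rewrite preimage_setT => -> h; apply: etrans h.
by apply: eq_measure_integral.
Qed.

Lemma measurable_rV_slice n (f : 'rV[R]_n.+1 -> \bar R) a : measurable_fun setT f ->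
  measurable_fun setT (fun x => f (rV_cons (a, x))).
Proof.
move=> mf; apply: (measurableT_comp mf); apply: (measurableT_comp (@measurable_rV_cons R n)).
exact: measurable_fun_pair.
Qed.

Lemma measurable_rV_integral n (f : 'rV[R]_n.+1 -> \bar R) : measurable_fun setT f -> (forall x, 0 <= f x)%E ->
  measurable_fun setT (fun a => \int[lam n]_x f (rV_cons (a, x)))%E.
Proof.
move=> mf f0.
exact: (@measurable_fun_fubini_tonelli_F _ _ _ _ _ (lam n) (f \o @rV_cons R n)
  (measurableT_comp mf (@measurable_rV_cons R n)) (fun=> f0 _)).
Qed.

Lemma ge0_integral_rV_shift n y (f : 'rV[R]_n -> \bar R) : measurable_fun setT f -> (forall x, 0 <= f x)%E ->
  (\int[lam n]_x f (x + y)%R = \int[lam n]_x f x)%E.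
Proof.
elim: n y f => [|n IH] y f mf f0.
  by apply: eq_integral => x _; congr f; rewrite [x + y]thinmx0 [x]thinmx0.
have ms : measurable_fun setT (fun x : 'rV[R]_n.+1 => x + y) by apply: measurable_funD_rV.
rewrite ge0_integral_rVS//; last exact: measurableT_comp.
rewrite ge0_integral_rVS//.
have h := @ge0_integral_leb_shift R (rV_uncons y).1 (fun a => \int[lam n]_x f (rV_cons (a, x)))%E.
rewrite -h; [|exact: measurable_rV_integral|by move=> a; apply: integral_ge0].
apply: eq_integral => a _.
rewrite -(IH (rV_uncons y).2 (fun x => f (rV_cons (a + (rV_uncons y).1, x))))//; last exact: measurable_rV_slice.
by apply: eq_integral => x _; rewrite (rV_consD (a, x) (rV_uncons y)) rV_unconsK.
Qed.

Lemma ge0_integral_rVN n (f : 'rV[R]_n -> \bar R) : measurable_fun setT f -> (forall x, 0 <= f x)%E ->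
  (\int[lam n]_x f (- x)%R = \int[lam n]_x f x)%E.
Proof.
elim: n f => [|n IH] f mf f0.
  by apply: eq_integral => x _; congr f; rewrite [- x]thinmx0 [x]thinmx0.
have ms : measurable_fun setT (fun x : 'rV[R]_n.+1 => - x) by apply: measurable_funN_rV.
rewrite ge0_integral_rVS//; last exact: measurableT_comp.
rewrite ge0_integral_rVS//.
have h := @ge0_integral_lebN R (fun a => \int[lam n]_x f (rV_cons (a, x)))%E.
rewrite -h; [|exact: measurable_rV_integral|by move=> a; apply: integral_ge0].
apply: eq_integral => a _.
rewrite -(IH (fun x => f (rV_cons (- a, x))))//; last exact: measurable_rV_slice.
by apply: eq_integral => x _; rewrite (rV_consN (a, x)).
Qed.

Lemma ge0_integral_rV_subl n y (f : 'rV[R]_n -> \bar R) : measurable_fun setT f -> (forall x, 0 <= f x)%E ->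
  (\int[lam n]_x f (y - x)%R = \int[lam n]_x f x)%E.
Proof.
move=> mf f0; rewrite -[RHS](ge0_integral_rV_shift y)//.
rewrite -[RHS]ge0_integral_rVN//.
  by apply: eq_integral => x _; rewrite addrC.
by apply: (measurableT_comp mf); exact: measurable_funD_rV.
Qed.

End lebesgue_rV_translation.

Section product_sigma_finite.
Context {d1 d2 : measure_display} {T1 : measurableType d1} {T2 : measurableType d2} {R : realType}.
Variables (m1 : {sigma_finite_measure set T1 -> \bar R}) (m2 : {sigma_finite_measure set T2 -> \bar R}).

(* In the library the sigma-finite structure of a product is canonical only for
   subprobabilities, which prevents iterated products. *)
Definition prod_measure (A : set (T1 * T2)%type) : \bar R := (m1 \x m2)%E A.

Let pm0 : prod_measure set0 = 0%E.
Proof. exact: measure0. Qed.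

Let pm_ge0 A : (0 <= prod_measure A)%E.
Proof. exact: measure_ge0. Qed.

Let pm_sigma : semi_sigma_additive prod_measure.
Proof. exact: measure_semi_sigma_additive. Qed.

HB.instance Definition _ := isMeasure.Build _ _ _ prod_measure pm0 pm_ge0 pm_sigma.

Let pm_sigma_finite : sigma_finite setT prod_measure.
Proof.
have /sigma_finiteP[F [FT ndF Foo]] := sigma_finiteT m1.
have /sigma_finiteP[G [GT ndG Goo]] := sigma_finiteT m2.
exists (fun n => F n `*` G n).
  apply/esym; rewrite -subTset => -[x y] _ /=.
  have [i _ Fi] : (\bigcup_i F i) x by rewrite -FT.
  have [j _ Gj] : (\bigcup_i G i) y by rewrite -GT.
  exists (maxn i j) => //; split.
  - by move: Fi; exact/subsetPset/ndF/leq_maxl.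
  - by move: Gj; exact/subsetPset/ndG/leq_maxr.
move=> k; have [? ?] := Foo k; have [? ?] := Goo k.
split; first exact: measurableX.
by rewrite /prod_measure product_measure1E// lte_mul_pinfty// ge0_fin_numE.
Qed.

HB.instance Definition _ := @Measure_isSigmaFinite.Build _ _ _ prod_measure pm_sigma_finite.

Definition prod_sf : {sigma_finite_measure set (T1 * T2)%type -> \bar R} := prod_measure.

Lemma integral_prod_sf (F : (T1 * T2)%type -> \bar R) :
  (\int[prod_sf]_q F q = \int[(m1 \x m2)%E]_q F q)%E.
Proof. exact: eq_measure_integral. Qed.

Lemma tonelli1 (F : (T1 * T2)%type -> \bar R) : measurable_fun setT F -> (forall q, 0 <= F q)%E ->
  (\int[prod_sf]_q F q = \int[m1]_x \int[m2]_y F (x, y))%E.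
Proof. by move=> mF F0; rewrite integral_prod_sf; exact: (fubini_tonelli1 F mF F0). Qed.

Lemma tonelli2 (F : (T1 * T2)%type -> \bar R) : measurable_fun setT F -> (forall q, 0 <= F q)%E ->
  (\int[prod_sf]_q F q = \int[m2]_y \int[m1]_x F (x, y))%E.
Proof. by move=> mF F0; rewrite integral_prod_sf; exact: (fubini_tonelli2 F mF F0). Qed.

Lemma fubini_int1 (F : (T1 * T2)%type -> \bar R) : prod_sf.-integrable setT F ->
  (\int[prod_sf]_q F q = \int[m1]_x \int[m2]_y F (x, y))%E.
Proof.
move=> /integrableP[mF Foo]; rewrite integral_prod_sf.
have iF : (m1 \x m2)%E.-integrable setT F.
  by apply/integrableP; split=> //; rewrite -integral_prod_sf.
exact/esym/(integral12_prod_meas1 iF).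
Qed.

Lemma measurable_inner (F : (T1 * T2)%type -> \bar R) : measurable_fun setT F -> (forall q, 0 <= F q)%E ->
  measurable_fun setT (fun x => \int[m2]_y F (x, y))%E.
Proof. by move=> mF F0; exact: (measurable_fun_fubini_tonelli_F F mF F0). Qed.

Lemma measurable_pair1 dX (Y : measurableType dX) (F : (T1 * T2)%type -> Y) x :
  measurable_fun setT F -> measurable_fun setT (fun y => F (x, y)).
Proof. by move=> mF; apply: (measurableT_comp mF); exact: measurable_fun_pair. Qed.

End product_sigma_finite.

Arguments tonelli1 {d1 d2 T1 T2 R m1 m2} [F] _ _.
Arguments tonelli2 {d1 d2 T1 T2 R m1 m2} [F] _ _.
Arguments fubini_int1 {d1 d2 T1 T2 R m1 m2} [F] _.
Arguments measurable_inner {d1 d2 T1 T2 R} m2 [F] _ _.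

(** * The covariance form of the noise *)

Lemma measurable_sqrtr {R : realType} : measurable_fun setT (@Num.sqrt R).
Proof. by apply: continuous_measurable_fun; exact: sqrt_continuous. Qed.

Section noise_form.
Context {R : realType} {d : nat}.
Local Notation E := 'rV[R]_d.
Local Notation leb := (@lebesgue_measure R).
Local Notation lam := (@lebesgue_rV R d).
Local Notation ST := (measurableTypeR R * E)%type.
Local Notation ST2 := (measurableTypeR R * (E * E))%type.
Local Notation lam2 := (prod_sf lam lam).
Local Notation mst := (prod_sf leb lam).
Local Notation m3 := (prod_sf leb lam2).
Variable gam : E -> \bar R.
Hypothesis gam_ge0 : forall x, (0 <= gam x)%E.
Hypothesis gam_L1 : lam.-integrable setT gam.

(** An integrable [gam] is infinite on a null set at most; [fine] puts 0 there, and energies do not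
    change ([energyE]). *)
Definition gamr x : R := fine (gam x).
(** The L1 norm of [gam], which bounds the covariance form by the L2 norms ([nform_le]). *)
Definition kap : R := \int[lam]_x gamr x.

Lemma gamr_ge0 x : 0 <= gamr x. Proof. exact: fine_ge0. Qed.

Lemma measurable_gamr : measurable_fun setT gamr.
Proof. by apply: measurableT_comp => //; exact: measurable_int gam_L1. Qed.

Let mgE : measurable_fun setT (fun x => (gamr x)%:E).
Proof. by apply/measurable_EFinP; exact: measurable_gamr. Qed.

Lemma integral_gamr : (\int[lam]_x (gamr x)%:E = kap%:E)%E.
Proof.
rewrite /kap /Rintegral fineK//; apply: integrable_fin_num => //.
apply: (le_integrable _ _ _ gam_L1) => //.
by move=> x _; rewrite /gamr; case: (gam x) => [r| |] //=; rewrite ?normr0 ?leey.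
Qed.

Lemma kap_ge0 : 0 <= kap.
Proof. by apply: Rintegral_ge0 => x _; exact: gamr_ge0. Qed.

Lemma measurable_diff : measurable_fun setT (fun p : E * E => p.1 - p.2).
Proof. exact: measurable_funB_rV. Qed.

Lemma ae_gam : {ae lam2, forall p : E * E, gam (p.1 - p.2) = (gamr (p.1 - p.2))%:E}.
Proof.
pose Z := gam @^-1` [set +oo%E].
have mZ : measurable Z.
  by rewrite /Z -[X in measurable X]setTI; apply: (measurable_int _ gam_L1) => //; exact: emeasurable_set1.
have lZ : lam Z = 0%E.
  have [N [mN N0 sN]] := integrable_ae measurableT gam_L1.
  apply/eqP; rewrite eq_le measure_ge0 andbT -N0; apply: le_measure; rewrite ?inE//.
  by move=> x /= Zx; apply: sN => /= /(_ Logic.I); rewrite Zx.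
pose S := [set p : E * E | Z (p.1 - p.2)].
have mS : measurable S.
  by rewrite -[X in measurable X]setTI; apply: measurable_diff.
exists S; split=> //; last first.
  move=> p /= h; rewrite /S /Z /=; apply: contrapT => h'; apply: h; rewrite /gamr.
  by move: (gam_ge0 (p.1 - p.2)) h'; case: (gam _) => //= _ /(_ erefl).
have -> : lam2 S = (\int[lam2]_p (\1_S p)%:E)%E by rewrite integral_indic// setIT.
have mI : measurable_fun setT (fun p : E * E => (\1_S p : R)%:E).
  by apply/measurable_EFinP; exact: measurable_indic.
have I0 (p : E * E) : (0 <= (\1_S p : R)%:E)%E by rewrite lee_fin indicE.
rewrite (tonelli1 mI I0).
apply: integral0_eq => x _.
rewrite (_ : (fun y => _) = fun y => (\1_Z (x - y))%:E); last first.
  by apply/funext => y; rewrite !indicE; congr (_%:R%:E); apply/idP/idP; rewrite !inE.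
rewrite (@ge0_integral_rV_subl R d x (fun y => (\1_Z y)%:E)).
- by rewrite integral_indic// setIT.
- by apply/measurable_EFinP; exact: measurable_indic.
- by move=> y; rewrite lee_fin indicE.
Qed.

Lemma measurable_prod2 (f g : E -> R) : measurable_fun setT f -> measurable_fun setT g ->
  measurable_fun setT (fun p : E * E => f p.1 * g p.2).
Proof.
move=> mf mg; apply: measurable_funM.
- exact: (measurableT_comp mf measurable_fst).
- exact: (measurableT_comp mg measurable_snd).
Qed.

Lemma energyE (f g : E -> R) : measurable_fun setT f -> measurable_fun setT g ->
  energy gam f g = (\int[lam2]_p (f p.1 * g p.2 * gamr (p.1 - p.2))%:E)%E.
Proof.
move=> mf mg; rewrite /energy -integral_prod_sf; apply: ae_eq_integral => //.
- apply: emeasurable_funM; first by apply/measurable_EFinP; exact: measurable_prod2.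
  exact: (measurableT_comp (measurable_int _ gam_L1) measurable_diff).
- apply/measurable_EFinP; apply: measurable_funM; first exact: measurable_prod2.
  exact: (measurableT_comp measurable_gamr measurable_diff).
by apply: filterS ae_gam => p h _; rewrite h -EFinM.
Qed.

Implicit Types (f g h : ST -> R).

Definition st1 (q : ST2) : ST := (q.1, q.2.1).
Definition st2 (q : ST2) : ST := (q.1, q.2.2).
Definition gam3 (q : ST2) : R := gamr (q.2.1 - q.2.2).

Lemma measurable_st1 : measurable_fun setT st1.
Proof.
apply: measurable_fun_pair; first exact: measurable_fst.
exact: (measurableT_comp measurable_fst measurable_snd).
Qed.

Lemma measurable_st2 : measurable_fun setT st2.
Proof.
apply: measurable_fun_pair; first exact: measurable_fst.
exact: (measurableT_comp measurable_snd measurable_snd).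
Qed.

Lemma measurable_gam3 : measurable_fun setT gam3.
Proof. exact: (measurableT_comp (measurableT_comp measurable_gamr measurable_diff) measurable_snd). Qed.

(** With half of the weight on each side, the covariance form is the inner product of [lft f] and
    [rgt g] in L2, from which it inherits bilinearity and continuity. *)
Definition lft (f : ST -> R) (q : ST2) : R := f (st1 q) * Num.sqrt (gam3 q).
Definition rgt (f : ST -> R) (q : ST2) : R := f (st2 q) * Num.sqrt (gam3 q).

Lemma measurable_lft f : measurable_fun setT f -> measurable_fun setT (lft f).
Proof.
move=> mf; apply: measurable_funM; first exact: (measurableT_comp mf measurable_st1).
exact: (measurableT_comp measurable_sqrtr measurable_gam3).
Qed.

Lemma measurable_rgt f : measurable_fun setT f -> measurable_fun setT (rgt f).
Proof.
move=> mf; apply: measurable_funM; first exact: (measurableT_comp mf measurable_st2).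
exact: (measurableT_comp measurable_sqrtr measurable_gam3).
Qed.

Lemma ge0_integral_m3 (F : ST2 -> \bar R) : measurable_fun setT F -> (forall q, 0 <= F q)%E ->
  (\int[m3]_q F q = \int[leb]_s \int[lam]_y \int[lam]_z F (s, (y, z)))%E.
Proof.
move=> mF F0; rewrite (tonelli1 mF F0); apply: eq_integral => s _.
by rewrite (tonelli1 (measurable_pair1 s mF)).
Qed.

Lemma ge0_integral_m3' (F : ST2 -> \bar R) : measurable_fun setT F -> (forall q, 0 <= F q)%E ->
  (\int[m3]_q F q = \int[leb]_s \int[lam]_z \int[lam]_y F (s, (y, z)))%E.
Proof.
move=> mF F0; rewrite (tonelli1 mF F0); apply: eq_integral => s _.
by rewrite (tonelli2 (measurable_pair1 s mF)).
Qed.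

Lemma integral_gamr_subl (y : E) : (\int[lam]_z (gamr (y - z))%:E = kap%:E)%E.
Proof.
rewrite (@ge0_integral_rV_subl R d y (fun z => (gamr z)%:E)) ?integral_gamr//.
by move=> z; rewrite lee_fin gamr_ge0.
Qed.

Lemma integral_gamr_subr (z : E) : (\int[lam]_y (gamr (y - z))%:E = kap%:E)%E.
Proof.
rewrite (@ge0_integral_rV_shift R d (- z) (fun z => (gamr z)%:E)) ?integral_gamr//.
by move=> x; rewrite lee_fin gamr_ge0.
Qed.

Lemma sqn_lft f : measurable_fun setT f -> sqn m3 (lft f) = (kap%:E * sqn mst f)%E.
Proof.
move=> mf; rewrite /sqn ge0_integral_m3; last 2 first.
- by apply: measurable_sq; exact: measurable_lft.
- by move=> q; rewrite lee_fin sqr_ge0.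
have mf2 := measurable_sq mf.
have f20 (p : ST) : (0 <= (f p ^+ 2)%:E)%E by rewrite lee_fin sqr_ge0.
rewrite (tonelli1 mf2 f20).
rewrite -ge0_integralZl_EFin//; last 3 first.
- by move=> s _; apply: integral_ge0 => y _; rewrite lee_fin sqr_ge0.
- exact: (measurable_inner lam mf2 f20).
- exact: kap_ge0.
apply: eq_integral => s _.
rewrite -ge0_integralZl_EFin//; last 2 first.
- by apply: measurable_sq; exact: measurable_pair1.
- exact: kap_ge0.
apply: eq_integral => y _; rewrite muleC -(integral_gamr_subl y) -ge0_integralZl_EFin//; last 3 first.
- by move=> z _; rewrite lee_fin gamr_ge0.
- by apply: (measurableT_comp mgE); apply: measurable_funB_rV.
- exact: sqr_ge0.
by apply: eq_integral => z _; rewrite -EFinM /lft /st1 /gam3 /= exprMn sqr_sqrtr ?gamr_ge0.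
Qed.

Lemma sqn_rgt f : measurable_fun setT f -> sqn m3 (rgt f) = (kap%:E * sqn mst f)%E.
Proof.
move=> mf; rewrite /sqn ge0_integral_m3'; last 2 first.
- by apply: measurable_sq; exact: measurable_rgt.
- by move=> q; rewrite lee_fin sqr_ge0.
have mf2 := measurable_sq mf.
have f20 (p : ST) : (0 <= (f p ^+ 2)%:E)%E by rewrite lee_fin sqr_ge0.
rewrite (tonelli1 mf2 f20).
rewrite -ge0_integralZl_EFin//; last 3 first.
- by move=> s _; apply: integral_ge0 => y _; rewrite lee_fin sqr_ge0.
- exact: (measurable_inner lam mf2 f20).
- exact: kap_ge0.
apply: eq_integral => s _.
rewrite -ge0_integralZl_EFin//; last 2 first.
- by apply: measurable_sq; exact: measurable_pair1.
- exact: kap_ge0.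
apply: eq_integral => z _; rewrite muleC -(integral_gamr_subr z) -ge0_integralZl_EFin//; last 3 first.
- by move=> y _; rewrite lee_fin gamr_ge0.
- by apply: (measurableT_comp mgE); apply: measurable_funB_rV.
- exact: sqr_ge0.
by apply: eq_integral => y _; rewrite -EFinM /rgt /st2 /gam3 /= exprMn sqr_sqrtr ?gamr_ge0.
Qed.

Lemma L2_lft f : L2 mst f -> L2 m3 (lft f).
Proof.
move=> [mf foo]; split; first exact: measurable_lft.
by rewrite sqn_lft//; apply: lte_mul_pinfty => //; rewrite lee_fin kap_ge0.
Qed.

Lemma L2_rgt f : L2 mst f -> L2 m3 (rgt f).
Proof.
move=> [mf foo]; split; first exact: measurable_rgt.
by rewrite sqn_rgt//; apply: lte_mul_pinfty => //; rewrite lee_fin kap_ge0.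
Qed.

Definition nform (f g : ST -> R) : R := ip m3 (lft f) (rgt g).

(* The form on nonnegative functions, possibly infinite. *)
Definition nenergy (f g : ST -> R) : \bar R :=
  (\int[m3]_q (f (st1 q) * g (st2 q) * gam3 q)%:E)%E.

Lemma lft_rgt f g q : lft f q * rgt g q = f (st1 q) * g (st2 q) * gam3 q.
Proof. by rewrite /lft /rgt mulrACA -expr2 sqr_sqrtr// gamr_ge0. Qed.

Lemma measurable_nenergy f g : measurable_fun setT f -> measurable_fun setT g ->
  measurable_fun setT (fun q => f (st1 q) * g (st2 q) * gam3 q).
Proof.
move=> mf mg; apply: measurable_funM; last exact: measurable_gam3.
apply: measurable_funM; first exact: (measurableT_comp mf measurable_st1).
exact: (measurableT_comp mg measurable_st2).
Qed.

Lemma nform_nenergy f g : L2 mst f -> L2 mst g -> nenergy f g = (nform f g)%:E.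
Proof.
move=> Lf Lg; rewrite /nform /ip /Rintegral fineK.
  by apply: eq_integral => q _; rewrite lft_rgt.
by apply: integrable_fin_num => //; apply: L2_int; [exact: L2_lft|exact: L2_rgt].
Qed.

Lemma nform_le f g : L2 mst f -> L2 mst g ->
  `|nform f g| <= kap * Num.sqrt (ip mst f f) * Num.sqrt (ip mst g g).
Proof.
move=> Lf Lg; apply: le_trans (ip_norm_le (L2_lft Lf) (L2_rgt Lg)) _.
have h1 : ip m3 (lft f) (lft f) = kap * ip mst f f.
  apply/EFin_inj; rewrite -(sqn_ip (L2_lft Lf)) sqn_lft; last by case: Lf.
  by rewrite (sqn_ip Lf).
have h2 : ip m3 (rgt g) (rgt g) = kap * ip mst g g.
  apply/EFin_inj; rewrite -(sqn_ip (L2_rgt Lg)) sqn_rgt; last by case: Lg.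
  by rewrite (sqn_ip Lg).
rewrite h1 h2 !sqrtrM ?kap_ge0// mulrACA -expr2 sqr_sqrtr ?kap_ge0//.
by rewrite mulrA.
Qed.

Lemma nform_le_sqn f : L2 mst f -> ((nform f f)%:E <= kap%:E * sqn mst f)%E.
Proof.
move=> Lf; rewrite (sqn_ip Lf) -EFinM lee_fin; apply: le_trans (ler_norm _) _.
apply: le_trans (nform_le Lf Lf) _.
by rewrite -mulrA -expr2 sqr_sqrtr// ip_ge0.
Qed.

Lemma lftD f g : lft (fun p => f p + g p) = fun q => lft f q + lft g q.
Proof. by apply/funext => q; rewrite /lft mulrDl. Qed.
Lemma rgtD f g : rgt (fun p => f p + g p) = fun q => rgt f q + rgt g q.
Proof. by apply/funext => q; rewrite /rgt mulrDl. Qed.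
Lemma lftZ k f : lft (fun p => k * f p) = fun q => k * lft f q.
Proof. by apply/funext => q; rewrite /lft mulrA. Qed.
Lemma rgtZ k f : rgt (fun p => k * f p) = fun q => k * rgt f q.
Proof. by apply/funext => q; rewrite /rgt mulrA. Qed.
Lemma lftB f g : lft (fun p => f p - g p) = fun q => lft f q - lft g q.
Proof. by apply/funext => q; rewrite /lft mulrBl. Qed.
Lemma rgtB f g : rgt (fun p => f p - g p) = fun q => rgt f q - rgt g q.
Proof. by apply/funext => q; rewrite /rgt mulrBl. Qed.

Lemma nformDl f g h : L2 mst f -> L2 mst g -> L2 mst h ->
  nform (fun p => f p + g p) h = nform f h + nform g h.
Proof. by move=> *; rewrite /nform lftD ipDl//; [exact: L2_lft|exact: L2_lft|exact: L2_rgt]. Qed.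
Lemma nformDr f g h : L2 mst f -> L2 mst g -> L2 mst h ->
  nform h (fun p => f p + g p) = nform h f + nform h g.
Proof. by move=> *; rewrite /nform rgtD ipDr//; [exact: L2_rgt|exact: L2_rgt|exact: L2_lft]. Qed.
Lemma nformBl f g h : L2 mst f -> L2 mst g -> L2 mst h ->
  nform (fun p => f p - g p) h = nform f h - nform g h.
Proof. by move=> *; rewrite /nform lftB ipBl//; [exact: L2_lft|exact: L2_lft|exact: L2_rgt]. Qed.
Lemma nformBr f g h : L2 mst f -> L2 mst g -> L2 mst h ->
  nform h (fun p => f p - g p) = nform h f - nform h g.
Proof. by move=> *; rewrite /nform rgtB ipBr//; [exact: L2_rgt|exact: L2_rgt|exact: L2_lft]. Qed.
Lemma nformZl k f g : L2 mst f -> L2 mst g -> nform (fun p => k * f p) g = k * nform f g.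
Proof. by move=> *; rewrite /nform lftZ ipZl//; [exact: L2_lft|exact: L2_rgt]. Qed.
Lemma nformZr k f g : L2 mst f -> L2 mst g -> nform g (fun p => k * f p) = k * nform g f.
Proof. by move=> *; rewrite /nform rgtZ ipZr//; [exact: L2_rgt|exact: L2_lft]. Qed.

Lemma l2cvg_lft (f_ : nat -> ST -> R) f : (forall n, L2 mst (f_ n)) -> L2 mst f -> l2cvg mst f_ f ->
  l2cvg m3 (fun n => lft (f_ n)) (lft f).
Proof.
move=> Lf_ Lf H e e0; have k0 : 0 < kap + 1 by rewrite ltr_wpDl// kap_ge0.
have [N HN] := H _ (divr_gt0 e0 k0); exists N => n /HN Hn.
rewrite -lftB sqn_lft; last by case: (L2B (Lf_ n) Lf).
apply: le_trans (lee_wpmul2l _ Hn) _; first by rewrite lee_fin kap_ge0.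
by rewrite -EFinM lee_fin mulrA ler_pdivrMr// mulrC ler_pM2l//; lra.
Qed.

Lemma l2cvg_rgt (f_ : nat -> ST -> R) f : (forall n, L2 mst (f_ n)) -> L2 mst f -> l2cvg mst f_ f ->
  l2cvg m3 (fun n => rgt (f_ n)) (rgt f).
Proof.
move=> Lf_ Lf H e e0; have k0 : 0 < kap + 1 by rewrite ltr_wpDl// kap_ge0.
have [N HN] := H _ (divr_gt0 e0 k0); exists N => n /HN Hn.
rewrite -rgtB sqn_rgt; last by case: (L2B (Lf_ n) Lf).
apply: le_trans (lee_wpmul2l _ Hn) _; first by rewrite lee_fin kap_ge0.
by rewrite -EFinM lee_fin mulrA ler_pdivrMr// mulrC ler_pM2l//; lra.
Qed.

Lemma l2cvg_nform (f_ g_ : nat -> ST -> R) f g : (forall n, L2 mst (f_ n)) -> (forall n, L2 mst (g_ n)) ->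
  L2 mst f -> L2 mst g -> l2cvg mst f_ f -> l2cvg mst g_ g ->
  nform (f_ n) (g_ n) @[n --> \oo] --> nform f g.
Proof.
move=> Lf_ Lg_ Lf Lg cf cg; apply: l2cvg_ip.
- by move=> n; exact: L2_lft.
- by move=> n; exact: L2_rgt.
- exact: L2_lft.
- exact: L2_rgt.
- exact: l2cvg_lft.
- exact: l2cvg_rgt.
Qed.

(** [noise_form] integrates over nonnegative times and [mst] over all times; [pt] and [tsupp]
    reconcile the two. *)
Definition pt (f : ST -> R) (p : ST) : R := if 0 <= p.1 then f p else 0.

Lemma measurable_pt f : measurable_fun setT f -> measurable_fun setT (pt f).
Proof.
move=> mf; rewrite (_ : pt f = fun p => \1_(`[0, +oo[ `*` setT) p * f p).
  apply: measurable_funM => //; apply: measurable_indic; exact: measurableX.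
apply/funext => -[s y]; rewrite /pt indicE /=; case: ifP => s0.
  by rewrite mem_set ?mul1r//; split => //=; rewrite in_itv/= s0.
by rewrite memNset ?mul0r// => -[/=]; rewrite in_itv/= s0.
Qed.

Definition tsupp (f : ST -> R) := forall p, p.1 < 0 -> f p = 0.

Lemma pt_id f : tsupp f -> pt f = f.
Proof. by move=> h; apply/funext => p; rewrite /pt; case: leP => // /h. Qed.

Let intE (f g : ST -> R) : measurable_fun setT f -> measurable_fun setT g ->
  noise_form gam f g = (\int[leb]_s \int[lam2]_p (pt f (s, p.1) * pt g (s, p.2) * gamr (p.1 - p.2))%:E)%E.
Proof.
move=> mf mg; rewrite /noise_form integral_mkcond; apply: eq_integral => s _.
rewrite patchE; case: ifPn => [|]; rewrite ?notin_setE ?inE /= in_itv/= andbT => s0.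
  rewrite energyE; [|exact: measurable_pair1..].
  by apply: eq_integral => p _; rewrite /pt /= s0.
apply/esym/integral0_eq => p _; rewrite /pt /=; case: ifP => [h|_]; last by rewrite !mul0r.
by case: s0.
Qed.

Lemma noise_formE f g : L2 mst f -> L2 mst g -> tsupp f -> tsupp g ->
  noise_form gam f g = (nform f g)%:E.
Proof.
move=> Lf Lg sf sg; rewrite intE; [|by case: Lf|by case: Lg].
rewrite !pt_id// -(nform_nenergy Lf Lg) /nenergy.
have ig : m3.-integrable setT (fun q => (f (st1 q) * g (st2 q) * gam3 q)%:E).
  have := L2_int (L2_lft Lf) (L2_rgt Lg).
  by under eq_fun do rewrite /= lft_rgt.
by rewrite (fubini_int1 ig).
Qed.

Lemma ge0_noise_formE f g : measurable_fun setT f -> measurable_fun setT g ->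
  (forall p, 0 <= f p) -> (forall p, 0 <= g p) ->
  noise_form gam f g = nenergy (pt f) (pt g).
Proof.
move=> mf mg f0 g0; rewrite intE// /nenergy.
have p0 (h : ST -> R) : (forall p, 0 <= h p) -> forall p, 0 <= pt h p.
  by move=> h0 p; rewrite /pt; case: ifP.
rewrite tonelli1//.
- by apply/measurable_EFinP; apply: measurable_nenergy; exact: measurable_pt.
- by move=> q; rewrite lee_fin !mulr_ge0 ?p0// gamr_ge0.
Qed.

Lemma le_nenergy f g f' g' : measurable_fun setT f -> measurable_fun setT g ->
  measurable_fun setT f' -> measurable_fun setT g' ->
  (forall p, 0 <= f p <= f' p) -> (forall p, 0 <= g p <= g' p) -> (nenergy f g <= nenergy f' g')%E.
Proof.
move=> mf mg mf' mg' ff gg; apply: ge0_le_integral => //.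
- move=> q _; have /andP[f0 _] := ff (st1 q); have /andP[g0 _] := gg (st2 q).
  by rewrite lee_fin !mulr_ge0// gamr_ge0.
- by apply/measurable_EFinP; exact: measurable_nenergy.
- by apply/measurable_EFinP; exact: measurable_nenergy.
- move=> q _; have /andP[f0 f1] := ff (st1 q); have /andP[g0 g1] := gg (st2 q).
  by rewrite lee_fin ler_wpM2r ?gamr_ge0// ler_pM.
Qed.

End noise_form.

Lemma cvg_maxr {R : realType} {X : Type} (F : set_system X) {FF : Filter F} (f g : X -> R) a b :
  f @ F --> a -> g @ F --> b -> (fun x => Num.max (f x) (g x)) @ F --> Num.max a b.
Proof.
move=> fa gb; rewrite (_ : (fun x => _) = fun x => (f x + g x + `|f x - g x|) / 2); last first.
  by apply/funext => x; rewrite maxr_absE.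
rewrite maxr_absE; apply: cvgM; last exact: cvg_cst.
by apply: cvgD; [exact: cvgD|apply: cvg_norm; exact: cvgB].
Qed.

Lemma cvg_minr {R : realType} {X : Type} (F : set_system X) {FF : Filter F} (f g : X -> R) a b :
  f @ F --> a -> g @ F --> b -> (fun x => Num.min (f x) (g x)) @ F --> Num.min a b.
Proof.
move=> fa gb; rewrite (_ : (fun x => _) = fun x => (f x + g x - `|f x - g x|) / 2); last first.
  by apply/funext => x; rewrite minr_absE.
rewrite minr_absE; apply: cvgM; last exact: cvg_cst.
by apply: cvgB; [exact: cvgD|apply: cvg_norm; exact: cvgB].
Qed.

(** * Measurability of continuous functions on space-time *)

Section continuous_measurable.
Context {R : realType} {d : nat}.
Local Notation E := 'rV[R]_d.
Local Notation ST := (measurableTypeR R * E)%type.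

Lemma rV_norm_le (x : E) (k : R) : 0 <= k -> (`|x| <= k) = [forall i, `|x ord0 i| <= k].
Proof.
move=> k0; rewrite [`|x|]mx_normrE; apply/idP/forallP => [h i|h].
  apply: le_trans h; exact: (le_bigmax _ (fun ij : 'I_1 * 'I_d => `|x ij.1 ij.2|) (ord0, i)).
by apply: bigmax_le => // -[i j] _ /=; rewrite ord1.
Qed.

Lemma st_norm_le (p : R * E) (k : R) : (`|p| <= k) = (`|p.1| <= k) && (`|p.2| <= k).
Proof. by rewrite prod_normE ge_max. Qed.

Definition grid_index (n : nat) (p : R * E) : int * {ffun 'I_d -> int} :=
  (Num.floor (n.+1%:R * p.1), [ffun i => Num.floor (n.+1%:R * p.2 ord0 i)]).

Definition grid_point (n : nat) (k : int * {ffun 'I_d -> int}) : R * E :=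
  (k.1%:~R / n.+1%:R, \row_i ((k.2 i)%:~R / n.+1%:R)).

Lemma measurable_grid n k : measurable [set p : ST | grid_index n p = k].
Proof.
have mf (r0 : int) : measurable [set r : R | Num.floor (n.+1%:R * r) = r0].
  rewrite (_ : [set r | _] = (fun r : R => n.+1%:R * r) @^-1` `[r0%:~R, (r0 + 1)%:~R[).
    rewrite -[X in measurable X]setTI; have : measurable_fun setT (fun r : R => n.+1%:R * r).
      exact: measurable_funM.
    by apply.
  apply/seteqP; split => r /=; rewrite in_itv /= -floor_eq; first by move=> ->; rewrite eqxx.
  by move/eqP.
rewrite (_ : [set p | _] = ([set r : R | Num.floor (n.+1%:R * r) = k.1] `*` setT) `&`
   \bigcap_(i in [set: 'I_d]) ((fun p : ST => p.2 ord0 i) @^-1` [set r : R | Num.floor (n.+1%:R * r) = k.2 i])).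
  apply: measurableI; first by apply: measurableX => //; exact: mf.
  apply: fin_bigcap_measurable => [|i _]; first exact: finite_finset.
  rewrite -[X in measurable X]setTI.
  have m2 : measurable_fun setT (fun p : ST => p.2 ord0 i).
    by apply: (measurableT_comp (measurable_rV_coord i)); exact: measurable_snd.
  by apply: m2 => //; exact: mf.
apply/seteqP; split => [p /= <-|p /= [[h _] h2]].
  by split=> //= i _ /=; rewrite ffunE.
case: k h h2 => k1 k2 /= h h2; rewrite /grid_index h; congr pair.
by apply/ffunP => i; rewrite ffunE; exact: h2.
Qed.

Lemma grid_dist n p : `|grid_point n (grid_index n p) - p| <= n.+1%:R^-1.
Proof.
have n0 : (0 : R) < n.+1%:R by [].
have h (r : R) : `|(Num.floor (n.+1%:R * r))%:~R / n.+1%:R - r| <= n.+1%:R^-1.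
  have := floor_itv (n.+1%:R * r); set k := Num.floor _; rewrite intrD => /andP[h1 h2].
  have -> : k%:~R / n.+1%:R - r = n.+1%:R^-1 * (k%:~R - n.+1%:R * r).
    by rewrite mulrBr mulrA mulVf ?mul1r ?pnatr_eq0// mulrC.
  rewrite normrM gtr0_norm ?invr_gt0// ler_piMr ?invr_ge0//.
  by rewrite ler_norml; move: h1 h2; rewrite -[1%:~R]/1; move: (n.+1%:R * r) (k%:~R : R) => a b; lra.
rewrite st_norm_le /= h /= rV_norm_le ?invr_ge0//; apply/forallP => i.
by rewrite !mxE ffunE.
Qed.

(** The sigma-algebra is generated by coordinates, not by open sets. The function is the pointwise
    limit of its values on grids of mesh [1 / (n+1)], which are constant on countably many
    measurable cells. *)
Lemma continuous_measurable_st (f : R * E -> R) : continuous f -> measurable_fun setT (f : ST -> R).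
Proof.
move=> cf; apply: (measurable_fun_cvg (h := fun n p => f (grid_point n (grid_index n p)))) => [n|p _].
  move=> _ B mB; rewrite setTI.
  rewrite (_ : _ @^-1` _ = \bigcup_k ([set p : ST | grid_index n p = k] `&` [set p : ST | B (f (grid_point n k))])).
    apply: countable_bigcupT_measurable; first exact: countableP.
    move=> k; apply: measurableI; first exact: measurable_grid.
    have [Bk|nBk] := pselect (B (f (grid_point n k))).
      by rewrite (_ : [set p | _] = setT)//; apply/seteqP; split.
    by rewrite (_ : [set p | _] = set0)//; apply/seteqP; split.
  apply/seteqP; split => [p /= Bp|p [k _ [/= -> Bk]]//].
  by exists (grid_index n p).
apply: (continuous_cvg _ (cf p)); apply/cvgrPdist_le => e e0.
have /cvgrPdist_le/(_ _ e0)[N _ HN] := @cvg_harmonic R.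
exists N => // n /HN /=; rewrite sub0r normrN ger0_norm ?invr_ge0// => h.
by rewrite distrC; apply: le_trans (grid_dist n p) h.
Qed.

End continuous_measurable.

(** * Test functions are square integrable *)

Section Cc_L2.
Context {R : realType} {d : nat}.
Local Notation E := 'rV[R]_d.
Local Notation leb := (@lebesgue_measure R).
Local Notation lam := (@lebesgue_rV R d).
Local Notation ST := (measurableTypeR R * E)%type.
Local Notation mst := (prod_sf leb lam).
Implicit Types (f g : R * E -> R).

Definition cube n (k : R) : set 'rV[R]_n := [set x | forall i, `|x ord0 i| <= k].

Arguments cube : clear implicits.

Lemma measurable_cube n k : measurable (cube n k).
Proof.
rewrite (_ : cube n k = \bigcap_(i in [set: 'I_n]) (rV_coord i @^-1` `[- k, k])).
  apply: fin_bigcap_measurable => [|i _]; first exact: finite_finset.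
  by rewrite -[X in measurable X]setTI; exact: measurable_rV_coord.
apply/seteqP; split => x /= h i; first by rewrite /= in_itv/= -ler_norml; move=> _; exact: h.
by have := h i Logic.I; rewrite /= in_itv/= -ler_norml.
Qed.

Lemma leb_itv_fin (a b : R) : leb `[a, b]%classic \is a fin_num.
Proof. by rewrite lebesgue_measure_itv/=; case: ifP. Qed.

Lemma cube_lty n k : (lebesgue_rV n (cube n k) < +oo)%E.
Proof.
elim: n => [|n IH]; first by rewrite /= diracE ltry.
have c2 : (lebesgue_rV n.+1 (cube n.+1 k) <= (leb \x lebesgue_rV n)%E (`[(- k)%R, k]%classic `*` cube n k))%E.
  rewrite [leLHS](_ : _ = (leb \x lebesgue_rV n)%E (@rV_cons R n @^-1` cube n.+1 k))//.
  apply: le_measure; rewrite ?inE.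
  - by rewrite -[X in measurable X]setTI; apply: measurable_rV_cons => //; exact: measurable_cube.
  - by apply: measurableX => //; exact: measurable_cube.
  move=> [a x] /= h; split => /=.
    have := h ord0; rewrite in_itv/= -ler_norml.
    by have /(congr1 fst) /= -> := rV_consK (a, x).
  move=> i; have hi := h (rshift 1 i).
  have /(congr1 snd) /= <- := rV_consK (a, x).
  by rewrite mxE; exact: hi.
apply: le_lt_trans c2 _; rewrite product_measure1E//; last exact: measurable_cube.
by apply: lte_mul_pinfty => //; exact: leb_itv_fin.
Qed.

Definition box (k : R) : set ST := [set p | `|p| <= k].

Lemma boxE k : 0 <= k -> box k = `[- k, k]%classic `*` cube d k.
Proof.
move=> k0; apply/seteqP; split => -[s y]; rewrite /box /cube /= st_norm_le /= in_itv/= -ler_norml.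
  by move=> /andP[-> +]; rewrite rV_norm_le// => /forallP.
by move=> [-> h]; rewrite rV_norm_le//=; apply/forallP.
Qed.

Lemma measurable_box k : measurable (box k).
Proof.
have [k0|k0] := leP 0 k; first by rewrite boxE//; apply: measurableX => //; exact: measurable_cube.
rewrite (_ : box k = set0)//; apply/seteqP; split => // p /= h.
by have := le_lt_trans h k0; rewrite ltNge normr_ge0.
Qed.

Lemma box_lty k : (mst (box k) < +oo)%E.
Proof.
have [k0|k0] := leP 0 k.
  rewrite boxE// /= /prod_measure product_measure1E//; last exact: measurable_cube.
  by apply: lte_mul_pinfty => //; [exact: leb_itv_fin|exact: cube_lty].
rewrite (_ : box k = set0) ?measure0//; apply/seteqP; split => // p /= h.
by have := le_lt_trans h k0; rewrite ltNge normr_ge0.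
Qed.

Definition bbs (f : ST -> R) := [/\ measurable_fun setT f, bdd f & exists k, forall p, k < `|p| -> f p = 0].

Lemma bbs_L2 f : bbs f -> L2 mst f.
Proof.
move=> [mf [M fM] [k fk]]; split=> //.
apply: (@le_lt_trans _ _ (\int[mst]_p ((M ^+ 2)%:E * (\1_(box k) p)%:E)))%E.
  apply: ge0_le_integral => //.
  - by move=> p _; rewrite lee_fin sqr_ge0.
  - exact: measurable_sq.
  - by apply: measurable_funeM; apply/measurable_EFinP; apply: measurable_indic; exact: measurable_box.
  move=> p _; rewrite -EFinM lee_fin indicE; have [h|h] := leP `|p| k.
    rewrite mem_set// mulr1 -[leLHS]real_normK ?num_real//.
    by rewrite lerXn2r ?nnegrE// ?(le_trans _ (fM p)).
  by rewrite fk// expr0n/= mulr_ge0// sqr_ge0.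
have mI : measurable_fun setT (fun p : ST => (\1_(box k) p : R)%:E).
  by apply/measurable_EFinP; apply: measurable_indic; exact: measurable_box.
have I0 (p : ST) : setT p -> (0 <= (\1_(box k) p : R)%:E)%E by rewrite lee_fin indicE.
rewrite (ge0_integralZl_EFin mst measurableT I0 mI (sqr_ge0 M)).
rewrite integral_indic ?setIT//; last exact: measurable_box.
by apply: lte_mul_pinfty; [rewrite lee_fin sqr_ge0|by []|exact: box_lty].
Qed.

Lemma Cc_tsupp f : Cc_spacetime f -> tsupp (f : ST -> R).
Proof.
move=> [_ [K [_ K0 fK]]] p p0; apply: fK => /K0 /=.
by rewrite leNgt p0.
Qed.

Lemma Cc_bbs f : Cc_spacetime f -> bbs f.
Proof.
move=> Cf; have ts := Cc_tsupp Cf; case: Cf => cf [K [cK K0 fK]]; split.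
(* A test function may jump at time 0, being continuous within the half-space only. Extended by its
   value at time 0 it is continuous, and [f] is this extension cut to nonnegative times. *)
- pose g (p : R * E) := f (Num.max p.1 0, p.2).
  have cg : continuous g.
    move=> p; have cm : {for p, continuous (fun p : R * E => (Num.max p.1 0, p.2) : R * E)}.
      apply/cvgrPdist_le => e e0; have /cvgrPdist_le/(_ _ e0) := @cvg_id _ (nbhs p).
      apply: filterS => p' h; apply: le_trans h; rewrite st_norm_le /=.
      have := lexx `|p - p'|; rewrite (st_norm_le (p - p')) /= => /andP[h1 ->].
      rewrite andbT; apply: le_trans h1.
      rewrite /Num.max; do 2 case: ifP; rewrite ?subrr ?normr0//= => a1 a2.
      - by rewrite sub0r normrN ler_norml; have := ler_norm (p'.1 - p.1); rewrite distrC; lra.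
      - by rewrite subr0 ler_norml; have := ler_norm (p.1 - p'.1); lra.
    have Ap (p' : R * E) : [set p : R * E | 0 <= p.1] (Num.max p'.1 0, p'.2).
      by rewrite /= le_max lexx orbT.
    have /subspace_continuousP/(_ _ (Ap p)) cfp := cf.
    move=> U hU; have h : nbhs (Num.max p.1 0, p.2) (fun p' : R * E => 0 <= p'.1 -> U (f p')) := cfp U hU.
    have h' : nbhs p (fun p' : R * E => 0 <= Num.max p'.1 0 -> U (g p')) := cm _ h.
    by apply: filterS h' => p' /(_ (Ap p')).
  have -> : f = fun p => \1_(`[0, +oo[ `*` setT) p * g p.
    apply/funext => -[s y]; rewrite indicE /g /=; have [s0|s0] := leP 0 s.
      by rewrite mem_set ?mul1r ?max_l//; split => //=; rewrite in_itv/= s0.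
    by rewrite memNset ?mul0r ?ts// => -[/=]; rewrite in_itv/= leNgt s0.
  apply: measurable_funM; last exact: (continuous_measurable_st cg).
  by apply: measurable_indic; exact: measurableX.
- have [M Mr] : bounded_set (f @` K).
    apply: compact_bounded; apply: continuous_compact cK.
    exact: continuous_subspaceW K0 cf.
  exists (`|M| + 1) => p; have M1 : M < `|M| + 1 by rewrite ltr_pwDr// ler_norm.
  have [Kp|nKp] := pselect (K p); first by apply: (Mr.2 _ M1); exists p.
  by rewrite fK// normr0 addr_ge0.
- have [M Mr] := compact_bounded cK; exists (M + 1) => p hp; apply: fK => Kp.
  have := Mr.2 (M + 1) _ p Kp; rewrite ltrDl ltr01 => /(_ isT) h.
  by have := lt_le_trans hp h; rewrite ltxx.
Qed.

End Cc_L2.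

(** * Operations on test functions *)

Section Cc_algebra.
Context {R : realType} {d : nat}.
Local Notation E := 'rV[R]_d.
Local Notation leb := (@lebesgue_measure R).
Local Notation lam := (@lebesgue_rV R d).
Local Notation ST := (measurableTypeR R * E)%type.
Local Notation mst := (prod_sf leb lam).
Implicit Types (f g : R * E -> R).

Lemma Cc_op2 (op : R -> R -> R) f g : op 0 0 = 0 ->
  (forall (F : set_system (R * E)) (FF : Filter F) (a b : R), f @ F --> a -> g @ F --> b ->
     (fun p => op (f p) (g p)) @ F --> op a b) ->
  Cc_spacetime f -> Cc_spacetime g -> Cc_spacetime (fun p => op (f p) (g p)).
Proof.
move=> op0 cop [cf [K [cK K0 fK]]] [cg [K' [cK' K0' gK]]]; split.
  apply/subspace_continuousP => p Ap.
  move/subspace_continuousP : cf => /(_ p Ap) cf; move/subspace_continuousP : cg => /(_ p Ap) cg.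
  exact: (cop _ _ _ _ cf cg).
exists (K `|` K'); split; first exact: compactU.
  by move=> p [/K0|/K0'].
by move=> p nK; rewrite fK ?gK ?op0// => h; apply: nK; [right|left].
Qed.

Lemma CcD f g : Cc_spacetime f -> Cc_spacetime g -> Cc_spacetime (fun p => f p + g p).
Proof. by apply: (@Cc_op2 +%R); rewrite ?addr0// => F FF a b; exact: cvgD. Qed.

Lemma CcM f g : Cc_spacetime f -> Cc_spacetime g -> Cc_spacetime (fun p => f p * g p).
Proof. by apply: (@Cc_op2 *%R); rewrite ?mulr0// => F FF a b; exact: cvgM. Qed.

Lemma CcZ (k : R) f : Cc_spacetime f -> Cc_spacetime (fun p => k * f p).
Proof.
move=> Cf; apply: (@Cc_op2 (fun a _ => k * a) f f _ _ Cf Cf); rewrite ?mulr0// => F FF a b fa _.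
by apply: cvgM => //; exact: cvg_cst.
Qed.

Lemma compact_tbox (k : R) : compact [set p : R * E | 0 <= p.1 /\ `|p| <= k].
Proof.
have [k0|k0] := leP 0 k; last first.
  rewrite (_ : [set _ | _] = set0); first exact: compact0.
  by apply/seteqP; split => // p [_ h]; have := le_lt_trans h k0; rewrite ltNge normr_ge0.
rewrite (_ : [set _ | _] = `[0, k]%classic `*` [set v : E | forall i, `[- k, k]%classic (v ord0 i)]).
  apply: compact_setX; first exact: segment_compact.
  by apply: (@rV_compact R d (fun=> `[- k, k]%classic)) => _; exact: segment_compact.
apply/seteqP; split => -[s y] /=.
  rewrite st_norm_le /= rV_norm_le// in_itv/= => -[s0 /andP[h1 /forallP h2]]; split.
    by rewrite s0 (le_trans (ler_norm _) h1).
  by move=> i; rewrite in_itv/= -ler_norml.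
rewrite in_itv/= => -[/andP[s0 sk] h]; split=> //; rewrite st_norm_le /= ger0_norm// sk /=.
by rewrite rV_norm_le//; apply/forallP => i; have := h i; rewrite in_itv/= -ler_norml.
Qed.

Lemma Cc_pt (g : R * E -> R) (n : R) : continuous g -> (forall p, n <= `|p| -> g p = 0) ->
  Cc_spacetime (pt (g : ST -> R)).
Proof.
move=> cg gn; split.
  apply: (@subspace_eq_continuous _ _ _ g); last exact: continuous_subspaceT.
  have gE (q : ST) : 0 <= q.1 -> g q = pt (g : ST -> R) q by rewrite /pt => ->.
  by move=> p /set_mem; exact: gE.
exists [set p : R * E | 0 <= p.1 /\ `|p| <= n]; split; first exact: compact_tbox.
  by move=> p [].
move=> p h; rewrite /pt; case: ifP => // p0; apply: gn.
by rewrite leNgt; apply/negP => pn; apply: h; split => //; exact: ltW.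
Qed.

End Cc_algebra.

Section restriction.
Context {d0 : measure_display} {X : measurableType d0} {R : realType}.
Variables (m : {measure set X -> \bar R}) (D : set X).
Hypotheses (mD : measurable D) (Doo : (m D < +oo)%E).

(** The closure theory requires a finite measure, while [mst] is sigma-finite; it is applied on
    bounded sets. *)
Definition mres : {finite_measure set X -> \bar R} := mfrestr mD Doo.

Lemma ge0_integral_mres (f : X -> \bar R) : measurable_fun setT f -> (forall p, 0 <= f p)%E ->
  (\int[mres]_p f p = \int[m]_(p in D) f p)%E.
Proof.
move=> mf f0; have mC := measurableC mD.
have n0 : mres (~` D) = 0%E by rewrite /= /mfrestr /mrestr setICl measure0.
have := @ge0_negligible_integral _ X R mres setT (~` D) f mC measurableT mf (fun p _ => f0 p) n0 => ->.
rewrite setTD setCK; apply: eq_measure_integral => A mA An.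
by rewrite /= /mfrestr /mrestr setIidl.
Qed.

Lemma sqn_mres (f : X -> R) : measurable_fun setT f -> sqn mres f = sqn m (fun p => \1_D p * f p).
Proof.
move=> mf; rewrite /sqn ge0_integral_mres; last 2 first.
- exact: measurable_sq.
- by move=> p; rewrite lee_fin sqr_ge0.
rewrite [LHS]integral_mkcond; apply: eq_integral => p _; rewrite patchE indicE.
by case: ifP => _; rewrite ?mul1r ?mul0r ?expr0n.
Qed.

Lemma L2cl_mres_eq A (f g : X -> R) : is_alg A -> L2cl mres A f -> measurable_fun setT g ->
  (forall p, D p -> f p = g p) -> L2cl mres A g.
Proof.
move=> alg [mf hf] mg fg; split=> // e e0; have [h Ah hh] := hf e e0; exists h => //.
have mh := alg_meas alg Ah.
move: hh; rewrite !sqn_mres; [|exact: measurable_funB..].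
apply: le_trans; rewrite le_eqVlt; apply/orP; left; apply/eqP; apply: eq_integral => p _.
rewrite indicE; have [hp|hp] := boolP (p \in D); last by rewrite !mul0r.
by rewrite fg//; move: hp; rewrite inE.
Qed.

End restriction.

(** * Density of the test functions in L2 *)

Section Cc_dense.
Context {R : realType} {d : nat}.
Local Notation E := 'rV[R]_d.
Local Notation leb := (@lebesgue_measure R).
Local Notation lam := (@lebesgue_rV R d).
Local Notation ST := (measurableTypeR R * E)%type.
Local Notation mst := (prod_sf leb lam).

Definition tbox (n : nat) : set ST := [set p | 0 <= p.1 /\ `|p| < n%:R].

Lemma measurable_st_norm : measurable_fun setT (fun p : ST => `|p : R * E|).
Proof. by apply: continuous_measurable_st; exact: norm_continuous. Qed.

Lemma measurable_tbox n : measurable (tbox n).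
Proof.
rewrite (_ : tbox n = (fst @^-1` `[0, +oo[) `&` ((fun p : ST => `|p : R * E|) @^-1` `]-oo, n%:R[)).
  apply: measurableI; rewrite -[X in measurable X]setTI.
    by apply: measurable_fst.
  exact: measurable_st_norm.
by apply/seteqP; split => p; rewrite /tbox /= !in_itv/= andbT => -[].
Qed.

Lemma tbox_lty n : (mst (tbox n) < +oo)%E.
Proof.
apply: le_lt_trans (box_lty (R := R) (d := d) n%:R); apply: le_measure; rewrite ?inE.
- exact: measurable_tbox.
- exact: measurable_box.
- by move=> p [_ /ltW].
Qed.

Definition mbox n : {finite_measure set ST -> \bar R} := mres (measurable_tbox n) (tbox_lty n).

Definition Cc_box n : set (ST -> R) := [set f | Cc_spacetime f /\ forall p, f p != 0 -> `|p| < n%:R].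

Lemma Cc_box_alg n : is_alg (Cc_box n).
Proof.
have z (f : ST -> R) p : (forall p, f p != 0 -> `|p| < n%:R) -> ~~ (`|p| < n%:R) -> f p = 0.
  by move=> h hp; apply/eqP; apply: contraNT hp => /h.
split.
- by move=> f [/Cc_bbs[]].
- by move=> f [/Cc_bbs[]].
- move=> f g [Cf hf] [Cg hg]; split; first exact: CcD.
  by move=> p; apply: contraNT => hp; rewrite (z f)// (z g)// addr0.
- move=> k f [Cf hf]; split; first exact: CcZ.
  by move=> p; apply: contraNT => hp; rewrite (z f)// mulr0.
- move=> f g [Cf hf] [Cg hg]; split; first exact: CcM.
  by move=> p; apply: contraNT => hp; rewrite (z f)// mul0r.
Qed.

Definition cutoff n (k : nat) (p : ST) : R := Num.min 1 (k%:R * Num.max 0 (n%:R - `|p : R * E|)).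

Lemma cutoff_ge0 n k p : 0 <= cutoff n k p.
Proof. by rewrite le_min ler01 mulr_ge0// le_max lexx. Qed.

Lemma continuous_cutoff n k : continuous (cutoff n k : R * E -> R).
Proof.
move=> p; apply: cvg_minr; first exact: cvg_cst.
apply: cvgM; first exact: cvg_cst.
apply: cvg_maxr; first exact: cvg_cst.
by apply: cvgB; [exact: cvg_cst|exact: norm_continuous].
Qed.

(** The cutoffs increase to the indicator of the open ball; multiplied by [c] and cut to nonnegative
    times they give test functions, dominated by a constant. *)
Lemma L2cl_continuous n (c : R * E -> R) M : continuous c ->
  (forall p, `|p| < n%:R -> `|c p| <= M) -> L2cl (mbox n) (Cc_box n) (c : ST -> R).
Proof.
move=> cc cM; have mc := continuous_measurable_st cc.
have z p k : n%:R <= `|p : R * E| -> c p * cutoff n k p = 0.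
  move=> hp; rewrite /cutoff max_l ?mulr0 ?min_r ?mulr0//.
  by rewrite subr_le0.
apply: (@L2cl_mres_eq _ _ _ _ _ (measurable_tbox n) (tbox_lty n) _ (fun p => \1_(tbox n) p * c p) _ (Cc_box_alg n)) => //; last first.
  by move=> p hp; rewrite indicE mem_set// mul1r.
apply: (@L2cl_dct _ _ _ (mbox n) _ (Cc_box_alg n) (fun k => pt (fun p => c p * cutoff n k p)) _ `|M|).
- move=> k; apply: (sub_L2cl _ (Cc_box_alg n)); split.
    apply: (@Cc_pt _ _ _ n%:R); last by move=> p; exact: z.
    by move=> p; apply: cvgM; [exact: cc|exact: continuous_cutoff].
  move=> p; apply: contraNT; rewrite -leNgt => /z h.
  by rewrite /pt; case: ifP => // _; rewrite h.
- move=> k p; rewrite /pt; case: ifP => _; last by rewrite normr0.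
  have [hp|hp] := ltP `|p : R * E| n%:R; last by rewrite z// normr0.
  rewrite normrM (ger0_norm (cutoff_ge0 _ _ _)).
  apply: le_trans (ler_norm _); rewrite -[leRHS]mulr1 ler_pM ?cutoff_ge0//; first exact: cM.
  by rewrite ge_min lexx.
move=> p; rewrite indicE; have [hp|hp] := pselect (tbox n p).
  rewrite mem_set// mul1r; case: hp => p0 hp; rewrite /pt p0.
  have q0 : 0 < n%:R - `|p : R * E| by rewrite subr_gt0.
  apply: (@cvg_eventually _ _ _ (Num.bound (n%:R - `|p : R * E|)^-1)) => k hk.
  rewrite /cutoff (max_r (ltW q0)) min_l ?mulr1//.
  rewrite -ler_pdivrMr// mul1r; apply: le_trans (ltW (archi_boundP _)) _; first by rewrite invr_ge0 ltW.
  by rewrite ler_nat.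
rewrite memNset// mul0r; apply: (@cvg_eventually _ _ _ 0) => k _.
rewrite /pt; case: ifP => // p0; rewrite z//.
by rewrite leNgt; apply/negP => h; apply: hp.
Qed.

Lemma L2cl_mbox1 n : L2cl (mbox n) (Cc_box n) (cst 1).
Proof. by apply: (@L2cl_continuous n (cst 1) 1) => [|p _]; [exact: cst_continuous|rewrite normr1]. Qed.

(** The coordinates are continuous and bounded on the box, hence in the closure of the test
    functions, and their level sets generate the sigma-algebra. *)
Lemma Sig_mbox n (S : set ST) : measurable S -> Sig (mbox n) (Cc_box n) S.
Proof.
have A := Cc_box_alg n; have A1 := L2cl_mbox1 n.
have n0 : (0 : R) <= n%:R by [].
have h1 (B : set R) : measurable B -> Sig (mbox n) (Cc_box n) (fst @^-1` B).
  apply: (Sig_L2cl A A1); apply: (@L2cl_continuous n (fst : R * E -> R) n%:R) => [p|p /ltW].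
    exact: cvg_fst.
  by rewrite st_norm_le => /andP[].
have h2 i (B : set R) : measurable B -> Sig (mbox n) (Cc_box n) ((fun p : ST => p.2 ord0 i) @^-1` B).
  apply: (Sig_L2cl A A1); apply: (@L2cl_continuous n (fun p : R * E => p.2 ord0 i) n%:R) => [p|p /ltW].
    apply: (@continuous_comp (R * E)%type E R snd (fun x => x ord0 i)); first exact: cvg_snd.
    exact: coord_continuous.
  by rewrite st_norm_le => /andP[_]; rewrite rV_norm_le// => /forallP.
have h3 (B : set E) : measurable B -> Sig (mbox n) (Cc_box n) (snd @^-1` B).
  move: B; apply: smallest_sub.
    split=> [|S' hS|F hF].
    - by rewrite /= preimage_set0; exact: (Sig0 A A1).
    - by rewrite setTD /= preimage_setC; exact: (SigC A A1).
    - by rewrite /= preimage_bigcup; exact: (Sig_bigcup A A1 hF).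
  rewrite -bigcup_seq; apply: bigcup_sub => i _ _ [B mB <-] /=.
  by rewrite setTI; exact: h2.
rewrite measurable_prod_measurableType => mS; move: S mS; apply: (Sig_sub_sigma A A1).
move=> _ [B mB [C mC <-]].
have -> : B `*` C = (fst @^-1` B) `&` (snd @^-1` C) by [].
by apply: (SigI A); [exact: h1|exact: h3].
Qed.

Lemma Cc_dense (f : ST -> R) (e : R) : L2 mst f -> tsupp f -> 0 < e ->
  exists2 phi, Cc_spacetime phi & (sqn mst (fun p => f p - phi p)%R <= e%:E)%E.
Proof.
move=> Lf sf e0; have [mf foo] := Lf; have e4 : 0 < e / 4 by rewrite divr_gt0.
have mI n : measurable_fun setT (fun p => \1_(tbox n) p * f p).
  by apply: measurable_funM => //; apply: measurable_indic; exact: measurable_tbox.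
have [|||||N HN] := @sqn_cvg0 _ _ _ mst (fun n p => f p - \1_(tbox n) p * f p) f _ _ _ _ _ _ e4.
- by move=> n; exact: measurable_funB.
- by [].
- by [].
- by move=> n p; rewrite indicE; case: (_ \in _); rewrite ?mul1r ?subrr ?normr0// mul0r subr0.
- move=> p; have [p0|p0] := ltP p.1 0.
    by apply: (@cvg_eventually _ _ _ 0) => n _; rewrite sf// mulr0 subrr.
  apply: (@cvg_eventually _ _ _ (Num.bound `|p : R * E|)) => n hn.
  rewrite indicE mem_set ?mul1r ?subrr//; split=> //.
  apply: lt_le_trans (archi_boundP (normr_ge0 _)) _; first by rewrite ler_nat.
have hf : L2cl (mbox N) (Cc_box N) f.
  apply: (L2cl_of_Sig (Cc_box_alg N) (L2cl_mbox1 N)) => [B mB|].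
    by apply: Sig_mbox; rewrite -[X in measurable X]setTI; exact: mf.
  rewrite sqn_mres//; apply: le_lt_trans foo; apply: le_sqn => // p.
  by rewrite indicE; case: (_ \in _); rewrite ?mul1r// mul0r normr0.
have [phi [Cphi hphi] fphi] := hf.2 _ e4; exists phi => //.
have [mphi _ _] := Cc_bbs Cphi.
apply: le_trans (sqnB _ mf (mI N) mphi) _.
have h2 : (sqn mst (fun p => \1_(tbox N) p * f p - phi p)%R <= (e / 4)%:E)%E.
  move: fphi; rewrite sqn_mres; last exact: measurable_funB.
  apply: le_trans; rewrite le_eqVlt; apply/orP; left; apply/eqP; apply: eq_integral => p _.
  rewrite indicE; have [hp|hp] := boolP (p \in tbox N); first by rewrite !mul1r.
  rewrite !mul0r sub0r sqrrN (_ : phi p = 0)//; apply/eqP; apply: contraNT hp => pp.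
  rewrite inE; split; last exact: hphi.
  by rewrite leNgt; apply/negP => h; move: pp; rewrite (Cc_tsupp Cphi)// eqxx.
apply: le_trans (leeD (lee_wpmul2l _ (HN N (leqnn N))) (lee_wpmul2l _ h2)) _ => //.
by rewrite -!EFinM -EFinD lee_fin; lra.
Qed.

End Cc_dense.

(** * The isonormal family and spatial shifts *)

Section positive.
Context {R : realType} {d : nat} {disp : measure_display} {T : measurableType disp}.
Variable P : probability T R.
Local Notation E := 'rV[R]_d.
Local Notation leb := (@lebesgue_measure R).
Local Notation lam := (@lebesgue_rV R d).
Local Notation ST := (measurableTypeR R * E)%type.
Local Notation mst := (prod_sf leb lam).
Variable gam : E -> \bar R.
Hypothesis gam_ge0 : forall x, (0 <= gam x)%E.
Hypothesis gam_L1 : lam.-integrable setT gam.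
Variable W : hilbert gam -> T -> R.
Hypothesis hW : isonormal P W.
Local Notation nform := (nform gam).
Local Notation nfE := (noise_formE gam_ge0 gam_L1).
Implicit Types f g : ST -> R.

Lemma isonormal_gaussian : gaussian_family P W.
Proof. by case: hW. Qed.

Lemma qcov_hdot h h' : (qcov P W h h')%:E = hdot h h'.
Proof.
case: hW => _ _ <-; rewrite unlock /qcov /ip /Rintegral fineK//.
by apply: integrable_fin_num => //; apply: L2_int; exact: (L2_W isonormal_gaussian).
Qed.

Lemma Cc_L2 phi : Cc_spacetime phi -> L2 mst (phi : ST -> R).
Proof. by move=> /Cc_bbs; exact: bbs_L2. Qed.

Lemma qcov_Cc phi psi (Cphi : Cc_spacetime phi) (Cpsi : Cc_spacetime psi) :
  qcov P W (hilbert_of gam Cphi) (hilbert_of gam Cpsi) = nform phi psi.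
Proof.
apply: EFin_inj; rewrite qcov_hdot /hdot /= lim_cst// nfE//.
- exact: Cc_L2.
- exact: Cc_L2.
- exact: Cc_tsupp.
- exact: Cc_tsupp.
Qed.

Lemma Cc_seq f : L2 mst f -> tsupp f ->
  exists2 phi_ : nat -> R * E -> R, forall n, Cc_spacetime (phi_ n) & l2cvg mst phi_ f.
Proof.
move=> Lf sf; have h n : exists2 phi, Cc_spacetime phi &
    (sqn mst (fun p => f p - phi p)%R <= (n.+1%:R^-1)%:E)%E.
  by apply: Cc_dense.
have /choice[phi_ H] : forall n, exists phi : R * E -> R, Cc_spacetime phi /\
    (sqn mst (fun p => f p - phi p)%R <= (n.+1%:R^-1)%:E)%E.
  by move=> n; have [phi ? ?] := h n; exists phi.
exists phi_ => [n|e e0]; first exact: (H n).1.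
have /cvgrPdist_le/(_ _ e0)[N _ HN] := @cvg_harmonic R.
exists N => n /HN /=; rewrite sub0r normrN ger0_norm ?invr_ge0// => hn.
by rewrite sqnBC; apply: le_trans (H n).2 _; rewrite lee_fin.
Qed.

(** For a test function this is the variance of its noise; density extends it to L2. The symmetry
    [nformC] is obtained in the same way. *)
Lemma nform_ge0 f : L2 mst f -> tsupp f -> 0 <= nform f f.
Proof.
move=> Lf sf; have [phi_ Cphi cphi] := Cc_seq Lf sf.
have Lphi n := Cc_L2 (Cphi n).
have H := @l2cvg_nform R d gam gam_ge0 gam_L1 _ _ f f Lphi Lphi Lf Lf cphi cphi.
rewrite -(cvg_lim _ H)//; apply: limr_ge; first exact: cvgP H.
by apply: nearW => n; rewrite -(qcov_Cc (Cphi n) (Cphi n)); exact: ip_ge0.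
Qed.

Lemma nformC f g : L2 mst f -> tsupp f -> L2 mst g -> tsupp g -> nform f g = nform g f.
Proof.
move=> Lf sf Lg sg; have [phi_ Cphi cphi] := Cc_seq Lf sf; have [psi_ Cpsi cpsi] := Cc_seq Lg sg.
have Lphi n := Cc_L2 (Cphi n); have Lpsi n := Cc_L2 (Cpsi n).
have H1 := @l2cvg_nform R d gam gam_ge0 gam_L1 _ _ f g Lphi Lpsi Lf Lg cphi cpsi.
have H2 := @l2cvg_nform R d gam gam_ge0 gam_L1 _ _ g f Lpsi Lphi Lg Lf cpsi cphi.
rewrite -(cvg_lim _ H1)// -(cvg_lim _ H2)//; congr (lim (_ @ \oo)); apply/funext => n.
by rewrite -(qcov_Cc (Cphi n) (Cpsi n)) -(qcov_Cc (Cpsi n) (Cphi n)) /qcov ipC.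
Qed.

Lemma tsuppD f g : tsupp f -> tsupp g -> tsupp (fun p => f p + g p).
Proof. by move=> sf sg p p0; rewrite sf ?sg ?addr0. Qed.

Lemma tsuppB f g : tsupp f -> tsupp g -> tsupp (fun p => f p - g p).
Proof. by move=> sf sg p p0; rewrite sf ?sg ?subr0. Qed.

Lemma tsuppZ k f : tsupp f -> tsupp (fun p => k * f p).
Proof. by move=> sf p p0; rewrite sf ?mulr0. Qed.

Lemma nform_CS f g : L2 mst f -> tsupp f -> L2 mst g -> tsupp g ->
  `|nform f g| <= Num.sqrt (nform f f) * Num.sqrt (nform g g).
Proof.
move=> Lf sf Lg sg; have f0 := nform_ge0 Lf sf; have g0 := nform_ge0 Lg sg.
rewrite -sqrtrM// -sqrtr_sqr ler_wsqrtr//; apply: discriminant_le0 => // k.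
have Lk := L2Z k Lg; have Lfg := L2D Lf Lk.
have := nform_ge0 Lfg (tsuppD sf (tsuppZ k sg)).
rewrite nformDl// !nformDr// !nformZl// !nformZr// (nformC Lg sg Lf sf).
by congr (_ <= _); ring.
Qed.

Lemma nform_le_mix f g : L2 mst f -> tsupp f -> L2 mst g -> tsupp g ->
  nform (fun p => f p + g p) (fun p => f p + g p) <= 2 * nform f f + 2 * nform g g.
Proof.
move=> Lf sf Lg sg; have := nform_ge0 (L2B Lf Lg) (tsuppB sf sg).
have Ld := L2D Lf Lg; have Lb := L2B Lf Lg.
rewrite nformBl// !nformBr// nformDl// !nformDr//; lra.
Qed.

Lemma represents_nform (h : hilbert gam) f : L2 mst f -> tsupp f -> represents h f ->
  (fun n => nform (fun p => h n p - f p) (fun p => h n p - f p)) @ \oo --> 0.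
Proof.
move=> Lf sf /fine_cvg H.
suff -> : (fun n => nform (fun p => h n p - f p) (fun p => h n p - f p)) =
  fine \o (fun n => noise_norm2 gam (h n \- f)) by [].
apply/funext => n /=; rewrite /noise_norm2 nfE//.
- by apply: L2B => //; exact: Cc_L2 (hseq_Cc h n).
- by apply: L2B => //; exact: Cc_L2 (hseq_Cc h n).
- by apply: tsuppB => //; exact: Cc_tsupp (hseq_Cc h n).
- by apply: tsuppB => //; exact: Cc_tsupp (hseq_Cc h n).
Qed.

(** [represents] gives convergence in the noise norm and not in L2, so the limit is controlled by
    the Cauchy-Schwarz inequality of the form itself. *)
Lemma qcov_represents (h h' : hilbert gam) f f' : L2 mst f -> tsupp f -> L2 mst f' -> tsupp f' ->
  represents h f -> represents h' f' -> qcov P W h h' = nform f f'.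
Proof.
move=> Lf sf Lf' sf' /(represents_nform Lf sf) ra /(represents_nform Lf' sf') rb.
pose a n : ST -> R := fun p => h n p - f p; pose b n : ST -> R := fun p => h' n p - f' p.
have Lh n : L2 mst (h n : ST -> R) := Cc_L2 (hseq_Cc h n).
have Lh' n : L2 mst (h' n : ST -> R) := Cc_L2 (hseq_Cc h' n).
have sh n : tsupp (h n : ST -> R) := Cc_tsupp (hseq_Cc h n).
have sh' n : tsupp (h' n : ST -> R) := Cc_tsupp (hseq_Cc h' n).
have La n : L2 mst (a n) by exact: L2B.
have Lb n : L2 mst (b n) by exact: L2B.
have sa n : tsupp (a n) by exact: tsuppB.
have sb n : tsupp (b n) by exact: tsuppB.
have sq (u : nat -> R) : u @ \oo --> 0 -> (fun n => Num.sqrt (u n)) @ \oo --> 0.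
  by move=> hu; rewrite -(sqrtr0 R); apply: continuous_cvg hu; exact: sqrt_continuous.
have H : nform (h n) (h' n) @[n --> \oo] --> nform f f'.
  apply/subr_cvg0.
  pose u n := Num.sqrt (nform (a n) (a n)) * Num.sqrt (nform f' f') +
    Num.sqrt (nform f f) * Num.sqrt (nform (b n) (b n)) +
    Num.sqrt (nform (a n) (a n)) * Num.sqrt (nform (b n) (b n)).
  have u0 : u @ \oo --> 0.
    rewrite [X in _ --> X](_ : 0 = 0 * Num.sqrt (nform f' f') + Num.sqrt (nform f f) * 0 + 0 * 0); last by ring.
    apply: cvgD; [apply: cvgD|]; apply: cvgM; (try exact: cvg_cst); exact: sq.
  apply: norm_cvg0; apply: (@squeeze_cvgr _ _ _ _ (cst 0) u) => //; last exact: cvg_cst.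
  apply: nearW => n; rewrite normr_ge0 /=.
  have -> : nform (h n) (h' n) - nform f f' = nform (a n) f' + nform f (b n) + nform (a n) (b n).
    by rewrite !nformBl// !nformBr//; ring.
  apply: le_trans (ler_normD _ _) _; apply: lerD; last exact: nform_CS.
  by apply: le_trans (ler_normD _ _) _; apply: lerD; exact: nform_CS.
apply: EFin_inj; rewrite qcov_hdot /hdot.
have -> : (fun n => noise_form gam (h n) (h' n)) = fun n => (nform (h n) (h' n))%:E.
  by apply/funext => n; exact: nfE.
apply: cvg_lim => //; apply: cvg_EFin => //.
by apply: nearW.
Qed.

(** The noise norm is dominated by the L2 norm, up to the factor [kap gam]: an approximating
    sequence of test functions is Cauchy for it. *)
Lemma exists_represents f : L2 mst f -> tsupp f -> exists h : hilbert gam, represents h f.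
Proof.
move=> Lf sf; have [phi_ Cphi cphi] := Cc_seq Lf sf; have k1 : 0 < kap gam + 1 by rewrite ltr_wpDl// kap_ge0.
have Lphi n := Cc_L2 (Cphi n); have sphi n := Cc_tsupp (Cphi n).
have le (g : ST -> R) e : 0 < e -> L2 mst g -> tsupp g -> (sqn mst g <= (e / (kap gam + 1))%:E)%E ->
    (noise_norm2 gam g <= e%:E)%E.
  move=> e0 Lg sg hg; rewrite /noise_norm2 nfE//; apply: le_trans (nform_le_sqn gam_ge0 gam_L1 Lg) _.
  apply: le_trans (lee_wpmul2l _ hg) _; first by rewrite lee_fin kap_ge0.
  by rewrite -EFinM lee_fin mulrCA ger_pMr// ler_pdivrMr// mul1r lerDl.
have cau (e : R) : 0 < e -> exists N, forall m n, (N <= m)%N -> (N <= n)%N ->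
    (noise_norm2 gam (phi_ m \- phi_ n)%R < e%:E)%E.
  move=> e0; have e8 : 0 < e / 2 / (kap gam + 1) / 4 by rewrite !divr_gt0.
  have [N HN] := cphi _ e8; exists N => m n hm hn.
  apply: (@le_lt_trans _ _ (e / 2)%:E); last by rewrite lte_fin; lra.
  apply: le; [by rewrite divr_gt0|exact: L2B|exact: tsuppB|].
  apply: le_trans (sqnB _ (Lphi m).1 Lf.1 (Lphi n).1) _.
  apply: le_trans (leeD (lee_wpmul2l _ (HN m hm)) (lee_wpmul2l _ (_ : _ <= (e / 2 / (kap gam + 1) / 4)%:E)%E)) _ => //.
    by rewrite sqnBC; exact: HN.
  by rewrite -!EFinM -EFinD lee_fin; lra.
exists (Hilbert Cphi cau); rewrite /represents /=.
apply: le0_cvge => [n|e e0].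
  rewrite /noise_norm2 nfE ?lee_fin; [|exact: L2B|exact: L2B|exact: tsuppB|exact: tsuppB].
  by apply: nform_ge0; [exact: L2B|exact: tsuppB].
have [N HN] := cphi _ (divr_gt0 e0 k1); exists N => n /HN h.
by apply: le => //; [exact: L2B|exact: tsuppB].
Qed.

End positive.

(** * Spatial translations *)

Section shift.
Context {R : realType} {d : nat}.
Local Notation E := 'rV[R]_d.
Local Notation leb := (@lebesgue_measure R).
Local Notation lam := (@lebesgue_rV R d).
Local Notation ST := (measurableTypeR R * E)%type.
Local Notation ST2 := (measurableTypeR R * (E * E))%type.
Local Notation mst := (prod_sf leb lam).
Local Notation m3 := (prod_sf leb (prod_sf lam lam)).
Implicit Types f g : ST -> R.

Definition shf (y : E) f (p : ST) : R := f (p.1, p.2 - y).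

Lemma measurable_sh (y : E) : measurable_fun setT (fun p : ST => (p.1, p.2 - y) : ST).
Proof.
apply: measurable_fun_pair; first exact: measurable_fst.
by apply: measurable_funB_rV => //; exact: measurable_snd.
Qed.

Lemma measurable_shf y f : measurable_fun setT f -> measurable_fun setT (shf y f).
Proof. by move=> mf; exact: (measurableT_comp mf (measurable_sh y)). Qed.

Lemma ge0_integral_shf y (F : ST -> \bar R) : measurable_fun setT F -> (forall p, 0 <= F p)%E ->
  (\int[mst]_p F (p.1, p.2 - y)%R = \int[mst]_p F p)%E.
Proof.
move=> mF F0; rewrite tonelli1//; last exact: (measurableT_comp mF (measurable_sh y)).
rewrite (tonelli1 mF F0); apply: eq_integral => s _ /=.
by rewrite (@ge0_integral_rV_shift R d (- y) (fun z => F (s, z)))//; exact: measurable_pair1.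
Qed.

Lemma sqn_shf y f : measurable_fun setT f -> sqn mst (shf y f) = sqn mst f.
Proof.
move=> mf; rewrite /sqn -(@ge0_integral_shf y (fun p => (f p ^+ 2)%:E))//.
- exact: measurable_sq.
- by move=> p; rewrite lee_fin sqr_ge0.
Qed.

Lemma L2_shf y f : L2 mst f -> L2 mst (shf y f).
Proof. by move=> [mf foo]; split; [exact: measurable_shf|rewrite sqn_shf]. Qed.

Lemma tsupp_shf y f : tsupp f -> tsupp (shf y f).
Proof. by move=> sf p p0; exact: sf. Qed.

Lemma integral_m3_shift y (F : ST2 -> \bar R) : measurable_fun setT F ->
  (\int[m3]_q F (q.1, (q.2.1 - y, q.2.2 - y))%R = \int[m3]_q F q)%E.
Proof.
move=> mF; have mth : measurable_fun setT (fun q : ST2 => (q.1, (q.2.1 - y, q.2.2 - y)) : ST2).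
  apply: measurable_fun_pair; first exact: measurable_fst.
  apply: measurable_fun_pair; apply: measurable_funB_rV => //.
    exact: (measurableT_comp measurable_fst measurable_snd).
  exact: (measurableT_comp measurable_snd measurable_snd).
have H (G : ST2 -> \bar R) : measurable_fun setT G -> (forall q, 0 <= G q)%E ->
    (\int[m3]_q G (q.1, (q.2.1 - y, q.2.2 - y))%R = \int[m3]_q G q)%E.
  move=> mG G0; rewrite ge0_integral_m3//; last exact: (measurableT_comp mG mth).
  rewrite (ge0_integral_m3 mG G0); apply: eq_integral => s _ /=.
  have ms := measurable_pair1 s mG.
  rewrite -(@ge0_integral_rV_shift R d (- y) (fun u => \int[lam]_z G (s, (u, z))))%E.
  - apply: eq_integral => u _; rewrite (@ge0_integral_rV_shift R d (- y) (fun z => G (s, (u - y, z))))//.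
    exact: (measurable_pair1 (u - y) ms).
  - exact: (measurable_inner _ ms).
  - by move=> u; exact: integral_ge0.
rewrite integralE [RHS]integralE; congr (_ - _)%E.
  by rewrite -(H _ (measurable_funepos mF) (funepos_ge0 F)); apply: eq_integral => q _; rewrite !funeposE.
by rewrite -(H _ (measurable_funeneg mF) (funeneg_ge0 F)); apply: eq_integral => q _; rewrite !funenegE.
Qed.

Variable gam : E -> \bar R.
Hypothesis gam_ge0 : forall x, (0 <= gam x)%E.
Hypothesis gam_L1 : lam.-integrable setT gam.
Local Notation nform := (nform gam).

(** The weight [gam] depends on differences of points only. *)
Lemma nform_shf y f g : measurable_fun setT f -> measurable_fun setT g ->
  nform (shf y f) (shf y g) = nform f g.
Proof.
move=> mf mg; rewrite /nform /ip /Rintegral.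
rewrite -(@integral_m3_shift y (fun q => (lft gam f q * rgt gam g q)%:E)).
  congr fine; apply: eq_integral => q _; rewrite !lft_rgt// /shf /gam3 /=.
  by rewrite opprB addrA subrK.
by apply/measurable_EFinP; apply: measurable_funM; [exact: measurable_lft|exact: measurable_rgt].
Qed.

End shift.

(** * Decorrelation at infinity *)

Section mixing.
Context {R : realType} {d : nat}.
Local Notation E := 'rV[R]_d.
Local Notation leb := (@lebesgue_measure R).
Local Notation lam := (@lebesgue_rV R d).
Local Notation ST := (measurableTypeR R * E)%type.
Local Notation mst := (prod_sf leb lam).
Variable gam : E -> \bar R.
Hypothesis gam_ge0 : forall x, (0 <= gam x)%E.
Hypothesis gam_L1 : lam.-integrable setT gam.
Implicit Types f g : ST -> R.

Definition far (n : nat) : E := const_mx n%:R.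

Lemma measurable_rV_norm : measurable_fun setT (fun x : E => `|x|).
Proof.
rewrite (_ : (fun x : E => _) = (fun p : ST => `|p : R * E|) \o (fun x : E => ((0 : R), x))).
  by apply: (measurableT_comp measurable_st_norm); exact: measurable_fun_pair.
by apply/funext => x; rewrite /= prod_normE /= normr0 max_r.
Qed.

Section cut.
Variables (k : R) (n : nat).
Definition farset : set E := [set x | `|x + far n| <= k].
(** The part of [gam] on the ball of radius [k] around [- far n]. It is all that the form sees
    between functions with supports near the origin when one is translated by [far n]
    ([nform_gcut]), and its mass tends to 0 as [gam] is integrable. *)
Definition gcut x : \bar R := ((\1_farset x)%:E * gam x)%E.

Lemma measurable_farset : measurable farset.
Proof.
have := measurableT_comp measurable_rV_norm (measurable_funD_rV (@measurable_id _ E setT) (measurable_cst (far n))).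
move=> /(_ measurableT `]-oo, k]%classic (measurable_itv _)); rewrite setTI; congr measurable.
Qed.

Lemma gcut_ge0 x : (0 <= gcut x)%E.
Proof. by rewrite mule_ge0// lee_fin indicE. Qed.

Lemma gcut_L1 : lam.-integrable setT gcut.
Proof.
apply: le_integrable gam_L1 => //.
  apply: emeasurable_funM; last exact: measurable_int gam_L1.
  by apply/measurable_EFinP; apply: measurable_indic; exact: measurable_farset.
move=> x _; rewrite /gcut abseM /= indicE; case: (_ \in _); rewrite ?normr1 ?mul1e// normr0 mul0e.
exact: abse_ge0.
Qed.

Lemma gamr_gcut x : gamr gcut x = \1_farset x * gamr gam x.
Proof. by rewrite /gamr /gcut indicE; case: (_ \in _); rewrite ?mul1e ?mul1r ?mul0e ?mul0r. Qed.

End cut.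

Lemma kap_gcut k (e : R) : 0 < e -> (0 < d)%N -> exists N, forall n, (N <= n)%N -> kap (gcut k n) <= e.
Proof.
move=> e0 d0; have ms : measurable_fun setT (fun x => Num.sqrt (gamr gam x)).
  exact: (measurableT_comp measurable_sqrtr (measurable_gamr gam_L1)).
have [|||||N HN] := @sqn_cvg0 _ _ _ lam (fun n x => \1_(farset k n) x * Num.sqrt (gamr gam x))
    (fun x => Num.sqrt (gamr gam x)) _ _ _ _ _ _ e0.
- by move=> n; apply: measurable_funM => //; apply: measurable_indic; exact: measurable_farset.
- by [].
- rewrite /sqn; under eq_integral do rewrite sqr_sqrtr ?gamr_ge0//.
  by rewrite integral_gamr// ltry.
- by move=> n x; rewrite indicE; case: (_ \in _); rewrite ?mul1r// mul0r normr0.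
- move=> x; apply: (@cvg_eventually _ _ _ (Num.bound (`|k| + `|x|))) => n hn.
  rewrite indicE memNset ?mul0r// /farset /= => h.
  have hf : `|far n| <= k + `|x|.
    rewrite -(addrK x (far n)) (addrC (far n)); apply: le_trans (ler_normB _ _) _.
    by rewrite lerD2r.
  have k0 : 0 <= k + `|x| by apply: le_trans hf.
  (* All coordinates of [far n] equal [n], and [0 < d] provides one of them. *)
  move: hf; rewrite rV_norm_le// => /forallP/(_ (Ordinal d0)); rewrite mxE normr_nat => hf.
  have : n%:R < n%:R :> R; last by rewrite ltxx.
  apply: le_lt_trans (lt_le_trans (archi_boundP (_ : 0 <= `|k| + `|x|)) (_ : _ <= n%:R)).
  - by apply: le_trans hf _; rewrite lerD2r ler_norm.
  - by rewrite addr_ge0.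
  - by rewrite ler_nat.
exists N => n /HN; rewrite /sqn.
under eq_integral do rewrite exprMn sqr_sqrtr ?gamr_ge0//.
rewrite (eq_integral (fun x => (gamr (gcut k n) x)%:E)) => [|x _].
  by rewrite integral_gamr ?lee_fin//; exact: gcut_L1.
by rewrite gamr_gcut indicE; case: (_ \in _); rewrite ?expr1n// expr0n.
Qed.

Lemma nform_gcut k n f g : (forall p, k < `|p : R * E| -> f p = 0) -> (forall p, k < `|p : R * E| -> g p = 0) ->
  nform gam f (shf (far n) g) = nform (gcut (k + k) n) f (shf (far n) g).
Proof.
move=> fk gk; rewrite /nform /ip /Rintegral; congr fine; apply: eq_integral => q _.
rewrite !lft_rgt//; last exact: gcut_ge0.
rewrite /gam3 gamr_gcut indicE; case: (boolP (_ \in _)) => h; rewrite ?mul1r// mul0r mulr0.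
have [h1|h1] := leP `|(st1 q : R * E)| k; last by rewrite fk// !mul0r.
have [h2|h2] := leP `|((q.1, q.2.2 - far n) : R * E)| k; last by rewrite /shf gk// mulr0 mul0r.
move: h; rewrite notin_setE => -[]; rewrite /farset /=.
have -> : q.2.1 - q.2.2 + far n = q.2.1 - (q.2.2 - far n) by rewrite opprB addrA addrAC.
apply: le_trans (ler_normB _ _) _; move: h1 h2; rewrite !st_norm_le /= => /andP[_ h1] /andP[_ h2].
exact: lerD.
Qed.

(** Both functions are replaced by test functions [phi] and [psi], each replacement and the
    remaining term costing [e / 3]. The precision [b] of [psi] involves the norm of [phi], which is
    therefore chosen first. *)
Lemma nform_far f g : (0 < d)%N -> L2 mst f -> tsupp f -> L2 mst g -> tsupp g ->
  nform gam f (shf (far n) g) @[n --> \oo] --> 0.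
Proof.
move=> d0 Lf sf Lg sg; apply/cvgrPdist_le => e e0.
have nrm (u : ST -> R) : 0 <= Num.sqrt (ip mst u u) by exact: sqrtr_ge0.
have dense (u : ST -> R) a : L2 mst u -> tsupp u -> 0 < a -> exists2 phi : R * E -> R, Cc_spacetime phi &
    Num.sqrt (ip mst (fun p => u p - phi p) (fun p => u p - phi p)) <= a.
  move=> Lu su a0; have [phi Cphi h] := Cc_dense Lu su (exprn_gt0 2 a0).
  exists phi => //; move: h; rewrite sqn_ip; last by apply: L2B => //; exact: Cc_L2.
  by rewrite lee_fin => h; apply: le_trans (ler_wsqrtr h) _; rewrite sqrtr_sqr ger0_norm// ltW.
have shN y u : L2 mst u -> Num.sqrt (ip mst (shf y u) (shf y u)) = Num.sqrt (ip mst u u).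
  move=> Lu; congr Num.sqrt; apply: EFin_inj; rewrite -(sqn_ip (L2_shf y Lu)) -(sqn_ip Lu).
  by apply: sqn_shf; case: Lu.
have k0 := kap_ge0 gam_ge0.
pose a := e / 3 / ((kap gam + 1) * (Num.sqrt (ip mst g g) + 1)).
have a0 : 0 < a by rewrite divr_gt0 ?divr_gt0// mulr_gt0// ltr_wpDl.
have [phi Cphi hphi] := dense f a Lf sf a0.
pose b := e / 3 / ((kap gam + 1) * (Num.sqrt (ip mst phi phi) + 1)).
have b0 : 0 < b by rewrite divr_gt0 ?divr_gt0// mulr_gt0// ltr_wpDl.
have [psi Cpsi hpsi] := dense g b Lg sg b0.
have Lphi := Cc_L2 Cphi; have Lpsi := Cc_L2 Cpsi.
have [_ _ [k1 hk1]] := Cc_bbs Cphi; have [_ _ [k2 hk2]] := Cc_bbs Cpsi.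
pose k := Num.max k1 k2; pose c := e / 3 / ((Num.sqrt (ip mst phi phi) + 1) * (Num.sqrt (ip mst psi psi) + 1)).
have c0 : 0 < c by rewrite divr_gt0 ?divr_gt0// mulr_gt0// ltr_wpDl.
have [N HN] := kap_gcut (k + k) c0 d0; exists N => // n /HN hn; rewrite sub0r normrN.
have -> : nform gam f (shf (far n) g) = nform gam (fun p => f p - phi p) (shf (far n) g) +
    nform gam phi (shf (far n) (fun p => g p - psi p)) + nform (gcut (k + k) n) phi (shf (far n) psi).
  rewrite -nform_gcut.
  - rewrite nformBl//; last exact: L2_shf.
    rewrite [X in _ + X + _](_ : _ = nform gam phi (fun p => shf (far n) g p - shf (far n) psi p))//.
    rewrite nformBr//; [by ring|exact: L2_shf|exact: L2_shf].
  - by move=> p hp; apply: hk1; apply: le_lt_trans hp; rewrite le_max lexx.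
  - by move=> p hp; apply: hk2; apply: le_lt_trans hp; rewrite le_max lexx orbT.
have Lfp := L2B Lf Lphi; have Lgp := L2B Lg Lpsi.
have bnd (x u v : R) : 0 <= x -> 0 <= u -> 0 <= v -> u <= e / 3 / ((x + 1) * (v + 1)) -> x * u * v <= e / 3.
  move=> x0 u0 v0; rewrite ler_pdivlMr; last by rewrite mulr_gt0// ltr_wpDl.
  by move: (e / 3) => e'; nra.
apply: le_trans (ler_normD _ _) _; rewrite (_ : e = e / 3 + e / 3 + e / 3); last by lra.
apply: lerD; first (apply: le_trans (ler_normD _ _) _; apply: lerD).
- apply: le_trans (nform_le gam_ge0 gam_L1 Lfp (L2_shf _ Lg)) _; rewrite shN//.
  exact: bnd.
- apply: le_trans (nform_le gam_ge0 gam_L1 Lphi (L2_shf _ Lgp)) _; rewrite shN// mulrAC.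
  exact: bnd.
apply: le_trans (nform_le (@gcut_ge0 _ _) (gcut_L1 _ _) Lphi (L2_shf _ Lpsi)) _; rewrite shN//.
rewrite (mulrC (kap _)); apply: bnd => //.
by apply: kap_ge0; exact: gcut_ge0.
Qed.

End mixing.

(** * Stochastic integrals of simple processes *)

Section rvec.
Context {R : realType} {d : nat} {disp : measure_display} {T : measurableType disp}.
Variable P : probability T R.
Local Notation E := 'rV[R]_d.
Local Notation leb := (@lebesgue_measure R).
Local Notation lam := (@lebesgue_rV R d).
Local Notation ST := (measurableTypeR R * E)%type.
Local Notation ST2 := (measurableTypeR R * (E * E))%type.
Local Notation mst := (prod_sf leb lam).
Local Notation m3 := (prod_sf leb (prod_sf lam lam)).
Variable gam : E -> \bar R.

(** An element of the completion need not be a function. Codes are built on those that are, together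
    with an L2 representative on which covariances and translations are computed. *)
Record rvec := Rvec {
  rv_h : hilbert gam ;
  rv_f : ST -> R ;
  rv_L2 : L2 mst rv_f ;
  rv_ts : tsupp rv_f ;
  rv_rep : represents rv_h rv_f }.

Hypothesis gam_ge0 : forall x, (0 <= gam x)%E.
Hypothesis gam_L1 : lam.-integrable setT gam.
Variable W : hilbert gam -> T -> R.
Hypothesis hW : isonormal P W.
Local Notation nform := (nform gam).

Definition WV (v : rvec) : T -> R := W (rv_h v).

Lemma WV_gaussian : gaussian_family P WV.
Proof. by have [h1 h2] := isonormal_gaussian hW; split=> [v|n c v]; [exact: h1|exact: h2]. Qed.

Local Notation gV := WV_gaussian.
Local Notation ev := (ev WV).
Local Notation mean := (mean P WV).

Lemma qcov_rvec v v' : qcov P WV v v' = nform (rv_f v) (rv_f v').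
Proof. exact: (qcov_represents gam_ge0 gam_L1 hW (rv_L2 v) (rv_ts v) (rv_L2 v') (rv_ts v') (rv_rep v) (rv_rep v')). Qed.

Lemma exists_rvec f : L2 mst f -> tsupp f -> exists v, rv_f v = f.
Proof. by move=> Lf sf; have [h hf] := exists_represents gam_ge0 gam_L1 hW Lf sf; exists (Rvec Lf sf hf). Qed.

(** Any element represented by the shifted function will do, as only covariances matter; hence the
    arbitrary choice. *)
Definition tr (y : E) (v : rvec) : rvec :=
  sval (cid (exists_rvec (L2_shf y (rv_L2 v)) (tsupp_shf y (rv_ts v)))).

Lemma rv_f_tr y v : rv_f (tr y v) = shf y (rv_f v).
Proof. exact: (svalP (cid (exists_rvec (L2_shf y (rv_L2 v)) (tsupp_shf y (rv_ts v))))). Qed.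

Lemma qcov_tr y v v' : qcov P WV (tr y v) (tr y v') = qcov P WV v v'.
Proof. by rewrite !qcov_rvec !rv_f_tr nform_shf//; [case: (rv_L2 v)|case: (rv_L2 v')]. Qed.

Lemma qcov_far v v' : (0 < d)%N -> qcov P WV v (tr (far n) v') @[n --> \oo] --> 0.
Proof.
move=> d0; rewrite (_ : (fun n => _) = fun n => nform (rv_f v) (shf (far n) (rv_f v'))).
  exact: (nform_far gam_ge0 gam_L1 d0 (rv_L2 v) (rv_ts v) (rv_L2 v') (rv_ts v')).
by apply/funext => n; rewrite qcov_rvec rv_f_tr.
Qed.

Definition past (a : R) (v : rvec) := forall p, a < p.1 -> rv_f v p = 0.
Definition future (a : R) (v : rvec) := forall p, p.1 <= a -> rv_f v p = 0.

Fixpoint lpast a (l : @linform R rvec) : Prop := if l is p :: l' then past a p.2 /\ lpast a l' else True.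

Lemma lpast_closed a : linform_closed (lpast a).
Proof.
split=> [l l'|k l]; first by elim: l => //= p l IH [? ?] ?; split => //; exact: IH.
by elim: l => //= p l IH [? ?]; split => //; exact: IH.
Qed.

Lemma lpast_le a b l : a <= b -> lpast a l -> lpast b l.
Proof.
by move=> ab; elim: l => //= p l IH [h1 h2]; split; [move=> q /(le_lt_trans ab); exact: h1|exact: IH].
Qed.

Lemma terms_sub (Q Q' : @linform R rvec -> Prop) c : (forall l, Q l -> Q' l) -> terms Q c -> terms Q' c.
Proof. by move=> QQ; elim: c => //= p c IH [? ?]; split; [exact: QQ|exact: IH]. Qed.

(** The noise is white in time: the form pairs the two functions at equal times, where one of them
    vanishes. *)
Lemma qcov_past_future a v v' : past a v -> future a v' -> qcov P WV v v' = 0.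
Proof.
move=> pv fv; rewrite qcov_rvec /nform /ip /Rintegral integral0_eq// => q _.
rewrite lft_rgt//; have [h|h] := leP q.1 a; first by rewrite (fv (st2 q))// mulr0 mul0r.
by rewrite (pv (st1 q))// !mul0r.
Qed.

Lemma lpast_uncorrelated a v l : future a v -> lpast a l -> uncorrelated P WV v l.
Proof.
move=> fv; rewrite /uncorrelated /orth /cov; elim: l => [|p l IH] /=; first by rewrite big_nil.
move=> [pv /IH h]; rewrite big_cons h addr0 big_seq1 (qcov_past_future pv fv).
by rewrite mulr0.
Qed.

(* [ev c * f], where the random variable [ev c] is determined by the noise before time [a]
   and the function [f] vanishes before time [a]. *)
Record celt := Celt {
  ce_a : R ;
  ce_c : @code R rvec ;
  ce_v : rvec ;
  ce_ge0 : 0 <= ce_a ;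
  ce_past : terms (lpast ce_a) ce_c ;
  ce_future : future ce_a ce_v }.

(** The stochastic integral of the process [spro S]. *)
Definition isum (S : seq celt) (w : T) : R := \sum_(e <- S) ev (ce_c e) w * WV (ce_v e) w.
Definition spro (S : seq celt) (p : ST) (w : T) : R := \sum_(e <- S) ev (ce_c e) w * rv_f (ce_v e) p.

Lemma L2_celt e : L2 P (fun w => ev (ce_c e) w * WV (ce_v e) w).
Proof.
apply: L2Ml; [exact: (measurable_ev gV)|exact: (ev_bdd WV)|exact: (L2_W gV)].
Qed.

Lemma L2_isum S : L2 P (isum S).
Proof. exact: (@L2_sum _ _ _ P _ S (fun e w => ev (ce_c e) w * WV (ce_v e) w) L2_celt). Qed.

(** Walsh's isometry for two terms: both codes belong to the past of the term that starts later, so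
    their product factors out by [ip_past]. *)
Lemma ip_celt_le e e' : ce_a e <= ce_a e' ->
  ip P (fun w => ev (ce_c e) w * WV (ce_v e) w) (fun w => ev (ce_c e') w * WV (ce_v e') w) =
  mean (cmul (ce_c e) (ce_c e')) * nform (rv_f (ce_v e)) (rv_f (ce_v e')).
Proof.
move=> aa; rewrite -qcov_rvec -(ip_past gV).
  by apply: eq_Rintegral => w _; rewrite ev_mul; ring.
apply: (@terms_sub (lpast (ce_a e'))) => [l|]; first exact: (lpast_uncorrelated (@ce_future e')).
apply: terms_mul; [exact: lpast_closed| |exact: ce_past].
by apply: terms_sub (ce_past e) => l; exact: lpast_le.
Qed.

Lemma ip_celt e e' :
  ip P (fun w => ev (ce_c e) w * WV (ce_v e) w) (fun w => ev (ce_c e') w * WV (ce_v e') w) =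
  mean (cmul (ce_c e) (ce_c e')) * nform (rv_f (ce_v e)) (rv_f (ce_v e')).
Proof.
have [aa|/ltW aa] := leP (ce_a e) (ce_a e'); first exact: ip_celt_le.
rewrite ipC ip_celt_le//; congr (_ * _); first by rewrite -!(ip_ev gV) ipC.
by rewrite -!qcov_rvec /qcov ipC.
Qed.

Lemma sqn_isum S : sqn P (isum S) =
  (\sum_(e <- S) \sum_(e' <- S) mean (cmul (ce_c e) (ce_c e')) * nform (rv_f (ce_v e)) (rv_f (ce_v e')))%:E.
Proof.
rewrite (sqn_ip (L2_isum S)); congr EFin; rewrite /isum.
rewrite (ip_suml _ (F := fun e w => ev (ce_c e) w * WV (ce_v e) w)); [|exact: L2_celt|exact: L2_isum].
apply: eq_bigr => e _; rewrite (ip_sumr _ (F := fun e w => ev (ce_c e) w * WV (ce_v e) w)).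
- by apply: eq_bigr => e' _; exact: ip_celt.
- exact: L2_celt.
- exact: L2_celt.
Qed.

Lemma L2_spro S p : L2 P (spro S p).
Proof.
apply: (@L2_sum _ _ _ P _ S (fun e w => ev (ce_c e) w * rv_f (ce_v e) p)) => e.
rewrite (_ : (fun w => _) = fun w => rv_f (ce_v e) p * ev (ce_c e) w); last by apply/funext => w; rewrite mulrC.
by apply: L2Z; exact: (L2_ev gV).
Qed.

Lemma ip_spro S p p' : ip P (spro S p) (spro S p') =
  \sum_(e <- S) \sum_(e' <- S) mean (cmul (ce_c e) (ce_c e')) * (rv_f (ce_v e) p * rv_f (ce_v e') p').
Proof.
have L q e : L2 P (fun w => ev (ce_c e) w * rv_f (ce_v e) q).
  rewrite (_ : (fun w => _) = fun w => rv_f (ce_v e) q * ev (ce_c e) w); last by apply/funext => w; rewrite mulrC.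
  by apply: L2Z; exact: (L2_ev gV).
rewrite {1}/spro (ip_suml _ (F := fun e w => ev (ce_c e) w * rv_f (ce_v e) p)); [|exact: L|exact: L2_spro].
apply: eq_bigr => e _; rewrite {1}/spro (ip_sumr _ (F := fun e w => ev (ce_c e) w * rv_f (ce_v e) p')); [|exact: L|exact: L].
apply: eq_bigr => e' _; rewrite -(ip_ev gV) /ip -RintegralZr//; last exact: L2_int (L2_ev gV _) (L2_ev gV _).
by apply: eq_Rintegral => w _; ring.
Qed.

Lemma Rintegral_sum_seq d1 (X : measurableType d1) (m : {measure set X -> \bar R}) (I : Type) (s : seq I) (F : I -> X -> R) :
  (forall i, m.-integrable setT (EFin \o F i)) ->
  m.-integrable setT (EFin \o (fun x => \sum_(i <- s) F i x)) /\
  \int[m]_x (\sum_(i <- s) F i x) = \sum_(i <- s) \int[m]_x F i x.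
Proof.
move=> iF; elim: s => [|i s [IH1 IH2]].
  split; last by rewrite big_nil /Rintegral integral0_eq// => x _; rewrite big_nil.
  by apply: (eq_integrable _ (cst 0%E)) => // [x _|]; [rewrite /= big_nil|exact: integrable0].
have E1 : (EFin \o fun x => \sum_(j <- i :: s) F j x) = ((EFin \o F i) \+ (EFin \o (fun x => (\sum_(j <- s) F j x)%R)))%E.
  by apply/funext => x; rewrite /= big_cons EFinD.
split; first by rewrite E1; exact: integrableD.
rewrite big_cons -IH2 -RintegralD//.
by apply: eq_Rintegral => x _; rewrite big_cons.
Qed.

Definition stdev S (p : ST) : R := Num.sqrt (ip P (spro S p) (spro S p)).

Lemma measurable_stdev S : measurable_fun setT (stdev S).
Proof.
apply: (measurableT_comp measurable_sqrtr).
rewrite (_ : (fun p => _) = fun p => \sum_(e <- S) (fun e p => \sum_(e' <- S)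
   (fun e' p => mean (cmul (ce_c e) (ce_c e')) * (rv_f (ce_v e) p * rv_f (ce_v e') p)) e' p) e p); last first.
  by apply/funext => p; rewrite ip_spro.
apply: measurable_sum => e; apply: measurable_sum => e'.
apply: measurable_funM => //; apply: measurable_funM; [by case: (rv_L2 (ce_v e))|by case: (rv_L2 (ce_v e'))].
Qed.

(** The expectation is taken first at two points of space-time, where Cauchy-Schwarz bounds it by
    the product of the standard deviations. This is the bound for the Gronwall argument, which knows
    the error only through second moments at each point. *)
Lemma isum_le_stdev S : (sqn P (isum S) <= nenergy gam (stdev S) (stdev S))%E.
Proof.
pose K e e' (q : ST2) := mean (cmul (ce_c e) (ce_c e')) * (lft gam (rv_f (ce_v e)) q * rgt gam (rv_f (ce_v e')) q).
have iK e e' : m3.-integrable setT (EFin \o K e e').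
  rewrite (_ : EFin \o _ = fun q => ((mean (cmul (ce_c e) (ce_c e')))%:E * (lft gam (rv_f (ce_v e)) q * rgt gam (rv_f (ce_v e')) q)%:E)%E)//.
  apply: integrableZl => //; apply: (L2_int (m := m3)).
    by apply: L2_lft => //; exact: rv_L2.
  by apply: L2_rgt => //; exact: rv_L2.
have iK2 e := (Rintegral_sum_seq S (iK e)).1.
have [i3 I3] := Rintegral_sum_seq S iK2.
pose J q := ip P (spro S (st1 q)) (spro S (st2 q)) * gam3 gam q.
have JE : J = fun q => \sum_(e <- S) \sum_(e' <- S) K e e' q.
  apply/funext => q; rewrite /J ip_spro mulr_suml; apply: eq_bigr => e _.
  rewrite mulr_suml; apply: eq_bigr => e' _; rewrite /K lft_rgt//; ring.
have iJ : m3.-integrable setT (EFin \o J) by rewrite JE.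
have -> : sqn P (isum S) = (\int[m3]_q (J q)%:E)%E.
  rewrite sqn_isum -[RHS]fineK; last exact: integrable_fin_num.
  congr EFin; rewrite -/(Rintegral m3 setT J) JE I3; apply: eq_bigr => e _.
  rewrite (Rintegral_sum_seq S (iK e)).2; apply: eq_bigr => e' _.
  by rewrite /K RintegralZl//; apply: L2_int; [apply: L2_lft|apply: L2_rgt] => //; exact: rv_L2.
have mJ := measurable_int _ iJ.
apply: le_trans (lee_abs _) _; apply: le_trans (le_abse_integral _ measurableT mJ) _.
apply: ge0_le_integral => //.
- exact: measurableT_comp.
- by apply/measurable_EFinP; exact: (measurable_nenergy gam_L1 (measurable_stdev S) (measurable_stdev S)).
move=> q _; rewrite lee_fin normrM (ger0_norm (gamr_ge0 gam_ge0 _)).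
by apply: ler_wpM2r; [exact: gamr_ge0|exact: ip_norm_le (L2_spro _ _) (L2_spro _ _)].
Qed.

End rvec.

(** * Walsh's norm *)

Section walsh_energy.
Context {R : realType} {d : nat} {disp : measure_display} {T : measurableType disp}.
Variable P : probability T R.
Local Notation E := 'rV[R]_d.
Local Notation leb := (@lebesgue_measure R).
Local Notation lam := (@lebesgue_rV R d).
Local Notation ST := (measurableTypeR R * E)%type.
Local Notation ST2 := (measurableTypeR R * (E * E))%type.
Local Notation mst := (prod_sf leb lam).
Local Notation m3 := (prod_sf leb (prod_sf lam lam)).
Local Notation mTS := (prod_sf P mst).
Variable gam : E -> \bar R.
Hypothesis gam_ge0 : forall x, (0 <= gam x)%E.
Hypothesis gam_L1 : lam.-integrable setT gam.
Local Notation nenergy := (nenergy gam).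
Implicit Types f g : ST -> R.

(* The square of Walsh's norm, for a nonnegative process. *)
Definition wen (F : T * ST -> R) : \bar R :=
  (\int[P]_w nenergy (fun p => F (w, p)) (fun p => F (w, p)))%E.

Lemma measurable_wen3 (F : T * ST -> R) : measurable_fun setT F ->
  measurable_fun setT (fun z : T * ST2 => F (z.1, st1 z.2) * F (z.1, st2 z.2) * gam3 gam z.2).
Proof.
move=> mF; have mp (g : ST2 -> ST) : measurable_fun setT g -> measurable_fun setT (fun z : T * ST2 => F (z.1, g z.2)).
  move=> mg; apply: (measurableT_comp mF); apply: measurable_fun_pair; first exact: measurable_fst.
  exact: (measurableT_comp mg measurable_snd).
apply: measurable_funM; last exact: (measurableT_comp (measurable_gam3 gam_L1) measurable_snd).
by apply: measurable_funM; apply: mp; [exact: measurable_st1|exact: measurable_st2].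
Qed.

Lemma measurable_wen (F : T * ST -> R) : measurable_fun setT F -> (forall z, 0 <= F z) ->
  measurable_fun setT (fun w => nenergy (fun p => F (w, p)) (fun p => F (w, p))).
Proof.
move=> mF F0; apply: (measurable_inner m3 (F := fun z : T * ST2 => (F (z.1, st1 z.2) * F (z.1, st2 z.2) * gam3 gam z.2)%:E)).
  by apply/measurable_EFinP; exact: measurable_wen3.
by move=> z; rewrite lee_fin !mulr_ge0// gamr_ge0.
Qed.

Lemma nenergy_ge0 f g : (forall p, 0 <= f p) -> (forall p, 0 <= g p) -> (0 <= nenergy f g)%E.
Proof. by move=> f0 g0; apply: integral_ge0 => q _; rewrite lee_fin !mulr_ge0// gamr_ge0. Qed.

Lemma nenergy_le_kap f : measurable_fun setT f -> (forall p, 0 <= f p) ->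
  (nenergy f f <= (kap gam)%:E * sqn mst f)%E.
Proof.
move=> mf f0; have mr := measurable_rgt gam_L1 mf; have ml := measurable_lft gam_L1 mf.
have m2 (g : ST2 -> R) : measurable_fun setT g -> measurable_fun setT (fun q => ((2^-1)%:E * (g q ^+ 2)%:E)%E).
  by move=> mg; apply: measurable_funeM; exact: measurable_sq.
have p2 (g : ST2 -> R) q : (0 <= (2^-1)%:E * (g q ^+ 2)%:E)%E by rewrite -EFinM lee_fin mulr_ge0// sqr_ge0.
apply: (@le_trans _ _ (\int[m3]_q ((2^-1)%:E * (lft gam f q ^+ 2)%:E + (2^-1)%:E * (rgt gam f q ^+ 2)%:E)))%E.
  apply: ge0_le_integral => //.
  - by move=> q _; rewrite lee_fin !mulr_ge0// gamr_ge0.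
  - by apply/measurable_EFinP; exact: measurable_nenergy.
  - by apply: emeasurable_funD; exact: m2.
  move=> q _; rewrite -lft_rgt// -!EFinM -EFinD lee_fin.
  by have := sqr_ge0 (lft gam f q - rgt gam f q); nra.
rewrite ge0_integralD//; [|exact: m2..].
rewrite !ge0_integralZl_EFin//; [|by move=> q _; rewrite lee_fin sqr_ge0|exact: measurable_sq|by move=> q _; rewrite lee_fin sqr_ge0|exact: measurable_sq].
rewrite -/(sqn m3 (lft gam f)) -/(sqn m3 (rgt gam f)) sqn_lft// sqn_rgt//.
rewrite -ge0_muleDl ?lee_fin// -EFinD (_ : 2^-1 + 2^-1 = 1) ?mul1e//; by lra.
Qed.

Lemma wen_kap (F : T * ST -> R) : measurable_fun setT F -> (forall z, 0 <= F z) ->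
  (wen F <= (kap gam)%:E * sqn mTS F)%E.
Proof.
move=> mF F0; have mF2 : measurable_fun setT (fun z => (F z ^+ 2)%:E) by exact: measurable_sq.
have p2 z : (0 <= (F z ^+ 2)%:E)%E by rewrite lee_fin sqr_ge0.
have mi : measurable_fun setT (fun w => sqn mst (fun p => F (w, p))) := measurable_inner mst mF2 p2.
rewrite /sqn tonelli1// -ge0_integralZl_EFin ?kap_ge0//; last by move=> w _; exact: sqn_ge0.
apply: ge0_le_integral => //.
- by move=> w _; exact: nenergy_ge0.
- exact: measurable_wen.
- exact: measurable_funeM.
- by move=> w _; apply: nenergy_le_kap => //; exact: measurable_pair1.
Qed.

Variable W : hilbert gam -> T -> R.
Hypothesis hW : isonormal P W.
Local Notation nform := (nform gam).

(** The inequality of the quadratic form holds for L2 functions, which [g1] and [g2] need not be. So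
    [f] is split into [min (f, g1)] and the rest, which are in L2 and dominated by [g1] and [g2]. *)
Lemma nenergy_mix f (g1 g2 : ST -> R) : L2 mst f -> tsupp f -> measurable_fun setT g1 -> measurable_fun setT g2 ->
  (forall p, 0 <= f p) -> (forall p, 0 <= g1 p) -> (forall p, 0 <= g2 p) -> (forall p, f p <= g1 p + g2 p) ->
  (nenergy f f <= 2%:E * nenergy g1 g1 + 2%:E * nenergy g2 g2)%E.
Proof.
move=> Lf sf m1 m2 f0 g10 g20 fg; have [mf _] := Lf.
pose h1 p := Num.min (f p) (g1 p); pose h2 p := f p - h1 p.
have h10 p : 0 <= h1 p <= g1 p by rewrite le_min f0 g10 /= ge_min lexx orbT.
have h20 p : 0 <= h2 p <= g2 p.
  rewrite /h2 /h1 subr_ge0 ge_min lexx /=; case: (leP (f p) (g1 p)) => h; first by rewrite subrr g20.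
  by have := fg p; lra.
have mh1 : measurable_fun setT h1 by exact: measurable_minr.
have L1 : L2 mst h1.
  apply: (L2_le mh1 Lf) => p; have /andP[? _] := h10 p.
  by rewrite !ger0_norm// ge_min lexx.
have Lh2 : L2 mst h2 by exact: L2B.
have s1 : tsupp h1 by move=> p p0; rewrite /h1 sf// min_l.
have s2 : tsupp h2 by move=> p p0; rewrite /h2 s1// sf// subr0.
have h12 : f = fun p => h1 p + h2 p by apply/funext => p; rewrite /h2; lra.
rewrite {1 2}h12 (nform_nenergy gam_ge0 gam_L1 (L2D L1 Lh2) (L2D L1 Lh2)).
apply: le_trans (_ : _ <= (2 * nform h1 h1 + 2 * nform h2 h2)%:E)%E _.
  by rewrite lee_fin; exact: (nform_le_mix gam_ge0 gam_L1 hW).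
rewrite EFinD !EFinM -!(nform_nenergy gam_ge0 gam_L1)//.
by apply: leeD; apply: lee_wpmul2l => //; apply: le_nenergy => //; case: Lh2.
Qed.

Lemma wen_mix (F G1 G2 : T * ST -> R) : measurable_fun setT F -> measurable_fun setT G1 -> measurable_fun setT G2 ->
  (forall w, L2 mst (fun p => F (w, p))) -> (forall w, tsupp (fun p => F (w, p))) ->
  (forall z, 0 <= F z) -> (forall z, 0 <= G1 z) -> (forall z, 0 <= G2 z) -> (forall z, F z <= G1 z + G2 z) ->
  (wen F <= 2%:E * wen G1 + 2%:E * wen G2)%E.
Proof.
move=> mF m1 m2 LF sF F0 G10 G20 FG; have w1 := measurable_wen m1 G10; have w2 := measurable_wen m2 G20.
have n1 w : (0 <= nenergy (fun p => G1 (w, p)) (fun p => G1 (w, p)))%E by exact: nenergy_ge0.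
have n2 w : (0 <= nenergy (fun p => G2 (w, p)) (fun p => G2 (w, p)))%E by exact: nenergy_ge0.
rewrite /wen -!ge0_integralZl_EFin// -ge0_integralD//; last 4 first.
- by move=> w _; apply: mule_ge0.
- exact: measurable_funeM.
- by move=> w _; apply: mule_ge0.
- exact: measurable_funeM.
apply: ge0_le_integral => //.
- by move=> w _; exact: nenergy_ge0.
- exact: measurable_wen.
- by apply: emeasurable_funD; exact: measurable_funeM.
- move=> w _; apply: nenergy_mix => //; exact: measurable_pair1.
Qed.

Local Notation ev := (ev (WV W)).
Local Notation gV := (WV_gaussian hW).
Local Notation mean := (mean P (WV W)).
Implicit Types S : seq (celt gam).

Lemma measurable_spro S : measurable_fun setT (fun z : T * ST => spro W S z.2 z.1).
Proof.
rewrite (_ : (fun z => _) = fun z => \sum_(e <- S) (fun e z => ev (ce_c e) z.1 * rv_f (ce_v e) z.2) e z)//.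
apply: measurable_sum => e; apply: measurable_funM.
  exact: (measurableT_comp (measurable_ev gV (ce_c e)) measurable_fst).
by apply: measurableT_comp measurable_snd; case: (rv_L2 (ce_v e)).
Qed.

Lemma L2_spro_st S w : L2 mst (fun p => spro W S p w).
Proof. by apply: (@L2_sum _ _ _ mst _ S (fun e p => ev (ce_c e) w * rv_f (ce_v e) p)) => e; apply: L2Z; exact: rv_L2. Qed.

Lemma tsupp_spro S w : tsupp (fun p => spro W S p w).
Proof. by move=> p p0; rewrite /spro big1// => e _; rewrite rv_ts ?mulr0. Qed.

Lemma nform_spro S w : nform (fun p => spro W S p w) (fun p => spro W S p w) =
  \sum_(e <- S) \sum_(e' <- S) ev (cmul (ce_c e) (ce_c e')) w * nform (rv_f (ce_v e)) (rv_f (ce_v e')).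
Proof.
have LZ e : L2 mst (fun p => ev (ce_c e) w * rv_f (ce_v e) p) by apply: L2Z; exact: rv_L2.
have E1 (f : ST2 -> ST) : (fun q => spro W S (f q) w * Num.sqrt (gam3 gam q)) =
    fun q => \sum_(e <- S) (fun e q => ev (ce_c e) w * rv_f (ce_v e) (f q) * Num.sqrt (gam3 gam q)) e q.
  by apply/funext => q; rewrite /spro mulr_suml.
have Lr e := L2_rgt gam_ge0 gam_L1 (LZ e); have Ll e := L2_lft gam_ge0 gam_L1 (LZ e).
have Lr' := L2_rgt gam_ge0 gam_L1 (L2_spro_st S w).
pose G e p := ev (ce_c e) w * rv_f (ce_v e) p.
have El : lft gam (fun p => spro W S p w) = fun q => \sum_(e <- S) (fun e => lft gam (G e)) e q by exact: E1.
have Er : rgt gam (fun p => spro W S p w) = fun q => \sum_(e <- S) (fun e => rgt gam (G e)) e q by exact: E1.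
rewrite {1}/nform El (ip_suml S Ll Lr'); apply: eq_bigr => e _.
rewrite Er (ip_sumr S Lr (Ll e)); apply: eq_bigr => e' _.
rewrite -[LHS]/(nform (fun p => ev (ce_c e) w * rv_f (ce_v e) p) (fun p => ev (ce_c e') w * rv_f (ce_v e') p)).
rewrite nformZl//; [|exact: rv_L2]; rewrite nformZr//; [|exact: rv_L2|exact: rv_L2].
by rewrite ev_mul mulrA.
Qed.

(** Here the form is taken first, at a fixed outcome, and the expectation last; absolute values then
    give Walsh's norm. This bound applies where convergence is known in Walsh's norm only. *)
Lemma isum_le_wen S : (sqn P (isum W S) <= wen (fun z => `|spro W S z.2 z.1|%R))%E.
Proof.
pose K e e' w := ev (cmul (ce_c e) (ce_c e')) w * nform (rv_f (ce_v e)) (rv_f (ce_v e')).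
have iK e e' : P.-integrable setT (EFin \o K e e').
  apply: bdd_int; first by apply: measurable_funM => //; exact: (measurable_ev gV).
  have [M hM] := ev_bdd (WV W) (cmul (ce_c e) (ce_c e')).
  exists (M * `|nform (rv_f (ce_v e)) (rv_f (ce_v e'))|) => w.
  by rewrite normrM ler_wpM2r.
have [i3 I3] := Rintegral_sum_seq S (fun e => (Rintegral_sum_seq S (iK e)).1).
have KE w : \sum_(e <- S) \sum_(e' <- S) K e e' w = nform (fun p => spro W S p w) (fun p => spro W S p w).
  by rewrite nform_spro.
have -> : sqn P (isum W S) = (\int[P]_w (nform (fun p => spro W S p w) (fun p => spro W S p w))%:E)%E.
  rewrite (sqn_isum gam_ge0 gam_L1 hW) -[RHS]fineK; last first.
    by apply: integrable_fin_num => //; apply: eq_integrable i3 => // w _ /=; rewrite KE.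
  congr EFin; transitivity (\int[P]_w \sum_(e <- S) \sum_(e' <- S) K e e' w); last by apply: eq_Rintegral => w _; rewrite KE.
  rewrite I3; apply: eq_bigr => e _; rewrite (Rintegral_sum_seq S (iK e)).2; apply: eq_bigr => e' _.
  rewrite -(Ex_ev gV) /K /Ex RintegralZr//; apply: bdd_int; [exact: (measurable_ev gV)|exact: (ev_bdd (WV W))].
apply: ge0_le_integral => //.
- by move=> w _; rewrite lee_fin; apply: (nform_ge0 gam_ge0 gam_L1 hW); [exact: L2_spro_st|exact: tsupp_spro].
- by apply: eq_measurable_fun (measurable_int _ i3) => w _ /=; rewrite KE.
- apply: (measurable_wen (F := fun z => `|spro W S z.2 z.1|)) => //.
  by apply: measurableT_comp => //; exact: measurable_spro.
move=> w _; have Ls := L2_spro_st S w; rewrite -(nform_nenergy gam_ge0 gam_L1)//.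
apply: le_trans (lee_abs _) _; apply: le_trans (le_abse_integral _ measurableT _) _.
  by apply/measurable_EFinP; exact: (measurable_nenergy gam_L1 Ls.1 Ls.1).
rewrite le_eqVlt; apply/orP; left; apply/eqP; apply: eq_integral => q _ /=.
by rewrite !normrM (ger0_norm (gamr_ge0 gam_ge0 _)).
Qed.

End walsh_energy.

(** * Simple processes as limits of sums over codes *)

Section approximation.
Context {R : realType} {d : nat} {disp : measure_display} {T : measurableType disp}.
Variable P : probability T R.
Local Notation E := 'rV[R]_d.
Local Notation leb := (@lebesgue_measure R).
Local Notation lam := (@lebesgue_rV R d).
Local Notation ST := (measurableTypeR R * E)%type.
Local Notation mst := (prod_sf leb lam).
Local Notation mTS := (prod_sf P mst).
Variable gam : E -> \bar R.
Hypothesis gam_ge0 : forall x, (0 <= gam x)%E.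
Hypothesis gam_L1 : lam.-integrable setT gam.
Variable W : hilbert gam -> T -> R.
Hypothesis hW : isonormal P W.
Local Notation nform := (nform gam).
Local Notation V := (WV W).
Local Notation ev := (ev V).
Local Notation gV := (WV_gaussian hW).
Local Notation tr := (tr gam_ge0 gam_L1 hW).
Local Notation near y := (near P V (tr y)).
Local Notation qtr y := (qcov_tr gam_ge0 gam_L1 hW y).
Implicit Types (S : seq (celt gam)) (e : celt gam).

Lemma cmap_sin y n (v : rvec gam) : @cmap R _ _ (tr y) (csin n [:: (1, v)]) = csin n [:: (1, tr y v)].
Proof. by []. Qed.

Lemma near_lim y (X Y : T -> R) : measurable_fun setT X -> measurable_fun setT Y ->
  (forall e : R, 0 < e -> exists c, (sqn P (fun w => X w - ev c w)%R <= e%:E)%E /\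
    (sqn P (fun w => Y w - ev (cmap (tr y) c) w)%R <= e%:E)%E) -> near y X Y 0.
Proof. by move=> mX mY h; split=> // e /h; rewrite add0r. Qed.

Lemma nearD y X Y X' Y' : near y X Y 0 -> near y X' Y' 0 ->
  near y (fun w => X w + X' w) (fun w => Y w + Y' w) 0.
Proof.
move=> n1 n2; have [m1 m2 _] := n1; have [m3 m4 _] := n2.
have alg := pair_alg_alg gV (tr y).
apply: (L2cl_near gV); [|exact: measurable_funD..].
rewrite (_ : glue _ _ = fun z => glue X Y z + glue X' Y' z).
  by apply: (L2clD alg); exact: (near_L2cl gV).
by apply/funext => -[w []].
Qed.

(** [csin n] approximates the noise of the vector, and its translate that of the translated vector;
    a large [n] serves both. *)
Lemma near_celt y e : near y (fun w => ev (ce_c e) w * V (ce_v e) w)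
  (fun w => ev (cmap (tr y) (ce_c e)) w * V (tr y (ce_v e)) w) 0.
Proof.
have mV v : measurable_fun setT (V v) by case: (L2_W gV v).
apply: near_lim => [||r r0]; [by apply: measurable_funM => //; exact: (measurable_ev gV)..|].
have cv c v := l2cvgMl (measurable_ev gV c) (ev_bdd V c) (fun n => L2_sinr n (L2_W gV v)) (L2_W gV v) (l2cvg_sinr (L2_W gV v)).
have [N1 H1] := cv (ce_c e) (ce_v e) _ r0.
have [N2 H2] := cv (cmap (tr y) (ce_c e)) (tr y (ce_v e)) _ r0.
pose n := maxn N1 N2; exists (cmul (ce_c e) (csin n [:: (1, ce_v e)])).
rewrite cmap_mul cmap_sin; split.
- rewrite sqnBC; have := H1 n (leq_maxl _ _); congr (sqn _ _ <= _)%E.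
  by apply/funext => w; rewrite ev_mul ev_sin lin1.
- rewrite sqnBC; have := H2 n (leq_maxr _ _); congr (sqn _ _ <= _)%E.
  by apply/funext => w; rewrite ev_mul ev_sin lin1.
Qed.

Lemma past_tr y a v : past a v -> past a (tr y v).
Proof. by move=> pv p hp; rewrite rv_f_tr /shf pv. Qed.

Lemma future_tr y a v : future a v -> future a (tr y v).
Proof. by move=> fv p hp; rewrite rv_f_tr /shf fv. Qed.

Lemma terms_past_tr y a c : terms (lpast a) c -> terms (lpast a) (cmap (tr y) c).
Proof.
elim: c => //= p c IH [hp hc]; split; last exact: IH.
by elim: p.1.2 hp => //= q l IHl [h1 h2]; split; [exact: past_tr|exact: IHl].
Qed.

Definition tr_celt y e : celt gam :=
  Celt (ce_ge0 e) (terms_past_tr y (ce_past e)) (@future_tr y _ _ (@ce_future _ _ _ e)).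

Lemma near_isum y S : near y (isum W S) (isum W (map (tr_celt y) S)) 0.
Proof.
elim: S => [|e S IH].
  have E0 : isum W [::] = cst 0 by apply/funext => w; rewrite /isum big_nil.
  rewrite /= E0; apply: near_lim => // r r0; exists [::].
  by split; rewrite /sqn; under eq_integral do rewrite /= /ev big_nil subr0 expr0n/=; rewrite integral0 lee_fin ltW.
have -> : isum W (e :: S) = fun w => ev (ce_c e) w * V (ce_v e) w + isum W S w.
  by apply/funext => w; rewrite /isum big_cons.
have -> : isum W (map (tr_celt y) (e :: S)) =
    fun w => ev (cmap (tr y) (ce_c e)) w * V (tr y (ce_v e)) w + isum W (map (tr_celt y) S) w.
  by apply/funext => w; rewrite /isum /= big_cons.
exact: nearD (near_celt y e) IH.
Qed.

Lemma L2cl_sub (A A' : set (T -> R)) X : A `<=` A' -> L2cl P A X -> L2cl P A' X.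
Proof. by move=> AA [mX h]; split=> // r /h[g /AA ? ?]; exists g. Qed.

Lemma past_alg a : is_alg (past_codes V (lpast (gam := gam) a)).
Proof. by apply: (past_codes_alg gV); exact: lpast_closed. Qed.

Lemma past_alg1 a : L2cl P (past_codes V (lpast (gam := gam) a)) (cst 1).
Proof. by apply: (past_codes1 gV) => //; exact: lpast_closed. Qed.

(** Of the generators, the null sets have an indicator at distance 0 from the empty code, and the
    noise of a test function supported before [a] is the L2 limit of its codes [csin]. This is how
    adaptedness is translated into codes. *)
Lemma filtration_Sig a A : filtration P W a A -> Sig P (past_codes V (lpast a)) A.
Proof.
move=> FA; have alg := past_alg a; have alg1 := past_alg1 a.
apply: (Sig_sub_sigma alg alg1 _ FA) => {A FA} A [[mA A0]|[phi [Cphi [B [hphi mB ->]]]]].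
  split=> //; split=> [|e e0]; first exact: measurable_indic.
  exists (ev [::]); first by exists [::].
  rewrite (_ : (fun x => _) = \1_A); last by apply/funext => w; rewrite /ev big_nil subr0.
  rewrite /sqn (_ : (fun x => _) = fun x => (\1_A x)%:E); last first.
    by apply/funext => x; rewrite indicE; case: (_ \in _); rewrite ?expr1n// expr0n.
  have -> : (\int[P]_x (\1_A x)%:E = 0)%E by rewrite integral_indic// setIT; exact: A0.
  by rewrite lee_fin ltW.
have rep : represents (hilbert_of gam Cphi) phi.
  rewrite /represents /= (_ : (fun n => _) = cst 0%E); first exact: cvg_cst.
  apply/funext => n; rewrite (_ : phi \- phi = cst 0) ?noise_norm20//.
  by apply/funext => p /=; rewrite subrr.
pose v := Rvec (Cc_L2 Cphi) (Cc_tsupp Cphi) rep.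
have pv : past a v.
  move=> p ap; apply/eqP; apply: contraTT ap => pp; rewrite -leNgt; apply: hphi.
  exact: subset_closure.
suff : L2cl P (past_codes V (lpast a)) (V v) by move/(Sig_L2cl alg alg1)/(_ _ mB).
have Lv := L2_W gV v; split=> [|e e0]; first by case: Lv.
have [N HN] := l2cvg_sinr Lv e0; exists (ev (csin N [:: (1, v)])); first by exists (csin N [:: (1, v)]).
rewrite sqnBC; have := HN N (leqnn N); congr (sqn _ _ <= _)%E.
by apply/funext => w; rewrite ev_sin lin1.
Qed.

Lemma filtration_L2cl a (X : T -> R) : (forall B, measurable B -> filtration P W a (X @^-1` B)) -> bdd X ->
  L2cl P (past_codes V (lpast a)) X.
Proof.
move=> hX bX; have H B : measurable B -> Sig P (past_codes V (lpast a)) (X @^-1` B).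
  by move=> /hX; exact: filtration_Sig.
apply: (L2cl_of_Sig (past_alg a) (past_alg1 a) H).
by apply: sqn_bdd_lty => //; exact: Sig_meas H.
Qed.

Lemma sqn_tensor (X : T -> R) (f : ST -> R) : measurable_fun setT X -> L2 mst f ->
  sqn mTS (fun z => X z.1 * f z.2)%R = (sqn P X * sqn mst f)%E.
Proof.
move=> mX Lf; have [mf _] := Lf.
have mXf : measurable_fun setT (fun z : T * ST => ((X z.1 * f z.2) ^+ 2)%:E).
  apply: measurable_sq; apply: measurable_funM; first exact: (measurableT_comp mX measurable_fst).
  exact: (measurableT_comp mf measurable_snd).
rewrite /sqn tonelli1//; last by move=> z; rewrite lee_fin sqr_ge0.
rewrite -!/(sqn _ _) (sqn_ip Lf) muleC -ge0_integralZl_EFin ?ip_ge0//; last 2 first.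
- by move=> w _; rewrite lee_fin sqr_ge0.
- exact: measurable_sq.
apply: eq_integral => w _; rewrite -(sqn_ip Lf) muleC -ge0_integralZl_EFin ?sqr_ge0//; last 2 first.
- by move=> p _; rewrite lee_fin sqr_ge0.
- exact: measurable_sq.
by apply: eq_integral => p _; rewrite exprMn EFinM.
Qed.

Section elementary.
Local Notation elementary := (elementary P W).
Implicit Types (el : elementary) (L : seq elementary).

Definition el_fun el : ST -> R := \1_(`]el_start el, el_end el] `*` el_set el).

Lemma el_fun_future el p : p.1 <= el_start el -> el_fun el p = 0.
Proof.
by move=> h; rewrite /el_fun indicE memNset// => -[]; rewrite /= in_itv/= ltNge h.
Qed.

Lemma el_fun_tsupp el : tsupp (el_fun el).
Proof. by move=> p p0; rewrite el_fun_future//; case/andP: (el_time el) => h _; exact: le_trans (ltW p0) h. Qed.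

Lemma measurable_el_fun el : measurable_fun setT (el_fun el).
Proof. by apply: measurable_indic; apply: measurableX => //; case: (el_setP el). Qed.

Lemma L2_el_fun el : L2 mst (el_fun el).
Proof.
apply: bbs_L2; split; [exact: measurable_el_fun|exact: indic_bdd|].
have [_ [M [_ HM]]] := el_setP el; exists (Num.max (el_end el) (M + 1)) => p hp.
rewrite /el_fun indicE memNset// => -[]; rewrite /= in_itv/= => /andP[h1 h2] h3.
move: hp; rewrite ltNge st_norm_le => /negP[]; apply/andP; split.
  rewrite ger0_norm ?le_max ?h2//; case/andP: (el_time el) => h _; exact: ltW (le_lt_trans h h1).
by rewrite le_max; apply/orP; right; apply: (HM _ _ _ h3); rewrite ltrDl.
Qed.

Lemma measurable_el_coef el : measurable_fun setT (el_coef el).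
Proof.
move=> _ B mB; rewrite setTI; exact: (filtration_Sig (@el_past _ _ _ _ _ _ _ el _ mB)).1.
Qed.

(** A single code of the past, close to the coefficient, serves both purposes. Its error enters the
    integral with the factor [4 qcov v v] by [sqn_past], and the process with the squared norm of
    the deterministic function; [q] exceeds both. *)
Lemma approx_elementary el (r : R) : 0 < r -> exists e,
  (sqn P (fun w => el_coef el w * W (el_vec el) w - ev (ce_c e) w * V (ce_v e) w)%R <= r%:E)%E /\
  (sqn mTS (fun z => el_coef el z.1 * el_fun el z.2 - ev (ce_c e) z.1 * rv_f (ce_v e) z.2)%R <= r%:E)%E.
Proof.
move=> r0; pose v := Rvec (L2_el_fun el) (el_fun_tsupp el) (el_vecP el).
have fv : future (el_start el) v by move=> p; exact: el_fun_future.
have X_L2cl := filtration_L2cl (@el_past _ _ _ _ _ _ _ el) (el_bounded el).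
pose q := 4 * qcov P V v v + ip mst (el_fun el) (el_fun el) + 1.
have q0 : 0 <= qcov P V v v by exact: ip_ge0.
have i0 : 0 <= ip mst (el_fun el) (el_fun el) by exact: ip_ge0.
have q1 : 0 < q by rewrite /q ltr_wpDl// addr_ge0// mulr_ge0.
have [_ [c pc ->] hc] := X_L2cl.2 _ (divr_gt0 r0 q1).
have [a0 _] := andP (el_time el); exists (Celt a0 pc fv) => /=.
have mX := measurable_el_coef el; have mc := measurable_ev gV c.
have unc l : lpast (el_start el) l -> uncorrelated P V v l by exact: (lpast_uncorrelated gam_ge0 gam_L1 hW fv).
have bnd (k : R) : 0 <= k -> k <= q -> (k%:E * sqn P (fun w => el_coef el w - ev c w)%R <= r%:E)%E.
  move=> k0 kq; apply: le_trans (lee_wpmul2l _ hc) _; first by rewrite lee_fin.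
  by rewrite -EFinM lee_fin mulrCA ger_pMr// ler_pdivrMr// mul1r.
split.
- rewrite (_ : (fun w => _) = fun w => (el_coef el w - ev c w) * V v w); last by apply/funext => w; rewrite mulrBl.
  apply: le_trans (sqn_past gV _ _) _.
  + by apply: L2cl_sub X_L2cl => _ [c' pc' ->]; exists c' => //; exact: terms_sub unc _.
  + exact: terms_sub unc pc.
  + by apply: bnd; rewrite ?mulr_ge0// /q -addrA lerDl addr_ge0.
rewrite (_ : (fun z => _) = fun z => (el_coef el z.1 - ev c z.1) * el_fun el z.2); last by apply/funext => z; rewrite mulrBl.
rewrite (sqn_tensor (X := fun w => el_coef el w - ev c w)); [|exact: measurable_funB|exact: L2_el_fun].
rewrite (sqn_ip (L2_el_fun el)) muleC; apply: bnd => //; by rewrite /q -addrA addrCA lerDl addr_ge0// mulr_ge0.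
Qed.

Lemma measurable_simple L : measurable_fun setT (fun z : T * ST => simple_process L z.2.1 z.2.2 z.1).
Proof.
rewrite (_ : (fun z => _) = fun z => \sum_(el <- L) (fun el z => el_coef el z.1 * el_fun el z.2) el z); last first.
  by apply/funext => -[w [s y]].
apply: measurable_sum => el; apply: measurable_funM.
  exact: (measurableT_comp (measurable_el_coef el) measurable_fst).
exact: (measurableT_comp (measurable_el_fun el) measurable_snd).
Qed.

Lemma measurable_simple_integral L : measurable_fun setT (simple_integral L).
Proof.
rewrite (_ : simple_integral L = fun w => \sum_(el <- L) (fun el w => el_coef el w * W (el_vec el) w) el w)//.
apply: measurable_sum => el; apply: measurable_funM; first exact: measurable_el_coef.
by case: (isonormal_gaussian hW) => h _; exact: h.
Qed.

Lemma approx_simple L (r : R) : 0 < r -> exists S,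
  (sqn P (fun w => simple_integral L w - isum W S w)%R <= r%:E)%E /\
  (sqn mTS (fun z => simple_process L z.2.1 z.2.2 z.1 - spro W S z.2 z.1)%R <= r%:E)%E.
Proof.
elim: L r => [|el L IH] r r0.
  exists [::]; split; rewrite /sqn; under eq_integral do rewrite ?/simple_integral ?/isum ?/simple_process ?/spro !big_nil subrr expr0n/=;
    by rewrite integral0 lee_fin ltW.
have r4 : 0 < r / 4 by rewrite divr_gt0.
have [S [h1 h2]] := IH _ r4; have [e [h3 h4]] := approx_elementary el r4.
exists (e :: S).
have le4 : (2%:E * (r / 4)%:E + 2%:E * (r / 4)%:E <= r%:E)%E by rewrite -!EFinM -EFinD lee_fin; lra.
have [mi _] := L2_isum hW S; have [me _] := L2_celt hW e.
have mel : measurable_fun setT (fun w => el_coef el w * W (el_vec el) w).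
  by apply: measurable_funM; [exact: measurable_el_coef|case: (isonormal_gaussian hW) => h _; exact: h].
split.
- rewrite (_ : (fun w => _) = fun w => (el_coef el w * W (el_vec el) w - ev (ce_c e) w * V (ce_v e) w) +
     (simple_integral L w - isum W S w)); last first.
    by apply/funext => w; rewrite /simple_integral /isum !big_cons; ring.
  apply: le_trans (sqnD _ _ _) _; [exact: measurable_funB| |].
    by apply: measurable_funB => //; exact: measurable_simple_integral.
  by apply: le_trans (leeD (lee_wpmul2l _ h3) (lee_wpmul2l _ h1)) _.
have m1 : measurable_fun setT (fun z : T * ST => el_coef el z.1 * el_fun el z.2).
  apply: measurable_funM; first exact: (measurableT_comp (measurable_el_coef el) measurable_fst).
  exact: (measurableT_comp (measurable_el_fun el) measurable_snd).
have m2 : measurable_fun setT (fun z : T * ST => ev (ce_c e) z.1 * rv_f (ce_v e) z.2).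
  apply: measurable_funM; first exact: (measurableT_comp (measurable_ev gV (ce_c e)) measurable_fst).
  by apply: measurableT_comp measurable_snd; case: (rv_L2 (ce_v e)).
rewrite (_ : (fun z => _) = fun z : T * ST => (el_coef el z.1 * el_fun el z.2 - ev (ce_c e) z.1 * rv_f (ce_v e) z.2) +
     (simple_process L z.2.1 z.2.2 z.1 - spro W S z.2 z.1)); last first.
  by apply/funext => -[w [s y]]; rewrite /simple_process /spro !big_cons /el_fun /=; ring.
apply: le_trans (sqnD _ _ _) _; [exact: measurable_funB| |].
  by apply: measurable_funB; [exact: measurable_simple|exact: (measurable_spro hW)].
by apply: le_trans (leeD (lee_wpmul2l _ h4) (lee_wpmul2l _ h2)) _.
Qed.

End elementary.
End approximation.

(** * Predictable processes *)

Section predictable.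
Context {R : realType} {d : nat} {disp : measure_display} {T : measurableType disp}.
Variable P : probability T R.
Local Notation E := 'rV[R]_d.
Local Notation leb := (@lebesgue_measure R).
Local Notation lam := (@lebesgue_rV R d).
Local Notation ST := (measurableTypeR R * E)%type.
Local Notation mst := (prod_sf leb lam).
Local Notation mTS := (prod_sf P mst).
Variable gam : E -> \bar R.
Hypothesis gam_ge0 : forall x, (0 <= gam x)%E.
Hypothesis gam_L1 : lam.-integrable setT gam.
Variable W : hilbert gam -> T -> R.
Hypothesis hW : isonormal P W.
Local Notation V := (WV W).
Local Notation ev := (ev V).
Local Notation gV := (WV_gaussian hW).
Local Notation spro := (spro W).
Variable n : R.
Implicit Types (S : seq (celt gam)) (e : celt gam).

(** Time 0 is left out so that the indicator of the box vanishes up to the start 0, as a [celt]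
    demands; thus the constant 1 on the box is a sum over codes. *)
Definition pbox2 : set ST := [set p | 0 < p.1 /\ `|p| <= n].
Definition pbox : set (T * ST) := setT `*` pbox2.

Lemma measurable_pbox2 : measurable pbox2.
Proof.
rewrite (_ : pbox2 = (fst @^-1` `]0, +oo[) `&` box n).
  apply: measurableI; last exact: measurable_box.
  by rewrite -[X in measurable X]setTI; apply: measurable_fst.
by apply/seteqP; split => p; rewrite /pbox2 /= in_itv/= andbT.
Qed.

Lemma measurable_pbox : measurable pbox.
Proof. by apply: measurableX => //; exact: measurable_pbox2. Qed.

Lemma pbox2_lty : (mst pbox2 < +oo)%E.
Proof.
apply: le_lt_trans (box_lty (R := R) (d := d) n); apply: le_measure; rewrite ?inE.
- exact: measurable_pbox2.
- exact: measurable_box.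
- by move=> p [].
Qed.

Lemma pbox_lty : (mTS pbox < +oo)%E.
Proof.
rewrite /= /prod_measure product_measure1E//; last exact: measurable_pbox2.
by rewrite [X in (X * _)%E](_ : _ = 1%E) ?mul1e ?pbox2_lty//; exact: probability_setT.
Qed.

Local Notation mP := (mres measurable_pbox pbox_lty).

Definition box_fun (f : ST -> R) := bdd f /\ forall p, ~ pbox2 p -> f p = 0.

Fixpoint box_seq S : Prop := if S is e :: S' then box_fun (rv_f (ce_v e)) /\ box_seq S' else True.

Definition pal : set (T * ST -> R) := [set f | exists2 S, box_seq S & f = fun z => spro S z.2 z.1].

Lemma box_seq_cat S S' : box_seq S -> box_seq S' -> box_seq (S ++ S').
Proof. by elim: S => //= e S IH [? ?] ?; split=> //; exact: IH. Qed.

Lemma spro_cons e S p w : spro (e :: S) p w = ev (ce_c e) w * rv_f (ce_v e) p + spro S p w.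
Proof. exact: big_cons. Qed.

Lemma spro_nil p w : spro [::] p w = 0.
Proof. exact: big_nil. Qed.

Lemma spro_cat S S' p w : spro (S ++ S') p w = spro S p w + spro S' p w.
Proof. exact: big_cat. Qed.

Lemma box_spro0 S p w : box_seq S -> ~ pbox2 p -> spro S p w = 0.
Proof.
move=> + hp; elim: S => [_|e S IH [[_ h1] h2]]; first exact: spro_nil.
by rewrite spro_cons h1// mulr0 add0r IH.
Qed.

Lemma celt_scale k e : exists2 e', rv_f (ce_v e') = rv_f (ce_v e) &
  forall w, ev (ce_c e') w = k * ev (ce_c e) w.
Proof.
exists (Celt (ce_ge0 e) (terms_scale k (ce_past e)) (@ce_future _ _ _ e)) => // w.
exact: ev_scale.
Qed.

(** The product starts at the later of the two times: both codes are in its past and the product of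
    the functions vanishes up to it. *)
Lemma celt_mul e e' : box_fun (rv_f (ce_v e)) -> box_fun (rv_f (ce_v e')) ->
  exists2 e'', box_fun (rv_f (ce_v e'')) &
  forall p w, ev (ce_c e'') w * rv_f (ce_v e'') p =
    (ev (ce_c e) w * rv_f (ce_v e) p) * (ev (ce_c e') w * rv_f (ce_v e') p).
Proof.
move=> [[M fM] f0] [[M' fM'] f0']; set f := rv_f (ce_v e) in fM f0 *; set f' := rv_f (ce_v e') in fM' f0' *.
have [mf _] := rv_L2 (ce_v e); have [mf' _] := rv_L2 (ce_v e').
have L : L2 mst (fun p => f p * f' p) by apply: L2Ml => //; [exists M|exact: rv_L2].
have ts : tsupp (fun p => f p * f' p) by move=> p p0; rewrite /f rv_ts// mul0r.
have [v fv] := exists_rvec gam_ge0 gam_L1 hW L ts.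
pose a := Num.max (ce_a e) (ce_a e').
have a0 : 0 <= a by rewrite le_max ce_ge0.
have pa : terms (lpast a) (cmul (ce_c e) (ce_c e')).
  apply: terms_mul; first exact: lpast_closed.
    by apply: terms_sub (ce_past e) => l; apply: lpast_le; rewrite le_max lexx.
  by apply: terms_sub (ce_past e') => l; apply: lpast_le; rewrite le_max lexx orbT.
have fa : future a v.
  move=> p; rewrite fv le_max => /orP[h|h]; first by rewrite /f ce_future// mul0r.
  by rewrite /f' ce_future// mulr0.
exists (Celt a0 pa fa) => /=.
  rewrite fv; split; last by move=> p hp; rewrite f0// mul0r.
  exists (M * M') => p; rewrite normrM ler_pM//.
by move=> p w; rewrite fv ev_mul; ring.
Qed.

Lemma pal_alg : is_alg pal.
Proof.
split.
- by move=> _ [S _ ->]; exact: (measurable_spro hW).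
- move=> _ [S hS ->]; elim: S hS => [_|e S IH [[/bddP[M M0 fM] _] /IH /bddP[N N0 HN]]].
    by exists 0 => z; rewrite spro_nil normr0.
  have [K K0 cK] := bddP (ev_bdd V (ce_c e)); exists (K * M + N) => z.
  rewrite spro_cons; apply: le_trans (ler_normD _ _) _; apply: lerD; last exact: HN.
  by rewrite normrM ler_pM.
- move=> _ _ [S hS ->] [S' hS' ->]; exists (S ++ S'); first exact: box_seq_cat.
  by apply/funext => z; rewrite spro_cat.
- move=> k _ [S hS ->]; elim: S hS => [_|e S IH [h1 /IH[S' hS' E']]].
    by exists [::] => //; apply/funext => z; rewrite !spro_nil mulr0.
  have [e' fe' ce'] := celt_scale k e; exists (e' :: S'); first by split=> //; rewrite fe'.
  apply/funext => z; have /(congr1 (@^~ z)) /= E1 := E'.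
  by rewrite !spro_cons mulrDr E1 fe' ce' mulrA.
- move=> _ _ [S hS ->] [S' hS' ->]; elim: S hS => [_|e S IH [h1 /IH[S1 hS1 E1]]].
    by exists [::] => //; apply/funext => z; rewrite !spro_nil mul0r.
  suff [S2 hS2 E2] : pal (fun z => ev (ce_c e) z.1 * rv_f (ce_v e) z.2 * spro S' z.2 z.1).
    exists (S2 ++ S1); first exact: box_seq_cat.
    apply/funext => z; have /(congr1 (@^~ z)) /= E3 := E1; have /(congr1 (@^~ z)) /= E4 := E2.
    by rewrite spro_cat -E3 -E4 spro_cons mulrDl.
  elim: S' hS' {IH S1 hS1 E1} => [_|e' S' IH' [h2 /IH'[S1 hS1 E1]]].
    by exists [::] => //; apply/funext => z; rewrite !spro_nil mulr0.
  have [e'' h'' E''] := celt_mul h1 h2; exists (e'' :: S1) => //.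
  apply/funext => z; have /(congr1 (@^~ z)) /= E3 := E1.
  by rewrite !spro_cons mulrDr E'' E3.
Qed.

Lemma box_rvec (B : set ST) a : measurable B -> 0 <= a -> (forall p, B p -> a < p.1) ->
  exists v : rvec gam, [/\ rv_f v = \1_(B `&` pbox2), future a v & box_fun (rv_f v)].
Proof.
move=> mB a0 Ba; have mBp : measurable (B `&` pbox2) by apply: measurableI => //; exact: measurable_pbox2.
have L : L2 mst (\1_(B `&` pbox2) : ST -> R).
  apply: bbs_L2; split; [exact: measurable_indic|exact: indic_bdd|exists n => p hp].
  by rewrite indicE memNset// => -[_ [_]]; rewrite leNgt hp.
have ft p : p.1 <= a -> (\1_(B `&` pbox2) : ST -> R) p = 0.
  by move=> h; rewrite indicE memNset// => -[/Ba]; rewrite ltNge h.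
have [v fv] := exists_rvec gam_ge0 gam_L1 hW L (fun p p0 => ft p (le_trans (ltW p0) a0)).
exists v; split=> //; first by move=> p; rewrite fv; exact: ft.
rewrite fv; split; first exact: indic_bdd.
by move=> p hp; rewrite indicE memNset// => -[].
Qed.

Lemma pal1 : L2cl mP pal (cst 1).
Proof.
have mB : measurable ([set p | 0 < p.1] : set ST).
  rewrite (_ : mkset _ = fst @^-1` `]0, +oo[); last by apply/seteqP; split => p; rewrite /= in_itv/= andbT.
  by rewrite -[X in measurable X]setTI; apply: measurable_fst.
have [v [fv futv bv]] := box_rvec mB (lexx 0) (fun p h => h).
have p1 : terms (lpast 0) (ccst (rvec gam) (1 : R)) by [].
apply: (L2cl_mres_eq pal_alg (f := fun z => spro [:: Celt (lexx 0) p1 futv] z.2 z.1)) => //.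
  by apply: (sub_L2cl _ pal_alg); eexists; last by [].
move=> z [_ hz]; rewrite spro_cons spro_nil /= ev_cst fv indicE mem_set ?mul1r ?addr0//.
by split => //; case: hz.
Qed.

Definition ppre (D : set (R * E * T)) : set (T * ST) := [set z | D (z.2.1, z.2.2, z.1)].

Lemma sqn_mres_le (h : T * ST -> R) : measurable_fun setT h -> (sqn mP h <= sqn mTS h)%E.
Proof.
move=> mh; rewrite sqn_mres//; apply: le_sqn => //.
  by apply: measurable_funM => //; apply: measurable_indic; exact: measurable_pbox.
by move=> z; rewrite indicE; case: (_ \in _); rewrite ?mul1r// mul0r normr0.
Qed.

(** On a generator the indicator is that of [F], a limit of codes of the past of [a], times a
    deterministic function that vanishes up to [a]. The error of the product is the product of the
    norms. *)
Lemma predictable_Sig D : predictable_sets P W D -> Sig mP pal (ppre D).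
Proof.
move: D; apply: smallest_sub.
  split=> [|S hS|F hF].
  - by rewrite (_ : ppre _ = set0)//; exact: (Sig0 pal_alg pal1).
  - by rewrite setTD; exact: (SigC pal_alg pal1 hS).
  - exact: (Sig_bigcup pal_alg pal1 hF).
move=> _ [a [b [A [F [/andP[a0 ab] mA FF ->]]]]].
have [mF clF] := filtration_Sig hW FF.
have mAB : measurable (`]a, b]%classic `*` A : set ST) by exact: measurableX.
have mD : measurable (ppre ((`]a, b] `*` A) `*` F)).
  rewrite (_ : ppre _ = F `*` (`]a, b]%classic `*` A)); first exact: measurableX.
  by apply/seteqP; split => -[w [s y]] /= => [[[h1 h2] h3]|[h3 [h1 h2]]].
split=> //.
have hB (p : ST) : (`]a, b]%classic `*` A) p -> a < p.1 by case; rewrite /= in_itv/= => /andP[].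
have [v [fv futv bv]] := box_rvec mAB a0 hB.
have [mf _] := rv_L2 v.
apply: (L2cl_mres_eq pal_alg (f := fun z => \1_F z.1 * rv_f v z.2)); last 2 first.
- exact: measurable_indic.
- move=> z [_ hz]; rewrite fv !indicE -natrM mulnb; congr (_%:R); congr nat_of_bool.
  apply/andP/idP => [[/set_mem h1 /set_mem[h2 _]]|/set_mem[h1 h2]]; first by rewrite inE; split.
  by rewrite !inE; split.
have mX : measurable_fun setT (fun z : T * ST => \1_F z.1 * rv_f v z.2).
  apply: measurable_funM; last exact: (measurableT_comp mf measurable_snd).
  by apply: (measurableT_comp _ measurable_fst); exact: measurable_indic.
split=> // r r0; have i0 : 0 <= ip mst (rv_f v) (rv_f v) by exact: ip_ge0.
have i1 : 0 < ip mst (rv_f v) (rv_f v) + 1 by rewrite ltr_wpDl.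
have [_ [c pc ->] hc] := clF.2 _ (divr_gt0 r0 i1).
pose S := [:: Celt a0 pc futv]; exists (fun z => spro S z.2 z.1); first by exists S.
have mS := measurable_spro hW S.
apply: le_trans (sqn_mres_le _) _; first exact: measurable_funB.
rewrite (_ : (fun z => _) = fun z => (\1_F z.1 - ev c z.1) * rv_f v z.2); last first.
  by apply/funext => z; rewrite /S spro_cons spro_nil addr0 mulrBl.
rewrite (@sqn_tensor _ _ _ _ P (fun w => \1_F w - ev c w) (rv_f v)); last 2 first.
- by apply: measurable_funB; [exact: measurable_indic|exact: (measurable_ev gV)].
- exact: rv_L2.
rewrite (sqn_ip (rv_L2 v)) muleC; apply: le_trans (lee_wpmul2l _ hc) _; first by rewrite lee_fin.
by rewrite -EFinM lee_fin mulrCA ger_pMr// ler_pdivrMr// mul1r lerDl.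
Qed.

Section process.
Variable Phi : R -> E -> T -> R.
Hypothesis pPhi : predictable P W Phi.

Definition ppos (z : T * ST) : R := if 0 < z.2.1 then Phi z.2.1 z.2.2 z.1 else 0.

Lemma ppos_Sig B : measurable B -> Sig mP pal (ppos @^-1` B).
Proof.
move=> mB; have H (C : set R) : measurable C -> Sig mP pal [set z | 0 < z.2.1 /\ C (Phi z.2.1 z.2.2 z.1)].
  by move=> /pPhi /predictable_Sig; congr (Sig _ _ _).
(* Predictability concerns positive times only. The value 0 at the other times adds them to the
   preimage if [B] contains 0, in which case the complement is used. *)
have [B0|nB0] := pselect (B 0).
  rewrite (_ : _ @^-1` _ = ~` [set z : T * ST | 0 < z.2.1 /\ (~` B) (Phi z.2.1 z.2.2 z.1)]).
    by apply: (SigC pal_alg pal1); apply: H; exact: measurableC.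
  apply/seteqP; split => z /=; rewrite /ppos; case: ifPn => h.
  - by move=> Bz [_].
  - by move=> _ [].
  - by move=> /not_andP[//|/contrapT].
  - by [].
rewrite (_ : _ @^-1` _ = [set z : T * ST | 0 < z.2.1 /\ B (Phi z.2.1 z.2.2 z.1)]); first exact: H.
apply/seteqP; split => z /=; rewrite /ppos; case: ifPn => h //; first by move=> [].
by case.
Qed.

Lemma measurable_ppos : measurable_fun setT ppos.
Proof. exact: (Sig_meas ppos_Sig). Qed.

Lemma approx_predictable k (r : R) : (forall z, n < `|(z.2 : R * E)| -> ppos z = 0) -> 0 <= k -> 0 < r ->
  exists S, (sqn mTS (fun z => clip k (ppos z) - spro S z.2 z.1)%R <= r%:E)%E.
Proof.
move=> h0 k0 r0.
have [mc hc] : L2cl mP pal (clip k \o ppos).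
  apply: (L2cl_comp_bdd pal_alg pal1 ppos_Sig (measurable_clip k) (M := k)) => x.
  exact: clip_le.
have [_ [S hS ->] h] := hc _ r0; exists S; move: h.
rewrite sqn_mres; last by apply: measurable_funB => //; exact: (measurable_spro hW).
apply: le_trans; rewrite le_eqVlt; apply/orP; left; apply/eqP; apply: eq_integral => z _.
rewrite indicE; have [hz|hz] := boolP (z \in pbox); first by rewrite mul1r.
have nz : ~ pbox2 z.2 by move=> h; move: hz; rewrite notin_setE; apply; split.
rewrite mul0r (box_spro0 _ hS nz) subr0 (_ : ppos z = 0) ?clip_id ?normr0//.
have [h|h] := ltP n `|(z.2 : R * E)|; first exact: h0.
by rewrite /ppos; case: ifP => // h1; case: nz.
Qed.

End process.
End predictable.

(** * Stochastic integrals as limits of sums over codes *)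

Section walsh.
Context {R : realType} {d : nat} {disp : measure_display} {T : measurableType disp}.
Variable P : probability T R.
Local Notation E := 'rV[R]_d.
Local Notation leb := (@lebesgue_measure R).
Local Notation lam := (@lebesgue_rV R d).
Local Notation ST := (measurableTypeR R * E)%type.
Local Notation ST2 := (measurableTypeR R * (E * E))%type.
Local Notation mst := (prod_sf leb lam).
Local Notation m3 := (prod_sf leb (prod_sf lam lam)).
Local Notation mTS := (prod_sf P mst).
Variable gam : E -> \bar R.
Hypothesis gam_ge0 : forall x, (0 <= gam x)%E.
Hypothesis gam_L1 : lam.-integrable setT gam.
Local Notation nenergy := (nenergy gam).
Local Notation wen := (wen P gam).

Lemma measurable_energy (f : ST -> R) : measurable_fun setT f -> (forall p, 0 <= f p) ->
  measurable_fun setT (fun s : measurableTypeR R => energy gam (fun y => f (s, y)) (fun z => f (s, z))).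
Proof.
move=> mf f0; have mF : measurable_fun setT (fun q : ST2 => (f (st1 q) * f (st2 q) * gam3 gam q)%:E).
  by apply/measurable_EFinP; exact: measurable_nenergy.
have F0 (q : ST2) : (0 <= (f (st1 q) * f (st2 q) * gam3 gam q)%:E)%E by rewrite lee_fin !mulr_ge0// gamr_ge0.
have := measurable_inner (prod_sf lam lam) mF F0; congr measurable_fun; apply/funext => s.
by rewrite energyE//; exact: measurable_pair1.
Qed.

Lemma walsh_wen (Psi : R -> E -> T -> R) (F : T * ST -> R) : measurable_fun setT F ->
  (forall z, 0 < z.2.1 -> F z = Psi z.2.1 z.2.2 z.1) -> (forall z, z.2.1 <= 0 -> F z = 0) ->
  walsh_norm2 P gam Psi = wen (fun z => `|F z|%R).
Proof.
move=> mF FP F0; apply: eq_integral => w _.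
pose f : ST -> R := fun p => `|F (w, p)|.
have mf : measurable_fun setT f by apply: measurableT_comp => //; exact: measurable_pair1.
have f0 p : 0 <= f p by exact: normr_ge0.
have me := measurable_energy mf f0.
have fE s : 0 < s -> (fun y => `|Psi s y w|) = fun y => f (s, y).
  by move=> s0; apply/funext => y; rewrite /f FP.
have pf : pt f = f by apply: pt_id => p p0; rewrite /f F0 ?normr0// ltW.
have nE : nenergy f f = noise_form gam f f by rewrite (ge0_noise_formE gam_ge0 gam_L1)// pf.
rewrite -[RHS]/(nenergy f f) nE /noise_form.
rewrite -[RHS]integral_itv_obnd_cbnd; last exact: measurable_funS me.
rewrite -integral_itv_obnd_cbnd.
  by apply: eq_integral => s; rewrite inE /= in_itv/= andbT => s0; rewrite fE.
apply: (eq_measurable_fun (fun s : R => energy gam (fun y => f (s, y)) (fun z => f (s, z)))).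
  by move=> s; rewrite inE /= in_itv/= andbT => s0; rewrite fE.
exact: measurable_funS me.
Qed.

(** In this form dominated convergence ([sqn_cvg0]) applies to the truncations of the process. *)
Lemma wen_sqn (F : T * ST -> R) : measurable_fun setT F -> (forall z, 0 <= F z) ->
  wen F = sqn (prod_sf P m3) (fun z => Num.sqrt (F (z.1, st1 z.2) * F (z.1, st2 z.2) * gam3 gam z.2)).
Proof.
move=> mF F0; have p0 (z : T * ST2) : 0 <= F (z.1, st1 z.2) * F (z.1, st2 z.2) * gam3 gam z.2.
  by rewrite !mulr_ge0// gamr_ge0.
rewrite /sqn (eq_integral (fun z : T * ST2 => (F (z.1, st1 z.2) * F (z.1, st2 z.2) * gam3 gam z.2)%:E)).
  by rewrite tonelli1//; apply/measurable_EFinP; exact: measurable_wen3.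
by move=> z _; rewrite sqr_sqrtr.
Qed.

Lemma clip_dist (k x : R) : 0 <= k -> `|x - clip k x| <= `|x|.
Proof.
move=> k0; have [h|h] := leP `|x| k; first by rewrite clip_id// subrr normr0.
have [x0|x0] := leP 0 x.
  move: h; rewrite (ger0_norm x0) => h; rewrite (clip_sat k0 (ltW h)) ger0_norm; last by rewrite subr_ge0 ltW.
  by rewrite lerBlDr lerDl.
move: h; rewrite (ltr0_norm x0) => h; rewrite /clip min_l; last by lra.
rewrite max_l; last by lra.
rewrite ler0_norm; lra.
Qed.

Lemma wen_clip (F : T * ST -> R) (r : R) : measurable_fun setT F -> (wen (fun z => `|F z|%R) < +oo)%E -> 0 < r ->
  exists K : nat, forall k : nat, (K <= k)%N -> (wen (fun z => `|F z - clip k%:R (F z)|%R) <= r%:E)%E.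
Proof.
move=> mF foo r0.
have mn (G : T * ST -> R) : measurable_fun setT G -> measurable_fun setT (fun z => `|G z|).
  by move=> mG; apply: measurableT_comp.
have mc k : measurable_fun setT (fun z => F z - clip k%:R (F z)).
  by apply: measurable_funB => //; exact: (measurableT_comp (measurable_clip _)).
have ms (G : T * ST -> R) : measurable_fun setT G ->
    measurable_fun setT (fun z : T * ST2 => Num.sqrt (G (z.1, st1 z.2) * G (z.1, st2 z.2) * gam3 gam z.2)).
  by move=> mG; apply: (measurableT_comp measurable_sqrtr); exact: measurable_wen3.
have ev0 (x : R) : `|x - clip k%:R x| @[k --> \oo] --> (0 : R).
  rewrite -(normr0 R) -(subrr x); apply: cvg_norm; apply: cvgB; first exact: cvg_cst.
  exact: cvg_clip.
have g0 z := gamr_ge0 gam_ge0 (z.2.2.1 - z.2.2.2 : E) : 0 <= gam3 gam (z : T * ST2).2.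
have [|||||K HK] := @sqn_cvg0 _ _ _ (prod_sf P m3)
   (fun k z => Num.sqrt (`|F (z.1, st1 z.2) - clip k%:R (F (z.1, st1 z.2))| *
                         `|F (z.1, st2 z.2) - clip k%:R (F (z.1, st2 z.2))| * gam3 gam z.2))
   (fun z => Num.sqrt (`|F (z.1, st1 z.2)| * `|F (z.1, st2 z.2)| * gam3 gam z.2)) _ _ _ _ _ _ r0.
- by move=> k; exact: (ms _ (mn _ (mc k))).
- exact: (ms _ (mn _ mF)).
- by rewrite -(wen_sqn (mn _ mF) (fun z => normr_ge0 _)).
- move=> k z; rewrite (ger0_norm (sqrtr_ge0 _)) (ger0_norm (sqrtr_ge0 _)) ler_wsqrtr//.
  by apply: ler_wpM2r => //; apply: ler_pM => //; exact: clip_dist.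
- move=> z; rewrite -(sqrtr0 R); apply: continuous_cvg; first exact: sqrt_continuous.
  rewrite [X in _ --> X](_ : 0 = 0 * 0 * gam3 gam z.2); last by rewrite !mul0r.
  by apply: cvgM; [apply: cvgM; exact: ev0|exact: cvg_cst].
by exists K => k /HK; rewrite -(wen_sqn (mn _ (mc k)) (fun z => normr_ge0 _)).
Qed.

Variable W : hilbert gam -> T -> R.
Hypothesis hW : isonormal P W.
Local Notation V := (WV W).
Implicit Types (S : seq (celt gam)).

Lemma seq_sub S S' : exists S'', (forall w, isum W S'' w = isum W S w - isum W S' w) /\
  (forall p w, spro W S'' p w = spro W S p w - spro W S' p w).
Proof.
pose neg (e : celt gam) := Celt (ce_ge0 e) (terms_scale (-1) (ce_past e)) (@ce_future _ _ _ e).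
exists (S ++ map neg S'); split=> [w|p w].
  rewrite /isum big_cat big_map /=; congr (_ + _); rewrite -sumrN; apply: eq_bigr => e _.
  by rewrite ev_scale mulN1r mulNr.
rewrite /spro big_cat big_map /=; congr (_ + _); rewrite -sumrN; apply: eq_bigr => e _.
by rewrite ev_scale mulN1r mulNr.
Qed.

(** [A] is small in L2, [B1] and [B2] in Walsh's norm only. The minimum [F'] keeps the intermediate
    process square integrable in space-time at each outcome, as [wen_mix] requires. *)
Lemma wen_split (F A B1 B2 : T * ST -> R) (r1 r2 r3 : R) : measurable_fun setT F -> measurable_fun setT A ->
  measurable_fun setT B1 -> measurable_fun setT B2 ->
  (forall w, L2 mst (fun p => F (w, p))) -> (forall w, tsupp (fun p => F (w, p))) ->
  (forall z, 0 <= F z) -> (forall z, 0 <= A z) -> (forall z, 0 <= B1 z) -> (forall z, 0 <= B2 z) ->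
  (forall z, F z <= A z + (B1 z + B2 z)) ->
  (sqn mTS A <= r1%:E)%E -> (wen B1 <= r2%:E)%E -> (wen B2 <= r3%:E)%E ->
  (wen F <= (2 * kap gam * r1 + 4 * r2 + 4 * r3)%:E)%E.
Proof.
move=> mF mA m1 m2 LF sF F0 A0 B10 B20 FA hA h1 h2.
pose F' z := Num.min (F z) (B1 z + B2 z).
have mF' : measurable_fun setT F' by apply: measurable_minr => //; exact: measurable_funD.
have F'0 z : 0 <= F' z by rewrite le_min F0 addr_ge0.
have LF' w : L2 mst (fun p => F' (w, p)).
  apply: (L2_le _ (LF w)); first exact: measurable_pair1.
  by move=> p; rewrite !ger0_norm// ge_min lexx.
have sF' w : tsupp (fun p => F' (w, p)) by move=> p p0; rewrite /F' sF// min_l// addr_ge0.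
have w1 : (wen F <= 2%:E * wen A + 2%:E * wen F')%E.
  apply: (wen_mix gam_ge0 gam_L1 hW) => // z.
  by rewrite -lerBlDl le_min !lerBlDl lerDr A0 FA.
have w2 : (wen F' <= 2%:E * wen B1 + 2%:E * wen B2)%E.
  by apply: (wen_mix gam_ge0 gam_L1 hW) => // z; rewrite ge_min lexx orbT.
have wA : (wen A <= (kap gam * r1)%:E)%E.
  apply: le_trans (wen_kap P gam_ge0 gam_L1 mA A0) _.
  by rewrite EFinM lee_wpmul2l// lee_fin kap_ge0.
have wF' : (wen F' <= (2 * r2 + 2 * r3)%:E)%E.
  by apply: le_trans w2 _; rewrite (EFinD (2 * r2)) (EFinM 2 r2) (EFinM 2 r3); apply: leeD; apply: lee_wpmul2l.
apply: le_trans w1 _; apply: le_trans (leeD (lee_wpmul2l _ wA) (lee_wpmul2l _ wF')) _ => //.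
by rewrite -!EFinM -EFinD lee_fin; lra.
Qed.

(** The definition of the integral provides simple processes close to [Phi] in Walsh's norm, and
    [S'] is close to one of them in L2. On the other hand [S] is close in L2 to a truncation of
    [Phi], itself close to [Phi] in Walsh's norm. The isometry applied to the difference of [S'] and
    [S] shows that the integral of [S] is also close to [I]. *)
Lemma walsh_approx (Phi : R -> E -> T -> R) (I : T -> R) (n r : R) :
  walsh_integral P W Phi I -> (forall z, n < `|(z.2 : R * E)| -> ppos Phi z = 0) -> 0 < r ->
  exists K : nat, forall k : nat, (K <= k)%N -> exists S,
    (sqn P (fun w => I w - isum W S w)%R <= r%:E)%E /\
    (sqn mTS (fun z => clip k%:R (ppos Phi z) - spro W S z.2 z.1)%R <= r%:E)%E.
Proof.
move=> [pPhi foo mI [L_ [cw ci]]] supp r0.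
have mPhi : measurable_fun setT (ppos Phi) := measurable_ppos gam_ge0 gam_L1 hW n pPhi.
have kap0 := kap_ge0 gam_ge0.
(* A generous choice: the errors add up to [(38 + 32 kap gam) de]. *)
pose de := r / (100 * (kap gam + 1)).
have k1 : 0 < kap gam + 1 by rewrite ltr_wpDl.
have de0 : 0 < de by rewrite divr_gt0// mulr_gt0.
have hde : 100 * kap gam * de + 100 * de = r.
  rewrite /de; have kN : kap gam + 1 != 0 by rewrite gt_eqF.
  by field.
have foo' : (wen (fun z => `|ppos Phi z|%R) < +oo)%E.
  rewrite -(walsh_wen (Psi := Phi))// => z z0; first by rewrite /ppos z0.
  by rewrite /ppos ltNge z0.
have [K HK] := wen_clip mPhi foo' de0.
have [N1 H1] := cvge0_le cw de0; have [N2 H2] := cvge0_le ci de0.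
pose L := L_ (maxn N1 N2).
have {}H1 := H1 _ (leq_maxl N1 N2); have {}H2 : (sqn P (fun w => simple_integral L w - I w)%R <= de%:E)%E.
  exact: H2 _ (leq_maxr N1 N2).
pose sp (z : T * ST) := simple_process L z.2.1 z.2.2 z.1.
have msp : measurable_fun setT sp := measurable_simple hW L.
have {}H1 : (wen (fun z => `|sp z - ppos Phi z|%R) <= de%:E)%E.
  rewrite -(walsh_wen (Psi := fun s y w => simple_process L s y w - Phi s y w))//.
  - exact: measurable_funB.
  - by move=> z z0; rewrite /ppos z0.
  - move=> z z0; rewrite /ppos ltNge z0 subr0 /sp /simple_process big1// => el _.
    rewrite -[X in _ * X]/(el_fun el (z.2.1, z.2.2)) el_fun_future ?mulr0//.
    by case/andP: (el_time el) => h _; exact: le_trans z0 h.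
have [S' [h3 h4]] := approx_simple gam_ge0 gam_L1 hW L de0.
exists K => k Kk; have {}HK := HK k Kk.
have [S hS] := approx_predictable gam_ge0 gam_L1 hW pPhi supp (ler0n _ k) de0.
exists S; split; last first.
  apply: le_trans hS _; rewrite lee_fin -hde -[X in X <= _]mul1r.
  by have := mulr_ge0 kap0 (ltW de0); lra.
have [S'' [E1 E2]] := seq_sub S' S.
have mS := measurable_spro hW S; have mS' := measurable_spro hW S'; have mS'' := measurable_spro hW S''.
have mn (G : T * ST -> R) : measurable_fun setT G -> measurable_fun setT (fun z => `|G z|).
  by move=> mG; apply: measurableT_comp.
have mc : measurable_fun setT (fun z => clip k%:R (ppos Phi z)) by exact: (measurableT_comp (measurable_clip _)).
have hw : (sqn P (isum W S'') <= (2 * kap gam * (4 * de) + 4 * de + 4 * de)%:E)%E.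
  apply: le_trans (isum_le_wen gam_ge0 gam_L1 hW S'') _.
  apply: (@wen_split _ (fun z => `|sp z - spro W S' z.2 z.1| + `|clip k%:R (ppos Phi z) - spro W S z.2 z.1|)
    (fun z => `|sp z - ppos Phi z|) (fun z => `|ppos Phi z - clip k%:R (ppos Phi z)|)) => //.
  - exact: mn.
  - by apply: measurable_funD; apply: mn; exact: measurable_funB.
  - by apply: mn; exact: measurable_funB.
  - by apply: mn; exact: measurable_funB.
  - move=> w; have Lw := L2_spro_st W S'' w; apply: (L2_le _ Lw); last by move=> p; rewrite normr_id.
    by apply: measurableT_comp => //; case: Lw.
  - by move=> w p p0; rewrite tsupp_spro ?normr0.
  - move=> z; rewrite E2.
    have -> : spro W S' z.2 z.1 - spro W S z.2 z.1 = - (sp z - spro W S' z.2 z.1) +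
      (clip k%:R (ppos Phi z) - spro W S z.2 z.1) + ((sp z - ppos Phi z) + (ppos Phi z - clip k%:R (ppos Phi z))) by ring.
    apply: le_trans (ler_normD _ _) _; apply: lerD; last exact: ler_normD.
    by apply: le_trans (ler_normD _ _) _; rewrite normrN.
  - apply: le_trans (sqnD _ _ _) _; [by apply: mn; exact: measurable_funB|by apply: mn; exact: measurable_funB|].
    have sn (G : T * ST -> R) : sqn mTS (fun z => `|G z|)%R = sqn mTS G.
      by apply: eq_integral => z _; rewrite real_normK// num_real.
    rewrite !sn; apply: le_trans (leeD (lee_wpmul2l _ h4) (lee_wpmul2l _ hS)) _ => //.
    by rewrite -!EFinM -EFinD lee_fin; lra.
have m1 := measurable_simple_integral hW L; have [m2 _] := L2_isum hW S; have [m3' _] := L2_isum hW S'.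
have hw' : (sqn P (fun w => isum W S' w - isum W S w)%R <= (2 * kap gam * (4 * de) + 4 * de + 4 * de)%:E)%E.
  by move: hw; congr (sqn _ _ <= _)%E; apply/funext => w; rewrite E1.
apply: le_trans (sqnB _ mI m1 m2) _.
rewrite sqnBC in H2.
pose b := 2 * kap gam * (4 * de) + 4 * de + 4 * de.
have hb : (sqn P (fun w => simple_integral L w - isum W S w)%R <= (2 * de + 2 * b)%:E)%E.
  apply: le_trans (sqnB _ m1 m3' m2) _; rewrite (EFinD (2 * de)) (EFinM 2 de) (EFinM 2 b).
  by apply: leeD; apply: lee_wpmul2l.
apply: le_trans (leeD (lee_wpmul2l _ H2) (lee_wpmul2l _ hb)) _ => //.
rewrite -(EFinM 2 de) -(EFinM 2 (_ + _)) -EFinD lee_fin -hde /b.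
by have := mulr_ge0 kap0 (ltW de0); lra.
Qed.

End walsh.

(** * Comparison of an integral with a translated one *)

Section near_step.
Context {R : realType} {d : nat} {disp : measure_display} {T : measurableType disp}.
Variable P : probability T R.
Local Notation E := 'rV[R]_d.
Local Notation leb := (@lebesgue_measure R).
Local Notation lam := (@lebesgue_rV R d).
Local Notation ST := (measurableTypeR R * E)%type.
Local Notation mst := (prod_sf leb lam).
Local Notation mTS := (prod_sf P mst).
Variable gam : E -> \bar R.
Hypothesis gam_ge0 : forall x, (0 <= gam x)%E.
Hypothesis gam_L1 : lam.-integrable setT gam.
Local Notation nenergy := (nenergy gam).

Lemma measurable_slice_sqn (F : T * ST -> R) : measurable_fun setT F ->
  measurable_fun setT (fun p => sqn P (fun w => F (w, p))).
Proof.
move=> mF; apply: (measurable_fun_fubini_tonelli_G (fun z => (F z ^+ 2)%:E)).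
  exact: measurable_sq.
by move=> z; rewrite lee_fin sqr_ge0.
Qed.

Lemma sqn_slices (F : T * ST -> R) : measurable_fun setT F ->
  sqn mTS F = (\int[mst]_p sqn P (fun w => F (w, p)))%E.
Proof.
move=> mF; have m2 : measurable_fun setT (fun z => (F z ^+ 2)%:E) by exact: measurable_sq.
have p2 z : (0 <= (F z ^+ 2)%:E)%E by rewrite lee_fin sqr_ge0.
by rewrite /sqn (tonelli2 m2 p2).
Qed.

Variable W : hilbert gam -> T -> R.
Hypothesis hW : isonormal P W.
Local Notation V := (WV W).
Local Notation ev := (ev V).
Local Notation gV := (WV_gaussian hW).
Local Notation tr := (tr gam_ge0 gam_L1 hW).
Local Notation tr_celt := (tr_celt gam_ge0 gam_L1 hW).
Local Notation near y := (near P V (tr y)).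
Implicit Types (S : seq (celt gam)).

Lemma L2_stdev S : L2 mst (stdev P W S).
Proof.
split; first exact: (measurable_stdev hW).
have mS := measurable_spro hW S.
have -> : sqn mst (stdev P W S) = sqn mTS (fun z => spro W S z.2 z.1).
  rewrite sqn_slices//; apply: eq_integral => p _.
  by rewrite /stdev sqr_sqrtr ?ip_ge0// -(sqn_ip (L2_spro hW S p)).
elim: S {mS} => [|e S IH].
  by rewrite /sqn; under eq_integral do rewrite spro_nil expr0n/=; rewrite integral0 ltry.
have me : measurable_fun setT (fun z : T * ST => ev (ce_c e) z.1 * rv_f (ce_v e) z.2).
  apply: measurable_funM; first exact: (measurableT_comp (measurable_ev gV (ce_c e)) measurable_fst).
  by apply: measurableT_comp measurable_snd; case: (rv_L2 (ce_v e)).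
rewrite (_ : (fun z => _) = fun z => ev (ce_c e) z.1 * rv_f (ce_v e) z.2 + spro W S z.2 z.1).
  apply: le_lt_trans (sqnD _ me (measurable_spro hW S)) _.
  rewrite (sqn_tensor P (measurable_ev gV (ce_c e)) (rv_L2 (ce_v e))).
  have L1 := L2_ev gV (ce_c e); rewrite (sqn_ip L1) (sqn_ip (rv_L2 (ce_v e))).
  by rewrite lte_add_pinfty// lte_mul_pinfty// -EFinM ltry.
by apply/funext => z; rewrite spro_cons.
Qed.

(** At a fixed point a sum over codes is a code, so [near_dist] can be applied point by point;
    translating it amounts to evaluating the translated sum at the translated point. *)
Lemma spro_code y S p : exists c, (forall w, ev c w = spro W S (p.1, p.2 - y) w) /\
  forall w, ev (cmap (tr y) c) w = spro W (map (tr_celt y) S) p w.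
Proof.
elim: S => [|e S [c [h1 h2]]].
  by exists [::]; split=> w; rewrite spro_nil /ev big_nil.
exists (cscale (rv_f (ce_v e) (p.1, p.2 - y)) (ce_c e) ++ c); split=> w.
  by rewrite ev_cat ev_scale h1 spro_cons mulrC.
by rewrite cmap_cat cmap_scale ev_cat ev_scale h2 /= spro_cons /= rv_f_tr /shf mulrC.
Qed.

(** With [S] close to [Phi], [S'] close to [Phi'] and [tS] the translate of [S], the standard
    deviation of the difference of [S'] and [tS] is at most [g + b] at each point, where [g] is a
    small approximation error. Then [isum_le_stdev] bounds the distance of their integrals by [2 Nb]
    up to a small error. The triangle inequality for squares, used twice on the way from [I'] to the
    code, turns 2 into 8. *)
Lemma near_step y (Phi Phi' : R -> E -> T -> R) (I I' : T -> R) (n Nb : R) (b : ST -> R) :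
  walsh_integral P W Phi I -> walsh_integral P W Phi' I' ->
  (forall z, n < `|(z.2 : R * E)| -> ppos Phi z = 0) ->
  (forall z, n < `|(z.2 : R * E)| -> ppos Phi' z = 0) ->
  measurable_fun setT b -> (forall p, 0 <= b p) -> (nenergy b b <= Nb%:E)%E ->
  (forall (k : nat) (p : ST), near y (fun w => clip k%:R (ppos Phi (w, (p.1, p.2 - y))))
    (fun w => clip k%:R (ppos Phi' (w, p))) (b p ^+ 2 / 12)) ->
  near y I I' (8 * Nb).
Proof.
move=> wI wI' supp supp' mb b0 hb hnear.
have [pPhi _ mI _] := wI; have [pPhi' _ mI' _] := wI'; split=> // e e0.
have mPhi : measurable_fun setT (ppos Phi) := measurable_ppos gam_ge0 gam_L1 hW n pPhi.
have mPhi' : measurable_fun setT (ppos Phi') := measurable_ppos gam_ge0 gam_L1 hW n pPhi'.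
have kap0 := kap_ge0 gam_ge0; have k1 : 0 < kap gam + 1 by rewrite ltr_wpDl.
pose r := e / (100 * (kap gam + 1)).
have r0 : 0 < r by rewrite divr_gt0// mulr_gt0.
have hr : 100 * kap gam * r + 100 * r = e.
  rewrite /r; have kN : kap gam + 1 != 0 by rewrite gt_eqF.
  by field.
have [K1 H1] := walsh_approx gam_ge0 gam_L1 hW wI supp r0.
have [K2 H2] := walsh_approx gam_ge0 gam_L1 hW wI' supp' r0.
pose k := maxn K1 K2; have [S [hS1 hS2]] := H1 k (leq_maxl _ _); have [S' [hS'1 hS'2]] := H2 k (leq_maxr _ _).
pose tS := map (tr_celt y) S; have [S'' [E1 E2]] := seq_sub W S' tS.
have [_ _ /(_ r r0)[c [hc1 hc2]]] := near_isum gam_ge0 gam_L1 hW y S; rewrite !add0r in hc1 hc2.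
have mcl (F : T * ST -> R) : measurable_fun setT F -> measurable_fun setT (fun z => clip k%:R (F z)).
  by move=> mF; exact: (measurableT_comp (measurable_clip _)).
have sl (F : T * ST -> R) p : measurable_fun setT F -> measurable_fun setT (fun w => F (w, p)).
  by move=> mF; apply: (measurableT_comp mF); exact: measurable_fun_pair.
pose F' (z : T * ST) := clip k%:R (ppos Phi' z) - spro W S' z.2 z.1.
pose F (z : T * ST) := clip k%:R (ppos Phi z) - spro W S z.2 z.1.
have mF' : measurable_fun setT F' by apply: measurable_funB; [exact: mcl|exact: measurable_spro hW _].
have mF : measurable_fun setT F by apply: measurable_funB; [exact: mcl|exact: measurable_spro hW _].
have fin (Psi : T * ST -> R) U p : measurable_fun setT Psi ->
    sqn P (fun w => clip k%:R (Psi (w, p)) - spro W U p w)%R \is a fin_num.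
  move=> mPsi; rewrite ge0_fin_numE ?sqn_ge0//.
  apply: (L2B (m := P) _ (L2_spro hW U p)).2; apply: bdd_L2.
    by apply: (measurableT_comp (measurable_clip _)); exact: sl.
  by exists k%:R => w; exact: clip_le.
pose a' p := fine (sqn P (fun w => F' (w, p))); pose a p := fine (sqn P (fun w => F (w, p))).
have a'E p : (a' p)%:E = sqn P (fun w => F' (w, p)) by rewrite fineK//; exact: fin.
have aE p : (a p)%:E = sqn P (fun w => F (w, p)) by rewrite fineK//; exact: fin.
have a'0 p : 0 <= a' p by rewrite -lee_fin a'E sqn_ge0.
have a0 p : 0 <= a p by rewrite -lee_fin aE sqn_ge0.
have ma' : measurable_fun setT a'.
  by apply/measurable_EFinP; apply: eq_measurable_fun (measurable_slice_sqn mF') => p _ /=; rewrite a'E.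
have ma : measurable_fun setT a.
  by apply/measurable_EFinP; apply: eq_measurable_fun (measurable_slice_sqn mF) => p _ /=; rewrite aE.
(* By [sqnB] and [near_dist], the squared standard deviation at [p] is at most [2 a' p + 2 (4 shf y
   a p + 6 (b p ^+ 2 / 12))]. The 12 in the hypothesis makes the last term equal to [b p ^+ 2]. *)
pose g p := Num.sqrt (2 * a' p + 8 * shf y a p).
have g20 p : 0 <= 2 * a' p + 8 * shf y a p by rewrite addr_ge0// mulr_ge0//; exact: a0.
have mg : measurable_fun setT g.
  apply: (measurableT_comp measurable_sqrtr); apply: measurable_funD; apply: measurable_funM => //.
  exact: measurable_shf.
have sg : (sqn mst g <= (10 * r)%:E)%E.
  rewrite /sqn (eq_integral (fun p => 2%:E * (a' p)%:E + 8%:E * (shf y a p)%:E))%E; last first.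
    by move=> p _; rewrite sqr_sqrtr// EFinD !EFinM.
  have m1 : measurable_fun setT (fun p => (a' p)%:E) by exact/measurable_EFinP.
  have m2 : measurable_fun setT (fun p => (shf y a p)%:E) by apply/measurable_EFinP; exact: measurable_shf.
  rewrite ge0_integralD//; last 4 first.
  - by move=> p _; rewrite -EFinM lee_fin mulr_ge0.
  - exact: measurable_funeM.
  - by move=> p _; rewrite -EFinM lee_fin mulr_ge0//; exact: a0.
  - exact: measurable_funeM.
  have p1 p : setT p -> (0 <= (a' p)%:E)%E by rewrite lee_fin.
  have p2 p : setT p -> (0 <= (shf y a p)%:E)%E by rewrite lee_fin => _; exact: a0.
  rewrite (ge0_integralZl_EFin mst measurableT p1 m1 (ler0n _ 2)) (ge0_integralZl_EFin mst measurableT p2 m2 (ler0n _ 8)).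
  rewrite (@ge0_integral_shf R d y (fun p => (a p)%:E)); last 2 first.
  - exact/measurable_EFinP.
  - by move=> p; rewrite lee_fin.
  have -> : (\int[mst]_p (a' p)%:E = sqn mTS F')%E by rewrite sqn_slices//; apply: eq_integral => p _.
  have -> : (\int[mst]_p (a p)%:E = sqn mTS F)%E by rewrite sqn_slices//; apply: eq_integral => p _.
  apply: le_trans (leeD (lee_wpmul2l _ hS'2) (lee_wpmul2l _ hS2)) _ => //.
  by rewrite -!EFinM -EFinD lee_fin; lra.
have D2 p : stdev P W S'' p <= g p + b p.
  have q0 : 0 <= b p ^+ 2 / 12 by rewrite divr_ge0// sqr_ge0.
  have [cp [c1 c2]] := spro_code y S p.
  have nd := near_dist gV (qcov_tr gam_ge0 gam_L1 hW y) cp q0 (hnear k p).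
  have h1 : (sqn P (spro W S'' p) <= 2%:E * (a' p)%:E + 2%:E * (4%:E * (shf y a p)%:E + (6 * (b p ^+ 2 / 12))%:E))%E.
    rewrite (_ : spro W S'' p = fun w => spro W S' p w - spro W tS p w); last first.
      by apply/funext => w; rewrite E2.
    have [mS' _] := L2_spro hW S' p; have [mtS _] := L2_spro hW tS p.
    have mc : measurable_fun setT (fun w => clip k%:R (ppos Phi' (w, p))) by exact: (sl _ p (mcl _ mPhi')).
    apply: le_trans (sqnB _ mS' mc mtS) _; apply: leeD; apply: lee_wpmul2l => //.
      by rewrite a'E sqnBC.
    rewrite /shf aE sqnBC; move: nd; congr (_ <= _)%E.
      by congr sqn; apply/funext => w; rewrite c2.
    rewrite sqnBC; congr (_ * sqn _ _ + _)%E; apply/funext => w; rewrite /F /=; by rewrite c1.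
  rewrite -[leRHS]ger0_norm ?addr_ge0 ?sqrtr_ge0// -sqrtr_sqr /stdev ler_wsqrtr//.
  rewrite -lee_fin -(sqn_ip (L2_spro hW S'' p)); apply: le_trans h1 _.
  rewrite -!EFinM -!EFinD -?EFinM -?EFinD lee_fin.
  have := sqr_sqrtr (g20 p); rewrite -/(g p) => g2.
  have := mulr_ge0 (sqrtr_ge0 (2 * a' p + 8 * shf y a p)) (b0 p); rewrite -/(g p).
  rewrite sqrrD g2 -mulr_natl; lra.
have hD : (sqn P (isum W S'') <= (20 * kap gam * r + 2 * Nb)%:E)%E.
  apply: le_trans (isum_le_stdev gam_ge0 gam_L1 hW S'') _.
  have ts : tsupp (stdev P W S'').
    move=> p p0; rewrite /stdev (_ : spro W S'' p = cst 0).
      by rewrite /ip; under eq_Rintegral do rewrite mul0r; rewrite /Rintegral integral0 sqrtr0.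
    by apply/funext => w; exact: (@tsupp_spro _ _ _ _ _ W S'' w p p0).
  apply: le_trans (nenergy_mix gam_ge0 gam_L1 hW (L2_stdev S'') ts mg mb _ _ b0 D2) _.
  - by move=> p; exact: sqrtr_ge0.
  - by move=> p; exact: sqrtr_ge0.
  have hg : (nenergy g g <= (10 * kap gam * r)%:E)%E.
    apply: le_trans (nenergy_le_kap gam_ge0 gam_L1 mg (fun p => sqrtr_ge0 _)) _.
    apply: le_trans (lee_wpmul2l _ sg) _; first by rewrite lee_fin.
    by rewrite -EFinM lee_fin; lra.
  apply: le_trans (leeD (lee_wpmul2l _ hg) (lee_wpmul2l _ hb)) _ => //.
  by rewrite -!EFinM -EFinD lee_fin; lra.
have [m1 _] := L2_isum hW S; have [m2 _] := L2_isum hW S'; have [m3 _] := L2_isum hW tS.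
have mc := measurable_ev gV c; have mtc := measurable_ev gV (cmap (tr y) c).
have kr : 0 <= kap gam * r by rewrite mulr_ge0// ltW.
have hb2 : (sqn P (fun w => I' w - isum W tS w)%R <= (2 * r + 2 * (20 * kap gam * r + 2 * Nb))%:E)%E.
  apply: le_trans (sqnB _ mI' m2 m3) _; rewrite (EFinD (2 * r)) (EFinM 2 r) (EFinM 2 (_ + _)).
  apply: leeD; apply: lee_wpmul2l => //.
  by move: hD; congr (sqn _ _ <= _)%E; apply/funext => w; rewrite E1.
have Nb0 : 0 <= Nb by rewrite -lee_fin; apply: le_trans hb; exact: nenergy_ge0.
exists c; split.
  apply: le_trans (sqnB _ mI m1 mc) _; apply: le_trans (leeD (lee_wpmul2l _ hS1) (lee_wpmul2l _ hc1)) _ => //.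
  by rewrite -!EFinM -EFinD lee_fin -hr; lra.
apply: le_trans (sqnB _ mI' m3 mtc) _; apply: le_trans (leeD (lee_wpmul2l _ hb2) (lee_wpmul2l _ hc2)) _ => //.
by rewrite -(EFinM 2 r) -(EFinM 2 (_ + _)) -EFinD lee_fin -hr; lra.
Qed.

End near_step.

(** * The wave kernel *)

Section power_integrals.
Context {R : realType}.
Local Notation leb := (@lebesgue_measure R).
Implicit Types a b c h q r : R.

(* AM-GM with weights [1 - 1/l], [1/(2l)], [1/(2l)]; the value of [p] makes the resulting
   exponents of [a] and [b] equal to [1]. *)
Lemma powR_young a b c l p : 1 <= l -> p = 2 * l / (2 * l - 1) -> 0 <= a -> 0 <= b -> 0 <= c ->
  a * b * c <= a `^ p * b `^ p + a `^ p * c `^ l + b `^ p * c `^ l.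
Proof.
move=> l1 pE a0 b0 c0; set X := a `^ p * b `^ p; set Y := a `^ p * c `^ l; set Z := b `^ p * c `^ l.
have X0 : 0 <= X by rewrite mulr_ge0// powR_ge0.
have Y0 : 0 <= Y by rewrite mulr_ge0// powR_ge0.
have Z0 : 0 <= Z by rewrite mulr_ge0// powR_ge0.
have [a00|aN] := eqVneq a 0; first by rewrite a00 !mul0r !addr_ge0.
have [b00|bN] := eqVneq b 0; first by rewrite b00 mulr0 mul0r !addr_ge0.
have [c00|cN] := eqVneq c 0; first by rewrite c00 mulr0 !addr_ge0.
pose be := (2 * l)^-1; have l2 : 2 * l != 0 by rewrite gt_eqF// mulr_gt0// (lt_le_trans ltr01).
have l3 : 2 * l - 1 != 0 by rewrite gt_eqF//; lra.
have be0 : 0 < be by rewrite invr_gt0; lra.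
have be1 : be <= 2^-1 by rewrite lef_pV2 ?posrE//; lra.
pose M := X + Y + Z.
have dist (x y u v s : R) : 0 <= x -> 0 <= y -> (x `^ u * y `^ v) `^ s = x `^ (u * s) * y `^ (v * s).
  by move=> x0 y0; rewrite powRM ?powR_ge0// -!powRrM.
have -> : a * b * c = X `^ (1 - 2 * be) * Y `^ be * Z `^ be.
  rewrite /X /Y /Z !dist//.
  have pd (x u v : R) : x != 0 -> x `^ u * x `^ v = x `^ (u + v) by move=> xN; rewrite powRD// xN implybT.
  transitivity ((a `^ (p * (1 - 2 * be)) * a `^ (p * be)) * (b `^ (p * (1 - 2 * be)) * b `^ (p * be)) *
     (c `^ (l * be) * c `^ (l * be))); last by ring.
  rewrite !pd// -mulrDr.
  have -> : p * (1 - 2 * be + be) = 1 by rewrite pE /be; field; rewrite ?l2 ?l3 //=; apply/andP; split=> //; lra.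
  have -> : l * be + l * be = 1 by rewrite /be; field; rewrite ?l2//; lra.
  by rewrite !powRr1.
have le1 (x s : R) : 0 <= x <= M -> 0 <= s -> x `^ s <= M `^ s.
  by move=> /andP[x0 xM] s0; apply: ge0_ler_powR => //; rewrite nnegrE// (le_trans x0).
have M0 : 0 <= M by rewrite !addr_ge0.
apply: (@le_trans _ _ (M `^ (1 - 2 * be) * M `^ be * M `^ be)).
  apply: ler_pM; rewrite ?mulr_ge0 ?powR_ge0//.
    apply: ler_pM; rewrite ?powR_ge0//; apply: le1; rewrite /M; lra.
  by apply: le1; rewrite /M; lra.
have [M00|MN] := eqVneq M 0.
  by rewrite M00 (powR0 (lt0r_neq0 be0)) !mulr0.
have pd (u v : R) : M `^ u * M `^ v = M `^ (u + v) by rewrite powRD// MN implybT.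
rewrite !pd (_ : 1 - 2 * be + be + be = 1); last by ring.
by rewrite powRr1.
Qed.

Lemma integral_powR_itv e h q : 0 < e -> e < h -> q < 1 ->
  (\int[leb]_(s in `[e, h]) (s `^ (- q))%:E <= (h `^ (1 - q) / (1 - q))%:E)%E.
Proof.
move=> e0 eh q1; have q10 : 0 < 1 - q by lra.
pose F s := s `^ (1 - q) / (1 - q).
have dF s : 0 < s -> derivable F s 1.
  by move=> s0; apply: derivableM => //; apply: derivable_powR; rewrite in_itv/= s0.
have cF s : 0 < s -> {for s, continuous F}.
  by move=> /dF/derivable1_diffP/differentiable_continuous.
rewrite (@continuous_FTC2 _ _ F)//.
- rewrite -EFinB lee_fin /F -mulrBl ler_pM2r ?invr_gt0//.
  by rewrite lerBlDr lerDl powR_ge0.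
- apply: derivable_within_continuous => s; rewrite in_itv/= => /andP[es _].
  by apply: derivable_powR; rewrite in_itv/= (lt_le_trans e0).
- split.
  + by move=> s; rewrite in_itv/= => /andP[es _]; apply: dF; exact: lt_trans es.
  + by apply: cvg_at_right_filter; exact: cF.
  + by apply: cvg_at_left_filter; apply: cF; exact: lt_trans eh.
move=> s; rewrite in_itv/= => /andP[es _]; have s0 := lt_trans e0 es.
rewrite derive1E deriveM//; last by apply: derivable_powR; rewrite in_itv/= s0.
rewrite derive_cst scaler0 add0r -derive1E powR_derive1 ?in_itv/= ?s0//.
rewrite [LHS]/GRing.scale /= mulrA mulVf ?gt_eqF// mul1r; congr (_ `^ _); ring.
Qed.

Definition phi_q h q s : R := \1_(`]0, h]%classic : set R) s * s `^ (- q).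

Lemma phi_q_ge0 h q s : 0 <= phi_q h q s.
Proof. by rewrite /phi_q mulr_ge0 ?powR_ge0// indicE. Qed.

Lemma measurable_phi_q h q : measurable_fun setT (phi_q h q).
Proof. by apply: measurable_funM; [exact: measurable_indic|exact: measurable_powR]. Qed.

(** The fundamental theorem of calculus applies on [[h / (n+2), h]], away from the singularity, and
    Fatou's lemma concludes. Square roots appear because [sqn_fatou] speaks of squares. *)
Lemma integral_phi_q h q : 0 < h -> q < 1 ->
  (\int[leb]_s (phi_q h q s)%:E <= (h `^ (1 - q) / (1 - q))%:E)%E.
Proof.
move=> h0 q1; pose D n : set R := `[h / n.+2%:R, h]%classic.
pose g n (s : measurableTypeR R) := \1_(D n) s * Num.sqrt (s `^ (- q)) : R.
have mg n : measurable_fun setT (g n).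
  apply: measurable_funM; first by apply: measurable_indic; exact: measurable_itv.
  exact: (measurableT_comp measurable_sqrtr (measurable_powR _)).
pose f0 (s : measurableTypeR R) := \1_(`]0, h]%classic : set R) s * Num.sqrt (s `^ (- q)) : R.
suff : (sqn leb f0 <= (h `^ (1 - q) / (1 - q))%:E)%E.
  apply: le_trans; rewrite le_eqVlt; apply/orP; left; apply/eqP; apply: eq_integral => s _.
  rewrite /phi_q /f0 exprMn sqr_sqrtr ?powR_ge0// indicE.
  by case: (_ \in _); rewrite ?expr1n// expr0n.
apply: (@sqn_fatou _ _ _ leb g f0 _ mg) => [s|n].
- apply: cvgM; last exact: cvg_cst.
  rewrite !indicE; have [hs|hs] := boolP (s \in `]0, h]%classic); last first.
    apply: (@cvg_eventually _ _ _ 0) => n _; rewrite indicE memNset// => hD; move: hs.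
    rewrite notin_setE; apply; move: hD; rewrite /D /= !in_itv/= => /andP[h1 ->]; rewrite andbT.
    by apply: lt_le_trans h1; rewrite divr_gt0.
  move: hs; rewrite inE /= in_itv/= => /andP[s0 sh].
  apply: (@cvg_eventually _ _ _ (Num.bound (h / s))) => n hn.
  rewrite indicE mem_set// /D /= in_itv/= sh andbT ler_pdivrMr// mulrC -ler_pdivrMr//.
  apply: le_trans (ltW (archi_boundP _)) _; first by rewrite divr_ge0// ltW.
  by rewrite ler_nat; apply: leq_trans hn _; rewrite ltnW.
have nh : h / n.+2%:R < h by rewrite ltr_pdivrMr// ltr_pMr// ltr1n.
apply: le_trans (integral_powR_itv (divr_gt0 h0 (ltr0Sn _ _)) nh q1).
rewrite [leRHS]integral_mkcond le_eqVlt; apply/orP; left; apply/eqP; apply: eq_integral => s _.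
rewrite patchE /g indicE exprMn sqr_sqrtr ?powR_ge0//; case: ifP => _; rewrite ?expr1n ?mul1r//.
by rewrite expr0n mul0r.
Qed.

Lemma phi_qE h q s : 0 < s <= h -> phi_q h q s = s `^ (- q).
Proof. by move=> hs; rewrite /phi_q indicE mem_set ?mul1r//= in_itv. Qed.

Opaque phi_q.

(** Up to constants, a power of the planar wave kernel along a chord of half-length [h]. *)
Definition arc_q h q b : R := \1_(`]- h, h[%classic : set R) b * (h ^+ 2 - b ^+ 2) `^ (- q).

Lemma arc_q_ge0 h q b : 0 <= arc_q h q b.
Proof. by rewrite /arc_q mulr_ge0 ?powR_ge0// indicE. Qed.

Lemma measurable_arc_q h q : measurable_fun setT (arc_q h q).
Proof.
apply: measurable_funM; first exact: measurable_indic.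
by apply: (measurableT_comp (measurable_powR _)); apply: measurable_funB => //; exact: measurable_funX.
Qed.

Lemma arc_qE h q b : b \in `]- h, h[ -> arc_q h q b = (h ^+ 2 - b ^+ 2) `^ (- q).
Proof. by move=> hb; rewrite /arc_q indicE mem_set ?mul1r. Qed.

Lemma powR_antitone x y q : 0 < x -> x <= y -> 0 <= q -> y `^ (- q) <= x `^ (- q).
Proof.
move=> x0 xy q0; rewrite !powRN lef_pV2 ?posrE ?powR_gt0// ?(lt_le_trans x0)//.
by apply: ge0_ler_powR; rewrite ?nnegrE// ltW// (lt_le_trans x0).
Qed.

(** [h^2 - b^2 = (h + b) (h - b)], where one factor is at least [h]; the other one carries the
    singularity of one end of the chord. *)
Lemma arc_q_le h q b : 0 < h -> 0 < q -> arc_q h q b <= h `^ (- q) * (phi_q h q (b + h) + phi_q h q (- b + h)).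
Proof.
move=> h0 q0; rewrite /arc_q indicE.
have [hb|_] := boolP (b \in _); last by rewrite mul0r mulr_ge0 ?powR_ge0// addr_ge0// phi_q_ge0.
move: hb; rewrite inE /= in_itv/= => /andP[b1 b2]; rewrite mul1r.
have -> : h ^+ 2 - b ^+ 2 = (b + h) * (- b + h) by ring.
rewrite powRM; [|lra|lra].
have [b0|b0] := leP 0 b.
  rewrite (@phi_qE h q (- b + h)); last by lra.
  by rewrite ler_pM ?powR_ge0 ?lerDr ?phi_q_ge0// powR_antitone//; lra.
rewrite mulrC (@phi_qE h q (b + h)); last by lra.
by rewrite ler_pM ?powR_ge0 ?lerDl ?phi_q_ge0// powR_antitone//; lra.
Qed.

Opaque arc_q.

Lemma integral_arc_q h q : 0 < h -> 0 < q < 1 ->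
  (\int[leb]_b (arc_q h q b)%:E <= (2 * h `^ (1 - 2 * q) / (1 - q))%:E)%E.
Proof.
move=> h0 /andP[q0 q1]; pose G b : \bar R := ((phi_q h q (b + h))%:E + (phi_q h q (- b + h))%:E)%E.
have mE : measurable_fun setT (fun s : R => (phi_q h q s)%:E) by apply/measurable_EFinP; exact: measurable_phi_q.
have pE s : (0 <= (phi_q h q s)%:E)%E by rewrite lee_fin phi_q_ge0.
have ms1 : measurable_fun setT (fun b => (phi_q h q (b + h))%:E).
  by apply: (measurableT_comp mE); exact: measurable_funD.
have ms2 : measurable_fun setT (fun b => (phi_q h q (- b + h))%:E).
  by apply: (measurableT_comp mE); apply: measurable_funD => //; exact: measurable_funN.
have mG : measurable_fun setT G by exact: emeasurable_funD.
have G0 b : setT b -> (0 <= G b)%E by move=> _; apply: adde_ge0; exact: pE.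
have GE : (\int[leb]_b G b <= (h `^ (1 - q) / (1 - q))%:E + (h `^ (1 - q) / (1 - q))%:E)%E.
  rewrite (ge0_integralD leb measurableT (fun b _ => pE (b + h)) ms1 (fun b _ => pE (- b + h)) ms2).
  rewrite (@ge0_integral_leb_shift R h (fun s => (phi_q h q s)%:E) mE pE).
  rewrite (@ge0_integral_lebN R (fun s => (phi_q h q (s + h))%:E) ms1 (fun s => pE _)).
  rewrite (@ge0_integral_leb_shift R h (fun s => (phi_q h q s)%:E) mE pE).
  by apply: leeD; exact: integral_phi_q.
have hq0 : 0 <= h `^ (- q) by exact: powR_ge0.
have step : (\int[leb]_b (arc_q h q b)%:E <= \int[leb]_b ((h `^ (- q))%:E * G b))%E.
  apply: ge0_le_integral; first exact: measurableT.
  - by move=> b _; rewrite lee_fin arc_q_ge0.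
  - by apply/measurable_EFinP; exact: measurable_arc_q.
  - exact: measurable_funeM.
  - by move=> b _; rewrite /G -EFinD -EFinM lee_fin; exact: arc_q_le.
apply: (le_trans step); rewrite (ge0_integralZl_EFin leb measurableT G0 mG hq0).
apply: le_trans (lee_wpmul2l _ GE) _; first by rewrite lee_fin.
rewrite -EFinD -EFinM lee_fin le_eqVlt; apply/orP; left; apply/eqP.
have -> : 1 - 2 * q = - q + (1 - q) by ring.
rewrite (@powRD _ h (- q) (1 - q)); last by apply/implyP => _; rewrite gt_eqF.
by move: (h `^ (- q)) (h `^ (1 - q)) => x y; ring.
Qed.

End power_integrals.

(** * Properties of the wave kernel and integrals of its powers *)

Section wave_kernel_facts.
Context {R : realType} {d : nat}.
Local Notation E := 'rV[R]_d.
Local Notation ST := (measurableTypeR R * E)%type.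
Implicit Types (x : E) (t r : R).

Lemma enorm_ge0 x : 0 <= enorm x. Proof. exact: sqrtr_ge0. Qed.

Lemma dotv_ge0 x : 0 <= dotv x x.
Proof. by apply: sumr_ge0 => i _; rewrite -expr2 sqr_ge0. Qed.

Lemma norm_le_enorm x : `|x| <= enorm x.
Proof.
rewrite rV_norm_le ?enorm_ge0//; apply/forallP => i.
rewrite -sqrtr_sqr ler_wsqrtr// /dotv (bigD1 i)//= -expr2 lerDl.
by apply: sumr_ge0 => j _; rewrite -expr2 sqr_ge0.
Qed.

Lemma measurable_enorm : measurable_fun setT (@enorm R d).
Proof.
apply: (measurableT_comp measurable_sqrtr).
rewrite (_ : (fun x => _) = fun x => \sum_(i < d) (fun i (x : E) => rV_coord i x * rV_coord i x) i x)//.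
by apply: measurable_sum => i; apply: measurable_funM; exact: measurable_rV_coord.
Qed.

Lemma wave_kernel_ge0 t x : 0 <= wave_kernel t x.
Proof.
rewrite /wave_kernel; case: ifP => // _; case: ifP => // _.
by rewrite invr_ge0 mulr_ge0 ?sqrtr_ge0// mulr_ge0// pi_ge0.
Qed.

Lemma wave_kernel0 t x : t <= `|x| -> wave_kernel t x = 0.
Proof. by move=> h; rewrite /wave_kernel ltNge (le_trans h (norm_le_enorm x)). Qed.

Lemma measurable_wave_kernel : measurable_fun setT (fun p : ST => wave_kernel p.1 p.2).
Proof.
have m1 : measurable_fun setT (fun p : ST => p.1 : R) by exact: measurable_fst.
have m2 : measurable_fun setT (fun p : ST => enorm p.2) by exact: (measurableT_comp measurable_enorm measurable_snd).
have mD : measurable [set p : ST | enorm p.2 < p.1].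
  have := measurable_funB m1 m2 measurableT (measurable_itv `]0, +oo[); rewrite setTI; congr measurable.
  by apply/seteqP; split => p /=; rewrite in_itv/= andbT subr_gt0.
pose g (p : ST) : R := if d == 1%N then 2^-1 else (2 * pi * Num.sqrt (p.1 ^+ 2 - enorm p.2 ^+ 2)) `^ (-1).
have mg : measurable_fun setT g.
  rewrite /g; case: (d == 1%N) => //; apply: (measurableT_comp (measurable_powR (-1))).
  apply: measurable_funM => //; apply: (measurableT_comp measurable_sqrtr).
  by apply: measurable_funB; exact: measurable_funX.
rewrite (_ : (fun p => _) = fun p : ST => \1_[set p : ST | enorm p.2 < p.1] p * g p).
  by apply: measurable_funM => //; exact: measurable_indic.
apply/funext => p; rewrite indicE /wave_kernel /g; case: (ltP (enorm p.2) p.1) => h.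
  rewrite mem_set// mul1r; case: ifP => // _; rewrite powR_inv1//.
  by rewrite mulr_ge0 ?sqrtr_ge0// mulr_ge0// pi_ge0.
by rewrite memNset ?mul0r//= ltNge h.
Qed.

Lemma measurable_wave_slice r : measurable_fun setT (fun x => wave_kernel r x).
Proof. exact: (measurable_pair1 (r : measurableTypeR R) measurable_wave_kernel). Qed.

End wave_kernel_facts.

Section wave_kernel_power.
Context {R : realType}.
Local Notation leb := (@lebesgue_measure R).
Local Notation lam n := (@lebesgue_rV R n).
Implicit Types (a b r p q : R).

(** Dimension 1 uses the Young exponents [l = 1] and [p = 2]. The kernel is bounded by 1 and
    supported in the cube. *)
Lemma wave_kernel1_power (T0 : R) : 0 <= T0 -> exists A : R, 0 <= A /\ forall r, r <= T0 ->
  (\int[lam 1]_x (wave_kernel r x `^ 2)%:E <= A%:E)%E.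
Proof.
move=> T00; have mc : measurable (@cube R 1 T0) by exact: measurable_cube.
have fin : (lam 1 (@cube R 1 T0)) \is a fin_num by rewrite ge0_fin_numE// cube_lty.
exists (fine (lam 1 (@cube R 1 T0))); split=> [|r rT]; first exact: fine_ge0.
rewrite fineK// -[X in (_ <= lam 1 X)%E]setIT -integral_indic//.
apply: ge0_le_integral => //.
- by move=> x _; rewrite lee_fin powR_ge0.
- by apply/measurable_EFinP; apply: (measurableT_comp (measurable_powR _)); exact: measurable_wave_slice.
- by apply/measurable_EFinP; exact: measurable_indic.
move=> x _; rewrite lee_fin indicE; have [h|h] := leP `|x| T0.
  rewrite mem_set; last by move: h; rewrite rV_norm_le// => /forallP.
  rewrite powR_mulrn ?wave_kernel_ge0// exprn_ile1 ?wave_kernel_ge0//.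
  by rewrite /wave_kernel; case: ifP => //= _; rewrite invf_le1// ler1n.
by rewrite wave_kernel0 ?powR0// ltW// (le_lt_trans rT).
Qed.

Lemma rV_cons0 n (p : R * 'rV[R]_n) : rV_cons p ord0 ord0 = p.1.
Proof. by have /(congr1 fst) := rV_consK p. Qed.

Lemma rV_consS n (p : R * 'rV[R]_n) i : rV_cons p ord0 (lift ord0 i) = p.2 ord0 i.
Proof.
have /(congr1 snd) /= <- := rV_consK p; rewrite [RHS]mxE.
by congr (fun_of_matrix _ _ _); exact: val_inj.
Qed.

Lemma dotv_cons n (p : R * 'rV[R]_n) : dotv (rV_cons p) (rV_cons p) = p.1 ^+ 2 + dotv p.2 p.2.
Proof.
rewrite /dotv big_ord_recl rV_cons0 -expr2; congr (_ + _).
by apply: eq_bigr => i _; rewrite rV_consS.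
Qed.

(** [r^2 - |x|^2 = h^2 - b^2] with [h^2 = r^2 - a^2], and the constant [2 pi >= 1] is discarded. *)
Lemma wave_kernel2_le r a b p : 0 < r -> 1 < p ->
  wave_kernel r (rV_cons (a, rV_cons (b, 0 : 'rV[R]_0))) `^ p <=
  if `|a| < r then arc_q (Num.sqrt (r ^+ 2 - a ^+ 2)) (p / 2) b else 0.
Proof.
move=> r0 p1; set x := rV_cons _.
have dx : dotv x x = a ^+ 2 + b ^+ 2 by rewrite !dotv_cons /= /dotv big_ord0 addr0.
have pN : p != 0 by rewrite gt_eqF// (lt_trans ltr01).
rewrite /wave_kernel; case: ifPn => [hx|_]; last first.
  by rewrite powR0//; case: ifP => // _; exact: arc_q_ge0.
have hx2 : a ^+ 2 + b ^+ 2 < r ^+ 2.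
  rewrite -dx -(sqr_sqrtr (dotv_ge0 x)) -/(enorm x).
  by rewrite ltrXn2r ?enorm_ge0.
have ar : `|a| < r.
  rewrite -(ltr_pXn2r (n := 2)) ?nnegrE ?(ltW r0)// real_normK ?num_real//.
  by apply: le_lt_trans hx2; rewrite lerDl sqr_ge0.
rewrite ar; set h := Num.sqrt (r ^+ 2 - a ^+ 2).
have h2 : h ^+ 2 = r ^+ 2 - a ^+ 2.
  by rewrite sqr_sqrtr// subr_ge0; apply: ltW; apply: le_lt_trans hx2; rewrite lerDl sqr_ge0.
have X0 : 0 < h ^+ 2 - b ^+ 2 by rewrite h2; lra.
have bh : `|b| < h.
  rewrite -(ltr_pXn2r (n := 2)) ?nnegrE ?sqrtr_ge0// real_normK ?num_real//.
  by rewrite -subr_gt0.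
rewrite arc_qE//; last by rewrite in_itv/= -ltr_norml.
have -> : r ^+ 2 - enorm x ^+ 2 = h ^+ 2 - b ^+ 2.
  by rewrite h2 sqr_sqrtr ?dotv_ge0// dx; ring.
set X := h ^+ 2 - b ^+ 2 in X0 *.
have sX : 0 < Num.sqrt X by rewrite sqrtr_gt0.
have -> : X `^ (- (p / 2)) = (Num.sqrt X)^-1 `^ p.
  rewrite -powR12_sqrt ?(ltW X0)// -powRN -powRrM; congr (_ `^ _); lra.
apply: ge0_ler_powR; rewrite ?nnegrE ?invr_ge0 ?mulr_ge0 ?pi_ge0 ?sqrtr_ge0//.
  by rewrite ltW// (lt_trans ltr01).
rewrite lef_pV2 ?posrE// ?mulr_gt0 ?pi_gt0// ler_peMl ?ltW//.
by have := @pi_ge2 R; lra.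
Qed.

(** The integral over the chord at abscissa [a] is of order [h^(1 - 2 q)] with [h^2 = r^2 - a^2],
    which is again an [arc_q], in [a], of exponent [q' = q - 1/2]. Both exponents lie in []0, 1[]
    because [1 < p < 2]. The final power [r^(1 - 2 q') = r^(2 - p)] increases with [r], whence the
    uniformity up to [T0]. *)
Lemma wave_kernel2_power (T0 p : R) : 0 < T0 -> 1 < p < 2 -> exists A : R, 0 <= A /\ forall r, r <= T0 ->
  (\int[lam 2]_x (wave_kernel r x `^ p)%:E <= A%:E)%E.
Proof.
move=> T00 /andP[p1 p2]; pose q := p / 2; pose q' := q - 2^-1.
have q01 : 0 < q < 1 by rewrite /q; lra.
have q'01 : 0 < q' < 1 by rewrite /q' /q; lra.
have [q0 q1] := andP q01; have [q'0 q'1] := andP q'01.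
have pN : p != 0 by rewrite gt_eqF// (lt_trans ltr01).
pose C1 := 2 / (1 - q); pose C2 := 2 * T0 `^ (1 - 2 * q') / (1 - q').
have C10 : 0 <= C1 by rewrite divr_ge0// subr_ge0 ltW.
have C20 : 0 <= C2.
  by rewrite divr_ge0//; [rewrite mulr_ge0// powR_ge0|rewrite subr_ge0 ltW].
exists (C1 * C2); split=> [|r rT]; first exact: mulr_ge0.
have [r0|r0] := leP r 0.
  rewrite (_ : integral _ _ _ = 0%E); first by rewrite lee_fin mulr_ge0.
  by apply: integral0_eq => x _; rewrite wave_kernel0 ?powR0// (le_trans r0).
have mw : measurable_fun setT (fun x : 'rV[R]_2 => (wave_kernel r x `^ p)%:E).
  by apply/measurable_EFinP; apply: (measurableT_comp (measurable_powR _)); exact: measurable_wave_slice.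
have w0 (x : 'rV[R]_2) : (0 <= (wave_kernel r x `^ p)%:E)%E by rewrite lee_fin powR_ge0.
have mA := measurable_arc_q r q'.
have A0 a : setT a -> (0 <= (arc_q r q' a)%:E)%E by rewrite lee_fin => _; exact: arc_q_ge0.
have mAE : measurable_fun setT (fun a : R => (arc_q r q' a)%:E) by exact/measurable_EFinP.
rewrite (ge0_integral_rVS mw w0).
apply: (@le_trans _ _ (\int[leb]_a (C1%:E * (arc_q r q' a)%:E))%E).
  apply: ge0_le_integral => //.
  - by move=> a _; exact: integral_ge0.
  - exact: (measurable_rV_integral mw w0).
  - exact: measurable_funeM.
  move=> a _; have ms := measurable_rV_slice a mw.
  rewrite (ge0_integral_rVS ms (fun x => w0 _)).
  have -> : (\int[leb]_b \int[lam 0]_x (wave_kernel r (rV_cons (a, rV_cons (b, x))) `^ p)%:E =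
      \int[leb]_b (wave_kernel r (rV_cons (a, rV_cons (b, 0 : 'rV[R]_0))) `^ p)%:E)%E.
    apply: eq_integral => b _; rewrite integral_dirac//; last exact: (measurable_rV_slice b ms).
    by rewrite diracT mul1e.
  have msb : measurable_fun setT (fun b => (wave_kernel r (rV_cons (a, rV_cons (b, 0 : 'rV[R]_0))) `^ p)%:E).
    apply: (measurableT_comp ms); apply: (measurableT_comp (@measurable_rV_cons R 0)).
    exact: measurable_fun_pair.
  have [ar|ra] := ltP `|a| r; last first.
    rewrite integral0_eq => [|b _]; first by rewrite -EFinM lee_fin mulr_ge0// arc_q_ge0.
    have := wave_kernel2_le a b r0 p1; rewrite ltNge ra /= => h.
    by congr EFin; apply/eqP; rewrite eq_le h powR_ge0.
  pose h := Num.sqrt (r ^+ 2 - a ^+ 2).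
  have Y0 : 0 < r ^+ 2 - a ^+ 2.
    by rewrite subr_gt0 -(real_normK (num_real a)) ltrXn2r.
  have h0 : 0 < h by rewrite sqrtr_gt0.
  apply: (@le_trans _ _ (\int[leb]_b (arc_q h q b)%:E)%E).
    apply: ge0_le_integral => //.
    - by apply/measurable_EFinP; exact: measurable_arc_q.
    - by move=> b _; rewrite lee_fin; have := wave_kernel2_le a b r0 p1; rewrite ar.
  apply: le_trans (integral_arc_q h0 q01) _.
  rewrite -EFinM lee_fin arc_qE//; last by rewrite in_itv/= -ltr_norml.
  rewrite /C1 mulrAC ler_wpM2l// -?/C1//.
  rewrite /h -powR12_sqrt ?(ltW Y0)// -powRrM le_eqVlt; apply/orP; left; apply/eqP.
  by congr (_ `^ _); rewrite /q'; lra.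
rewrite (ge0_integralZl_EFin leb measurableT A0 mAE C10) (EFinM C1 C2); apply: lee_wpmul2l; first by rewrite lee_fin.
apply: le_trans (integral_arc_q r0 q'01) _; rewrite lee_fin /C2.
rewrite ler_pM2r ?invr_gt0 ?subr_gt0// ler_pM2l//.
apply: ge0_ler_powR; rewrite ?nnegrE ?(ltW r0) ?(ltW T00)//.
by rewrite /q' /q; lra.
Qed.

End wave_kernel_power.

(** * Uniform bound of the energy of the wave kernel *)

Section kernel_energy.
Context {R : realType} {d : nat}.
Local Notation E := 'rV[R]_d.
Local Notation lam := (@lebesgue_rV R d).

(** Each of the three terms is a product of two functions, of two among [y], [z] and [y - z];
    Tonelli and translation invariance factor its integral. *)
Lemma integral_young (f g : E -> R) (A B : R) : measurable_fun setT f -> measurable_fun setT g ->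
  (forall y, 0 <= f y) -> (forall y, 0 <= g y) ->
  (\int[lam]_y (f y)%:E <= A%:E)%E -> (\int[lam]_y (g y)%:E <= B%:E)%E -> 0 <= A -> 0 <= B ->
  (\int[prod_sf lam lam]_q ((f q.1 * f q.2)%:E + (f q.1 * g (q.1 - q.2)%R)%:E + (f q.2 * g (q.1 - q.2)%R)%:E) <=
   (A * A + A * B + A * B)%:E)%E.
Proof.
move=> mf mg f0 g0 If Ig A0 B0.
have mfE : measurable_fun setT (fun y => (f y)%:E) by exact/measurable_EFinP.
have mgE : measurable_fun setT (fun y => (g y)%:E) by exact/measurable_EFinP.
have g0E y : (0 <= (g y)%:E)%E by rewrite lee_fin.
have Igl y : (\int[lam]_z (g (y - z))%:E <= B%:E)%E.
  by rewrite (@ge0_integral_rV_subl R d y (fun z => (g z)%:E) mgE g0E).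
have Igr z : (\int[lam]_y (g (y - z))%:E <= B%:E)%E.
  by rewrite (@ge0_integral_rV_shift R d (- z) (fun z => (g z)%:E) mgE g0E).
have m1 : measurable_fun setT (fun q : E * E => f q.1) by exact: (measurableT_comp mf measurable_fst).
have m2 : measurable_fun setT (fun q : E * E => f q.2) by exact: (measurableT_comp mf measurable_snd).
have m3 : measurable_fun setT (fun q : E * E => g (q.1 - q.2)) by exact: (measurableT_comp mg measurable_diff).
have mEF (h : E * E -> R) : measurable_fun setT h -> measurable_fun setT (fun q => (h q)%:E).
  by move=> mh; exact/measurable_EFinP.
have scal (h : E -> R) (k c : R) : 0 <= k -> measurable_fun setT h -> (forall z, 0 <= h z) ->
    (\int[lam]_z (h z)%:E <= c%:E)%E -> (\int[lam]_z (k * h z)%:E <= (k * c)%:E)%E.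
  move=> k0 mh h0 hc; under eq_integral do rewrite EFinM.
  have hE z : setT z -> (0 <= (h z)%:E)%E by rewrite lee_fin.
  have mhE : measurable_fun setT (fun z => (h z)%:E) by exact/measurable_EFinP.
  rewrite (ge0_integralZl_EFin lam measurableT hE mhE k0) EFinM.
  by apply: lee_wpmul2l => //; rewrite lee_fin.
have outer (F : E -> \bar R) (c : R) : 0 <= c -> measurable_fun setT F -> (forall y, 0 <= F y)%E ->
    (forall y, F y <= (f y * c)%:E)%E -> (\int[lam]_y F y <= (A * c)%:E)%E.
  move=> c0 mF F0 hF; apply: (@le_trans _ _ (\int[lam]_y (c * f y)%:E)%E).
    apply: ge0_le_integral => //; first by apply/measurable_EFinP; exact: measurable_funM.
    by move=> y _; rewrite mulrC.
  by rewrite (mulrC A); exact: scal.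
have mt1 := mEF _ (measurable_funM m1 m2); have mt2 := mEF _ (measurable_funM m1 m3); have mt3 := mEF _ (measurable_funM m2 m3).
have p1 (q : E * E) : (0 <= (f q.1 * f q.2)%:E)%E by rewrite lee_fin mulr_ge0.
have p2 (q : E * E) : (0 <= (f q.1 * g (q.1 - q.2)%R)%:E)%E by rewrite lee_fin mulr_ge0.
have p3 (q : E * E) : (0 <= (f q.2 * g (q.1 - q.2)%R)%:E)%E by rewrite lee_fin mulr_ge0.
have t1 : (\int[prod_sf lam lam]_q (f q.1 * f q.2)%:E <= (A * A)%:E)%E.
  rewrite (tonelli1 mt1 p1); apply: outer => //.
  - exact: (measurable_inner lam mt1 p1).
  - by move=> y; apply: integral_ge0 => z _; exact: (p1 (y, z)).
  - by move=> y; exact: (scal f (f y) A (f0 y) mf f0 If).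
have t2 : (\int[prod_sf lam lam]_q (f q.1 * g (q.1 - q.2)%R)%:E <= (A * B)%:E)%E.
  rewrite (tonelli1 mt2 p2); apply: outer => //.
  - exact: (measurable_inner lam mt2 p2).
  - by move=> y; apply: integral_ge0 => z _; exact: (p2 (y, z)).
  - move=> y; apply: (scal (fun z => g (y - z)) (f y) B (f0 y)) => //.
    by apply: (measurableT_comp mg); exact: measurable_funB_rV.
have t3 : (\int[prod_sf lam lam]_q (f q.2 * g (q.1 - q.2)%R)%:E <= (A * B)%:E)%E.
  rewrite (tonelli2 mt3 p3); apply: outer => //.
  - exact: (measurable_fun_fubini_tonelli_G _ mt3 p3).
  - by move=> z; apply: integral_ge0 => y _; exact: (p3 (y, z)).
  - move=> z; apply: (scal (fun y => g (y - z)) (f z) B (f0 z)) => //.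
    by apply: (measurableT_comp mg); exact: measurable_funB_rV.
rewrite (ge0_integralD (prod_sf lam lam) measurableT (fun q _ => adde_ge0 (p1 q) (p2 q)) (emeasurable_funD mt1 mt2) (fun q _ => p3 q) mt3).
rewrite (ge0_integralD (prod_sf lam lam) measurableT (fun q _ => p1 q) mt1 (fun q _ => p2 q) mt2).
by rewrite (EFinD (A * A + A * B)) (EFinD (A * A)); apply: leeD => //; exact: leeD.
Qed.

Variable gam : E -> \bar R.
Hypothesis gam_ge0 : forall x, (0 <= gam x)%E.
Hypothesis gam_L1 : lam.-integrable setT gam.

Lemma kernel_energy_powers (T0 p l A B : R) : 1 <= l -> p = 2 * l / (2 * l - 1) -> 0 <= A -> 0 <= B ->
  (forall r, r <= T0 -> (\int[lam]_x (wave_kernel r x `^ p)%:E <= A%:E)%E) ->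
  (\int[lam]_x (gamr gam x `^ l)%:E <= B%:E)%E ->
  forall (r : R) (x : E), r <= T0 ->
  (\int[lam]_y \int[lam]_z (wave_kernel r (x - y) * wave_kernel r (x - z) * gamr gam (y - z))%:E <=
   (A * A + A * B + A * B)%:E)%E.
Proof.
move=> l1 pE A0 B0 hA hB r x rT.
have mgam := measurable_gamr gam_L1; have gam0 y := gamr_ge0 gam_ge0 y.
have mG : measurable_fun setT (fun y : E => wave_kernel r (x - y)).
  by apply: (measurableT_comp (measurable_wave_slice r)); exact: measurable_funB_rV.
have mf : measurable_fun setT (fun y : E => wave_kernel r (x - y) `^ p) by exact: (measurableT_comp (measurable_powR _) mG).
have mg : measurable_fun setT (fun y => gamr gam y `^ l) by exact: (measurableT_comp (measurable_powR _) mgam).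
have If : (\int[lam]_y (wave_kernel r (x - y) `^ p)%:E <= A%:E)%E.
  rewrite (@ge0_integral_rV_subl R d x (fun y => (wave_kernel r y `^ p)%:E)); first exact: hA.
    by apply/measurable_EFinP; apply: (measurableT_comp (measurable_powR _)); exact: measurable_wave_slice.
  by move=> y; rewrite lee_fin powR_ge0.
have mK : measurable_fun setT (fun q : E * E => (wave_kernel r (x - q.1) * wave_kernel r (x - q.2) * gamr gam (q.1 - q.2))%:E).
  apply/measurable_EFinP; apply: measurable_funM; last exact: (measurableT_comp mgam measurable_diff).
  by apply: measurable_funM; [exact: (measurableT_comp mG measurable_fst)|exact: (measurableT_comp mG measurable_snd)].
have K0 (q : E * E) : (0 <= (wave_kernel r (x - q.1)%R * wave_kernel r (x - q.2)%R * gamr gam (q.1 - q.2)%R)%:E)%E.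
  by rewrite lee_fin !mulr_ge0 ?wave_kernel_ge0.
rewrite -(tonelli1 mK K0).
apply: le_trans (integral_young mf mg (fun y => powR_ge0 _ _) (fun y => powR_ge0 _ _) If hB A0 B0).
have m1 := measurableT_comp mf (@measurable_fst _ _ E E).
have m2 := measurableT_comp mf (@measurable_snd _ _ E E).
have m3 := measurableT_comp mg (@measurable_diff R d).
have mE (h : E * E -> R) : measurable_fun setT h -> measurable_fun setT (fun q => (h q)%:E).
  by move=> mh; exact/measurable_EFinP.
apply: ge0_le_integral; first exact: measurableT.
- by move=> q _; exact: K0.
- exact: mK.
- exact: (emeasurable_funD (emeasurable_funD (mE _ (measurable_funM m1 m2)) (mE _ (measurable_funM m1 m3))) (mE _ (measurable_funM m2 m3))).
move=> q _; rewrite -!EFinD lee_fin.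
by apply: (powR_young l1 pE); rewrite ?wave_kernel_ge0.
Qed.

Lemma kernel_energy (T0 : R) : 0 < T0 -> d = 1%N \/ d = 2%N ->
  (d = 2%N -> exists2 l : R, 1 < l & ('N[lam]_(l%:E)[gam] < +oo)%E) ->
  exists C : R, 0 <= C /\ forall (r : R) (x : E), r <= T0 ->
  (\int[lam]_y \int[lam]_z (wave_kernel r (x - y) * wave_kernel r (x - z) * gamr gam (y - z))%:E <= C%:E)%E.
Proof.
move=> T00 hd gam_Ll; have k0 := kap_ge0 gam_ge0.
suff [p [l [A [B [l1 pE A0 B0 [hA hB]]]]]] : exists p l A B : R, [/\ 1 <= l, p = 2 * l / (2 * l - 1), 0 <= A, 0 <= B &
    (forall r, r <= T0 -> (\int[lam]_x (wave_kernel r x `^ p)%:E <= A%:E)%E) /\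
    (\int[lam]_x (gamr gam x `^ l)%:E <= B%:E)%E].
  exists (A * A + A * B + A * B); split; first by rewrite !addr_ge0// mulr_ge0.
  exact: kernel_energy_powers l1 pE A0 B0 hA hB.
case: hd => hd.
  have [A [A0 hA]] := wave_kernel1_power (ltW T00).
  exists 2, 1, A, (kap gam); split=> //; first by field.
  split; first by move: hA; rewrite -hd.
  by rewrite (eq_integral (fun x => (gamr gam x)%:E)) ?integral_gamr// => x _; rewrite powRr1// gamr_ge0.
have [l l1 hl] := gam_Ll hd.
have l0 : 0 < l by rewrite (lt_trans ltr01).
have lN : l != 0 by rewrite gt_eqF.
have l2 : 0 < 2 * l - 1 by lra.
pose p := 2 * l / (2 * l - 1).
have p12 : 1 < p < 2 by rewrite /p ltr_pdivlMr// ltr_pdivrMr//; lra.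
have [A [A0 hA]] := wave_kernel2_power T00 p12.
have foo : (\int[lam]_x (`|gam x| `^ l) < +oo)%E by rewrite -poweR_Lnorm// poweR_lty.
have fooge : (0 <= \int[lam]_x (`|gam x| `^ l))%E by apply: integral_ge0 => x _; exact: poweR_ge0.
exists p, l, A, (fine (\int[lam]_x (`|gam x| `^ l))%E); split=> //; first exact: ltW.
  exact: fine_ge0.
split; first by move: hA; rewrite -hd.
rewrite fineK ?ge0_fin_numE//; apply: ge0_le_integral => //.
- by move=> x _; rewrite lee_fin powR_ge0.
- by apply/measurable_EFinP; apply: (measurableT_comp (measurable_powR _)); exact: measurable_gamr.
- apply: (measurableT_comp (measurable_poweR _)); apply: measurableT_comp => //; exact: measurable_int gam_L1.
move=> x _; rewrite /gamr; have := gam_ge0 x; case: (gam x) => [v| |]//.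
  by rewrite lee_fin => v0; rewrite abse_EFin ger0_norm// poweR_EFin.
by move=> _; rewrite (_ : fine +oo = 0)// powR0//; exact: poweR_ge0.
Qed.

End kernel_energy.

(** * The Gronwall argument *)

Section gronwall.
Context {R : realType} {d : nat} {disp : measure_display} {T : measurableType disp}.
Variable P : probability T R.
Local Notation E := 'rV[R]_d.
Local Notation leb := (@lebesgue_measure R).
Local Notation lam := (@lebesgue_rV R d).
Local Notation ST := (measurableTypeR R * E)%type.
Local Notation ST2 := (measurableTypeR R * (E * E))%type.
Local Notation mst := (prod_sf leb lam).
Variable gam : E -> \bar R.
Hypothesis gam_ge0 : forall x, (0 <= gam x)%E.
Hypothesis gam_L1 : lam.-integrable setT gam.
Variable W : hilbert gam -> T -> R.
Hypothesis hW : isonormal P W.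
Local Notation V := (WV W).
Local Notation ev := (ev V).
Local Notation gV := (WV_gaussian hW).
Local Notation tr := (tr gam_ge0 gam_L1 hW).
Local Notation near y := (near P V (tr y)).
Variables (sigma : R -> R) (L : R) (u : R -> E -> T -> R).
Hypothesis L0 : 0 < L.
Hypothesis lip : forall a b, `|sigma a - sigma b| <= L * `|a - b|.
Hypothesis hu : wave_solution P W sigma u.
Variables (T0 C : R).
Hypothesis C0 : 0 <= C.
Hypothesis kernel_le : forall (r : R) (x : E), r <= T0 ->
  (\int[lam]_y \int[lam]_z (wave_kernel r (x - y) * wave_kernel r (x - z) * gamr gam (y - z))%:E <= C%:E)%E.

Lemma measurable_sigma : measurable_fun setT sigma.
Proof.
apply: continuous_measurable_fun => x; apply/cvgrPdist_lt => e e0.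
have e1 : 0 < e / L by rewrite divr_gt0.
have /cvgrPdist_lt/(_ _ e1) := @cvg_id _ (nbhs x); apply: filterS => y hy.
by apply: le_lt_trans (lip _ _) _; rewrite mulrC -ltr_pdivlMr.
Qed.

Lemma near_cst y r : near y (cst r) (cst r) 0.
Proof.
have := near_ev gV (tr y) (ccst _ r); congr (near y _ _ _); apply/funext => w; exact: ev_cst.
Qed.

Lemma measurable_solution s x : 0 <= s -> measurable_fun setT (u s x).
Proof.
case: hu => ad _ _ s0 _ B mB; rewrite setTI.
exact: (filtration_Sig hW (ad s x B s0 mB)).1.
Qed.

(** The empty code is its own translate, so the uniform bound of the second moments is an initial
    error for the iteration. *)
Lemma solution_bounded : 0 <= T0 -> exists M : R, 0 < M /\
  forall s x y, 0 <= s <= T0 -> near y (u s x) (u s (x + y)) M.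
Proof.
case: hu => _ mom _ T00; have := mom T0 2 T00 (lexx _).
set S := ereal_sup _ => Soo.
have uS s x : 0 <= s <= T0 -> (sqn P (u s x) <= S)%E.
  move=> hs; apply: ereal_sup_ubound; exists (s, x) => /=; first by split => //=; rewrite in_itv.
  by apply: eq_integral => w _; rewrite powR_mulrn// real_normK ?num_real.
have S0 : (0 <= S)%E.
  by apply: le_trans (uS 0 0 _); [exact: sqn_ge0|rewrite lexx T00].
have Sf : S \is a fin_num by rewrite ge0_fin_numE.
exists (fine S + 1); split; first by rewrite ltr_wpDl// fine_ge0.
move=> s x y hs; have [s0 _] := andP hs; split; [exact: measurable_solution|exact: measurable_solution|].
move=> e e0; exists [::].
have H z : (sqn P (fun w => u s z w - ev [::] w)%R <= (fine S + 1 + e)%:E)%E.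
  rewrite (_ : (fun w => _) = u s z); last by apply/funext => w; rewrite /ev big_nil subr0.
  by apply: le_trans (uS _ _ hs) _; rewrite -(fineK Sf) lee_fin -addrA lerDl addr_ge0// ltW.
by split; exact: H.
Qed.

(** The initial value 1 is a constant code, which translations leave unchanged. *)
Lemma near_ae y (X Y I J : T -> R) q : measurable_fun setT X -> measurable_fun setT Y ->
  {ae P, forall w, X w = 1 + I w} -> {ae P, forall w, Y w = 1 + J w} -> near y I J q -> near y X Y q.
Proof.
move=> mX mY XI YJ [mI mJ h]; split=> // e /h[c [h1 h2]]; exists (ccst _ 1 ++ c).
have H (X' I' : T -> R) c' : measurable_fun setT X' -> measurable_fun setT I' -> {ae P, forall w, X' w = 1 + I' w} ->
    sqn P (fun w => X' w - ev (ccst _ 1 ++ c') w)%R = sqn P (fun w => I' w - ev c' w)%R.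
  move=> mX' mI' XI'; apply: ae_eq_integral => //.
  - by apply: measurable_sq; apply: measurable_funB => //; exact: (measurable_ev gV).
  - by apply: measurable_sq; apply: measurable_funB => //; exact: (measurable_ev gV).
  by apply: filterS XI' => w -> _; rewrite ev_cat ev_cst; congr (_ ^+ 2)%:E; ring.
rewrite cmap_cat; split; first by rewrite (H _ I).
by rewrite (H Y J (cmap (tr y) c)).
Qed.

(** Where the error already vanishes, up to [s0], the integrands contribute nothing. On the
    remaining times the Lipschitz bound multiplies the error by the square of [L] times the kernel,
    whose energy is at most [C] at each time. *)
Lemma gronwall_step (y : E) (s0 s1 c : R) : 0 <= c -> s1 <= T0 ->
  (forall s x, 0 <= s <= s1 -> near y (u s x) (u s (x + y)) (if s <= s0 then 0 else c)) ->
  forall t x, 0 <= t <= s1 ->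
  near y (u t x) (u t (x + y)) (200 * L ^+ 2 * C * c * Num.max 0 (t - Num.max s0 0)).
Proof.
move=> c0 s1T H t x /andP[t0 ts1].
have [_ _ eqn] := hu; have [I [wI uI]] := eqn t x t0; have [I' [wI' uI']] := eqn t (x + y) t0.
apply: (near_ae (measurable_solution x t0) (measurable_solution (x + y) t0) uI uI').
pose m := Num.max s0 0; pose D : set R := `]m, t[%classic.
have lD : lebesgue_measure (`]m, t[%classic : set R) = (Num.max 0 (t - m))%:E.
  rewrite lebesgue_measure_itv/= lte_fin; case: ltP => h; rewrite -?EFinB; congr EFin.
    by rewrite max_r// subr_ge0 ltW.
  by rewrite max_l// subr_le0.
(* [near_lip] produces [2 (g L)^2 c] and [near_step] asks for at most [b^2 / 12]: 25 is a square
   above 24. With the factor 8 of [near_step] this gives 200. *)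
pose al := 5 * L * Num.sqrt c.
have al0 : 0 <= al by rewrite !mulr_ge0 ?sqrtr_ge0// ltW.
pose b (p : ST) : R := al * (\1_D p.1 * wave_kernel (t - p.1) (x + y - p.2)).
have b0 p : 0 <= b p by rewrite mulr_ge0// mulr_ge0 ?wave_kernel_ge0// indicE.
have mG : measurable_fun setT (fun p : ST => wave_kernel (t - p.1) (x + y - p.2)).
  have mth : measurable_fun setT (fun p : ST => (t - p.1, x + y - p.2) : ST).
    apply: measurable_fun_pair; first by apply: measurable_funB => //; exact: measurable_fst.
    by apply: measurable_funB_rV => //; exact: measurable_snd.
  exact: (measurableT_comp (@measurable_wave_kernel R d) mth).
have mD : measurable_fun setT (fun p : ST => \1_D p.1 : R).
  by apply: (measurableT_comp _ measurable_fst); apply: measurable_indic; exact: measurable_itv.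
have mb : measurable_fun setT b by apply: measurable_funM => //; exact: measurable_funM.
have al2 : al ^+ 2 = 25 * L ^+ 2 * c by rewrite /al !exprMn sqr_sqrtr//; ring.
have hb : (nenergy gam b b <= (25 * L ^+ 2 * C * c * Num.max 0 (t - m))%:E)%E.
  have mN := measurable_nenergy gam_L1 mb mb.
  have mNE : measurable_fun setT (fun q : ST2 => (b (st1 q) * b (st2 q) * gam3 gam q)%:E) by exact/measurable_EFinP.
  have N0 (q : ST2) : (0 <= (b (st1 q) * b (st2 q) * gam3 gam q)%:E)%E.
    by rewrite lee_fin; apply: mulr_ge0; [exact: mulr_ge0|exact: gamr_ge0].
  rewrite /nenergy (ge0_integral_m3 mNE N0).
  have aC0 : 0 <= al ^+ 2 * C by rewrite mulr_ge0// sqr_ge0.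
  have mI : measurable_fun setT (fun s : R => (\1_D s : R)%:E).
    by apply/measurable_EFinP; apply: measurable_indic; exact: measurable_itv.
  have I0 s : setT s -> (0 <= (\1_D s : R)%:E)%E by rewrite lee_fin indicE.
  apply: (@le_trans _ _ (\int[leb]_s ((al ^+ 2 * C)%:E * (\1_D s : R)%:E))%E).
    apply: ge0_le_integral => //.
    - by move=> s _; apply: integral_ge0 => z _; apply: integral_ge0 => z' _; exact: (N0 (s, (z, z'))).
    - have := measurable_inner (prod_sf lam lam) mNE N0; congr measurable_fun; apply/funext => s.
      by rewrite (tonelli1 (measurable_pair1 s mNE))// => q; exact: (N0 (s, q)).
    - exact: measurable_funeM.
    move=> s _; rewrite -EFinM indicE; have [hs|hs] := boolP (s \in D); last first.
      rewrite mulr0 integral0_eq// => z _; rewrite integral0_eq// => z' _.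
      by rewrite /b /= indicE (negbTE hs) mul0r mulr0 !mul0r.
    have ht : t - s <= T0.
      move: hs; rewrite inE /D /= in_itv/= => /andP[ms _].
      have : 0 <= m by rewrite le_max lexx orbT.
      lra.
    have mw : measurable_fun setT (fun z : E => wave_kernel (t - s) (x + y - z)).
      exact: (measurable_pair1 (s : measurableTypeR R) mG).
    pose K (q : E * E) := wave_kernel (t - s) (x + y - q.1) * wave_kernel (t - s) (x + y - q.2) * gamr gam (q.1 - q.2).
    have mK : measurable_fun setT (fun q : E * E => (K q)%:E).
      apply/measurable_EFinP; apply: measurable_funM.
        by apply: measurable_funM; [exact: (measurableT_comp mw measurable_fst)|exact: (measurableT_comp mw measurable_snd)].
      exact: (measurableT_comp (measurable_gamr gam_L1) measurable_diff).
    have K0 q : setT q -> (0 <= (K q)%:E)%E by rewrite lee_fin !mulr_ge0 ?wave_kernel_ge0 ?gamr_ge0.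
    have := kernel_le (x + y) ht; rewrite -(tonelli1 mK (fun q => K0 q Logic.I)) => hK.
    rewrite -(tonelli1 (measurable_pair1 s mNE) (fun q => N0 (s, q))).
    rewrite (eq_integral (fun q => ((al ^+ 2)%:E * (K q)%:E)%E)).
      rewrite (ge0_integralZl_EFin (prod_sf lam lam) measurableT K0 mK (sqr_ge0 al)) mulr1 (EFinM (al ^+ 2) C).
      by apply: lee_wpmul2l => //; rewrite lee_fin sqr_ge0.
    by move=> q _; rewrite -EFinM /b /K /gam3 /= !indicE hs !mul1r; congr EFin; ring.
  rewrite (ge0_integralZl_EFin leb measurableT I0 mI aC0) integral_indic ?setIT//; last exact: measurable_itv.
  rewrite [X in (_ * X)%E](_ : _ = (Num.max 0 (t - m))%:E); last first.
    exact: lD.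
  by rewrite -EFinM lee_fin al2 le_eqVlt; apply/orP; left; apply/eqP; ring.
(* Outside the ball of this radius the kernels centred at [x] and at [x + y] both vanish at all
   positive times, by finite speed of propagation. *)
pose n := t + `|x| + `|x + y|.
have supp (x0 : E) : `|x0| <= `|x| + `|x + y| -> forall z : T * ST, n < `|(z.2 : R * E)| ->
    ppos (fun s y w => wave_kernel (t - s) (x0 - y) * sigma (u s y w)) z = 0.
  move=> hx0 z hz; rewrite /ppos; case: ifP => // s00; rewrite wave_kernel0 ?mul0r//.
  have [ts|st] := leP t z.2.1; first by apply: le_trans (normr_ge0 _); rewrite subr_le0.
  have hz2 : n < `|z.2.2|.
    rewrite ltNge; apply: contraTN hz => h; rewrite -leNgt st_norm_le h andbT.
    rewrite ger0_norm ?(ltW s00)// /n -addrA; apply: le_trans (ltW st) _.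
    by rewrite lerDl addr_ge0.
  have : `|z.2.2| - `|x0| <= `|x0 - z.2.2| by rewrite distrC lerB_dist.
  by move: hz2 hx0 s00; rewrite /n; lra.
have -> : 200 * L ^+ 2 * C * c * Num.max 0 (t - m) = 8 * (25 * L ^+ 2 * C * c * Num.max 0 (t - m)) by ring.
have supp1 := supp x (eqbRL (lerDl _ _) (normr_ge0 _)); have supp2 := supp (x + y) (eqbRL (lerDr _ _) (normr_ge0 _)).
refine (@near_step _ _ _ _ P gam gam_ge0 gam_L1 W hW y _ _ I I' n _ b wI wI' supp1 supp2 mb b0 hb _) => k p.
have k0 : (0 : R) <= k%:R by [].
have q0 : 0 <= b p ^+ 2 / 12 by rewrite divr_ge0// sqr_ge0.
have zero : near y (fun=> 0) (fun=> 0) (b p ^+ 2 / 12) by exact: (near_le q0 (near_cst y 0)).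
rewrite /ppos /=; have [p0|p0] := leP p.1 0.
  by rewrite clip_id ?normr0.
(* The equation commutes with translations: the kernel of [x] at the point moved back by [y] is the
   kernel of [x + y], so only the values of [u] differ. *)
have -> : x - (p.2 - y) = x + y - p.2 by rewrite opprB addrA addrAC.
set g := wave_kernel (t - p.1) (x + y - p.2).
have g0 : 0 <= g by exact: wave_kernel_ge0.
have [tp|pt] := leP t p.1.
  have g00 : g = 0 by rewrite /g wave_kernel0// (le_trans _ (normr_ge0 _))// subr_le0.
  have z v : (fun w => clip k%:R (g * sigma (u p.1 v w))) = fun=> 0.
    by apply/funext => w; rewrite g00 mul0r clip_id ?normr0.
  by rewrite !z.
have ps1 : 0 <= p.1 <= s1 by rewrite (ltW p0) (le_trans (ltW pt)).
have nu := H p.1 (p.2 - y) ps1; rewrite subrK in nu.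
have mf : measurable_fun setT (fun r => clip k%:R (g * sigma r)).
  apply: (measurableT_comp (measurable_clip _)); apply: measurable_funM => //.
  exact: measurable_sigma.
have gL0 : 0 <= g * L by rewrite mulr_ge0// ltW.
have flip r r' : `|clip k%:R (g * sigma r) - clip k%:R (g * sigma r')| <= g * L * `|r - r'|.
  apply: le_trans (clip_lip _ _ _) _; rewrite -mulrBr normrM (ger0_norm g0) -mulrA.
  by rewrite ler_wpM2l.
apply: (near_le _ (near_lip gV gL0 mf flip nu)).
have [ps0|s0p] := leP p.1 s0; first by rewrite mulr0.
rewrite /b indicE mem_set ?mul1r; last by rewrite /D /= in_itv/= pt andbT gt_max s0p.
have -> : (al * g) ^+ 2 = 25 * (g * L) ^+ 2 * c.
  by rewrite (exprMn _ al g) al2 (exprMn _ g L); ring.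
have := mulr_ge0 (sqr_ge0 (g * L)) c0.
by move: ((g * L) ^+ 2) => h; lra.
Qed.

(* Short time intervals of length eta are treated one after the other; on each of them
   the error is halved by every application of the Gronwall step. *)
Lemma near_solution y t x : 0 <= t <= T0 -> near y (u t x) (u t (x + y)) 0.
Proof.
move=> /andP[t0 tT]; pose A := 200 * L ^+ 2 * C.
have A0 : 0 <= A by rewrite mulr_ge0// mulr_ge0// sqr_ge0.
have A1 : 0 < 2 * (A + 1) by rewrite mulr_gt0// ltr_wpDl.
(* On an interval of this length the factor of [gronwall_step] is at most one half. *)
pose eta := (2 * (A + 1))^-1; have eta0 : 0 < eta by rewrite invr_gt0.
have Aeta : A * eta <= 2^-1.
  by rewrite ler_pdivrMr// mulrA mulVf// mul1r lerDl.
have [M [M0 HM]] := solution_bounded (le_trans t0 tT).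
(* The shift by [eta] makes the case [j = 0] vacuous, as it concerns negative times. *)
have claim j : forall s z, 0 <= s <= T0 -> s <= j%:R * eta - eta -> near y (u s z) (u s (z + y)) 0.
  elim: j => [|j IH] s z /andP[s0 sT] hs; first by move: hs; rewrite mul0r sub0r; lra.
  pose a := j%:R * eta - eta; pose a1 := Num.min (j%:R * eta) T0.
  have step n : forall r v, 0 <= r <= a1 -> near y (u r v) (u r (v + y)) (if r <= a then 0 else M * 2^-1 ^+ n).
    elim: n => [|n IHn] r v /andP[r0 ra1]; have /andP[ra rT] : (r <= j%:R * eta) && (r <= T0) by rewrite -le_min.
      case: ifP => h; first by apply: IH; rewrite ?r0.
      by rewrite expr0 mulr1; apply: HM; rewrite r0.
    have c0 : 0 <= M * 2^-1 ^+ n by rewrite mulr_ge0 ?exprn_ge0// ltW.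
    have a1T : a1 <= T0 by rewrite ge_min lexx orbT.
    have r01 : 0 <= r <= a1 by rewrite r0.
    apply: (near_le _ (gronwall_step c0 a1T IHn v r01)); rewrite -/A.
    have hm : a <= Num.max a 0 by rewrite le_max lexx.
    case: ifP => h; first by rewrite max_l ?mulr0// subr_le0 (le_trans h).
    have he : Num.max 0 (r - Num.max a 0) <= eta.
      by rewrite ge_max (ltW eta0) /=; move: ra hm; rewrite /a; lra.
    apply: le_trans (ler_wpM2l (mulr_ge0 A0 c0) he) _.
    by rewrite exprSr [leRHS]mulrA (mulrC A) -[leLHS]mulrA; exact: ler_wpM2l.
  have sE : s <= j%:R * eta by move: hs; rewrite -natr1 mulrDl mul1r addrK.
  have s01 : 0 <= s <= a1 by rewrite s0 le_min sE sT.
  case sa: (s <= a); first by have := step 0%N s z s01; rewrite sa.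
  by apply: (near_inf M0) => n; have := step n s z s01; rewrite sa add0r.
apply: (claim (Num.bound ((t + eta) / eta))); rewrite ?t0// lerBrDr -ler_pdivrMr//.
by apply: ltW; apply: archi_boundP; rewrite divr_ge0 ?addr_ge0// ltW.
Qed.

End gronwall.

(** * Stationarity and ergodicity of the solution at a fixed time *)

Theorem proposition1p1 (R : realType) (disp : measure_display)
  (T : measurableType disp) (P : probability T R)
  (d : nat) (hd : d = 1%N \/ d = 2%N)
  (sigma : R -> R) (L : R) (hL : 0 < L) (hsigma : L.-lipschitz sigma)
  (hsigma1 : sigma 1 <> 0)
  (gam : 'rV[R]_d -> \bar R)
  (gam_ge0 : forall x, (0 <= gam x)%E)
  (gam_tempered : tempered_fun gam)
  (gam_nonneg_definite : nonneg_definite gam)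
  (mu : {measure set 'rV[R]_d -> \bar R})
  (hmu : spectral_measure gam mu)
  (dalang : (\int[mu]_z ((1 + enorm z ^+ 2)^-1)%:E < +oo)%E)
  (gam_L1 : (@lebesgue_rV R d).-integrable setT gam)
  (gam_Ll : d = 2%N ->
    exists2 l : R, 1 < l & ('N[@lebesgue_rV R d]_(l%:E)[gam] < +oo)%E)
  (W : hilbert gam -> T -> R) (hW : isonormal P W)
  (u : R -> 'rV[R]_d -> T -> R) (hu : wave_solution P W sigma u)
  (t : R) (ht : 0 < t) :
  strictly_stationary P (u t) /\ ergodic P (u t).
Proof.
have lip a b : `|sigma a - sigma b| <= L * `|a - b| by exact: (hsigma (a, b)).
(* The horizon of the Gronwall argument is [t] itself. *)
have [C [C0 hC]] := kernel_energy gam_ge0 gam_L1 ht hd gam_Ll.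
have t0 : 0 <= t <= t by rewrite (ltW ht) lexx.
have near_u x y := near_solution gam_ge0 gam_L1 hW hL lip hu C0 hC y x t0.
have d0 : (0 < d)%N by case: hd => ->.
have gV := WV_gaussian hW; have qtr := qcov_tr gam_ge0 gam_L1 hW.
split; first exact: (near_stationary gV qtr near_u).
apply: (near_ergodic gV qtr near_u (y_ := @far R d)) => v v'.
exact: (qcov_far gam_ge0 gam_L1 hW v v' d0).
Qed.
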